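(* There exists a function $f:\mathbb{R}\to[0,1]$ with $f(c)\to 0$ as $|c|\to\infty$ such that the following holds. For every integer $n\ge 1$, every $\theta$ with $\frac{\log n}{\sqrt n}\le\theta\le\pi$ and $\theta>0$ (so $\theta=\theta(n)$ is allowed to vary with $n$), and every real $c$ for which $$t=\frac{n(\log n+c)}{2\sin^2(\theta/2)}$$ is a non-negative integer, one has $$\Bigl|\,\bigl\|\delta_{\mathrm{Id}}\cdot P_\theta^t-\nu\bigr\|_{\mathrm{TV}}-\mathbf{1}(c<0)\Bigr|\le f(c).$$
   Context: $\nu$ denotes the Haar probability measure on $SO(2n+1)$. $R(1,2;\theta)\in SO(2n+1)$ is the block diagonal matrix with upper left $2\times 2$ block $\begin{pmatrix}\cos\theta&-\sin\theta\\ \sin\theta&\cos\theta\end{pmatrix}$ and lower right block $I_{2n-1}$. The transition kernel of the walk is $$P_\theta f(X)=\int_{SO(2n+1)}f\bigl(U R(1,2;\theta)U^{-1}X\bigr)\,d\nu(U).$$ $\delta_{\mathrm{Id}}\cdot P_\theta^t$ is the law after $t$ steps of this chain started at the identity, i.e. the $t$-fold convolution power of the law of $UR(1,2;\theta)U^{-1}$ with $U\sim\nu$. The total variation distance is $\|\mu-\nu\|_{\mathrm{TV}}=\sup_{B}(\mu(B)-\nu(B))$ over Borel sets $B$. $\mathbf 1(c<0)$ is $1$ if $c<0$ and $0$ otherwise. *)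

(* Defs.v *)
From HB Require Import structures.
From mathcomp Require Import all_boot all_order all_algebra.
From mathcomp Require Import all_classical all_reals all_analysis.

Set Implicit Arguments.
Unset Strict Implicit.
Unset Printing Implicit Defensive.

Import Order.TTheory GRing.Theory Num.Theory.
Import numFieldNormedType.Exports.

Local Open Scope classical_set_scope.
Local Open Scope ring_scope.

Definition special_orthogonal (R : realType) (N : nat) : pred 'M[R]_N :=
  fun A => (A^T *m A == 1%:M) && (\det A == 1).

Record SO (R : realType) (N : nat) : Type := MkSO {
  so_mx :> 'M[R]_N ;
  so_mxP : special_orthogonal so_mx }.

HB.instance Definition _ (R : realType) (N : nat) := [isSub for @so_mx R N].
HB.instance Definition _ (R : realType) (N : nat) := [Choice of SO R N by <:].

Section SpecialOrthogonalGroup.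
Context {R : realType} {N : nat}.
Implicit Types A B : SO R N.

Lemma so1_subproof : special_orthogonal (1%:M : 'M[R]_N).
Proof. by rewrite /special_orthogonal trmx1 mul1mx det1 !eqxx. Qed.

Lemma soM_subproof A B : special_orthogonal (so_mx A *m so_mx B).
Proof.
case: A B => A /andP[/eqP AA /eqP dA] [B /andP[/eqP BB /eqP dB]] /=.
rewrite /special_orthogonal trmx_mul -mulmxA (mulmxA A^T) AA mul1mx BB eqxx /=.
by rewrite det_mulmx dA dB mulr1.
Qed.

Lemma soV_subproof A : special_orthogonal (so_mx A)^T.
Proof.
case: A => A /andP[/eqP AA /eqP dA] /=.
by rewrite /special_orthogonal trmxK (mulmx1C AA) det_tr dA !eqxx.
Qed.

Definition so1 : SO R N := MkSO so1_subproof.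
Definition soM A B : SO R N := MkSO (soM_subproof A B).
Definition soV A : SO R N := MkSO (soV_subproof A).

Lemma soMA : associative soM.
Proof. by move=> A B C; apply: val_inj; rewrite /= mulmxA. Qed.

Lemma so1M : left_id so1 soM.
Proof. by move=> A; apply: val_inj; rewrite /= mul1mx. Qed.

Lemma soM1 : right_id so1 soM.
Proof. by move=> A; apply: val_inj; rewrite /= mulmx1. Qed.

Lemma soVM : left_inverse so1 soV soM.
Proof.
by case=> A AP; apply: val_inj => /=; have /andP[/eqP] := AP.
Qed.

Lemma soMV : right_inverse so1 soV soM.
Proof.
case=> A AP; apply: val_inj => /=; have /andP[/eqP AA _] := AP.
exact: mulmx1C.
Qed.

End SpecialOrthogonalGroup.

HB.instance Definition _ (R : realType) (N : nat) :=
  isGroup.Build (SO R N) soMA so1M soM1 soVM soMV.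

HB.instance Definition _ (R : realType) (N : nat) :=
  isPointed.Build (SO R N) so1.

(* Topology inherited from the space of matrices, with its Borel sigma-algebra. *)
HB.instance Definition _ (R : realType) (N : nat) :=
  Topological.copy (SO R N) (initial_topology (@so_mx R N)).

Definition so_display : measure_display. Proof. exact. Qed.

HB.instance Definition _ (R : realType) (N : nat) :=
  @isMeasurable.Build so_display (SO R N) <<s @open (SO R N) >>
    (@sigma_algebra0 _ setT _) (@sigma_algebraC _ _)
    (@sigma_algebra_bigcup _ setT _).

Definition is_haar (R : realType) (N : nat) (nu : probability (SO R N) R) :=
  forall (g : SO R N) (A : set (SO R N)), measurable A ->
    nu [set (g * x)%g | x in A] = nu A.

Section Rotation.
Context {R : realType}.

Definition rot2 (theta : R) : 'M[R]_2 :=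
  \matrix_(i, j) nth 0 (nth [::] [:: [:: cos theta; - sin theta];
                                     [:: sin theta; cos theta]] i) j.

Definition rot12_mx (N : nat) (hN : (1 < N)%N) (theta : R) : 'M[R]_N :=
  castmx (subnKC hN, subnKC hN) (block_mx (rot2 theta) 0 0 (1%:M : 'M[R]_(N - 2))).

Lemma special_orthogonal_cast (m N : nat) (e : m = N) (M : 'M[R]_m) :
  special_orthogonal M -> special_orthogonal (castmx (e, e) M).
Proof. by case: N / e; rewrite castmx_id. Qed.

Lemma rot12_subproof (N : nat) (hN : (1 < N)%N) (theta : R) :
  special_orthogonal (rot12_mx hN theta).
Proof.
have cs : cos theta * cos theta + sin theta * sin theta = 1.
  by rewrite -!expr2 cos2Dsin2.
apply: special_orthogonal_cast.
have o2 : (rot2 theta)^T *m rot2 theta = 1%:M.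
  apply/matrixP => -[[|[|//]] ?] [[|[|//]] ?];
    rewrite !mxE !big_ord_recl big_ord0 /= !mxE /= addr0.
  - exact: cs.
  - by rewrite mulrN [sin _ * _]mulrC addNr.
  - by rewrite mulNr [sin _ * _]mulrC addNr.
  - by rewrite mulrNN addrC cs.
have d2 : \det (rot2 theta) = 1.
  rewrite (expand_det_row _ ord0) !big_ord_recl big_ord0 /cofactor !det_mx11.
  by rewrite !mxE /= expr0 expr1 mul1r mulN1r mulrNN addr0 cs.
apply/andP; split; apply/eqP.
  rewrite tr_block_mx !trmx0 trmx1 mulmx_block !mulmx0 !mul0mx !mulmx1.
  by rewrite addr0 !add0r o2 -scalar_mx_block.
by rewrite det_ublock d2 det1 mulr1.
Qed.

Definition rot12 (N : nat) (hN : (1 < N)%N) (theta : R) : SO R N :=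
  MkSO (rot12_subproof hN theta).

End Rotation.

Lemma ltn1_doubleS (n : nat) : (1 <= n)%N -> (1 < n.*2.+1)%N.
Proof. by case: n. Qed.

Definition transition_op (R : realType) (N : nat) (hN : (1 < N)%N)
    (nu : probability (SO R N) R) (theta : R) (f : SO R N -> \bar R)
    (X : SO R N) : \bar R :=
  (\int[nu]_U f (U * rot12 hN theta * U^-1 * X)%g)%E.

(* [mu . P], the law obtained from [mu] after one application of the Markov
   operator [P] (given by its action on functions). *)
Definition apply_law (R : realType) (N : nat) (mu : set (SO R N) -> \bar R)
    (P : (SO R N -> \bar R) -> SO R N -> \bar R) (B : set (SO R N)) : \bar R :=
  (\int[mu]_X P (fun Y => (\1_B Y)%:E) X)%E.

Definition walk_law (R : realType) (N : nat) (hN : (1 < N)%N)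
    (nu : probability (SO R N) R) (theta : R) (t : nat) :
    set (SO R N) -> \bar R :=
  apply_law (dirac (1%g : SO R N)) (iter t (transition_op hN nu theta)).

Definition tv_dist d (T : measurableType d) (R : realType)
    (mu nu : set T -> \bar R) : \bar R :=
  ereal_sup [set (mu B - nu B)%E | B in measurable].

(* Main.v *)
Require Import Defs.
(* Matrix coefficients of the highest weight vectors in tensor powers of the standard
   representation are eigenfunctions of the walk.  For the weight with [a j] columns of height
   [j + 1] the eigenvalue is the mean [r] of a product of leading minors, evaluated at
   [U R(1,2;theta) U^-1] in an isotropic basis; each minor depends only on the first two columns
   of [U] and [`|r| <= exp (- sin (theta / 2) ^+ 2 * rate a)], where
   [exp (- rate a)] is the mean of [exp (- 2 Psi a)].  The matrix coefficients of weight [a] have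
   rank at most [D ^ 2], where [D] is a product of binomial coefficients, read off either from the
   rows or from the columns of the Young diagram.

   Upper bound: the L2 norm is controlled by the sum of [D ^ 2 * r ^ (2 t)].  Integration by parts
   along rotations gives a crude bound, [12 rate a >= sum_k ln (1 + lam a k / N)], valid for all
   weights, and a sharp one for diagrams with few and short columns.  Cutting the diagram into a
   short part (sharp bound) and the rest (crude bound) yields
   [D ^ 2 <= exp (n (ln n + C) rate a)], and the remaining sum factors over the columns.

   Lower bound: conditionally on the present state, one step changes the trace by a factor
   [1 - 4 sin (theta / 2) ^+ 2 / N] with a variance of order [sin (theta / 2) ^+ 2 / N], so the
   variance of the trace stays bounded while its mean is still large when [c < 0]; Chebyshev's
   inequality separates the walk from Haar measure. *)
From HB Require Import structures.
From mathcomp Require Import all_boot all_order all_algebra.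
From mathcomp Require Import boolp.
From mathcomp Require Import ring lra zify.
From mathcomp Require Import fingroup perm.
From mathcomp Require Import complex mxtens.
Set Implicit Arguments.
Unset Strict Implicit.
Unset Printing Implicit Defensive.
Import Order.TTheory GRing.Theory Num.Theory.
Local Open Scope ring_scope.

(** * Highest weight vectors in tensor powers *)

Section TensorPower.

(** The main term n ln n of the cutoff time leaves no constant to lose where it matters. For few
    short columns with w boxes in all, the logarithm of D ^ 2 is about 2 w ln n and the rate about 2
    w / n, so both are needed with the exact leading constant. For the other columns the logarithm
    of the rank is at most a constant times n sum_k ln (1 + lam a k / N), without the factor ln n,
    and an estimate that loses a factor 12 is harmless. This is why two estimates of the rate and
    two readings of the rank are combined. Irreducible representations and their dimensions never
    appear. A relation between matrix coefficients is a polynomial identity, checked along curves of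
    orthogonal matrices; the L2 inequality comes from averaging a Cauchy-Schwarz inequality over all
    right translates, and asks only for a spanning set of eigenfunctions. The eigenvalues depend on
    theta, but they are compared with powers of exp (- 2 Psi a), which does not; convexity extracts
    the factor sin (theta / 2) ^ 2, so one rate serves all angles. *)

Fixpoint tdim (m k : nat) : nat := if k is k'.+1 then (m * tdim m k')%N else 1%N.

Fixpoint tpow {A : comNzRingType} {m : nat} (k : nat) (M : 'M[A]_m) : 'M[A]_(tdim m k) :=
  if k is k'.+1 then M *t tpow k' M else 1%:M.

(** Adjoining a trivial line makes the coefficients of [tpow k (ext 1 M)] span all polynomials of
    degree at most [k] in the entries of [M], not just the homogeneous ones. The corner [d] serves
    to clear denominators, see [rho_homog]. *)
Definition ext {A : comNzRingType} {m : nat} (d : A) (M : 'M[A]_m) : 'M[A]_(1 + m) :=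
  block_mx d%:M 0 0 M.

Variable A : comNzRingType.
Implicit Types (m k : nat).

Lemma tpowM m k (M M' : 'M[A]_m) : tpow k (M *m M') = tpow k M *m tpow k M'.
Proof. by elim: k => [|k IH] /=; rewrite ?mulmx1 // IH tensmx_mul. Qed.

Lemma tpow1 m k : tpow k (1%:M : 'M[A]_m) = 1%:M.
Proof.
elim: k => [//|k IH] /=; rewrite IH; apply/matrixP => i j.
case: (mxtens_indexP i) => i0 i1; case: (mxtens_indexP j) => j0 j1.
rewrite tensmxE !mxE (can_eq (@mxtens_indexK _ _)) xpair_eqE -natrM mulnb //.
Qed.

Lemma tpowZ m k (c : A) (M : 'M[A]_m) : tpow k (c *: M) = c ^+ k *: tpow k M.
Proof.
elim: k => [|k IH] /=; first by rewrite expr0 scale1r.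
rewrite IH; apply/matrixP => i j.
case: (mxtens_indexP i) => i0 i1; case: (mxtens_indexP j) => j0 j1.
transitivity ((c * M i0 j0) * (c ^+ k * tpow k M i1 j1)); first by rewrite tensmxE !mxE.
by rewrite [RHS]mxE tensmxE exprS mulrACA.
Qed.

Lemma tpow_tr m k (M : 'M[A]_m) : (tpow k M)^T = tpow k M^T.
Proof. by elim: k => [|k IH] /=; rewrite ?trmx1 // trmx_tens IH. Qed.

Lemma tpow_map (A' : comNzRingType) (f : {rmorphism A -> A'}) m k (M : 'M[A]_m) :
  map_mx f (tpow k M) = tpow k (map_mx f M).
Proof. by elim: k => [|k IH] /=; rewrite ?map_mx1 // map_mxT IH. Qed.

Lemma extM m (d d' : A) (M M' : 'M[A]_m) :
  ext d M *m ext d' M' = ext (d * d') (M *m M').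
Proof.
by rewrite /ext mulmx_block !mulmx0 !mul0mx !addr0 add0r -scalar_mxM.
Qed.

Lemma ext1 m : ext 1 (1%:M : 'M[A]_m) = 1%:M.
Proof. by rewrite /ext -scalar_mx_block. Qed.

Lemma extZ m c (d : A) (M : 'M[A]_m) : c *: ext d M = ext (c * d) (c *: M).
Proof. by rewrite /ext scale_block_mx !scaler0 scale_scalar_mx. Qed.

Lemma ext_tr m (d : A) (M : 'M[A]_m) : (ext d M)^T = ext d M^T.
Proof. by rewrite /ext tr_block_mx tr_scalar_mx !trmx0. Qed.

Lemma ext_map (A' : comNzRingType) (f : {rmorphism A -> A'}) m d (M : 'M[A]_m) :
  map_mx f (ext d M) = ext (f d) (map_mx f M).
Proof. by rewrite /ext map_block_mx map_scalar_mx !map_mx0. Qed.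

Definition rho m k (M : 'M[A]_m) := tpow k (ext 1 M).

Lemma rhoM m k (M M' : 'M[A]_m) : rho k (M *m M') = rho k M *m rho k M'.
Proof. by rewrite /rho -tpowM extM mulr1. Qed.

Lemma rho1 m k : rho k (1%:M : 'M[A]_m) = 1%:M.
Proof. by rewrite /rho ext1 tpow1. Qed.

Lemma rho_tr m k (M : 'M[A]_m) : (rho k M)^T = rho k M^T.
Proof. by rewrite /rho tpow_tr ext_tr. Qed.

Lemma rho_homog m k (d : A) (M : 'M[A]_m) :
  tpow k (ext d (d *: M)) = d ^+ k *: rho k M.
Proof. by rewrite -{1}[d]mulr1 -extZ tpowZ. Qed.

End TensorPower.

Lemma rho_map (A A' : comNzRingType) (f : {rmorphism A -> A'}) m k (M : 'M[A]_m) :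
  map_mx f (rho k M) = rho k (map_mx f M).
Proof. by rewrite /rho tpow_map ext_map rmorph1. Qed.

Section TensorWeights.
Variable A : comNzRingType.

Fixpoint tsum {m : nat} (w : 'I_m -> int) (k : nat) : 'I_(tdim m k) -> int :=
  if k is k'.+1 then
    fun i => w (@mxtens_unindex m (tdim m k') i).1 + tsum w (@mxtens_unindex m (tdim m k') i).2
  else fun=> 0.

Lemma tsumS m (w : 'I_m -> int) k i j :
  tsum w (k := k.+1) (mxtens_index (i, j)) = w i + tsum w j.
Proof.
rewrite -[LHS]/(w (mxtens_unindex (mxtens_index (i, j))).1 +
  tsum w (mxtens_unindex (mxtens_index (i, j))).2).
by rewrite mxtens_indexK.
Qed.

Lemma tsum_bound m (w : 'I_m -> int) k (i : 'I_(tdim m k)) :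
  (forall j, `|w j| <= 1) -> `|tsum w i| <= k%:Z.
Proof.
move=> h; elim: k i => [|k IH] i; first by rewrite /= normr0.
case: (mxtens_indexP i) => i0 i1; rewrite tsumS (le_trans (ler_normD _ _)) //.
by rewrite intS lerD.
Qed.

Lemma tsum_lin m n (H : 'I_n -> int) (w : 'I_n -> 'I_m -> int) k (i : 'I_(tdim m k)) :
  tsum (fun j => \sum_l H l * w l j) i = \sum_l H l * tsum (w l) i.
Proof.
elim: k i => [|k IH] i; first by rewrite /= big1 // => l _; rewrite mulr0.
case: (mxtens_indexP i) => i0 i1; rewrite tsumS IH -big_split.
by apply: eq_bigr => l _; rewrite tsumS mulrDr.
Qed.

(** Acting on row vectors, such a matrix fixes each component up to contributions to larger heights.
    For the heights [ht] below this covers the lower unipotent matrices. *)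
Definition unip m (h : 'I_m -> int) (M : 'M[A]_m) :=
  forall i j, M i j = (i == j)%:R \/ h i < h j.

Lemma tpow_unip m (h : 'I_m -> int) (M : 'M[A]_m) k :
  unip h M -> unip (fun i : 'I_(tdim m k) => tsum h i) (tpow k M).
Proof.
move=> hM; elim: k => [|k IH] i j; first by left; rewrite /= mxE.
case: (mxtens_indexP i) => i0 i1; case: (mxtens_indexP j) => j0 j1.
rewrite tensmxE !tsumS (can_eq (@mxtens_indexK _ _)) xpair_eqE.
case: (hM i0 j0) => [->|h1]; case: (IH i1 j1) => [->|h2].
- by left; rewrite -natrM mulnb.
- case: (eqVneq i0 j0) => [->|_]; first by right; rewrite ltrD2l.
  by left; rewrite mul0r.
- case: (eqVneq i1 j1) => [->|_]; first by right; rewrite ltrD2r.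
  by left; rewrite mulr0 andbF.
- by right; rewrite ltrD.
Qed.

End TensorWeights.

Definition lead (A : Type) (m j : nat) (Y : 'M[A]_m.+1) : 'M[A]_j :=
  \matrix_(a < j, b < j) Y (inord a) (inord b).

Lemma lead_map (A B : Type) (f : A -> B) m j (Y : 'M[A]_m.+1) :
  map_mx f (lead j Y) = lead j (map_mx f Y).
Proof. by apply/matrixP => a b; rewrite !mxE. Qed.

Lemma leadZ (A : pzRingType) m j c (Y : 'M[A]_m.+1) : lead j (c *: Y) = c *: lead j Y.
Proof. by apply/matrixP => a b; rewrite !mxE. Qed.

Lemma lead_full (A : Type) m (Y : 'M[A]_m.+1) : lead m.+1 Y = Y.
Proof. by apply/matrixP => a b; rewrite !mxE !inord_val. Qed.

Lemma lead_scalar (A : pzRingType) m j (c : A) : (j <= m.+1)%N ->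
  lead j (c%:M : 'M[A]_m.+1) = c%:M.
Proof.
move=> jm; apply/matrixP => a b; rewrite !mxE -!val_eqE /= !inordK //;
  by apply: leq_trans (ltn_ord _) jm.
Qed.

(** * Gaussian elimination and leading minors *)

Section LeadingMinors.
Variable F : fieldType.

Definition lowu m (L : 'M[F]_m) := forall i j : 'I_m, (i <= j)%N -> L i j = (i == j)%:R.
Definition upt m (V : 'M[F]_m) := forall i j : 'I_m, (j < i)%N -> V i j = 0.

Lemma det_lowu m (L : 'M[F]_m) : lowu L -> \det L = 1.
Proof.
move=> hL; rewrite det_trig; last first.
  by apply/is_trig_mxP => i j ij; rewrite hL 1?ltnW // -val_eqE /= ltn_eqF.
by rewrite big1 // => i _; rewrite hL // eqxx.
Qed.

Lemma det_upt m (V : 'M[F]_m) : upt V -> \det V = \prod_i V i i.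
Proof.
move=> hV; rewrite -det_tr det_trig; last by apply/is_trig_mxP => i j ij; rewrite mxE hV.
by apply: eq_bigr => i _; rewrite mxE.
Qed.

Lemma lead_mul m j (L V : 'M[F]_m.+1) : lowu L -> (j <= m.+1)%N ->
  lead j (L *m V) = lead j L *m lead j V.
Proof.
move=> hL jm; apply/matrixP => a b; rewrite !mxE.
pose g k := L (inord a) (inord k) * V (inord k) (inord b).
transitivity (\sum_(k < m.+1) g k); first by apply: eq_bigr => k _; rewrite /g inord_val.
transitivity (\sum_(k < j) g k); last by apply: eq_bigr => k _; rewrite !mxE.
rewrite (big_ord_widen _ g jm) [LHS]big_mkcond [RHS]big_mkcond /=.
apply: eq_bigr => k _; case: ifP => // /negbT; rewrite -leqNgt => jk.
have am : (a < m.+1)%N by apply: leq_trans (ltn_ord a) jm.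
have ak : (a < k)%N by apply: leq_trans (ltn_ord a) jk.
rewrite /g hL ?inord_val ?inordK //; last exact: ltnW.
by rewrite -val_eqE /= inordK // (ltn_eqF ak) mul0r.
Qed.

Lemma lminor_mul m j (L V : 'M[F]_m.+1) : lowu L -> upt V -> (j <= m.+1)%N ->
  \det (lead j (L *m V)) = \prod_(k < j) V (inord k) (inord k).
Proof.
move=> hL hV jm; rewrite lead_mul // det_mulmx det_lowu ?mul1r ?det_upt //.
- by apply: eq_bigr => k _; rewrite mxE.
- move=> a b ab; rewrite mxE hV // !inordK //; apply: leq_trans (ltn_ord _) jm.
- move=> a b ab; rewrite mxE hL ?inordK //; try by apply: leq_trans (ltn_ord _) jm.
  rewrite -!val_eqE /= !inordK //; by apply: leq_trans (ltn_ord _) jm.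
Qed.

Lemma schur_factor j (X : 'M[F]_(1 + j)) : X 0 0 != 0 ->
  X = block_mx 1%:M 0 ((X 0 0)^-1 *: dlsubmx X) 1%:M *m
      block_mx (X 0 0)%:M (ursubmx X) 0
        (drsubmx X - (X 0 0)^-1 *: (dlsubmx X *m ursubmx X)).
Proof.
move=> a0; rewrite mulmx_block !mul1mx !mul0mx !addr0 -[LHS]submxK.
have ul : ulsubmx X = (X 0 0)%:M.
  apply/matrixP => i k; rewrite !ord1 !mxE eqxx mulr1n.
  by congr (X _ _); apply: val_inj.
rewrite ul -!scalemxAl mul_mx_scalar scalerA mulVf // scale1r.
by rewrite addrC subrK.
Qed.

Lemma det_schur j (X : 'M[F]_(1 + j)) : X 0 0 != 0 ->
  \det X = X 0 0 * \det (drsubmx X - (X 0 0)^-1 *: (dlsubmx X *m ursubmx X)).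
Proof.
move=> a0; rewrite {1}(schur_factor a0) det_mulmx det_lblock det_ublock !det1 !mul1r.
by rewrite det_scalar1.
Qed.

(** Induction through the Schur complement of the corner entry: its leading minors are those of [Y]
    of one size more, divided by [Y 0 0], so they do not vanish either. *)
Lemma LU_exists m (Y : 'M[F]_m.+1) :
  (forall j, (0 < j <= m.+1)%N -> \det (lead j Y) != 0) ->
  exists L V : 'M[F]_m.+1, [/\ lowu L, upt V & Y = L *m V].
Proof.
elim: m Y => [|m IH] Y hY.
  exists 1%:M, Y; split; rewrite ?mul1mx // => i j; rewrite !ord1 ?mxE //.
have a0 : Y 0 0 != 0.
  have := hY 1%N isT; rewrite det_mx11 mxE.
  by congr (_ != _); congr (Y _ _); apply: val_inj; rewrite /= inordK.
pose Z : 'M[F]_(1 + m.+1) := Y.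
pose S := drsubmx Z - (Z 0 0)^-1 *: (dlsubmx Z *m ursubmx Z).
have [j /andP[j0 jm]|L [V [hL hV SE]]] := IH S.
  have := hY j.+1 jm.
  pose X : 'M[F]_(1 + j) := lead j.+1 Y.
  have XE : X 0 0 = Y 0 0.
    by rewrite mxE; congr (Y _ _); apply: val_inj; rewrite /= inordK.
  have /det_schur : X 0 0 != 0 by rewrite XE.
  rewrite -/X => ->; rewrite XE mulf_eq0 (negPf a0) /=.
  congr (\det _ != 0); apply/matrixP => i k.
  have e (i0 : 'I_j) : inord (lshift 0 i0).+1 = rshift 1 (inord i0 : 'I_m.+1) :> 'I_m.+2.
    apply: val_inj; rewrite /= inordK ?inordK ?add1n ?ltnS //.
      by apply: leq_trans (ltn_ord _) jm.
    by apply: leq_trans (ltn_ord _) jm.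
  have e0 : inord 0 = lshift m.+1 (0 : 'I_1) :> 'I_m.+2.
    by apply: val_inj; rewrite /= inordK.
  rewrite !mxE !big_ord1 !mxE /= /bump /= !add1n -!e !e0 /=.
  by rewrite /Z; congr (_ - _ * (_ * _)); rewrite -e.
exists (block_mx 1%:M 0 ((Z 0 0)^-1 *: dlsubmx Z) L : 'M_(1 + m.+1)).
exists (block_mx (Z 0 0)%:M (ursubmx Z) 0 V : 'M_(1 + m.+1)).
split.
- move=> x y; rewrite -[x](@splitK 1 m.+1) -[y](@splitK 1 m.+1).
  case: (@split 1 m.+1 x) => a; case: (@split 1 m.+1 y) => b /= ab.
  + by rewrite (@block_mxEul _ 1 m.+1 1 m.+1) !ord1 mxE eqxx.
  + by rewrite (@block_mxEur _ 1 m.+1 1 m.+1) !mxE -val_eqE /= !ord1.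
  + by move: ab; rewrite !ord1 /= add1n.
  + rewrite (@block_mxEdr _ 1 m.+1 1 m.+1) hL //; congr ((_ : bool)%:R); exact/esym/(inj_eq (@rshift_inj 1 m.+1)).
- move=> x y; rewrite -[x](@splitK 1 m.+1) -[y](@splitK 1 m.+1).
  case: (@split 1 m.+1 x) => a; case: (@split 1 m.+1 y) => b /= ab.
  + by move: ab; rewrite !ord1.
  + by move: ab; rewrite !ord1.
  + by rewrite (@block_mxEdl _ 1 m.+1 1 m.+1) mxE.
  + by rewrite (@block_mxEdr _ 1 m.+1 1 m.+1) hV.
- transitivity (Z : 'M_(1 + m.+1)); first by [].
  apply: etrans (esym (@mulmx_block F 1 m.+1 1 m.+1 1 m.+1 _ _ _ _ _ _ _ _)).
  by rewrite [LHS](@schur_factor m.+1 Z) // -/S SE mulmx_block !mul1mx !mul0mx mulmx0.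
Qed.

End LeadingMinors.

(** * Gauss decomposition in the orthogonal group of the antidiagonal form *)

Section SplitForm.
Variable F : fieldType.

Definition Jmx {A : comNzRingType} (m : nat) : 'M[A]_m := \matrix_(i, j) (j == rev_ord i)%:R.

Lemma JmxE {A : comNzRingType} m (M : 'M[A]_m) i j : (Jmx m *m M *m Jmx m) i j = M (rev_ord i) (rev_ord j).
Proof.
rewrite mxE (bigD1 (rev_ord j)) //= big1 => [|k kj]; last first.
  rewrite [X in _ * X]mxE (_ : (j == rev_ord k) = false) ?mulr0 //.
  by apply: contraNF kj => /eqP ->; rewrite rev_ordK.
rewrite addr0 [X in _ * X]mxE rev_ordK eqxx mulr1 mxE (bigD1 (rev_ord i)) //= big1 ?addr0.
  by rewrite mxE eqxx mul1r.
by move=> k ki; rewrite mxE (negPf ki) mul0r.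
Qed.

Lemma JmxK {A : comNzRingType} m : Jmx m *m Jmx m = 1%:M :> 'M[A]_m.
Proof.
apply/matrixP => i j; have := JmxE (1%:M : 'M[A]_m) i j.
by rewrite mulmx1 => ->; rewrite !mxE (inj_eq rev_ord_inj).
Qed.

Lemma Jmx_tr {A : comNzRingType} m : (Jmx m : 'M[A]_m)^T = Jmx m.
Proof.
apply/matrixP => i j; rewrite !mxE; congr ((_ : bool)%:R).
by apply/eqP/eqP => ->; rewrite rev_ordK.
Qed.

(** The orthogonal group of the antidiagonal form. Unlike for the standard form, its triangular
    elements form opposite Borel subgroups and its diagonal elements a torus. *)
Definition inOJ m (Y : 'M[F]_m) := Y^T *m Jmx m *m Y = Jmx m.

Lemma inOJ_inv m (Y : 'M[F]_m) : inOJ Y <-> (Jmx m *m Y^T *m Jmx m) *m Y = 1%:M.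
Proof.
rewrite /inOJ; split => h.
  by rewrite -!mulmxA (mulmxA Y^T) h JmxK.
by rewrite -[LHS]mul1mx -(JmxK m) -!mulmxA (mulmxA (Jmx m) Y^T) (mulmxA (Jmx m *m _)) h mulmx1.
Qed.

Lemma inOJM m (Y Z : 'M[F]_m) : inOJ Y -> inOJ Z -> inOJ (Y *m Z).
Proof.
rewrite /inOJ => hY hZ.
by rewrite trmx_mul -!mulmxA (mulmxA Y^T) (mulmxA (Y^T *m _)) hY mulmxA hZ.
Qed.

(** Uniqueness of the LU factorization, row by row: once the earlier rows of [W] are those of the
    identity, row [i] of the product shows [A i j] left of the diagonal and [W i j] from the
    diagonal on. *)
Lemma lowu_upt1 m (A W : 'M[F]_m) : lowu A -> upt W -> A *m W = 1%:M ->
  A = 1%:M /\ W = 1%:M.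
Proof.
move=> hA hW h.
suff H (i j : 'I_m) : A i j = (i == j)%:R /\ W i j = (i == j)%:R.
  by split; apply/matrixP => i j; rewrite mxE; case: (H i j).
have [k] := ubnP i; elim: k i j => // k IH i j; rewrite ltnS => ik.
have {}IH (i' : 'I_m) : (i' < i)%N -> forall j', W i' j' = (i' == j')%:R.
  by move=> ii j'; have [] // := IH i' j'; apply: leq_trans ii ik.
have row (j' : 'I_m) : (if (j' < i)%N then A i j' else 0) + W i j' = (i == j')%:R.
  have := congr1 (fun M : 'M_m => M i j') h; rewrite !mxE => <-.
  rewrite (bigD1 i) //= (hA i i) // eqxx mul1r addrC; congr (_ + _).
  rewrite (eq_bigr (fun k' : 'I_m => if (k' < i)%N then A i k' * (k' == j')%:R else 0)); last first.
    move=> k' k'i; case: ifP => [/IH -> //|/negbT].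
    by rewrite -leqNgt => ik'; rewrite hA // eq_sym (negPf k'i) mul0r.
  case: ifP => ji.
    rewrite (bigD1 j') /=; last by rewrite neq_ltn ji.
    rewrite ji eqxx mulr1 big1 ?addr0 // => k' /andP[_ k'j].
    by rewrite (negPf k'j) mulr0 if_same.
  rewrite big1 // => k' k'i; case: ifP => // k'lt.
  by case: eqP k'lt => [->|_]; rewrite ?ji // mulr0.
have := row j; case: (ltnP j i) => ji.
  by rewrite hW // addr0 => ->; rewrite -val_eqE /= gtn_eqF.
by rewrite add0r => ->; rewrite hA.
Qed.

Lemma upt_mul_diag m (V W : 'M[F]_m) i : upt V -> upt W -> (V *m W) i i = V i i * W i i.
Proof.
move=> hV hW; rewrite mxE (bigD1 i) //= big1 ?addr0 // => k ki.
case: (ltngtP k i) => [h|h|/val_inj e]; last by rewrite e eqxx in ki.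
  by rewrite hV // mul0r.
by rewrite [W _ _]hW // mulr0.
Qed.

Lemma upt_mul m (V W : 'M[F]_m) : upt V -> upt W -> upt (V *m W).
Proof.
move=> hV hW i j ji; rewrite mxE big1 // => k _.
case: (ltnP k i) => [h|h]; first by rewrite hV // mul0r.
by rewrite [W _ _]hW ?mulr0 //; apply: leq_trans ji h.
Qed.

Lemma lowu_mul m (V W : 'M[F]_m) : lowu V -> lowu W -> lowu (V *m W).
Proof.
move=> hV hW i j ij; rewrite mxE (bigD1 i) //= hV // eqxx mul1r hW //.
rewrite big1 ?addr0 // => k ki; case: (ltnP i k) => [h|h].
  by rewrite hV 1?ltnW // eq_sym (negPf ki) mul0r.
by rewrite [W _ _]hW ?(leq_trans h) // -val_eqE /= ltn_eqF ?mulr0 //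
  (leq_trans _ ij) // ltn_neqAle h andbT val_eqE.
Qed.

(** Transposition followed by conjugation with [Jmx] reverses products, preserves both triangular
    shapes and inverts the elements of the group. Applied to an LU factorization of [Y] it gives a
    factorization of the inverse; by uniqueness each factor of [Y] is inverted as well, hence lies
    in the group. *)
Lemma OJ_LTU m (Y : 'M[F]_m.+1) : inOJ Y ->
  (forall j, (0 < j <= m.+1)%N -> \det (lead j Y) != 0) ->
  exists L U : 'M[F]_m.+1, exists t : 'rV[F]_m.+1,
  [/\ [/\ lowu L, lowu U^T, inOJ L & inOJ U], Y = L *m diag_mx t *m U,
      forall p, t 0 p * t 0 (rev_ord p) = 1 &
      forall j, (j <= m.+1)%N -> \det (lead j Y) = \prod_(k < j) t 0 (inord k)].
Proof.
move=> YJ hY; have [L [V [hL hV YE]]] := LU_exists hY.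
pose L' := Jmx _ *m L^T *m Jmx _; pose V' := Jmx _ *m V^T *m Jmx _.
have hL' : lowu L'.
  move=> i j ij; rewrite /L' JmxE mxE hL ?(inj_eq rev_ord_inj) 1?eq_sym //=.
  by rewrite leq_sub2l.
have hV' : upt V'.
  move=> i j ij; rewrite /V' JmxE mxE hV //= ltn_sub2l //.
  by apply: leq_trans (ltn_ord i).
have h : V' *m (L' *m L *m V) = 1%:M.
  have /inOJ_inv <- := YJ; rewrite /V' /L' YE trmx_mul -!mulmxA.
  by do 2 congr (_ *m _); rewrite !mulmxA JmxK mul1mx.
have h2 : L' *m L *m (V *m V') = 1%:M by rewrite mulmxA; exact: mulmx1C.
have [LL VV] := lowu_upt1 (lowu_mul hL' hL) (upt_mul hV hV') h2.
have LJ : inOJ L by apply/inOJ_inv.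
have VJ : inOJ V by apply/inOJ_inv; exact: mulmx1C.
pose t := \row_p V p p.
have tt p : t 0 p * t 0 (rev_ord p) = 1.
  have := upt_mul_diag p hV hV'; rewrite VV mxE eqxx /V' JmxE !mxE => h3.
  by rewrite -h3.
have t0 p : t 0 p != 0.
  by apply/eqP => tp; have := tt p; rewrite tp mul0r => /esym/eqP; rewrite oner_eq0.
pose U := diag_mx (\row_p (t 0 p)^-1) *m V.
exists L, U, t; split => //.
- split=> //.
    move=> i j ij; rewrite mxE /U mul_diag_mx !mxE; case: (ltngtP i j) ij => // [ij _|/val_inj -> _].
      by rewrite (hV j i) // mulr0 -val_eqE /= ltn_eqF.
    have := t0 j; rewrite mxE => ?; by rewrite mulVf // eqxx.
  apply: inOJM => //; rewrite /inOJ tr_diag_mx.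
  apply/matrixP => i j; rewrite mul_mx_diag mul_diag_mx !mxE.
  case: eqP => [->|_]; last by rewrite mulr0 mul0r.
  by have := tt i; rewrite mulr1 -invfM !mxE => ->; rewrite invr1.
- rewrite /U mulmxA -(mulmxA L) mulmx_diag.
  rewrite (_ : diag_mx _ = 1%:M) ?mulmx1 //.
  by apply/matrixP => i j; rewrite !mxE; have := t0 i; rewrite mxE => ?; rewrite divff.
- move=> j jm; rewrite YE lminor_mul //; apply: eq_bigr => k _; by rewrite mxE.
Qed.

End SplitForm.

(** * The change of basis from the standard form to the antidiagonal one *)

Section IsotropicBasis.
Variable R : rcfType.
Local Notation C := R[i].

Definition adjm m p (M : 'M[C]_(m, p)) : 'M[C]_(p, m) := (map_mx conjc M)^T.

Lemma adjmM m p q (M : 'M[C]_(m, p)) (M' : 'M[C]_(p, q)) :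
  adjm (M *m M') = adjm M' *m adjm M.
Proof. by rewrite /adjm map_mxM trmx_mul. Qed.

Lemma adjmK m p (M : 'M[C]_(m, p)) : adjm (adjm M) = M.
Proof. by apply/matrixP => a b; rewrite !mxE conjcK. Qed.

Lemma adjm_rho m k (M : 'M[C]_m) : adjm (rho k M) = rho k (adjm M).
Proof. by rewrite /adjm (rho_map conjc) rho_tr. Qed.

Lemma row_adjm_eq0 m (z : 'rV[C]_m) : (z *m adjm z == 0) = (z == 0).
Proof.
apply/eqP/eqP => [h|->]; last by rewrite mul0mx.
have : (z *m adjm z) 0 0 = 0 by rewrite h mxE.
rewrite mxE => /eqP; rewrite psumr_eq0 => [/allP h2|a _]; last first.
  by rewrite !mxE -sqr_normc exprn_ge0 ?normr_ge0.
apply/rowP => a; have := h2 a; rewrite mem_index_enum => /(_ isT) /=.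
by rewrite !mxE -sqr_normc sqrf_eq0 normr_eq0 => /eqP.
Qed.

Definition cm m p (X : 'M[R]_(m, p)) : 'M[C]_(m, p) := map_mx (real_complex R) X.

Lemma cm_conj m p (X : 'M[R]_(m, p)) : map_mx conjc (cm X) = cm X.
Proof. by apply/matrixP => a b; rewrite !mxE conjc_real. Qed.

Lemma cm_adj m (X : 'M[R]_m) : adjm (cm X) = cm X^T.
Proof. by rewrite /adjm cm_conj /cm map_trmx. Qed.

Lemma cmP m p (M : 'M[C]_(m, p)) : map_mx conjc M = M -> exists X, M = cm X.
Proof.
move=> h; exists (map_mx (@complex.Re R) M); apply/matrixP => a b.
have := congr1 (fun Z : 'M_(m, p) => Z a b) h; rewrite !mxE.
case: (M a b) => x y /= [/eqP]; rewrite eq_sym -addr_eq0 -mulr2n mulrn_eq0 /= => /eqP ->.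
by [].
Qed.

Lemma cm_inj m p : injective (@cm m p).
Proof.
move=> X Y h; apply/matrixP => a b.
by have := congr1 (fun Z : 'M_(m, p) => Z a b) h; rewrite !mxE => /complexI.
Qed.

Variable n : nat.
Local Notation N := n.*2.+1.

Definition hf : C := (Num.sqrt 2 : R)^-1%:C%C.

Lemma hf2 : hf * hf = 2^-1.
Proof.
rewrite /hf -rmorphM -invfM -expr2 sqr_sqrtr ?ler0n //.
by rewrite fmorphV rmorphD rmorph1.
Qed.

Lemma hf_conj : conjc hf = hf. Proof. by rewrite conjc_real. Qed.

Local Notation plane p := (minn p (n.*2 - p)%N).

(** Column [p < n] is (e_2p + i e_(2p+1)) / sqrt 2, column [2n - p] is its conjugate, and the middle
    column is the last basis vector. Reversal of indices is thus complex conjugation, and the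
    standard form becomes the antidiagonal one ([Bmx_form]). *)
Definition Bmx : 'M[C]_N := \matrix_(q, p)
  if p == n :> nat then (q == n.*2 :> nat)%:R else
  if q == (plane p).*2 :> nat then hf else
  if q == (plane p).*2.+1 :> nat then (if (p < n)%N then 'i else - 'i)%C * hf else 0.

Lemma Bmx_conj q p : conjc (Bmx q p) = Bmx q (rev_ord p).
Proof.
have pN : (p <= n.*2)%N by rewrite -ltnS.
rewrite !mxE /=.
have -> : (n.*2.+1 - p.+1 == n)%N = (p == n :> nat) by apply/eqP/eqP; lia.
have -> : plane (n.*2.+1 - p.+1) = plane p by lia.
case: eqP => [_|/eqP pn]; first by case: eqP => _; rewrite ?conjc1 ?conjc0.
case: eqP => _; first exact: hf_conj.
case: eqP => _; last by rewrite conjc0.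
rewrite rmorphM [X in _ * X]hf_conj; congr (_ * _).
have -> : (n.*2.+1 - p.+1 < n)%N = (n < p)%N by lia.
by case: ltngtP pn => //= _ _; apply/eqP; rewrite eq_complex /= ?oppr0 ?opprK ?eqxx.
Qed.

Lemma Bmx_conjE : map_mx conjc Bmx = Bmx *m Jmx N.
Proof.
apply/matrixP => q p; rewrite [LHS]mxE Bmx_conj [RHS]mxE (bigD1 (rev_ord p)) //=.
rewrite [Jmx _ _ _]mxE rev_ordK eqxx mulr1 big1 ?addr0 // => k kp.
rewrite [Jmx _ _ _]mxE (_ : _ == _ = false) ?mulr0 //.
by apply: contraNF kp => /eqP ->; rewrite rev_ordK.
Qed.

Lemma Bmx_colsum p (f : 'I_N -> C) : \sum_q Bmx q p * f q =
  if p == n :> nat then f ord_max else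
  hf * (f (inord (plane p).*2) + (if (p < n)%N then 'i else - 'i)%C * f (inord (plane p).*2.+1)).
Proof.
have pN : (p <= n.*2)%N by rewrite -ltnS.
case: ifP => pn.
  rewrite (bigD1 ord_max) //= big1 ?addr0 => [|q qn].
    by rewrite mxE pn eqxx mul1r.
  rewrite mxE pn (_ : _ == _ = false) ?mul0r //.
  by apply: contraNF qn => /eqP h; apply/eqP/val_inj.
have k1 : ((plane p).*2 < N)%N by lia.
have k2 : ((plane p).*2.+1 < N)%N by lia.
rewrite (bigD1 (inord (plane p).*2)) //= (bigD1 (inord (plane p).*2.+1)) /=; last first.
  by rewrite -val_eqE /= !inordK // eqn_leq ltnn.
rewrite big1 ?addr0 => [|q /andP[q1 q2]]; last first.
  rewrite mxE pn.
  have -> : (q == (plane p).*2 :> nat) = false.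
    by apply: contraNF q1 => /eqP h; apply/eqP/val_inj; rewrite /= inordK.
  have -> : (q == (plane p).*2.+1 :> nat) = false.
    by apply: contraNF q2 => /eqP h; apply/eqP/val_inj; rewrite /= inordK.
  by rewrite mul0r.
rewrite !mxE pn !inordK // eqxx eqn_leq ltnn eqxx /=.
by rewrite mulrDr; congr (_ + _); rewrite mulrA; congr (_ * _); exact: mulrC.
Qed.

Lemma Bmx_unitary : adjm Bmx *m Bmx = 1%:M.
Proof.
apply/matrixP => p p'; rewrite [LHS]mxE.
rewrite (eq_bigr (fun q => Bmx q p' * Bmx q (rev_ord p))); last first.
  by move=> q _; rewrite mulrC; congr (_ * _); rewrite -Bmx_conj /adjm mxE mxE.
have pN : (p <= n.*2)%N by rewrite -ltnS.
have pN' : (p' <= n.*2)%N by rewrite -ltnS.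
have ii : ('i * 'i : C)%C = -1 by rewrite -expr2 sqr_i.
have r1 : (n.*2.+1 - p.+1 == n)%N = (p == n :> nat) by apply/eqP/eqP; lia.
have r2 : plane (n.*2.+1 - p.+1) = plane p by lia.
have r3 : (n.*2.+1 - p.+1 < n)%N = (n < p)%N by lia.
rewrite Bmx_colsum ![Bmx _ _]mxE /= r1 r2 r3 mxE -val_eqE /=.
case: (eqVneq (p' : nat) n) => [p'n|p'n].
  rewrite p'n; case: (eqVneq (p : nat) n) => [pn|pn]; first by rewrite eqxx.
  have -> : (n.*2 == (plane p).*2)%N = false by apply/eqP; lia.
  by have -> : (n.*2 == (plane p).*2.+1)%N = false by apply/eqP; lia.
have k1 : ((plane p').*2 < N)%N by lia.
have k2 : ((plane p').*2.+1 < N)%N by lia.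
rewrite !inordK //.
case: (eqVneq (p : nat) n) => [pn|pn].
  have -> : ((plane p').*2 == n.*2)%N = false by apply/eqP; lia.
  have -> : ((plane p').*2.+1 == n.*2)%N = false by apply/eqP; lia.
  by rewrite mulr0 addr0 mulr0 pn eq_sym (negPf p'n).
have -> : ((plane p').*2 == (plane p).*2.+1)%N = false by apply/eqP; lia.
have -> : ((plane p').*2.+1 == (plane p).*2)%N = false by apply/eqP; lia.
rewrite (inj_eq double_inj) eqSS (inj_eq double_inj).
case: (eqVneq (plane p') (plane p)) => [e|e]; last first.
  rewrite mulr0 addr0 mulr0 (_ : (p == p' :> nat) = false) //.
  by apply: contraNF e => /eqP ->.
have alg (a b : C) : hf * (hf + a * (b * hf)) = 2^-1 + a * b * 2^-1.
  by rewrite -hf2; ring.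
rewrite /= alg.
have half : 2^-1 + 2^-1 = 1 :> C by rewrite -div1r -splitr.
case: (ltngtP p' n) p'n => // p'n _; case: (ltngtP p n) pn => // pn _.
- by rewrite (_ : (p == p' :> nat) = true) ?mulrN ?ii ?opprK ?mul1r //; apply/eqP; lia.
- by rewrite (_ : (p == p' :> nat) = false) ?ii ?mulN1r ?subrr //; apply/eqP; lia.
- by rewrite (_ : (p == p' :> nat) = false) ?mulrNN ?ii ?mulN1r ?subrr //; apply/eqP; lia.
- have -> : (p == p' :> nat) = true by apply/eqP; lia.
  by rewrite mulNr ii opprK mul1r half.
Qed.

Lemma Bmx_unitary2 : Bmx *m adjm Bmx = 1%:M.
Proof. exact: mulmx1C Bmx_unitary. Qed.

Lemma Bmx_tr : Bmx^T = Jmx N *m adjm Bmx.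
Proof. by rewrite /adjm Bmx_conjE trmx_mul mulmxA Jmx_tr JmxK mul1mx. Qed.

Lemma Bmx_form : Bmx^T *m Bmx = Jmx N.
Proof.
by rewrite Bmx_tr -mulmxA Bmx_unitary mulmx1.
Qed.

Definition cj (X : 'M[C]_N) : 'M[C]_N := adjm Bmx *m X *m Bmx.

Lemma cjM X Y : cj (X *m Y) = cj X *m cj Y.
Proof.
by rewrite /cj !mulmxA; congr (_ *m _ *m _); rewrite -!mulmxA Bmx_unitary2 mulmx1.
Qed.

Lemma cj1 : cj 1%:M = 1%:M.
Proof. by rewrite /cj mulmx1 Bmx_unitary. Qed.

Lemma cj_adj X : adjm (cj X) = cj (adjm X).
Proof. by rewrite /cj !adjmM adjmK mulmxA. Qed.

Definition cji (Y : 'M[C]_N) : 'M[C]_N := Bmx *m Y *m adjm Bmx.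

Lemma cjK X : cji (cj X) = X.
Proof.
rewrite /cji /cj !mulmxA Bmx_unitary2 mul1mx -mulmxA Bmx_unitary2 mulmx1 //.
Qed.

Lemma cjiK Y : cj (cji Y) = Y.
Proof. by rewrite /cji /cj !mulmxA Bmx_unitary mul1mx -mulmxA Bmx_unitary mulmx1. Qed.

Lemma cj_OJ X : X^T *m X = 1%:M -> inOJ (cj X).
Proof.
move=> h; rewrite /inOJ /cj !trmx_mul.
have e : (adjm Bmx)^T *m Jmx N *m adjm Bmx = 1%:M.
  have -> : (adjm Bmx)^T = Bmx *m Jmx N by rewrite /adjm trmxK Bmx_conjE.
  by rewrite -(mulmxA Bmx) JmxK mulmx1 Bmx_unitary2.
rewrite -!mulmxA (mulmxA (adjm _)^T) (mulmxA ((adjm _)^T *m _)) e mul1mx.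
by rewrite (mulmxA X^T) h mul1mx Bmx_form.
Qed.

Lemma cji_orth Y : inOJ Y -> (cji Y)^T *m cji Y = 1%:M.
Proof.
move=> h; rewrite /cji !trmx_mul -!mulmxA (mulmxA Bmx^T) Bmx_form (mulmxA Y^T) (mulmxA (Y^T *m _)).
have -> : (adjm Bmx)^T = Bmx *m Jmx N by rewrite /adjm trmxK Bmx_conjE.
by rewrite h mulmxA -(mulmxA Bmx) JmxK mulmx1 Bmx_unitary2.
Qed.

Lemma cji_conj Y : map_mx conjc (cji Y) = cji (Jmx N *m map_mx conjc Y *m Jmx N).
Proof.
have e : map_mx conjc (adjm Bmx) = Jmx N *m adjm Bmx.
  rewrite -Bmx_tr; apply/matrixP => a b; rewrite !mxE; exact: conjcK.
by rewrite /cji !map_mxM Bmx_conjE e !mulmxA.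
Qed.

End IsotropicBasis.

(** * The Cayley transform *)

Section Cayley.
Variables (F : numFieldType) (m : nat).
Implicit Types (S Y X : 'M[F]_m).

Definition Cay S : 'M[F]_m := (1%:M + S) *m invmx (1%:M - S).

Lemma skew_unit S : S^T = - S -> 1%:M - S \in unitmx -> 1%:M + S \in unitmx.
Proof. by move=> h; rewrite -unitmx_tr linearB /= trmx1 h opprK. Qed.

Lemma skew_det S : S^T = - S -> \det (1%:M + S) = \det (1%:M - S).
Proof. by move=> h; rewrite -[LHS]det_tr linearD /= trmx1 h. Qed.

Lemma comm_1S S : (1%:M + S) *m (1%:M - S) = (1%:M - S) *m (1%:M + S).
Proof.
rewrite mulmxDl mul1mx mulmxBr mulmx1 mulmxBl mul1mx mulmxDr mulmx1.
by rewrite addrA subrK opprD addrA addrK.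
Qed.

Lemma Cay_orth S : S^T = - S -> 1%:M - S \in unitmx ->
  (Cay S)^T *m Cay S = 1%:M /\ \det (Cay S) = 1.
Proof.
move=> h u; have u' := skew_unit h u; split; last first.
  by rewrite /Cay det_mulmx det_inv skew_det // divff // -unitfE -unitmxE.
have h1 : (1%:M - S)^T = 1%:M + S by rewrite linearB /= trmx1 h opprK.
have h2 : (1%:M + S)^T = 1%:M - S by rewrite linearD /= trmx1 h.
rewrite /Cay trmx_mul trmx_inv h1 h2 -mulmxA (mulmxA (1%:M - S)) -comm_1S.
by rewrite -mulmxA mulmxV // mulmx1 mulVmx.
Qed.

Lemma Cay_surj Y : Y^T *m Y = 1%:M -> 1%:M + Y \in unitmx ->
  exists S, [/\ S^T = - S, 1%:M - S \in unitmx & Y = Cay S].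
Proof.
move=> hY u; pose W := invmx (1%:M + Y); pose S := (Y - 1%:M) *m W.
have SY : S *m (1%:M + Y) = Y - 1%:M by rewrite /S -mulmxA mulVmx // mulmx1.
have e1 : 1%:M - S = 2%:R *: W.
  have -> : (1%:M : 'M[F]_m) = (1%:M + Y) *m W by rewrite mulmxV.
  rewrite /S -mulmxBl addrC opprB addrACA [- Y + _]addrC subrr addr0 -mulr2n.
  by rewrite -scaler_nat -scalemxAl mul1mx.
have e2 : 1%:M + S = 2%:R *: (Y *m W).
  have -> : (1%:M : 'M[F]_m) = (1%:M + Y) *m W by rewrite mulmxV.
  rewrite /S -mulmxDl addrC addrA subrK -mulr2n.
  by rewrite -scaler_nat -scalemxAl.
have t0 : 2%:R != 0 :> F by rewrite pnatr_eq0.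
have Wu : W \in unitmx by rewrite unitmx_inv.
have Su : 1%:M - S \in unitmx.
  by rewrite e1 unitmxZ // unitfE.
exists S; split => //.
  have u' : (1%:M + Y)^T \in unitmx by rewrite unitmx_tr.
  apply: (can_inj (mulKmx u')); apply: (can_inj (mulmxK u)).
  have e3 : (Y - 1%:M)^T = Y^T - 1%:M by rewrite linearB /= trmx1.
  have e4 : (1%:M + Y)^T = 1%:M + Y^T by rewrite linearD /= trmx1.
  rewrite -trmx_mul SY mulmxN mulNmx -mulmxA SY e3 e4.
  rewrite mulmxBl mul1mx mulmxDr mulmx1 hY mulmxDl mul1mx mulmxBr mulmx1 hY.
  by rewrite opprD addrA addrK addrA subrK opprB.
rewrite /Cay e2 e1 -scalemxAl invmxZ ?unitfE //; last first.
  by rewrite -e1.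
by rewrite -scalemxAr scalerA mulfV // scale1r -mulmxA mulmxV // mulmx1.
Qed.

End Cayley.

(** * Rational curves of orthogonal matrices *)

Section PolyMatrices.
Variable F : numFieldType.

Lemma poly_nat0 (q : {poly F}) : (forall k : nat, q.[k%:R] = 0) -> q = 0.
Proof.
move=> h; apply: (@roots_geq_poly_eq0 _ _ [seq k%:R | k <- iota 0 (size q)]).
- by apply/allP => x /mapP [k _ ->]; apply/rootP.
- by rewrite map_inj_uniq ?iota_uniq // => a b /eqP; rewrite eqr_nat => /eqP.
- by rewrite size_map size_iota.
Qed.

Definition evm m p (c : F) (M : 'M[{poly F}]_(m, p)) : 'M[F]_(m, p) := map_mx (horner_eval c) M.

Lemma evm_polyC m p c (M : 'M[F]_(m, p)) : evm c (map_mx polyC M) = M.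
Proof. by apply/matrixP => a b; rewrite !mxE /horner_eval hornerC. Qed.

Lemma evm_mul m p q c (M : 'M[{poly F}]_(m, p)) (M' : 'M[{poly F}]_(p, q)) :
  evm c (M *m M') = evm c M *m evm c M'.
Proof. exact: map_mxM. Qed.

Lemma evm_tpow m k c (d : {poly F}) (M : 'M[{poly F}]_m) :
  evm c (tpow k (ext d M)) = tpow k (ext d.[c] (evm c M)).
Proof. by rewrite /evm tpow_map ext_map. Qed.

Variable m : nat.

(** [M / d] is a rational curve of orthogonal matrices from the identity to [X]. To prove a
    polynomial identity at [X] it suffices to check it along the curve at the natural numbers where
    some fixed nonzero polynomial does not vanish ([poly_nat0]). *)
Definition ratpath (X : 'M[F]_m) := exists (M : 'M[{poly F}]_m) (d : {poly F}),
  [/\ d.[0] != 0, d.[1] != 0, evm 0 M = (d.[0])%:M, evm 1 M = d.[1] *: X &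
      M^T *m M = (d * d)%:M].

Lemma ratpath1 : ratpath 1%:M.
Proof.
exists 1%:M, 1; rewrite !hornerC oner_eq0; split => //.
- by rewrite /evm map_mx1.
- by rewrite /evm map_mx1 scale1r.
- by rewrite trmx1 mulmx1 mulr1.
Qed.

Lemma ratpathM X Y : ratpath X -> ratpath Y -> ratpath (X *m Y).
Proof.
move=> [M [d [d0 d1 M0 M1 MM]]] [M' [d' [d0' d1' M0' M1' MM']]].
exists (M *m M'), (d * d'); rewrite !hornerM; split.
- by rewrite mulf_neq0.
- by rewrite mulf_neq0.
- by rewrite evm_mul M0 M0' -scalar_mxM.
- by rewrite evm_mul M1 M1' -scalemxAl -scalemxAr scalerA.
- rewrite trmx_mul -mulmxA (mulmxA M^T) MM -scalar_mxC mulmxA MM' -scalar_mxM.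
  by congr (_%:M); ring.
Qed.

(** The curve of the [Cay (x S)], with the denominator, the determinant of [1 - x S], cleared by the
    adjugate. *)
Lemma ratpath_Cay (S : 'M[F]_m) : S^T = - S -> 1%:M - S \in unitmx -> ratpath (Cay S).
Proof.
move=> h u; pose Sp := 'X *: map_mx polyC S : 'M[{poly F}]_m.
have hS : Sp^T = - Sp by rewrite /Sp linearZ /= map_trmx h map_mxN scalerN.
have evS c : evm c Sp = c *: S.
  by apply/matrixP => a b; rewrite !mxE /horner_eval hornerM hornerX hornerC.
have evD c : (\det (1%:M - Sp)).[c] = \det (1%:M - c *: S).
  rewrite -[LHS]/(horner_eval c _) -det_map_mx; congr (\det _).
  by rewrite map_mxB map_mx1 -/(evm c Sp) evS.
have h1 : (1%:M - Sp)^T = 1%:M + Sp by rewrite linearB /= trmx1 hS opprK.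
have h2 : (1%:M + Sp)^T = 1%:M - Sp by rewrite linearD /= trmx1 hS.
have cm : (1%:M + Sp) *m (1%:M - Sp) = (1%:M - Sp) *m (1%:M + Sp).
  rewrite mulmxDl mul1mx mulmxBr mulmx1 mulmxBl mul1mx mulmxDr mulmx1.
  by rewrite addrA subrK opprD addrA addrK.
exists ((1%:M + Sp) *m \adj (1%:M - Sp)), (\det (1%:M - Sp)); rewrite !evD.
rewrite scale0r subr0 det1 scale1r.
have evM c : evm c ((1%:M + Sp) *m \adj (1%:M - Sp)) = (1%:M + c *: S) *m \adj (1%:M - c *: S).
  by rewrite evm_mul /evm map_mxD map_mx1 map_mx_adj map_mxB map_mx1 -/(evm c Sp) evS.
rewrite !evM scale0r addr0 subr0 scale1r; split.
- by rewrite oner_eq0.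
- by rewrite -unitfE -unitmxE.
- by rewrite adj1 mulmx1.
- rewrite /Cay /invmx u -scalemxAr scalerA divff ?scale1r //.
  by rewrite -unitfE -unitmxE.
- rewrite trmx_mul trmx_adj h1 h2 -mulmxA (mulmxA (1%:M - Sp)) -cm.
  rewrite -mulmxA mul_mx_adj (mulmxA (\adj _)) mul_adj_mx -scalar_mxM; congr (_%:M).
  by congr (_ * _); rewrite -det_tr h2.
Qed.

End PolyMatrices.

(** * Every rotation is joined to the identity by a rational curve *)

Section RatpathSO.
Variable F : numFieldType.

(** Once the other signs are chosen by induction, the determinant is affine in the first one with
    nonzero slope, so it cannot vanish at both 1 and -1. *)
Lemma sign_shift m (A : 'M[F]_m) : exists d : 'rV[F]_m,
  (forall a, d 0 a = 1 \/ d 0 a = -1) /\ \det (A + diag_mx d) != 0.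
Proof.
elim: m A => [|m IH] A; first by exists 0; split => [[]//|]; rewrite det_mx00 oner_eq0.
pose A0 : 'M[F]_(1 + m) := A.
have [d' [hd' hA']] := IH (drsubmx A0).
pose E := drsubmx A0 + diag_mx d'.
pose dd (x : F) : 'rV[F]_(1 + m) := row_mx x%:M d'.
have dE x : A + diag_mx (dd x) =
    block_mx 1%:M (ursubmx A0 *m invmx E) 0 1%:M *m
    block_mx (ulsubmx A0 + x%:M - ursubmx A0 *m invmx E *m dlsubmx A0) 0 (dlsubmx A0) E.
  have Eu : E \in unitmx by rewrite unitmxE unitfE.
  rewrite mulmx_block !mul1mx !mul0mx !add0r /dd diag_mx_row.
  rewrite -[LHS]/(A0 + _) -{1}[A0]submxK add_block_mx.
  rewrite subrK -mulmxA mulVmx // mulmx1 !addr0 -/E.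
  rewrite (_ : diag_mx x%:M = x%:M) //.
  by apply/matrixP => a b; rewrite !ord1 !mxE.
have detE x : \det (A + diag_mx (dd x)) =
    ((ulsubmx A0 - ursubmx A0 *m invmx E *m dlsubmx A0) 0 0 + x) * \det E.
  rewrite dE (@det_mulmx F (1 + m)) (@det_ublock F 1 m) (@det_lblock F 1 m) !det1 !mul1r det_mx11; congr (_ * _).
  by rewrite !mxE eqxx mulr1n addrAC.
have hdd x : x = 1 \/ x = -1 -> forall a, (dd x : 'rV_m.+1) 0 a = 1 \/ (dd x : 'rV_m.+1) 0 a = -1.
  move=> hx a; rewrite mxE; case: (@split 1 m a) => b; last exact: hd'.
  by rewrite ord1 mxE eqxx.
case: (eqVneq ((ulsubmx A0 - ursubmx A0 *m invmx E *m dlsubmx A0) 0 0 + 1) 0) => h.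
  exists (dd (-1)); split; first by apply: hdd; right.
  rewrite detE mulf_neq0 //; apply: contraTN isT => /eqP h'.
  have : (2%:R : F) = 0 by rewrite -[RHS](subrr 0) -{1}h -h'; ring.
  by move/eqP; rewrite pnatr_eq0.
exists (dd 1); split; first by apply: hdd; left.
by rewrite detE mulf_neq0.
Qed.

Lemma pm1_sqr (x : F) : x = 1 \/ x = -1 -> x * x = 1.
Proof. by case=> ->; rewrite ?mulrNN mulr1. Qed.

Definition flipv m (k : 'I_m.+1) : 'rV[F]_m.+1 :=
  \row_a (if (a == 0) || (a == k) then -1 else 1).

(** A half turn has the eigenvalue -1 and is no Cayley transform, but it is the square of the
    quarter turn [Cay S]. *)
Lemma ratpath_flip m (k : 'I_m.+1) : k != 0 -> ratpath (diag_mx (flipv k)).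
Proof.
move=> k0; pose S : 'M[F]_m.+1 := delta_mx 0 k - delta_mx k 0.
pose P : 'M[F]_m.+1 := delta_mx 0 0 + delta_mx k k.
have k0' : (0 == k) = false by rewrite eq_sym (negPf k0).
pose dmE := (mul_delta_mx_cond, eqxx, k0', negPf k0, mulr1n, mulr0n).
have SS : S *m S = - P.
  by rewrite /S mulmxBl !mulmxBr !dmE sub0r subr0 opprD.
have PP : P *m P = P by rewrite /P mulmxDl !mulmxDr !dmE addr0 add0r.
have PS : P *m S = S by rewrite /P /S mulmxDl !mulmxBr !dmE subr0 sub0r.
have ST : S^T = - S by rewrite /S linearB /= !trmx_delta opprB.
have half : (2%:R : F) != 0 by rewrite pnatr_eq0.
have Su : 1%:M - S \in unitmx.
  have e : (1%:M - S) *m ((1%:M + S) *m (1%:M - 2^-1 *: P)) = 1%:M.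
    rewrite mulmxA mulmxDr mulmx1 mulmxBl mul1mx SS opprK addrA subrK.
    rewrite mulmxDl mul1mx mulmxBr mulmx1 -scalemxAr PP -addrA.
    have -> : - (2^-1 *: P) + (P - 2^-1 *: P) = 0.
      by rewrite addrCA -opprD -scalerDl -[2^-1 in X in X *: _]div1r -splitr scale1r subrr.
    by rewrite addr0.
  by have [] := mulmx1_unit e.
have -> : diag_mx (flipv k) = Cay S *m Cay S; last first.
  by apply: ratpathM; apply: ratpath_Cay.
have fl : diag_mx (flipv k) = 1%:M - 2 *: P.
  apply/matrixP => a b; rewrite !mxE; case: (eqVneq a b) => [->|ab]; last first.
    rewrite !mulr0n (_ : _ && _ = false) 1?(_ : (a == k) && _ = false) ?addr0 ?mulr0 ?subr0 //.
      by apply: contraNF ab => /andP[/eqP -> /eqP ->].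
    by apply: contraNF ab => /andP[/eqP -> /eqP ->].
  rewrite !andbb !mulr1n; case: (eqVneq b 0) => [->|_] /=.
    by rewrite k0' addr0; ring.
  by case: (eqVneq b k) => _ /=; ring.
have SP : S *m P = S.
  have PT : P^T = P by rewrite /P linearD /= !trmx_delta.
  by apply: trmx_inj; rewrite trmx_mul ST PT mulmxN PS.
clearbody S P.
have cm : (1%:M + S) *m invmx (1%:M - S) = invmx (1%:M - S) *m (1%:M + S).
  apply: (can_inj (mulKmx Su)); rewrite !mulmxA mulmxV // mul1mx -comm_1S.
  by rewrite -mulmxA mulmxV // mulmx1.
rewrite /Cay {1}cm mulmxA -(mulmxA _ (1%:M + S)).
apply: (can_inj (mulKmx Su)); apply: (can_inj (mulmxK Su)).
rewrite !mulmxA mulmxV // mul1mx -(mulmxA _ (invmx _)) mulVmx // mulmx1 fl.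
have -> : (1%:M - S) *m (1%:M - 2 *: P) = 1%:M + S - 2 *: P.
  rewrite mulmxBl mul1mx mulmxBr mulmx1 -scalemxAr SP.
  by apply/matrixP => a b; rewrite !mxE; ring.
rewrite mulmxBl !mulmxDl !mul1mx !mulmxBr !mulmxDr !mulmx1 -scalemxAl SS PS.
by apply/matrixP => a b; rewrite !mxE; ring.
Qed.

(** Each sign -1 away from coordinate 0 is removed by a half turn that also flips coordinate 0; the
    sign left at 0 is then the product, which is 1. *)
Lemma ratpath_diag m (d : 'rV[F]_m.+1) :
  (forall a, d 0 a = 1 \/ d 0 a = -1) -> \prod_a d 0 a = 1 -> ratpath (diag_mx d).
Proof.
have [c] := ubnP #|[set a : 'I_m.+1 | (a != 0) && (d 0 a == -1)]|.
elim: c d => // c IH d; rewrite ltnS => hc hd hp.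
case: (pickP [pred a : 'I_m.+1 | (a != 0) && (d 0 a == -1)]) => [k /= /andP[k0 /eqP dk]|hno].
  pose d' : 'rV[F]_m.+1 := \row_a (flipv k 0 a * d 0 a).
  have ne : (-1 : F) != 1 by rewrite eqNr oner_eq0.
  have -> : diag_mx d = diag_mx (flipv k) *m diag_mx d'.
    rewrite mulmx_diag; congr diag_mx; apply/rowP => a; rewrite !mxE mulrA pm1_sqr ?mul1r //.
    by case: ifP => _; [right|left].
  apply: ratpathM; first exact: ratpath_flip.
  apply: IH.
  - apply: leq_trans hc; apply: proper_card; apply/properP; split.
      apply/subsetP => a; rewrite !inE => /andP[a0]; rewrite a0 !mxE (negPf a0) /=.
      by case: (eqVneq a k) => [->|_]; rewrite ?dk ?mul1r // mulrNN mulr1 eq_sym (negPf ne).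
    exists k; first by rewrite inE k0 dk eqxx.
    by rewrite inE k0 !mxE eqxx orbT dk mulrNN mulr1 eq_sym (negPf ne).
  - move=> a; rewrite !mxE; case: (hd a) => ->; case: ifP => _; rewrite ?mulrNN ?mulr1 ?mul1r; by [left|right].
  - rewrite (bigD1 0) //= (bigD1 k) //= in hp; rewrite (bigD1 0) //= (bigD1 k) //=.
    rewrite -[RHS]hp !mxE !eqxx orbT /= (eq_bigr (fun a => d 0 a)).
      by ring.
    by move=> a /andP[a0 ak]; rewrite !mxE (negPf a0) (negPf ak) mul1r.
have h1 a : a != 0 -> d 0 a = 1.
  by move=> a0; case: (hd a) => // h; have := hno a; rewrite /= a0 h eqxx.
rewrite (_ : diag_mx d = 1%:M); first exact: ratpath1.
rewrite -diag_const_mx; congr diag_mx; apply/rowP => a; rewrite !mxE.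
case: (eqVneq a 0) => [->|]; last exact: h1.
by rewrite -hp (bigD1 0) //= big1 ?mulr1.
Qed.

(** A Cayley transform must avoid the eigenvalue -1. Multiplying [X] by a diagonal sign matrix [D]
    achieves this, and [D] then has determinant 1 and is handled by half turns. *)
Lemma ratpath_SO m (X : 'M[F]_m.+1) : X^T *m X = 1%:M -> \det X = 1 -> ratpath X.
Proof.
move=> hX dX; have [d [hd hdet]] := sign_shift X.
pose D := diag_mx d.
have DD : D *m D = 1%:M.
  rewrite mulmx_diag -diag_const_mx; congr diag_mx; apply/rowP => a; rewrite !mxE.
  exact: pm1_sqr.
pose Y := X *m D.
have hY : Y^T *m Y = 1%:M.
  by rewrite /Y trmx_mul /D tr_diag_mx -mulmxA (mulmxA X^T) hX mul1mx DD.
have uY : 1%:M + Y \in unitmx.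
  have -> : 1%:M + Y = (X + D) *m D by rewrite mulmxDl DD addrC.
  rewrite unitmx_mul; apply/andP; split; first by rewrite unitmxE unitfE.
  by have [] := mulmx1_unit DD.
(* The factors [1 + Y] and [Y^T + 1] in [1 + Y = (Y^T + 1) Y] have the same nonzero determinant. *)
have dY : \det Y = 1.
  have e : 1%:M + Y = (Y^T + 1%:M) *m Y by rewrite mulmxDl hY mul1mx.
  have := congr1 determinant e; rewrite det_mulmx.
  have -> : \det (Y^T + 1%:M) = \det (1%:M + Y).
    by rewrite -det_tr linearD /= trmxK trmx1 addrC.
  move/eqP; rewrite -{1}[\det _]mulr1 -subr_eq0 -mulrBr mulf_eq0.
  have := uY; rewrite unitmxE unitfE => /negPf -> /=.
  by rewrite subr_eq0 => /eqP.
have dD : \det D = 1 by move: dY; rewrite /Y det_mulmx dX mul1r.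
have -> : X = Y *m D by rewrite /Y -mulmxA DD mulmx1.
apply: ratpathM; last by apply: ratpath_diag => //; rewrite -det_diag.
have [S [hS uS ->]] := Cay_surj hY uY.
exact: ratpath_Cay.
Qed.

End RatpathSO.

(** * Relations pass from real rotations to complex ones *)

Section Unitarian.
Variable R : rcfType.
Local Notation C := R[i].

Lemma map_trace (A B : pzRingType) (f : {additive A -> B}) m (M : 'M[A]_m) :
  \tr (map_mx f M) = f (\tr M).
Proof. by rewrite /mxtrace raddf_sum; apply: eq_bigr => a _; rewrite mxE. Qed.

(* The entries of [rho k (Cay S)] times a power of a determinant are polynomial
   along a complex line of skew matrices; vanishing at the real points of the
   line forces vanishing at [S]. *)
Lemma unitarian_trick m k (Cm : 'M[C]_(tdim (1 + m) k)) (u : 'M[C]_m) :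
  (forall X : 'M[R]_m, X^T *m X = 1%:M -> \det X = 1 -> \tr (Cm *m rho k (cm X)) = 0) ->
  u^T *m u = 1%:M -> 1%:M + u \in unitmx -> \tr (Cm *m rho k u) = 0.
Proof.
move=> hC hu uu; have [S [hS uS ->]] := Cay_surj hu uu.
pose A := map_mx (@complex.Re R) S; pose A' := map_mx (@complex.Im R) S.
have SE : S = cm A + 'i%C *: cm A'.
  apply/matrixP => a b; rewrite !mxE; case: (S a b) => x y /=.
  by apply/eqP; rewrite eq_complex /= !mul0r !mul1r !subr0 ?add0r ?addr0 ?mulr0 ?subr0 ?oppr0 ?addr0 !eqxx.
have skA : A^T = - A.
  by apply/matrixP => a b; have := congr1 (fun Z : 'M_m => complex.Re (Z a b)) hS; rewrite !mxE raddfN.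
have skA' : A'^T = - A'.
  by apply/matrixP => a b; have := congr1 (fun Z : 'M_m => complex.Im (Z a b)) hS; rewrite !mxE raddfN.
pose Sp := map_mx polyC (cm A) + 'X *: map_mx polyC (cm A') : 'M[{poly C}]_m.
have evS c : evm c Sp = cm A + c *: cm A'.
  by apply/matrixP => a b; rewrite !mxE /horner_eval !hornerE.
pose d := \det (1%:M - Sp); pose M := (1%:M + Sp) *m \adj (1%:M - Sp).
have evd c : d.[c] = \det (1%:M - (cm A + c *: cm A')).
  rewrite -[LHS]/(horner_eval c _) -det_map_mx; congr (\det _).
  by rewrite map_mxB map_mx1 -/(evm c Sp) evS.
have evM c : evm c M = (1%:M + (cm A + c *: cm A')) *m \adj (1%:M - (cm A + c *: cm A')).
  by rewrite evm_mul /evm map_mxD map_mx1 map_mx_adj map_mxB map_mx1 -/(evm c Sp) evS.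
pose q := \tr (map_mx polyC Cm *m tpow k (ext d M)).
have evq c : d.[c] != 0 -> q.[c] = d.[c] ^+ k * \tr (Cm *m rho k (Cay (cm A + c *: cm A'))).
  move=> dc; rewrite -[LHS]/(horner_eval c _) -map_trace map_mxM -/(evm c _) evm_polyC.
  rewrite -/(evm c _) evm_tpow.
  have -> : evm c M = d.[c] *: Cay (cm A + c *: cm A').
    rewrite evM /Cay /invmx -evd unitmxE -evd unitfE dc -scalemxAr scalerA divff //.
    by rewrite scale1r.
  by rewrite rho_homog -scalemxAr mxtraceZ.
have di : d.['i%C] != 0 by rewrite evd -SE -unitfE -unitmxE.
suff q0 : q = 0.
  have := evq _ di; rewrite q0 horner0 -SE => /esym/eqP.
  by rewrite mulf_eq0 expf_eq0 (negPf di) andbF => /eqP.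
suff : q * d = 0.
  move/eqP; rewrite mulf_eq0 => /orP[/eqP //|/eqP d0].
  by move: di; rewrite d0 horner0 eqxx.
apply: poly_nat0 => x; rewrite hornerM.
case: (eqVneq d.[x%:R] 0) => [->|dx]; first by rewrite mulr0.
rewrite evq //.
pose Sx := A + x%:R *: A'.
have e : cm Sx = cm A + x%:R *: cm A'.
  by rewrite /cm map_mxD map_mxZ rmorph_nat.
have skx : Sx^T = - Sx by rewrite /Sx linearD linearZ /= skA skA' scalerN opprD.
have ux : 1%:M - Sx \in unitmx.
  have := dx; rewrite evd -e -[1%:M](map_mx1 (real_complex R)) -map_mxB det_map_mx.
  by rewrite fmorph_eq0 unitmxE unitfE.
have -> : Cay (cm A + x%:R *: cm A') = cm (Cay Sx).
  rewrite -e /Cay /cm map_mxM map_invmx; congr (_ *m invmx _).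
    by rewrite [RHS]map_mxD map_mx1.
  by rewrite [RHS]map_mxB map_mx1.
have [o dt] := Cay_orth skx ux.
by rewrite hC // mulr0 mul0r.
Qed.

End Unitarian.

(** * Highest weight functions as products of leading minors *)

Section HighestWeightFunctions.
Variables (R : rcfType) (n : nat).
Local Notation C := R[i].
Local Notation N := n.*2.+1.

(** Length of row [k] of the Young diagram; as a highest weight, its coordinate in the plane [k]. *)
Definition lam (a : 'I_n -> nat) (k : nat) : nat := \sum_(j < n | (k <= j)%N) a j.

Definition Fa (a : 'I_n -> nat) (Y : 'M[C]_N) : C := \prod_(j < n) \det (lead j.+1 Y) ^+ a j.

(** The middle entry 1 selects determinant 1. Excluding the value -1 keeps [1 + diag_mx t]
    invertible, so that the unitarian trick reaches these elements. *)
Definition torus (t : 'rV[C]_N) :=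
  [/\ forall p, t 0 p * t 0 (rev_ord p) = 1, t 0 (inord n) = 1 & forall p, t 0 p != -1].

Definition chi (mu : 'I_n -> int) (t : 'rV[C]_N) : C := \prod_(k < n) t 0 (inord k) ^ mu k.

Definition lowinv k (z : 'rV[C]_(tdim (1 + N) k)) :=
  forall L : 'M[C]_N, lowu L -> inOJ L -> z *m rho k L = z.
Definition upinv k (y : 'cV[C]_(tdim (1 + N) k)) :=
  forall U : 'M[C]_N, lowu U^T -> inOJ U -> rho k U *m y = y.
Definition weight k (mu : 'I_n -> int) (z : 'rV[C]_(tdim (1 + N) k)) :=
  forall t, torus t -> z *m rho k (diag_mx t) = chi mu t *: z.

Lemma prod_rev (t : 'rV[C]_N) : (forall p, t 0 p * t 0 (rev_ord p) = 1) ->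
  \prod_p t 0 p = t 0 (inord n).
Proof.
move=> tt; have nN : (n < N)%N by lia.
rewrite (bigID (fun p : 'I_N => (p < n)%N)) /=.
rewrite [X in _ * X](bigD1 (inord n)) /= ?inordK ?ltnn //.
rewrite [X in _ * (_ * X)](reindex_inj rev_ord_inj) /= mulrCA.
rewrite [X in _ * (_ * X)](eq_bigl (fun p : 'I_N => (p < n)%N)); last first.
  move=> p; rewrite -val_eqE /= inordK //; have := ltn_ord p; lia.
by rewrite -big_split /= big1 ?mulr1.
Qed.

(** On a product of a lower unipotent, a torus element and an upper unipotent, invariance of [z] and
    [y] strips the outer factors and the weight yields [chi], which is also the value of [Fa]. A
    rational curve from the identity to [X] leaves these products at finitely many parameters only,
    so the identity extends to its end. *)
Lemma hw_agree k (a : 'I_n -> nat) (z : 'rV[C]_(tdim (1 + N) k)) y X :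
  lowinv z -> upinv y -> weight (fun j => (lam a j)%:Z) z ->
  X^T *m X = 1%:M -> \det X = 1 ->
  (z *m rho k (cj X) *m y) 0 0 = Fa a (cj X) * (z *m y) 0 0.
Proof.
move=> hz hy hw hX dX; have [M [d [d0 d1 M0 M1 MM]]] := ratpath_SO hX dX.
pose M' : 'M[{poly C}]_N := map_mx polyC (adjm (Bmx R n)) *m M *m map_mx polyC (Bmx R n).
have evM' c : evm c M' = cj (evm c M) by rewrite !evm_mul !evm_polyC.
pose D j := \det (lead j M').
have evD j c : (D j).[c] = \det (lead j (cj (evm c M))).
  by rewrite -[LHS]/(horner_eval c _) -det_map_mx lead_map -/(evm c _) evM'.
pose w := (\sum_(j < n) j.+1 * a j)%N.
pose q := d ^+ w * (map_mx polyC z *m tpow k (ext d M') *m map_mx polyC y) 0 0 -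
  ((z *m y) 0 0)%:P * d ^+ k * \prod_(j < n) D j.+1 ^+ a j.
(* Where [g] does not vanish, all leading minors are nonzero, so the Gauss decomposition exists; and
   no torus entry, being a ratio of consecutive minors, equals -1. *)
pose g := d * \prod_(j < N) D j.+1 * \prod_(j < N) (D j.+1 + d * D j).
have evq c : q.[c] = d.[c] ^+ w * (z *m tpow k (ext d.[c] (cj (evm c M))) *m y) 0 0 -
    (z *m y) 0 0 * d.[c] ^+ k * Fa a (cj (evm c M)).
  rewrite /q hornerD hornerN !hornerM !horner_exp hornerC horner_prod; congr (_ * _ - _ * _).
    transitivity (evm c (map_mx polyC z *m tpow k (ext d M') *m map_mx polyC y) 0 0).
      by rewrite [RHS]mxE.
    by rewrite !evm_mul !evm_polyC evm_tpow evM'.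
  by apply: eq_bigr => j _; rewrite horner_exp evD.
have FaZ e Y : Fa a (e *: Y) = e ^+ w * Fa a Y.
  rewrite /Fa /w (big_morph _ (fun x y => exprD e x y) (expr0 e)) -big_split /=.
  by apply: eq_bigr => j _; rewrite leadZ detZ exprMn exprM.
have cjZ e Y : cj (e *: Y) = e *: cj Y :> 'M[C]_N.
  by rewrite /cj -scalemxAr -scalemxAl.
have qZ c Y : evm c M = d.[c] *: Y ->
    q.[c] = d.[c] ^+ w * d.[c] ^+ k * ((z *m rho k (cj Y) *m y) 0 0 - (z *m y) 0 0 * Fa a (cj Y)).
  move=> e; rewrite evq e cjZ rho_homog FaZ -scalemxAr -scalemxAl [X in _ * X - _]mxE; ring.
suff q0 : q = 0.
  have := qZ 1 X M1; rewrite q0 horner0 => /esym/eqP.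
  rewrite mulf_eq0 mulf_eq0 !expf_eq0 (negPf d1) !andbF /= subr_eq0 => /eqP ->.
  by rewrite mulrC.
have g0 : g != 0.
  apply: contraNneq d0 => gz; have := congr1 (fun p : {poly C} => p.[0]) gz.
  rewrite /= horner0 /g !hornerM !horner_prod => /eqP; rewrite !mulf_eq0.
  have lD j : (j <= N)%N -> (D j).[0] = d.[0] ^+ j.
    move=> jN; rewrite evD M0 /cj mul_mx_scalar -scalemxAl Bmx_unitary.
    by rewrite scalemx1 lead_scalar // det_scalar.
  case/orP => [/orP[//|]|]; rewrite prodf_seq_eq0 => /hasP[j _ /=].
    by rewrite lD // expf_eq0 /= => ?.
  rewrite hornerD hornerM !lD // 1?ltnW // -exprS -mulr2n mulrn_eq0 /= expf_eq0.
  by case/andP.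
(* [M^T *m M = d ^ 2] determines the determinant up to sign; the sign is read off at parameter 0,
   where [M] is the scalar [d]. *)
have dM : \det M = d ^+ N.
  have h : (\det M) ^+ 2 = (d ^+ N) ^+ 2.
    by rewrite expr2 -{1}(det_tr M) -det_mulmx MM det_scalar -expr2 exprAC.
  move/eqP: h; rewrite eqf_sqr => /orP[/eqP //|/eqP h].
  have := congr1 (fun p : {poly C} => p.[0]) h; rewrite /= hornerN horner_exp.
  rewrite -[LHS]/(horner_eval 0 _) -det_map_mx -/(evm 0 M) M0 det_scalar => /eqP.
  by rewrite -addr_eq0 -mulr2n mulrn_eq0 /= expf_eq0 (negPf d0) andbF.
suff : q * g = 0 by move/eqP; rewrite mulf_eq0 (negPf g0) orbF => /eqP.
apply: poly_nat0 => x; set c := x%:R; rewrite hornerM.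
case: (eqVneq g.[c] 0) => [->|gc]; first by rewrite mulr0.
have [dc /prodf_neq0 hD /prodf_neq0 hD1] : [/\ d.[c] != 0,
    \prod_(j < N) (D j.+1).[c] != 0 & \prod_(j < N) (D j.+1 + d * D j).[c] != 0].
  by move: gc; rewrite /g !hornerM !horner_prod !mulf_eq0 !negb_or => /andP[/andP[]].
pose Z := d.[c]^-1 *: evm c M.
have ZE : evm c M = d.[c] *: Z by rewrite /Z scalerA divff // scale1r.
have hZ : Z^T *m Z = 1%:M.
  rewrite /Z [(_ *: _)^T]linearZ /= -scalemxAl -scalemxAr scalerA /evm map_trmx -map_mxM MM.
  rewrite map_scalar_mx [X in X%:M](_ : _ = d.[c] * d.[c]); last exact: hornerM.
  rewrite -scalemx1 scalerA.
  by rewrite mulrACA mulVf // mulr1 scale1r.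
have dZ : \det Z = 1.
  rewrite /Z detZ /evm det_map_mx dM [X in _ * X](_ : _ = d.[c] ^+ N); last exact: horner_exp.
  rewrite -exprMn mulVf //.
  by rewrite expr1n.
have YJ := cj_OJ hZ; set Y := cj Z in YJ.
have lY j : \det (lead j Y) = d.[c]^-1 ^+ j * (D j).[c].
  by rewrite evD ZE cjZ leadZ detZ mulrA -exprMn mulVf // expr1n mul1r.
have lY0 j : (0 < j <= N)%N -> \det (lead j Y) != 0.
  case: j => // j /= jN; rewrite lY mulf_neq0 ?expf_neq0 ?invr_eq0 //.
  exact: (hD (Ordinal jN)).
have [L [U [t [[hL hU LJ UJ] YE tt lt]]]] := OJ_LTU YJ lY0.
have t1 : t 0 (inord n) = 1.
  rewrite -prod_rev //; have := lt N (leqnn _).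
  rewrite lead_full (_ : \det Y = 1) => [h|].
    by rewrite [RHS]h; apply: eq_bigr => p _; rewrite inord_val.
  by rewrite /Y /cj !det_mulmx mulrAC -det_mulmx Bmx_unitary det1 mul1r.
have htor : torus t.
  split => // p; apply/eqP => tp.
  have /eqP := hD1 p isT; apply; rewrite hornerD hornerM.
  have h1 := lt p.+1 (ltn_ord p); have h2 := lt p (ltnW (ltn_ord p)).
  have := h1; rewrite big_ord_recr /= -h2 inord_val tp mulrN1 !lY => h3.
  apply: (mulfI (expf_neq0 p.+1 (invr_neq0 dc))).
  rewrite mulr0 mulrDr h3 exprSr -[X in _ + X]mulrA (mulrA d.[c]^-1) mulVf // mul1r.
  by rewrite addNr.
rewrite (qZ c Z ZE) -/Y YE !rhoM -!mulmxA (hy _ hU UJ) !mulmxA (hz _ hL LJ) (hw _ htor).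
rewrite -scalemxAl [X in X - _]mxE.
suff -> : chi (fun j => (lam a j)%:Z) t = Fa a (L *m diag_mx t *m U) by ring.
rewrite -YE /Fa /chi.
rewrite [RHS](eq_bigr (fun j : 'I_n => \prod_(k < n | (k <= j)%N) t 0 (inord k) ^+ a j)); last first.
  move=> j _; rewrite lt; last by have := ltn_ord j; lia.
  rewrite prodrXl; congr (_ ^+ _).
  pose f k := t 0 (inord k).
  rewrite (big_ord_widen _ f (ltn_ord j)).
  by [].
rewrite [RHS](exchange_big_dep (fun=> true)) //=; apply: eq_bigr => l _.
by rewrite -exprnP /lam (big_morph _ (fun x y => exprD (t 0 (inord l)) x y) (expr0 _)).
Qed.

End HighestWeightFunctions.

(** * The unitarian trick in the isotropic basis *)

Section UnitarianSplit.
Variables (R : rcfType) (n k : nat).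
Local Notation C := R[i].
Local Notation N := n.*2.+1.
Local Notation D := (tdim (1 + N) k).

Lemma trace_delta m p (M : 'M[C]_(m, p)) i j : \tr (delta_mx j i *m M) = M i j.
Proof.
rewrite /mxtrace (bigD1 j) //= big1 => [|l lj]; last first.
  by rewrite mxE big1 // => q _; rewrite mxE (negPf lj) mul0r.
rewrite addr0 mxE (bigD1 i) //= big1 => [|l lj]; first by rewrite addr0 mxE !eqxx mul1r.
by rewrite mxE (negPf lj) andbF mul0r.
Qed.

Lemma unitarian_cj_tr (Cm : 'M[C]_D) (u : 'M[C]_N) :
  (forall X : 'M[R]_N, X^T *m X = 1%:M -> \det X = 1 -> \tr (Cm *m rho k (cj (cm X))) = 0) ->
  inOJ u -> 1%:M + u \in unitmx -> \tr (Cm *m rho k u) = 0.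
Proof.
move=> h uJ uu; pose Cm' := rho k (Bmx R n) *m Cm *m rho k (adjm (Bmx R n)).
have e M : \tr (Cm' *m rho k M) = \tr (Cm *m rho k (cj M)).
  by rewrite /Cm' /cj !rhoM -!mulmxA mxtrace_mulC !mulmxA.
rewrite -(cjiK u) -e; apply: unitarian_trick.
- by move=> X hX dX; rewrite e h.
- exact: cji_orth.
- have -> : 1%:M + cji u = Bmx R n *m (1%:M + u) *m adjm (Bmx R n).
    by rewrite mulmxDr mulmxDl mulmx1 Bmx_unitary2.
  have [u1 u2] := mulmx1_unit (Bmx_unitary R n).
  by rewrite !unitmx_mul uu u1 u2.
Qed.

Lemma unitarian_cj m p (P : 'M[C]_(m, D)) (Q : 'M[C]_(D, p)) (u : 'M[C]_N) :
  (forall X : 'M[R]_N, X^T *m X = 1%:M -> \det X = 1 -> P *m rho k (cj (cm X)) *m Q = 0) ->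
  inOJ u -> 1%:M + u \in unitmx -> P *m rho k u *m Q = 0.
Proof.
move=> h uJ uu; apply/matrixP => i j; rewrite [RHS]mxE.
have e M : (P *m M *m Q) i j = \tr ((Q *m delta_mx j i *m P) *m M).
  by rewrite -!mulmxA mxtrace_mulC -!mulmxA trace_delta mulmxA.
rewrite e; apply: unitarian_cj_tr => // X hX dX.
by rewrite -e h // mxE.
Qed.

Definition Cinv (Z : 'M[C]_D) := forall X : 'M[R]_N, X^T *m X = 1%:M -> \det X = 1 ->
  (Z *m rho k (cj (cm X)) <= Z)%MS.

Lemma Cinv_OJ Z u : Cinv Z -> inOJ u -> 1%:M + u \in unitmx -> (Z *m rho k u <= Z)%MS.
Proof.
move=> hZ uJ uu; rewrite submxE; apply/eqP; apply: unitarian_cj => // X hX dX.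
by apply/eqP; rewrite -submxE hZ.
Qed.

Lemma commute_OJ (A : 'M[C]_D) u :
  (forall X : 'M[R]_N, X^T *m X = 1%:M -> \det X = 1 ->
     A *m rho k (cj (cm X)) = rho k (cj (cm X)) *m A) ->
  inOJ u -> 1%:M + u \in unitmx -> A *m rho k u = rho k u *m A.
Proof.
move=> hA uJ uu; apply/matrixP => i j; apply/eqP; rewrite -subr_eq0; apply/eqP.
have e M : (A *m M) i j - (M *m A) i j =
    \tr ((delta_mx j i *m A - A *m delta_mx j i) *m M).
  rewrite mulmxBl linearB /= -!mulmxA trace_delta; congr (_ - _).
  by rewrite mxtrace_mulC -mulmxA trace_delta.
rewrite e; apply: unitarian_cj_tr => // X hX dX.
by rewrite -e hA // subrr.
Qed.

Lemma lowu_unit1 m (L : 'M[C]_m) : lowu L -> 1%:M + L \in unitmx.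
Proof.
move=> hL; rewrite unitmxE unitfE det_trig.
  apply/prodf_neq0 => i _; rewrite !mxE hL // eqxx -mulr2n.
  by rewrite pnatr_eq0.
apply/is_trig_mxP => i j ij; rewrite !mxE hL ?(ltnW ij) //.
by rewrite -val_eqE /= ltn_eqF // addr0.
Qed.

Lemma torus_unit1 (t : 'rV[C]_N) : torus t -> 1%:M + diag_mx t \in unitmx.
Proof.
case=> _ _ h; rewrite -diag_const_mx -linearD /= unitmxE unitfE det_diag.
apply/prodf_neq0 => i _; rewrite !mxE addrC; apply: contra (h i).
by rewrite addr_eq0.
Qed.

Lemma torus_OJ (t : 'rV[C]_N) : torus t -> inOJ (diag_mx t).
Proof.
case=> h _ _; rewrite /inOJ tr_diag_mx; apply/matrixP => i j.
rewrite mul_mx_diag mul_diag_mx !mxE; case: eqP => [->|_]; last by rewrite mulr0 mul0r.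
by rewrite mulr1 h.
Qed.

Lemma torus_neq0 (t : 'rV[C]_N) p : torus t -> t 0 p != 0.
Proof.
case=> h _ _; apply: contraTneq (oner_neq0 C) => tp.
by rewrite negbK -(h p) tp mul0r.
Qed.

(** Permutations commuting with reversal of indices form the Weyl group of type B. Such a matrix
    commutes with [Jmx], hence comes from a real one; since the size is odd, the scalar [(-1) ^+ s]
    makes the determinant 1. *)
Lemma perm_cj (s : {perm 'I_N}) : (forall p, s (rev_ord p) = rev_ord (s p)) ->
  exists2 X : 'M[R]_N, X^T *m X = 1%:M /\ \det X = 1 &
    cj (cm X) = (-1) ^+ s *: perm_mx s.
Proof.
move=> hs; pose Y : 'M[C]_N := (-1) ^+ s *: perm_mx s.
have sq : (-1) ^+ s * (-1) ^+ s = 1 :> C by rewrite -expr2 sqrr_sign.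
pose r : {perm 'I_N} := perm (@rev_ord_inj N).
have JE : Jmx N = perm_mx r :> 'M[C]_N.
  by apply/matrixP => i j; rewrite !mxE permE eq_sym.
have com : Jmx N *m perm_mx s = perm_mx s *m Jmx N :> 'M[C]_N.
  rewrite JE -!perm_mxM; congr perm_mx; apply/permP => i.
  by rewrite !permM !permE hs.
have YJ : inOJ Y.
  rewrite /inOJ /Y [(_ *: _)^T]linearZ /= -!scalemxAl -scalemxAr scalerA sq scale1r.
  by rewrite tr_perm_mx -mulmxA com mulmxA -perm_mxM mulVg perm_mx1 mul1mx.
have [X XE] : exists X, cji Y = cm X.
  apply: cmP; rewrite cji_conj; congr cji.
  have -> : map_mx conjc Y = Y.
    by rewrite /Y map_mxZ map_perm_mx rmorph_sign.
  by rewrite /Y -scalemxAr -scalemxAl com -mulmxA JmxK mulmx1.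
exists X; last by rewrite -XE cjiK.
have h := cji_orth YJ; rewrite XE in h; split.
  by apply: (@cm_inj R); rewrite /cm map_mxM -map_trmx map_mx1.
apply: (@complexI R); rewrite rmorph1 -det_map_mx -/(cm X) -XE /cji !det_mulmx mulrAC -det_mulmx.
rewrite Bmx_unitary2 det1 mul1r /Y detZ det_perm -exprSr -exprM mulnC exprM.
by rewrite -[X in X ^+ s]signr_odd /= odd_double expr1n.
Qed.
End UnitarianSplit.

(** * Weights and heights *)

Section HWExistence.
Variables (R : rcfType) (n k : nat).
Local Notation C := R[i].
Local Notation N := n.*2.+1.
Local Notation D := (tdim (1 + N) k).

(** The adjoined trivial line has weight 0. *)
Definition htil (f : 'I_N -> int) (i : 'I_(1 + N)) : int :=
  if split i is inr p then f p else 0.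

(* Planes are numbered by [l < n]; [wt l p] is the weight of the basis vector
   [e_p] in the plane [l]. *)
Definition wt (l : 'I_n) (p : 'I_N) : int :=
  (p == l :> nat)%:Z - (p == (n.*2 - l)%N :> nat)%:Z.

(** The height reads a weight as a number in base [2 k + 2]. Weights of the k-th tensor power have
    coordinates at most [k] in absolute value, so differences stay below the base and equal heights
    mean equal weights ([hk_wtk]). *)
Definition KK : nat := k.*2.+2.
Definition HH (l : 'I_n) : int := (KK ^ (n.-1 - l))%N%:Z.
Definition ht (p : 'I_N) : int := \sum_l HH l * wt l p.
Definition wtk (l : 'I_n) (i : 'I_D) : int := tsum (htil (wt l)) i.
Definition hk (i : 'I_D) : int := \sum_l HH l * wtk l i.

Lemma htE p : ht p = if (p < n)%N then (KK ^ (n.-1 - p))%N%:Z else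
  if (n < p)%N then - (KK ^ (n.-1 - (n.*2 - p)))%N%:Z else 0.
Proof.
have pN := ltn_ord p; rewrite /ht.
case: (ltnP p n) => pn.
  rewrite (bigD1 (Ordinal pn)) //= big1 ?addr0 => [|l lp].
    rewrite /wt /= eqxx (_ : _ == _ = false) ?subr0 ?mulr1 //; apply/eqP; lia.
  rewrite /wt; have ln := ltn_ord l.
  have -> : (p == l :> nat) = false.
    by apply: contraNF lp => /eqP h; apply/eqP/val_inj.
  by rewrite (_ : _ == _ = false) ?subr0 ?mulr0 //; apply/eqP; lia.
case: (ltnP n p) => np; last first.
  rewrite big1 // => l _; rewrite /wt; have ln := ltn_ord l.
  have -> : (p == l :> nat) = false by apply/eqP; lia.
  have -> : (p == (n.*2 - l)%N :> nat) = false by apply/eqP; lia.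
  by rewrite subr0 mulr0.
have qn : (n.*2 - p < n)%N by lia.
rewrite (bigD1 (Ordinal qn)) //= big1 ?addr0 => [|l lp].
  rewrite /wt /= (_ : p == _ :> nat = false); last by apply/eqP; lia.
  by rewrite (_ : p == _ :> nat = true) ?sub0r ?mulrN1 //; apply/eqP; lia.
rewrite /wt; have ln := ltn_ord l.
rewrite (_ : p == l :> nat = false); last by apply/eqP; lia.
rewrite (_ : p == _ :> nat = false) ?subr0 ?mulr0 //.
apply: contraNF lp => /eqP h; apply/eqP/val_inj => /=; lia.
Qed.

Lemma ht_dec (p q : 'I_N) : (q < p)%N -> ht p < ht q.
Proof.
move=> qp; rewrite !htE; have pN := ltn_ord p.
have Kgt0 e : (0 < KK ^ e)%N by rewrite expn_gt0.
have Kinc e e' : (e < e')%N -> (KK ^ e < KK ^ e')%N by move=> h; rewrite ltn_exp2l.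
case: (ltnP p n) => pn; case: (ltnP q n) => qn; try lia.
- by rewrite ltz_nat Kinc //; lia.
- case: ifP => _; last by rewrite ltz_nat.
  by apply: (@le_lt_trans _ _ 0); rewrite ?ltz_nat // oppr_le0.
- case: (ltnP n p) => np; last by lia.
  case: (ltnP n q) => nq; last by rewrite oppr_lt0 ltz_nat.
  by rewrite ltrN2 ltz_nat Kinc //; lia.
Qed.

Lemma ht_rev p : ht (rev_ord p) = - ht p.
Proof.
rewrite !htE /=; have pN := ltn_ord p.
have -> : (n.*2.+1 - p.+1 < n)%N = (n < p)%N by apply/idP/idP; lia.
have -> : (n < n.*2.+1 - p.+1)%N = (p < n)%N by apply/idP/idP; lia.
have -> : (n.*2 - (n.*2.+1 - p.+1) = p)%N by lia.
have -> : (n.*2.+1 - p.+1 = n.*2 - p)%N by lia.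
by case: (ltngtP n p) => //= _; rewrite ?opprK ?oppr0.
Qed.

Lemma hkE i : hk i = tsum (htil ht) i.
Proof.
rewrite /hk /wtk -tsum_lin; congr (tsum _ i); apply/funext => j.
by rewrite /htil; case: (split j) => // a; rewrite big1 // => l _; rewrite mulr0.
Qed.

Lemma wtk_bound l i : `|wtk l i| <= k%:Z.
Proof.
apply: tsum_bound => j; rewrite /htil; case: (split j) => p; first by rewrite normr0.
by rewrite /wt; case: (_ == _); case: (_ == _).
Qed.

Lemma base_unique m (K : nat) (d : 'I_m -> int) : (forall l, `|d l| < K%:Z) ->
  \sum_(l < m) (K ^ (m.-1 - l))%N%:Z * d l = 0 -> forall l, d l = 0.
Proof.
elim: m d => [|m IH] d hd; first by move=> _ [].
rewrite big_ord_recr /= subnn expn0 mul1r.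
have -> : \sum_(i < m) (K ^ (m - i))%N%:Z * d (widen_ord (leqnSn m) i) =
    K%:Z * \sum_(i < m) (K ^ (m.-1 - i))%N%:Z * d (widen_ord (leqnSn m) i).
  rewrite mulr_sumr; apply: eq_bigr => i _; rewrite mulrA -PoszM -expnS.
  by congr ((_ ^ _)%N%:Z * _); have := ltn_ord i; lia.
set T := \sum_(i < m) _ => h.
have T0 : T = 0.
  apply/eqP; apply: contraT => Tn; have := hd ord_max.
  have -> : d ord_max = - (K%:Z * T) by apply/eqP; rewrite -addr_eq0 addrC h.
  rewrite normrN normrM; have : 1 <= `|T| by rewrite -gtz0_ge1 normr_gt0.
  by move=> h1; rewrite ltNge ger0_norm // ler_peMr.
have d0 : d ord_max = 0 by move: h; rewrite T0 mulr0 add0r.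
move=> l; case: (unliftP ord_max l) => [l' ->|-> //].
have <- : widen_ord (leqnSn m) l' = lift ord_max l'.
  by apply: val_inj; rewrite /= /bump leqNgt ltn_ord.
exact: (IH (fun l => d (widen_ord (leqnSn m) l))).
Qed.

Lemma hk_wtk i j : hk i = hk j -> forall l, wtk l i = wtk l j.
Proof.
move=> h l; apply/eqP; rewrite -subr_eq0; apply/eqP; move: l.
apply: (base_unique (K := KK)) => [l|].
  apply: le_lt_trans (ler_normB _ _) _; apply: (@le_lt_trans _ _ (k%:Z + k%:Z)).
    by rewrite lerD ?wtk_bound.
  by rewrite -PoszD ltz_nat /KK; lia.
have h2 : \sum_l (HH l * wtk l i - HH l * wtk l j) = 0.
  by rewrite sumrB; apply/eqP; rewrite subr_eq0; exact/eqP.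
by rewrite -[RHS]h2; apply: eq_bigr => l _; rewrite mulrBr.
Qed.

Lemma chi_split (t : 'rV[C]_N) p : torus t -> t 0 p = chi (fun l => wt l p) t.
Proof.
move=> ht; case: (ht) => tt tn _; have pN := ltn_ord p.
have z0 l : t 0 l != 0 := torus_neq0 l ht.
rewrite /chi; case: (ltnP p n) => pn.
  rewrite (bigD1 (Ordinal pn)) //= big1 ?mulr1 => [|l lp].
    rewrite /wt /= eqxx (_ : _ == _ = false) ?subr0 ?expr1z //; last by apply/eqP; lia.
    by congr (t 0 _); apply: val_inj; rewrite /= inordK; lia.
  rewrite /wt; have ln := ltn_ord l.
  have -> : (p == l :> nat) = false.
    by apply: contraNF lp => /eqP h; apply/eqP/val_inj.
  by rewrite (_ : _ == _ = false) ?subr0 ?expr0z //; apply/eqP; lia.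
case: (ltnP n p) => np; last first.
  rewrite big1 => [|l _]; first by rewrite -tn; congr (t 0 _); apply: val_inj; rewrite /= inordK; lia.
  rewrite /wt; have ln := ltn_ord l.
  have -> : (p == l :> nat) = false by apply/eqP; lia.
  have -> : (p == (n.*2 - l)%N :> nat) = false by apply/eqP; lia.
  by rewrite subr0 expr0z.
have qn : (n.*2 - p < n)%N by lia.
rewrite (bigD1 (Ordinal qn)) //= big1 ?mulr1 => [|l lp].
  rewrite /wt /= (_ : p == _ :> nat = false); last by apply/eqP; lia.
  rewrite (_ : p == _ :> nat = true) ?sub0r; last by apply/eqP; lia.
  apply: (mulIf (z0 (rev_ord p))); rewrite tt.
  have -> : inord (n.*2 - p)%N = rev_ord p :> 'I_N by apply: val_inj; rewrite /= inordK; lia.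
  by rewrite -exprnN expr1 mulVf.
rewrite /wt; have ln := ltn_ord l.
rewrite (_ : p == l :> nat = false); last by apply/eqP; lia.
rewrite (_ : p == _ :> nat = false) ?subr0 ?expr0z //.
apply: contraNF lp => /eqP h; apply/eqP/val_inj => /=; lia.
Qed.

Lemma chiD mu mu' (t : 'rV[C]_N) : torus t ->
  chi (fun l => mu l + mu' l) t = chi mu t * chi mu' t.
Proof.
move=> ht; rewrite /chi -big_split; apply: eq_bigr => l _.
by rewrite expfzDr //; exact: torus_neq0 ht.
Qed.

End HWExistence.

Lemma rho_diag (R : rcfType) n k (t : 'rV[R[i]]_(n.*2.+1)) (a b : 'I_(tdim (1 + n.*2.+1) k)) :
  torus t -> rho k (diag_mx t) a b = if a == b then chi (fun l => wtk l a) t else 0.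
Proof.
move=> ht; rewrite /rho; elim: k a b => [|k IH] a b.
  rewrite /= mxE; case: eqP => //= _; by rewrite /chi big1.
case: (mxtens_indexP a) => a0 a1; case: (mxtens_indexP b) => b0 b1.
rewrite [LHS]tensmxE -/tpow IH (can_eq (@mxtens_indexK _ _)) xpair_eqE.
have -> : ext 1 (diag_mx t) a0 b0 = if a0 == b0 then chi (fun l => htil (wt l) a0) t else 0.
  rewrite /ext -[a0](@splitK 1) -[b0](@splitK 1).
  rewrite (inj_eq (can_inj (@unsplitK 1 _))).
  case: (@split 1 _ a0) => c; case: (@split 1 _ b0) => e /=.
  - rewrite block_mxEul !ord1 mxE eqxx eqxx /chi big1 // => l _.
    by rewrite /htil (unsplitK (inl _ : 'I_1 + 'I_(n.*2.+1))) expr0z.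
  - by rewrite block_mxEur mxE.
  - by rewrite block_mxEdl mxE.
  - rewrite block_mxEdr mxE (inj_eq (inr_inj)).
    case: eqP => [->|_]; last by rewrite mulr0n.
    rewrite mulr1n [LHS]chi_split //; congr (chi _ t); apply/funext => l.
    by rewrite /htil (unsplitK (inr _ : 'I_1 + 'I_(n.*2.+1))).
case: eqP => //= _; last by rewrite mul0r.
case: eqP => //= _; last by rewrite mulr0.
rewrite -chiD //; congr (chi _ t); apply/funext => l.
by rewrite /wtk tsumS.
Qed.

Section HWVector.
Variables (R : rcfType) (n k : nat).
Local Notation C := R[i].
Local Notation N := n.*2.+1.
Local Notation D := (tdim (1 + N) k).

Lemma ext_lowu_unip (L : 'M[C]_N) : lowu L -> unip (htil (@ht n k)) (ext 1 L).
Proof.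
move=> hL a b; rewrite /ext -[a](@splitK 1) -[b](@splitK 1).
rewrite (inj_eq (can_inj (@unsplitK 1 _))).
case: (@split 1 _ a) => c; case: (@split 1 _ b) => e /=.
- by left; rewrite block_mxEul !ord1 mxE eqxx.
- by left; rewrite block_mxEur mxE.
- by left; rewrite block_mxEdl mxE.
- rewrite block_mxEdr; case: (leqP c e) => ce; first by left; rewrite hL.
  right; rewrite /htil (unsplitK (inr c : 'I_1 + 'I_N)) (unsplitK (inr e : 'I_1 + 'I_N)).
  exact: ht_dec.
Qed.

(** One torus element that separates heights: it multiplies a basis vector of height [h] by
    [2 ^ h]. *)
Definition tau : 'rV[C]_N := \row_p 2%:R ^ (@ht n k p).

Lemma tau_gt0 p : 0 < tau 0 p.
Proof. by rewrite mxE exprz_gt0 ?ltr0n. Qed.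

Lemma tau_torus : torus tau.
Proof.
split=> [p||p].
- by rewrite !mxE ht_rev -expfzDr ?pnatr_eq0 // subrr expr0z.
- by rewrite mxE htE inordK ?ltnn ?expr0z //; lia.
- by apply: contraTN (tau_gt0 p) => /eqP ->; rewrite ltr0N1.
Qed.

Lemma chi_perm_tau (s : {perm 'I_N}) (mu : 'I_n -> int) :
  chi mu (\row_p tau 0 (s p)) = 2%:R ^ (\sum_l mu l * @ht n k (s (inord l))).
Proof.
rewrite /chi (big_morph _ (fun x y => expfzDr x y (_ : 2%:R != 0 :> C)) (expr0z _)) ?pnatr_eq0 //.
by apply: eq_bigr => l _; rewrite !mxE exprz_exp mulrC.
Qed.

Lemma ht_inord (l : 'I_n) : @ht n k (inord l) = @HH n k l.
Proof. by have ln := ltn_ord l; rewrite htE inordK ?ln //; lia. Qed.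

Lemma chi_tau_hk (i : 'I_D) : chi (fun l => wtk l i) tau = 2%:R ^ (hk i).
Proof.
have -> : tau = \row_p tau 0 ((1%g : {perm 'I_N}) p).
  by apply/rowP => p; rewrite [RHS]mxE perm1.
rewrite chi_perm_tau /hk; congr (_ ^ _); apply: eq_bigr => l _.
by rewrite perm1 ht_inord mulrC.
Qed.

Lemma exp2z_inj (a b : int) : 2%:R ^ a = 2%:R ^ b :> C -> a = b.
Proof.
have e (c : int) : 2%:R ^ c = (2%:R ^ c : R)%:C%C :> C by rewrite fmorphXz rmorph_nat.
rewrite !e => /complexI; apply: ieexprIz; first by rewrite ltr0n.
by rewrite (eqr_nat R 2 1).
Qed.

Lemma mul_rho_diag (x : 'rV[C]_D) t i : torus t ->
  (x *m rho k (diag_mx t)) 0 i = x 0 i * chi (fun l => wtk l i) t.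
Proof.
move=> ht; rewrite mxE (bigD1 i) //= big1 ?addr0 => [|j ji].
  by rewrite rho_diag // eqxx.
by rewrite rho_diag // (negPf ji) mulr0.
Qed.

Lemma map_Jmx : map_mx conjc (Jmx N) = Jmx N :> 'M[C]_N.
Proof. by apply/matrixP => i j; rewrite !mxE conjc_nat. Qed.

End HWVector.

(** * Existence of highest weight vectors *)

Section HWVector.
Variables (R : rcfType) (n k : nat).
Local Notation C := R[i].
Local Notation N := n.*2.+1.
Local Notation D := (tdim (1 + N) k).
Local Notation tau := (tau R n k).
Local Notation ext_lowu_unip := (@ext_lowu_unip R n k).
Local Notation tau_torus := (@tau_torus R n k).
Local Notation chi_perm_tau := (@chi_perm_tau R n k).
Local Notation ht_inord := (@ht_inord n k).
Local Notation chi_tau_hk := (@chi_tau_hk R n k).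
Local Notation exp2z_inj := (@exp2z_inj R).
Local Notation mul_rho_diag := (@mul_rho_diag R n k).
Local Notation map_Jmx := (@map_Jmx R n).

Lemma swap_rev (p0 p1 : 'I_N) : (p0 < n)%N -> (p1 < n)%N -> p0 != p1 ->
  let s := (tperm p0 p1 * tperm (rev_ord p0) (rev_ord p1))%g in
  [/\ forall p, s (rev_ord p) = rev_ord (s p), s p0 = p1, s p1 = p0 &
      forall p : 'I_N, (p < n)%N -> p != p0 -> p != p1 -> s p = p].
Proof.
move=> h0 h1 p01 s.
have nr (p q : 'I_N) : (p < n)%N -> (q < n)%N -> (p == rev_ord q) = false.
  by move=> hp hq; apply/eqP => /(congr1 val) /=; lia.
have nr' (p q : 'I_N) : (p < n)%N -> (q < n)%N -> (rev_ord p == q) = false.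
  by move=> hp hq; rewrite eq_sym nr.
have re (x y : 'I_N) : (rev_ord x == y) = (x == rev_ord y).
  by rewrite -{1}(rev_ordK y) (inj_eq rev_ord_inj).
have sE p : s p = if p == p0 then p1 else if p == p1 then p0 else
    if p == rev_ord p0 then rev_ord p1 else if p == rev_ord p1 then rev_ord p0 else p.
  rewrite permM !permE /=.
  case: (eqVneq p p0) => [_|e0]; first by rewrite !nr.
  by case: (eqVneq p p1) => [_|e1] //; rewrite !nr.
split.
- move=> p; rewrite !sE !re !rev_ordK.
  case: (eqVneq p p0) => [->|e0]; first by rewrite !nr // eqxx.
  case: (eqVneq p p1) => [->|e1]; first by rewrite !nr // eq_sym (negPf p01) eqxx.
  case: (eqVneq p (rev_ord p0)) => [_|e2]; first by rewrite rev_ordK.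
  by case: (eqVneq p (rev_ord p1)) => [_|e3]; rewrite ?rev_ordK.
- by rewrite sE eqxx.
- by rewrite sE eq_sym (negPf p01) eqxx.
- by move=> p hp /negPf e0 /negPf e1; rewrite sE e0 e1 !nr.
Qed.

Lemma scalemxE_entry m p (c : C) (M : 'M[C]_(m, p)) i j : (c *: M) i j = c * M i j.
Proof. by rewrite mxE. Qed.

Lemma lt_doubleS (j : nat) : (j < n)%N -> (j < N)%N.
Proof. by move=> h; lia. Qed.

Lemma mu_step (u v A B X : int) : A < B -> u * A + (v * B + X) <= u * B + (v * A + X) -> v <= u.
Proof.
move=> AB h; suff : (v - u) * (B - A) <= 0 by rewrite pmulr_lle0 ?subr_gt0 // subr_le0.
by rewrite mulrBl !mulrBr; lia.
Qed.

Lemma mu_flip (u A X : int) : 0 < A -> u * - A + X <= u * A + X -> 0 <= u.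
Proof. by move=> A0; rewrite lerD2r mulrN => h; rewrite -(pmulr_lge0 _ A0); lia. Qed.

Lemma flip_rev (p0 : 'I_N) : (p0 < n)%N ->
  let s := tperm p0 (rev_ord p0) in
  [/\ forall p, s (rev_ord p) = rev_ord (s p), s p0 = rev_ord p0 &
      forall p : 'I_N, (p < n)%N -> p != p0 -> s p = p].
Proof.
move=> h0 s; have nr (p q : 'I_N) : (p < n)%N -> (q < n)%N -> (p == rev_ord q) = false.
  by move=> hp hq; apply/eqP => /(congr1 val) /=; lia.
have re (x y : 'I_N) : (rev_ord x == y) = (x == rev_ord y).
  by rewrite -{1}(rev_ordK y) (inj_eq rev_ord_inj).
have sE p : s p = if p == p0 then rev_ord p0 else if p == rev_ord p0 then p0 else p.
  by rewrite permE.
split.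
- move=> p; rewrite !sE !re !rev_ordK.
  case: (eqVneq p p0) => [->|e0]; first by rewrite !nr // rev_ordK.
  by case: (eqVneq p (rev_ord p0)) => [_|e2]; rewrite ?rev_ordK.
- by rewrite sE eqxx.
- by move=> p hp /negPf e0; rewrite sE e0 !nr.
Qed.

Lemma telescope_dec (f : nat -> nat) j m : (forall i, (f i.+1 <= f i)%N) -> (j <= m)%N ->
  (\sum_(j <= i < m) (f i - f i.+1) + f m)%N = f j.
Proof.
move=> fd; elim: m => [|m IH]; first by rewrite leqn0 => /eqP ->; rewrite big_geq.
rewrite leq_eqVlt => /orP[/eqP ->|]; first by rewrite big_geq.
by rewrite ltnS => jm; rewrite big_nat_recr //= -addnA subnK // IH.
Qed.

(** A row of [Z] is projected to the largest height occurring in [Z]. Lower unipotents could only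
    add components of larger height, and there are none, so they fix the projection. The Weyl group
    forces its weight to be dominant, and differences of consecutive coordinates give the
    multiplicities [a]. *)
Theorem hw_exists (Z : 'M[C]_D) : Cinv Z -> Z != 0 ->
  exists z : 'rV[C]_D, exists a : 'I_n -> nat,
  [/\ (z <= Z)%MS, z != 0, lowinv z /\ upinv (adjm z),
      weight (fun j => (lam a j)%:Z) z & forall j, (a j <= k)%N].
Proof.
move=> hZ Z0.
have [i0 hi0] : exists i, col i Z != 0.
  apply/existsP; apply: contraNT Z0; rewrite negb_exists => /forallP h.
  apply/eqP/matrixP => a b; rewrite mxE.
  have := h b; rewrite negbK => /eqP /colP /(_ a); by rewrite !mxE.
pose I1 := [arg max_(i > i0 | col i Z != 0) hk i]%O.
have [I1P I1max] : col I1 Z != 0 /\ forall j, col j Z != 0 -> hk j <= hk I1.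
  by rewrite /I1; case: arg_maxP => //.
have supp (x : 'rV[C]_D) i : (x <= Z)%MS -> x 0 i != 0 -> hk i <= hk I1.
  move=> /submxP [w ->] h; apply: I1max; apply: contraNneq h => h.
  rewrite mxE big1 // => j _; have /colP /(_ j) := h; rewrite !mxE => ->.
  by rewrite mulr0.
have [r hr] : exists r, Z r I1 != 0.
  apply/existsP; apply: contraNT I1P; rewrite negb_exists => /forallP h.
  by apply/eqP/colP => a; rewrite !mxE; apply/eqP; have := h a; rewrite negbK.
have tT := tau_torus.
have stab (x : 'rV[C]_D) u : (x <= Z)%MS -> inOJ u -> 1%:M + u \in unitmx ->
    (x *m rho k u <= Z)%MS.
  by move=> xZ uJ uu; apply: submx_trans (submxMr _ xZ) (Cinv_OJ hZ uJ uu).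
(* Lagrange interpolation: the factor [tau - 2 ^ hk j] kills the components of height [hk j] and
   does not leave the invariant space. *)
have lagr (s : seq 'I_D) : exists2 x : 'rV[C]_D, (x <= Z)%MS &
    forall i, x 0 i = Z r i * \prod_(j <- s) (2%:R ^ hk i - 2%:R ^ hk j).
  elim: s => [|j s [x xZ hx]].
    by exists (row r Z); [exact: row_sub | move=> i; rewrite big_nil mulr1 mxE].
  exists (x *m rho k (diag_mx tau) - 2%:R ^ hk j *: x).
    rewrite addmx_sub ?eqmx_opp ?scalemx_sub //.
    by apply: stab => //; [exact: torus_OJ | exact: torus_unit1].
  move=> i; rewrite !mxE [X in X - _](_ : _ = x 0 i * chi (fun l => wtk l i) tau); last first.
    by rewrite -mul_rho_diag // mxE.
  by rewrite chi_tau_hk hx big_cons; ring.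
have [z zZ hz] := lagr [seq j <- enum 'I_D | hk j != hk I1].
have zsupp i : z 0 i != 0 -> hk i = hk I1.
  rewrite hz => h; apply/eqP; apply: contraNT h => hi.
  rewrite (_ : \prod_(j <- _) _ = 0) ?mulr0 //.
  apply/eqP; rewrite prodf_seq_eq0; apply/hasP; exists i; last by rewrite /= subrr.
  by rewrite mem_filter hi mem_enum.
have z0 : z != 0.
  apply: contraNneq hr => z0; have := hz I1; rewrite z0 mxE => /esym/eqP.
  rewrite mulf_eq0 => /orP[//|]; rewrite prodf_seq_eq0 => /hasP [j].
  rewrite mem_filter => /andP[hj _]; rewrite subr_eq0 => /eqP /exp2z_inj e.
  by rewrite e eqxx in hj.
have [q zq] : exists q, z 0 q != 0.
  apply/existsP; apply: contraNT z0; rewrite negb_exists => /forallP h.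
  by apply/eqP/rowP => a; rewrite mxE; apply/eqP; have := h a; rewrite negbK.
have hq := zsupp _ zq.
have lowz : lowinv z.
  move=> L hL LJ; apply/rowP => j.
  have xZ := stab z L zZ LJ (lowu_unit1 hL).
  have un := @tpow_unip C _ _ _ k (ext_lowu_unip hL).
  case: (ltgtP (hk j) (hk I1)) => hj.
  - rewrite mxE big1 => [|i _].
      by apply/esym/eqP; apply: contraTT hj => /zsupp ->; rewrite ltxx.
    case: (eqVneq (z 0 i) 0) => [->|/zsupp hi]; first by rewrite mul0r.
    have ij : (i == j) = false by apply: contraTF hj => /eqP <-; rewrite hi ltxx.
    case: (un i j) => [->|]; first by rewrite ij mulr0.
    by rewrite -!hkE hi ltNge (ltW hj).
  - have -> : (z *m rho k L) 0 j = 0.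
      by apply/eqP; apply: contraTT hj => /(supp _ _ xZ) h; rewrite -leNgt.
    by apply/esym/eqP; apply: contraTT hj => /zsupp ->; rewrite ltxx.
  - rewrite mxE (bigD1 j) //= big1 => [|i ij].
      case: (un j j) => [e|]; last by rewrite ltxx.
      by rewrite /rho e eqxx mulr1 addr0.
    case: (eqVneq (z 0 i) 0) => [->|/zsupp hi]; first by rewrite mul0r.
    case: (un i j) => [e|]; first by rewrite /rho e (negPf ij) mulr0.
    by rewrite -!hkE hi hj ltxx.
pose mu l := wtk l q.
have wz t : torus t -> z *m rho k (diag_mx t) = chi mu t *: z.
  move=> ht; apply/rowP => j; rewrite mul_rho_diag // [RHS]mxE mulrC.
  case: (eqVneq (z 0 j) 0) => [->|/zsupp hj]; first by rewrite !mulr0.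
  congr (_ * _); congr (chi _ t); apply/funext => l.
  by apply: hk_wtk; rewrite hj hq.
have muH : \sum_l mu l * @HH n k l = hk I1.
  by rewrite -hq; apply: eq_bigr => l _; rewrite mulrC.
(* Weyl group elements of the torus permute weights, so the top weight is dominant *)
have weyl (s : {perm 'I_N}) : (forall p, s (rev_ord p) = rev_ord (s p)) ->
    \sum_l mu l * @ht n k (s (inord l)) <= \sum_l mu l * @HH n k l.
  move=> hs; have [X [hX dX] XE] := perm_cj R hs.
  pose x := z *m rho k (cj (cm X)).
  have xZ : (x <= Z)%MS by apply: submx_trans (submxMr _ zZ) (hZ X hX dX).
  have xK : x *m rho k (cj (cm X^T)) = z.
    by rewrite /x -mulmxA -rhoM -cjM /cm -map_mxM (mulmx1C hX) map_mx1 cj1 rho1 mulmx1.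
  pose t' := \row_p tau 0 (s p).
  have t'T : torus t'.
    case: tT => h1 h2 h3; split=> [p||p]; rewrite !mxE.
    - by rewrite hs; have := h1 (s p); rewrite !mxE.
    - have sn : s (inord n) = inord n.
        have e : rev_ord (inord n : 'I_N) = inord n by apply: val_inj; rewrite /= !inordK; lia.
        have := hs (inord n); rewrite e => /(congr1 val) /= h.
        apply: val_inj; rewrite /= inordK; last by lia.
        by have := ltn_ord (s (inord n)); lia.
      by rewrite sn; have := h2; rewrite mxE.
    - by have := h3 (s p); rewrite mxE.
  have xT : x *m rho k (diag_mx tau) = chi mu t' *: x.
    rewrite /x -mulmxA -rhoM.
    have -> : cj (cm X) *m diag_mx tau = diag_mx t' *m cj (cm X).
      rewrite XE -scalemxAl -scalemxAr; congr (_ *: _); apply/matrixP => i j.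
      rewrite mul_mx_diag mul_diag_mx !mxE; case: eqP => [->|_]; last by rewrite mul0r mulr0.
      by rewrite mulrC.
    by rewrite rhoM mulmxA wz // -scalemxAl.
  have x0 : x != 0 by apply: contraNneq z0 => e; rewrite -xK e mul0mx.
  have [j xj] : exists j, x 0 j != 0.
    apply/existsP; apply: contraNT x0; rewrite negb_exists => /forallP h.
    by apply/eqP/rowP => b; rewrite [RHS]mxE; apply/eqP; have := h b; rewrite negbK.
  have := supp _ _ xZ xj; rewrite muH; suff -> : hk j = \sum_l mu l * @ht n k (s (inord l)) by [].
  apply: exp2z_inj; rewrite -chi_perm_tau -chi_tau_hk -/t'; apply: (mulIf xj).
  clear xK x0 xZ; clearbody x t'.
  have := congr1 (fun v : 'rV_D => v 0 j) xT; rewrite mul_rho_diag // mulrC => ->.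
  by rewrite scalemxE_entry.
(* Exchanging two neighbouring planes cannot raise the height above the maximum. *)
have muS (j : 'I_n) (j1 : (j.+1 < n)%N) : mu (Ordinal j1) <= mu j.
  have jN : (j < N)%N by rewrite lt_doubleS.
  have jN1 : (j.+1 < N)%N by rewrite lt_doubleS.
  pose p0 : 'I_N := inord j; pose p1 : 'I_N := inord j.+1.
  pose s : {perm 'I_N} := (tperm p0 p1 * tperm (rev_ord p0) (rev_ord p1))%g.
  have v0 : p0 = j :> nat by rewrite /p0 inordK.
  have v1 : p1 = j.+1 :> nat by rewrite /p1 inordK.
  have v01 : (p0 < n)%N by rewrite v0; apply: ltnW.
  have v11 : (p1 < n)%N by rewrite v1.
  have p01 : p0 != p1 by rewrite -val_eqE /= v0 v1 neq_ltn ltnSn.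
  have [hs s0 s1 sE] := swap_rev v01 v11 p01.
  have := weyl s hs.
  rewrite (bigD1 j) //= [leRHS](bigD1 j) //= (bigD1 (Ordinal j1)) /=; last first.
    by rewrite -val_eqE /=; lia.
  rewrite [X in _ <= _ + X](bigD1 (Ordinal j1)) /=; last by rewrite -val_eqE /=; lia.
  rewrite [X in _ + (_ + X) <= _](eq_bigr (fun l => mu l * @HH n k l)); last first.
    move=> l /andP[lj lj1]; have ln := ltn_ord l.
    have e : (inord l : 'I_N) = l :> nat by rewrite inordK // lt_doubleS.
    rewrite sE ?ht_inord // ?e // -val_eqE /= ?v0 ?v1 e; [exact: lj | exact: lj1].
  rewrite s0 /= -/p1 s1.
  have -> : @ht n k p1 = @HH n k (Ordinal j1) by rewrite -ht_inord.
  rewrite ht_inord => h.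
  have HHlt : (@HH n k (Ordinal j1) < @HH n k j)%R by rewrite /HH ltz_nat ltn_exp2l //= ltn_sub2l // ltn_predRL.
  exact: (mu_step HHlt h).

(* Exchanging the two vectors of the last plane changes the sign of the last coordinate. *)
have mu0 (j : 'I_n) : (j.+1 = n)%N -> 0 <= mu j.
  move=> jn; have ln := ltn_ord j.
  pose p0 : 'I_N := inord j.
  have v0 : p0 = j :> nat by rewrite /p0 inordK // lt_doubleS.
  have v01 : (p0 < n)%N by rewrite v0.
  have [hs s0 sE] := flip_rev v01.
  have := weyl _ hs; rewrite (bigD1 j) //= [leRHS](bigD1 j) //=.
  rewrite [X in _ + X <= _](eq_bigr (fun l => mu l * @HH n k l)); last first.
    move=> l lj; have e : (inord l : 'I_N) = l :> nat by rewrite inordK // lt_doubleS.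
    by rewrite sE ?ht_inord // ?e // -val_eqE /= ?v0 e.
  rewrite s0 ht_rev ht_inord; apply: mu_flip.
  by rewrite /HH ltz_nat expn_gt0.
have mu_ge0 j : 0 <= mu j.
  have [m] := ubnP (n - j)%N; elim: m j => // m IH j hm; have jn := ltn_ord j.
  case: (ltnP j.+1 n) => j1; last by apply: mu0; lia.
  by apply: le_trans (muS j j1); apply: IH => /=; lia.
have mu_le j : mu j <= k%:Z by apply: le_trans (ler_norm _) (wtk_bound j q).
pose mun (j : nat) : nat := if insub j is Some l then `|mu l|%N else 0%N.
have munE (j : 'I_n) : (mun j)%:Z = mu j.
  by rewrite /mun valK gez0_abs.
have mun_dec j : (mun j.+1 <= mun j)%N.
  rewrite /mun; case: insubP => [l lj le|] //; case: insubP => [l' lj' le'|]; last by lia.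
  rewrite -lez_nat !gez0_abs //.
  have j1 : (l'.+1 < n)%N by rewrite le'.
  by have := muS l' j1; congr (_ <= _); congr mu; apply: val_inj; rewrite /= le' le.
pose a (j : 'I_n) := (mun j - mun j.+1)%N.
have lamE (j : 'I_n) : lam a j = mun j.
  rewrite /lam /a.
  have mn : mun n = 0%N by rewrite /mun insubN // ltnn.
  transitivity (\sum_(j <= i < n) (mun i - mun i.+1))%N.
    rewrite big_mkcond /= -(big_mkord xpredT (fun i => if (j <= i)%N then (mun i - mun i.+1)%N else 0%N)).
    rewrite (big_cat_nat (n := j)) //=; last exact: ltnW.
    rewrite big_nat_cond big1 ?add0n => [|i /andP[/andP[_ ij] _]]; last by rewrite leqNgt ij.
    by rewrite big_nat_cond [RHS]big_nat_cond; apply: eq_bigr => i /andP[/andP[-> _] _].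
  by rewrite -(telescope_dec mun_dec (ltnW (ltn_ord j))) mn addn0.
exists z, a; split => //.
- split=> // U hU UJ.
  have hU' : lowu (adjm U).
    move=> i j ij; rewrite /adjm map_trmx mxE hU // ; by case: eqP => _; rewrite ?conjc1 ?conjc0.
  have UJ' : inOJ (adjm U).
    have /inOJ_inv/mulmx1C := UJ; rewrite !mulmxA => h1.
    rewrite /inOJ /adjm trmxK; apply: (can_inj (mulmxK (_ : Jmx N \in unitmx))).
      by have [] := mulmx1_unit (@JmxK C N).
    rewrite JmxK -map_Jmx map_trmx -!map_mxM h1.
    by rewrite map_mx1.
  by rewrite -[rho k U]adjmK -adjmM adjm_rho lowz.
- by move=> t ht; rewrite wz //; congr (chi _ t *: z); apply/funext => j; rewrite lamE munE.
- move=> j; apply: leq_trans (leq_subr _ _) _.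
  by rewrite -lez_nat munE.
Qed.

End HWVector.

(** Take a matrix of largest rank with all rows in [P]; a vector of [P] outside its row space would
    enlarge the rank. *)
Lemma subspace_mx (F : fieldType) m (P : 'rV[F]_m -> Prop) :
  P 0 -> (forall a u v, P u -> P v -> P (a *: u + v)) ->
  exists Q : 'M[F]_m, forall v, P v <-> (v <= Q)%MS.
Proof.
move=> P0 PL.
have Psum k (c : 'I_k -> F) (w : 'I_k -> 'rV_m) : (forall i, P (w i)) -> P (\sum_i c i *: w i).
  elim: k c w => [|k IH] c w hw; first by rewrite big_ord0.
  by rewrite big_ord_recl; apply: PL => //; apply: IH.
pose T r := `[< exists2 Q : 'M[F]_m, (forall i, P (row i Q)) & \rank Q = r >].
have ex0 : exists r, T r.
  by exists 0%N; apply/asboolP; exists 0; [move=> i; rewrite row0 | rewrite mxrank0].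
have ub r : T r -> (r <= m)%N by move=> /asboolP[Q _ <-]; exact: rank_leq_row.
case: (ex_maxnP ex0 ub) => r /asboolP[Q hQ rQ] rmax.
have PQ v : (v <= Q)%MS -> P v.
  by move=> /submxP[u ->]; rewrite mulmx_sum_row; apply: Psum.
exists Q => v; split=> [Pv|]; last exact: PQ.
case: (boolP (v <= Q)%MS) => // nv; exfalso.
have : T (\rank (Q + v)%MS).
  apply/asboolP; exists (Q + v)%MS => // i.
  have /sub_addsmxP [[u1 u2] /= ->] := row_sub i (Q + v)%MS.
  rewrite addrC; have -> : u2 *m v = u2 0 0 *: v.
    by rewrite [u2]mx11_scalar mul_scalar_mx mxE eqxx.
  by apply: PL => //; apply: PQ; exact: submxMl.
move=> /rmax; apply/negP; rewrite -ltnNge -rQ; apply: rank_ltmx.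
by rewrite ltmxE addsmxSl /= addsmx_sub submx_refl (negPf nv).
Qed.

(** * Completeness of the highest weight functions *)

Section Completeness.
Variables (R : rcfType) (n : nat).
Local Notation C := R[i].
Local Notation N := n.*2.+1.

Definition isSO (X : 'M[R]_N) := X^T *m X = 1%:M /\ \det X = 1.

Lemma isSOM X Y : isSO X -> isSO Y -> isSO (X *m Y).
Proof.
move=> [hX dX] [hY dY]; split; last by rewrite det_mulmx dX dY mulr1.
by rewrite trmx_mul -mulmxA (mulmxA X^T) hX mul1mx.
Qed.

Lemma isSOV X : isSO X -> isSO X^T.
Proof. by move=> [hX dX]; split; rewrite ?det_tr // trmxK (mulmx1C hX). Qed.

Lemma isSO1 : isSO 1%:M.
Proof. by split; rewrite ?det1 // trmx1 mul1mx. Qed.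

Lemma cm_isSO X : isSO X -> (cm X)^T *m cm X = 1%:M :> 'M[C]_N /\ \det (cm X) = 1 :> C.
Proof.
move=> [hX dX]; split; last by rewrite det_map_mx dX rmorph1.
by rewrite /cm map_trmx -map_mxM hX map_mx1.
Qed.

Definition isHW (a : 'I_n -> nat) := exists k (z : 'rV[C]_(tdim (1 + N) k)),
  [/\ z != 0, lowinv z, upinv (adjm z) & weight (fun j => (lam a j)%:Z) z].

(** A coefficient, a weight, and the rotations by which [Fa] is translated on the left and on the
    right. *)
Definition hwterm := (C * ('I_n -> nat) * ('M[R]_N * 'M[R]_N))%type.

Definition hwok (k : nat) (q : hwterm) :=
  [/\ isHW q.1.2, forall j, (q.1.2 j <= k)%N, isSO q.2.1 & isSO q.2.2].

Definition hwval (q : hwterm) (X : 'M[R]_N) : C :=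
  q.1.1 * Fa q.1.2 (cj (cm (q.2.1 *m X *m q.2.2))).

Definition hwspan (k : nat) (f : 'M[R]_N -> C) := exists s : seq hwterm,
  (forall q, List.In q s -> hwok k q) /\ forall X, isSO X -> f X = \sum_(q <- s) hwval q X.

Lemma hwspan_ext k f g : (forall X, isSO X -> f X = g X) -> hwspan k f -> hwspan k g.
Proof. by move=> e [s [h1 h2]]; exists s; split=> // X hX; rewrite -e // h2. Qed.

Lemma hwspan0 k : hwspan k (fun=> 0).
Proof. by exists [::]; split=> // X _; rewrite big_nil. Qed.

Lemma hwspanD k f g : hwspan k f -> hwspan k g -> hwspan k (fun X => f X + g X).
Proof.
move=> [s [s1 s2]] [s' [s1' s2']]; exists (s ++ s'); split.
  by move=> q hq; case: (List.in_app_or _ _ _ hq); [apply: s1 | apply: s1'].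
by move=> X hX; rewrite big_cat /= s2 // s2'.
Qed.

Lemma hwspanZ k c f : hwspan k f -> hwspan k (fun X => c * f X).
Proof.
move=> [s [s1 s2]]; exists [seq ((c * q.1.1, q.1.2), q.2) | q <- s]; split.
  by move=> q hq; case: ((List.in_map_iff _ _ _).1 hq) => p [<- /s1].
move=> X hX; rewrite s2 // big_map mulr_sumr; apply: eq_bigr => q _.
by rewrite /hwval /= mulrA.
Qed.

Lemma hwspan_left k f A : isSO A -> hwspan k f -> hwspan k (fun X => f (A *m X)).
Proof.
move=> hA [s [s1 s2]]; exists [seq (q.1, (q.2.1 *m A, q.2.2)) | q <- s]; split.
  move=> q hq; case: ((List.in_map_iff _ _ _).1 hq) => p [<- /s1 [h1 h2 h3 h4]].
  by split=> //=; apply: isSOM.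
move=> X hX; rewrite s2; last exact: isSOM.
by rewrite big_map; apply: eq_bigr => q _; rewrite /hwval /= !mulmxA.
Qed.

Lemma orth_split m (Q : 'M[C]_m) : (1%:M <= Q + kermx (adjm Q))%MS.
Proof.
have cap : (Q :&: kermx (adjm Q))%MS = 0.
  apply/eqP/rowV0P => v; rewrite sub_capmx => /andP[/submxP[u ->] /sub_kermxP h].
  by apply/eqP; rewrite -row_adjm_eq0 adjmM mulmxA h mul0mx.
have rk : \rank (adjm Q) = \rank Q by rewrite /adjm mxrank_tr mxrank_map.
rewrite sub1mx /row_full (mxrank_disjoint_sum cap) mxrank_ker rk subnKC //.
exact: rank_leq_col.
Qed.

Variable k : nat.
Local Notation D := (tdim (1 + N) k).
Local Notation g X := (@rho C N k (@cj R n (cm X))).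

Lemma gM X Y : g (X *m Y) = g X *m g Y.
Proof. by rewrite -rhoM -cjM /cm map_mxM. Qed.

Lemma g_adj X : adjm (g X) = g X^T.
Proof. by rewrite adjm_rho cj_adj cm_adj. Qed.

(** If [adjm y] is some [z *m g X], this is [hw_agree]; so it holds on the span of these vectors. A
    vector orthogonal to the span has coefficient 0. *)
Lemma hw_good (z : 'rV[C]_D) (a : 'I_n -> nat) (y : 'cV[C]_D) : z != 0 -> lowinv z -> upinv (adjm z) ->
  weight (fun j => (lam a j)%:Z) z -> (forall j, (a j <= k)%N) ->
  hwspan k (fun X => (z *m g X *m y) 0 0).
Proof.
move=> z0 zl zu zw ak.
pose S (x : 'rV[C]_D) := hwspan k (fun X => (z *m g X *m adjm x) 0 0).
have S0 : S 0.
  apply: hwspan_ext (hwspan0 k) => X _.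
  have -> : adjm (0 : 'rV[C]_D) = 0 by apply/matrixP => i j; rewrite !mxE conjc0.
  by rewrite mulmx0 mxE.
have SL c u v : S u -> S v -> S (c *: u + v).
  move=> u1 v1; apply: hwspan_ext (hwspanD (hwspanZ (conjc c) u1) v1) => X _.
  have -> : adjm (c *: u + v) = conjc c *: adjm u + adjm v.
    by apply/matrixP => i j; rewrite !mxE rmorphD rmorphM.
  by rewrite mulmxDr -scalemxAr [RHS]mxE [X in _ = X + _]mxE.
have Sg X : isSO X -> S (z *m g X).
  move=> hX; have aHW : isHW a by exists k, z.
  exists [:: (((z *m adjm z) 0 0, a), (1%:M, X^T))]; split.
    by move=> q [<-|[]]; split=> //=; [exact: isSO1 | exact: isSOV].
  move=> Y hY; rewrite big_seq1 /hwval /= mul1mx adjmM g_adj.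
  have [h1 h2] := cm_isSO (isSOM hY (isSOV hX)).
  by rewrite mulmxA -(mulmxA z) -gM (hw_agree zl zu zw h1 h2) mulrC.
have [Q hQ] := subspace_mx S0 SL.
have /sub_addsmxP [[U V] /= e] : (adjm y <= Q + kermx (adjm Q))%MS.
  by apply: submx_trans (orth_split Q); exact: submx1.
have yE : y = adjm (U *m Q) + adjm (V *m kermx (adjm Q)).
  rewrite -[LHS]adjmK e; apply/matrixP => i j.
  by rewrite [RHS]mxE ![adjm _ _ _]mxE ![map_mx _ _ _ _]mxE [X in conjc X]mxE rmorphD.
have S1 : S (U *m Q) by apply/hQ; exact: submxMl.
apply: hwspan_ext S1 => X hX; rewrite [in RHS]yE mulmxDr [RHS]mxE -[LHS]addr0; congr (_ + _).
have /submxP [W ->] : (z *m g X <= Q)%MS by apply/hQ/Sg.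
have -> : W *m Q *m adjm (V *m kermx (adjm Q)) = W *m adjm (V *m kermx (adjm Q) *m adjm Q).
  by rewrite -[LHS]mulmxA [in RHS]adjmM adjmK.
rewrite -mulmxA mulmx_ker mulmx0.
have -> : adjm (0 : 'M[C]_(1, D)) = 0 by apply/matrixP => i j; rewrite !mxE conjc0.
by rewrite mulmx0 mxE.
Qed.

(** The [x] all of whose coefficients lie in the span form an invariant subspace, and its orthogonal
    complement is invariant too. A nonzero complement would contain a highest weight vector; by
    [hw_good] this vector also lies in the subspace, so it would be orthogonal to itself. *)
Theorem hw_complete (x : 'rV[C]_D) (y : 'cV[C]_D) :
  hwspan k (fun X => (x *m g X *m y) 0 0).
Proof.
pose P (x : 'rV[C]_D) := forall y : 'cV[C]_D, hwspan k (fun X => (x *m g X *m y) 0 0).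
have P0 : P 0.
  by move=> y'; apply: hwspan_ext (hwspan0 k) => X _; rewrite !mul0mx mxE.
have PL c u v : P u -> P v -> P (c *: u + v).
  move=> hu hv y'; apply: hwspan_ext (hwspanD (hwspanZ c (hu y')) (hv y')) => X _.
  by rewrite !mulmxDl -!scalemxAl [RHS]mxE [X in _ = X + _]mxE.
have Pg X v : isSO X -> P v -> P (v *m g X).
  move=> hX hv y'; apply: hwspan_ext (hwspan_left hX (hv y')) => Y _.
  by rewrite gM mulmxA.
have [Q hQ] := subspace_mx P0 PL.
suff Z0 : kermx (adjm Q) = 0.
  suff : P x by apply.
  by apply/hQ; apply: submx_trans (submx1 x) (submx_trans (orth_split Q) _); rewrite Z0 addsmx0.
apply/eqP/negPn/negP => Z0.
have ZC : Cinv (kermx (adjm Q)).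
  move=> X hX dX; apply/sub_kermxP.
  have /submxP [V hV] : (Q *m g X^T <= Q)%MS.
    apply/row_subP => i; rewrite row_mul; apply/hQ; apply: Pg; first exact: isSOV.
    by apply/hQ; exact: row_sub.
  by rewrite -mulmxA -[X in X *m adjm Q]adjmK g_adj -adjmM hV adjmM mulmxA mulmx_ker mul0mx.
have [z [a [zZ z0 [zl zu] zw ak]]] := hw_exists ZC Z0.
have : (z <= Q)%MS by apply/hQ => y'; exact: hw_good zw ak.
move=> /submxP [v zv]; move/sub_kermxP: zZ => zQ.
by move: z0; rewrite -row_adjm_eq0 {2}zv adjmM mulmxA zQ mul0mx eqxx.
Qed.

End Completeness.

(** * Ranks of spaces of matrix coefficients *)

Section KernelRank.
Variable F : fieldType.

(* [krank K d]: the kernel [K], seen as an (infinite) matrix, factors through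
   a space of dimension at most [d]. *)
Definition krank (S T : Type) (K : S -> T -> F) (d : nat) :=
  exists (I : finType) (phi : S -> I -> F) (chi : T -> I -> F),
    (#|I| <= d)%N /\ forall s t, K s t = \sum_i phi s i * chi t i.

Lemma krankW (S T : Type) (K : S -> T -> F) d d' : (d <= d')%N -> krank K d -> krank K d'.
Proof. by move=> dd [I [f [g [h1 h2]]]]; exists I, f, g; split=> //; exact: leq_trans dd. Qed.

Lemma krank1 (S T : Type) : krank (fun (_ : S) (_ : T) => 1) 1.
Proof.
exists unit, (fun _ _ => 1), (fun _ _ => 1); split; first by rewrite card_unit.
by move=> s t; rewrite big_const card_unit /= mulr1 addr0.
Qed.

Lemma krankM (S T : Type) (K K' : S -> T -> F) d d' : krank K d -> krank K' d' ->
  krank (fun s t => K s t * K' s t) (d * d').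
Proof.
move=> [I [f [g [h1 h2]]]] [I' [f' [g' [h1' h2']]]].
exists (I * I')%type, (fun s i => f s i.1 * f' s i.2), (fun t i => g t i.1 * g' t i.2).
split; first by rewrite card_prod leq_mul.
move=> s t; rewrite h2 h2' big_distrl -(pair_bigA_idem _ (fun i j => f s i * f' s j * (g t i * g' t j))) /=.
  by apply: eq_bigr => i _; rewrite big_distrr; apply: eq_bigr => j _; rewrite mulrACA.
by rewrite addr0.
Qed.

Lemma krankX (S T : Type) (K : S -> T -> F) d m : krank K d -> krank (fun s t => K s t ^+ m) (d ^ m).
Proof.
move=> hK; elim: m => [|m IH]; first exact: krank1.
rewrite expnS; have := krankM hK IH; congr krank.
by apply/funext => s; apply/funext => t; rewrite exprS.
Qed.

Lemma krank_prod (S T : Type) (J : Type) (r : seq J) (K : J -> S -> T -> F) (d : J -> nat) :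
  (forall j, krank (K j) (d j)) -> krank (fun s t => \prod_(j <- r) K j s t) (\prod_(j <- r) d j).
Proof.
move=> hK; elim: r => [|j r IH].
  rewrite big_nil; have := @krank1 S T; congr krank.
  by apply/funext => s; apply/funext => t; rewrite big_nil.
rewrite big_cons; have := krankM (hK j) IH; congr krank.
by apply/funext => s; apply/funext => t; rewrite big_cons.
Qed.

(** Terms that share the same function of [t] are collected, so the rank is the number of these
    functions, however many terms there are. *)
Lemma krank_group (S T : Type) (I J : finType) (P : pred I) (A : {set J}) (h : I -> J)
  (c : I -> S -> F) (e : J -> T -> F) : (forall i, P i -> h i \in A) ->
  krank (fun s t => \sum_(i | P i) c i s * e (h i) t) #|A|.
Proof.
move=> hA; exists 'I_#|A|, (fun s x => \sum_(i | P i && (h i == enum_val x)) c i s),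
  (fun t x => e (enum_val x) t); split; first by rewrite card_ord.
move=> s t; rewrite (partition_big h (mem A)) //= big_enum_val /=.
apply: eq_bigr => x _; rewrite mulr_suml; apply: eq_bigr => i /andP[_ /eqP <-] //.
Qed.

Lemma krank_sym (S T : Type) (K : S -> T -> F) d : krank K d -> krank (fun t s => K s t) d.
Proof.
move=> [I [f [g [h1 h2]]]]; exists I, g, f; split=> // t s.
by rewrite h2; apply: eq_bigr => i _; rewrite mulrC.
Qed.

(** Take a nonsingular minor of maximal size. Bordered by one more row and column it becomes
    singular, and the vanishing Schur complement is the stated identity. The point is that the
    spanning functions are values [K (x i)] of the kernel itself, which remain eigenfunctions of the
    walk. *)
Lemma krank_basis (S T : Type) (K : S -> T -> F) d : krank K d ->
  exists m (x : 'I_m -> S) (y : 'I_m -> T) (W : 'M[F]_m), (m <= d)%N /\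
    forall s t, K s t = \sum_i (\sum_j K s (y j) * W j i) * K (x i) t.
Proof.
move=> [I [f [g [Id hK]]]].
pose P m := `[< exists (x : 'I_m -> S) (y : 'I_m -> T), (\matrix_(i, j) K (x i) (y j)) \in unitmx >].
have P0 : exists m, P m.
  have no0 (A : Type) : exists f : 'I_0 -> A, True by exists (fun i : 'I_0 => False_rect A (notF (ltn_ord i))).
  have [[u _] [v _]] := (no0 S, no0 T).
  by exists 0%N; apply/asboolP; exists u, v; rewrite unitmxE det_mx00 unitr1.
have Pd m : P m -> (m <= d)%N.
  move=> /asboolP[x [y hM]]; apply: leq_trans Id.
  have : \rank (\matrix_(i, j) K (x i) (y j)) = m by apply: mxrank_unit.
  have -> : (\matrix_(i, j) K (x i) (y j)) =
      (\matrix_(i < m, k < #|I|) f (x i) (enum_val k)) *m (\matrix_(k < #|I|, j < m) g (y j) (enum_val k)).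
    apply/matrixP => i j; rewrite !mxE hK (reindex (@enum_val I xpredT)) /=; last first.
      by apply: onW_bij; exact: enum_val_bij.
    by apply: eq_bigr => k _; rewrite !mxE.
  by move=> <-; apply: leq_trans (mxrankM_maxl _ _) (rank_leq_col _).
case: (ex_maxnP P0 Pd) => m Pm mmax; exists m; have md := Pd _ Pm.
move/asboolP: Pm => [x [y hM]]; set M := (\matrix_(i, j) _) in hM.
exists x, y, (invmx M); split=> // s t.
pose c : 'cV[F]_m := \col_i K (x i) t; pose r : 'rV[F]_m := \row_j K s (y j).
have E : (\sum_i (\sum_j K s (y j) * invmx M j i) * K (x i) t) = (r *m invmx M *m c) 0 0.
  rewrite mxE; apply: eq_bigr => i _; rewrite [c _ _]mxE; congr (_ * _).
  by rewrite mxE; apply: eq_bigr => j _; rewrite [r _ _]mxE.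
rewrite E; apply/eqP; rewrite -subr_eq0; apply/negPn/negP => hne.
have : P (m + 1)%N.
  apply/asboolP.
  exists (fun i : 'I_(m + 1) => match split i with inl a => x a | inr _ => s end).
  exists (fun i : 'I_(m + 1) => match split i with inl a => y a | inr _ => t end).
  set B := (\matrix_(i, j) _).
  have -> : B = block_mx 1%:M 0 (r *m invmx M) 1%:M *m block_mx M c 0 (K s t - (r *m invmx M *m c) 0 0)%:M.
    rewrite mulmx_block !mul1mx !mul0mx !addr0 mulmxKV //.
    apply/matrixP => i j; rewrite [LHS]mxE -(splitK i) -(splitK j).
    case: (split i) => a; case: (split j) => b; rewrite !unsplitK /=.
    - by rewrite block_mxEul mxE.
    - by rewrite block_mxEur mxE.
    - by rewrite block_mxEdl mxE.
    - by rewrite block_mxEdr !mxE !ord1 /= mulr1n addrC subrK.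
  rewrite unitmxE det_mulmx det_lblock det_ublock !det1 !mul1r det_scalar1 unitrM.
  by rewrite -unitmxE hM unitfE.
by move=> /mmax; rewrite addn1 ltnn.
Qed.

(** The Cauchy-Binet formula before its terms are grouped: the sum is over all maps, injective or
    not. *)
Lemma det_mulmx_expand j m (Z : 'M[F]_(j, m)) (W : 'M[F]_(m, j)) :
  \det (Z *m W) = \sum_(p : {ffun 'I_j -> 'I_m}) (\prod_k Z k (p k)) * \det (\matrix_(x, y) W (p x) y).
Proof.
rewrite /determinant.
under eq_bigr => s _.
  under eq_bigr => k _ do rewrite mxE.
  rewrite (bigA_distr_bigA (fun k l => Z k l * W l (s k))) big_distrr /=; over.
rewrite exchange_big /=; apply: eq_bigr => p _.
rewrite big_distrr /=; apply: eq_bigr => s _.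
rewrite big_split /= mulrCA; congr (_ * (_ * _)).
by apply: eq_bigr => k _; rewrite mxE.
Qed.

Lemma det_minor_expand j m (Z : 'M[F]_(j, m)) (Y : 'M[F]_m) (W : 'M[F]_(m, j)) :
  \det (Z *m Y *m W) = \sum_(pq : {ffun 'I_j -> 'I_m} * {ffun 'I_j -> 'I_m})
     ((\prod_k Z k (pq.1 k)) * (\prod_k W (pq.2 k) k)) * \det (\matrix_(x, y) Y (pq.1 x) (pq.2 y)).
Proof.
rewrite -mulmxA det_mulmx_expand.
rewrite -(pair_bigA_idem _ (fun p q : {ffun 'I_j -> 'I_m} => ((\prod_k Z k (p k)) * (\prod_k W (q k) k)) * \det (\matrix_(x, y) Y (p x) (q y)))) /= ?addr0 //.
apply: eq_bigr => p _.
have -> : (\matrix_(x, y) (Y *m W) (p x) y) = (\matrix_(x, y) Y (p x) y) *m W.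
  by apply/matrixP => x y; rewrite !mxE; apply: eq_bigr => k _; rewrite !mxE.
rewrite -det_tr trmx_mul det_mulmx_expand big_distrr /=; apply: eq_bigr => q _.
rewrite mulrA; congr (_ * _ * _); first by apply: eq_bigr => k _; rewrite mxE.
by rewrite -det_tr; congr (\det _); apply/matrixP => x y; rewrite !mxE.
Qed.

Definition set_nth_ord m (I : {set 'I_m.+1}) (x : nat) : 'I_m.+1 := nth ord0 (enum I) x.

(** Sorting the rows costs a sign, and a repeated row gives 0. *)
Lemma det_row_image j m (p : {ffun 'I_j -> 'I_m.+1}) : exists e : F, (~~ injectiveb p -> e = 0) /\
  forall W : 'M[F]_(m.+1, j),
   \det (\matrix_(x, y) W (p x) y) = e * \det (\matrix_(x < j, y < j) W (set_nth_ord (p @: setT) x) y).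
Proof.
case: (boolP (injectiveb p)) => pinj; last first.
  exists 0; split=> // W; rewrite mul0r.
  have /injectivePn [x [y xy pxy]] := pinj.
  by apply: (determinant_alternate xy) => k; rewrite !mxE pxy.
have /injectiveP pI := pinj.
have sz : size (enum (p @: setT)) = j by rewrite -cardE card_imset // cardsT card_ord.
have ix x : (index (p x) (enum (p @: setT)) < j)%N.
  by rewrite -[X in (_ < X)%N]sz index_mem mem_enum imset_f.
have sI : injective (fun x => Ordinal (ix x)).
  move=> x y /(congr1 val) /= h; apply: pI.
  by rewrite -(nth_index ord0 (s := enum (p @: setT)) (x := p x)) ?mem_enum ?imset_f // h nth_index // mem_enum imset_f.
exists ((-1) ^+ perm sI); split=> // W; rewrite -det_perm -det_mulmx -row_permE.
congr (\det _); apply/matrixP => x y; rewrite !mxE permE /set_nth_ord /= nth_index //.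
by rewrite mem_enum imset_f.
Qed.

Variable m : nat.
Local Notation N := m.+1.
Local Notation S := ('M[F]_N * 'M[F]_N)%type.
Local Notation T := 'M[F]_N.

Lemma lead_mul3 j (s : S) (Y : T) : lead j (s.1 *m Y *m s.2) =
  (\matrix_(x < j, l < N) s.1 (inord x) l) *m Y *m (\matrix_(l < N, y < j) s.2 l (inord y)).
Proof.
apply/matrixP => x y; rewrite [LHS]mxE [LHS]mxE [RHS]mxE; apply: eq_bigr => l _.
rewrite [X in _ = _ * X]mxE; congr (_ * _).
by rewrite [LHS]mxE [RHS]mxE; apply: eq_bigr => q _; rewrite [X in _ = X * _]mxE.
Qed.

(** After sorting, the minor depends on [Y] only through the minors of [Y] of size [j], one for each
    pair of subsets of rows and columns. *)
Lemma krank_minor j : krank (fun (s : S) (Y : T) => \det (lead j (s.1 *m Y *m s.2))) ('C(N, j) ^ 2).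
Proof.
have [eps heps] : exists eps : {ffun 'I_j -> 'I_N} -> F, forall p : {ffun 'I_j -> 'I_N}, (~~ injectiveb p -> eps p = 0) /\
    forall W : 'M[F]_(N, j),
     \det (\matrix_(x, y) W (p x) y) = eps p * \det (\matrix_(x < j, y < j) W (set_nth_ord (p @: setT) x) y).
  have [f hf] := boolp.choice (@det_row_image j m); exists f => p; exact: hf.
pose A := [set I : {set 'I_N} | #|I| == j].
pose co (pq : {ffun 'I_j -> 'I_N} * {ffun 'I_j -> 'I_N}) (s : S) :=
  (\prod_(k < j) s.1 (inord k) (pq.1 k)) * (\prod_(k < j) s.2 (pq.2 k) (inord k)) * (eps pq.1 * eps pq.2).
pose ee (IJ : {set 'I_N} * {set 'I_N}) (Y : T) :=
  \det (\matrix_(x < j, y < j) Y (set_nth_ord IJ.1 x) (set_nth_ord IJ.2 y)).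
have cA : #|setX A A| = ('C(N, j) ^ 2)%N by rewrite cardsX card_draws card_ord mulnn.
rewrite -cA; have := @krank_group S T _ _ (fun pq : {ffun 'I_j -> 'I_N} * {ffun 'I_j -> 'I_N} => injectiveb pq.1 && injectiveb pq.2) (setX A A)
  (fun pq : {ffun 'I_j -> 'I_N} * {ffun 'I_j -> 'I_N} => (pq.1 @: setT, pq.2 @: setT)) co ee.
have cI (p : {ffun 'I_j -> 'I_N}) : injectiveb p -> p @: setT \in A.
  by move=> /injectiveP pI; rewrite inE card_imset // cardsT card_ord.
move=> H; have : forall pq : {ffun 'I_j -> 'I_N} * {ffun 'I_j -> 'I_N}, injectiveb pq.1 && injectiveb pq.2 ->
    (pq.1 @: setT, pq.2 @: setT) \in setX A A.
  by move=> [p q] /andP[/= hp hq]; rewrite inE !cI.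
move=> /H; congr krank; apply/funext => s; apply/funext => Y.
rewrite lead_mul3 det_minor_expand big_mkcond; apply: eq_bigr => -[p q] _ /=.
have E : \det (\matrix_(x, y) Y (p x) (q y)) = eps p * eps q * ee (p @: setT, q @: setT) Y.
  have -> : (\matrix_(x, y) Y (p x) (q y)) = \matrix_(x, y) (\matrix_(l, y) Y l (q y)) (p x) y.
    by apply/matrixP => x y; rewrite !mxE.
  rewrite (heps p).2 -mulrA; congr (_ * _).
  rewrite -det_tr.
  have -> : (\matrix_(x < j, y < j) (\matrix_(l < N, y' < j) Y l (q y')) (set_nth_ord (p @: setT) x) y)^T =
      \matrix_(x < j, y < j) (\matrix_(l < N, y' < j) Y (set_nth_ord (p @: setT) y') l) (q x) y.
    by apply/matrixP => x y; rewrite !mxE.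
  rewrite (heps q).2; congr (_ * _); rewrite -det_tr.
  by congr (\det _); apply/matrixP => x y; rewrite !mxE.
rewrite E; case: ifP => [_|/negbT].
  rewrite /co /= !mulrA; congr (_ * _).
  by congr (_ * _ * _ * _); apply: eq_bigr => k _; rewrite mxE.
by rewrite negb_and => /orP[/(heps p).1 ->|/(heps q).1 ->]; rewrite ?mulr0 ?mul0r ?mulr0.
Qed.

Variable n : nat.

Definition mono (s : S) (e e' : 'I_n -> 'I_N -> nat) : F :=
  \prod_(k < n) \prod_(l < N) (s.1 (inord k) l ^+ e k l * s.2 l (inord k) ^+ e' k l).

(** For fixed [t] the kernel is a polynomial in [s], homogeneous of degree [lambda k] in row [k] of
    the left factor and in column [k] of the right one. Counting the monomials of these degrees
    gives the rank bound read off from the rows of the diagram. *)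
Definition homk (lambda : 'I_n -> nat) (K : S -> T -> F) := exists (I : finType)
  (c : I -> T -> F) (e e' : I -> 'I_n -> 'I_N -> nat),
  [/\ forall i k, (\sum_l e i k l = lambda k)%N, forall i k, (\sum_l e' i k l = lambda k)%N &
      forall s t, K s t = \sum_i mono s (e i) (e' i) * c i t].

Lemma homk1 : homk (fun=> 0%N) (fun _ _ => 1).
Proof.
exists unit, (fun _ _ => 1), (fun _ _ _ => 0%N), (fun _ _ _ => 0%N); split=> [i k|i k|s t].
- by rewrite big1.
- by rewrite big1.
- rewrite big_const card_unit /= mulr1 addr0 /mono big1 // => k _; rewrite big1 // => l _.
  by rewrite !expr0 mulr1.
Qed.

Lemma homkM la la' K K' : homk la K -> homk la' K' ->
  homk (fun k => la k + la' k)%N (fun s t => K s t * K' s t).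
Proof.
move=> [I [c [e [e' [h1 h2 h3]]]]] [J [c2 [e2 [e2' [g1 g2 g3]]]]].
exists (I * J)%type, (fun ij t => c ij.1 t * c2 ij.2 t),
  (fun ij k l => e ij.1 k l + e2 ij.2 k l)%N, (fun ij k l => e' ij.1 k l + e2' ij.2 k l)%N.
split=> [i k|i k|s t]; first by rewrite big_split /= h1 g1.
  by rewrite big_split /= h2 g2.
rewrite h3 g3 big_distrl -(pair_bigA_idem _ (fun i j => mono s (fun k l => e i k l + e2 j k l)%N
   (fun k l => e' i k l + e2' j k l)%N * (c i t * c2 j t))) /= ?addr0 //.
apply: eq_bigr => i _; rewrite big_distrr; apply: eq_bigr => j _.
rewrite [LHS]mulrACA; congr (_ * _); rewrite /mono -big_split; apply: eq_bigr => k _.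
rewrite -big_split; apply: eq_bigr => l _ /=; rewrite !exprD.
by rewrite mulrACA.
Qed.

Lemma homk_lead j : (j < n)%N -> (n < N)%N -> homk (fun k => (k <= j)%N : nat)
  (fun (s : S) (Y : T) => \det (lead j.+1 (s.1 *m Y *m s.2))).
Proof.
move=> jn nN; pose ex (p : {ffun 'I_j.+1 -> 'I_N}) (k : 'I_n) (l : 'I_N) : nat := ((k <= j) && (p (inord k) == l))%N.
have sex p k : (\sum_l ex p k l = (k <= j))%N.
  rewrite /ex; case: leqP => _ /=; last by rewrite big1.
  by rewrite (bigD1 (p (inord k))) //= eqxx big1 // => l; rewrite eq_sym => /negPf ->.
exists ({ffun 'I_j.+1 -> 'I_N} * {ffun 'I_j.+1 -> 'I_N})%type,
  (fun (pq : {ffun 'I_j.+1 -> 'I_N} * {ffun 'I_j.+1 -> 'I_N}) (Y : T) => \det (\matrix_(x < j.+1, y < j.+1) Y (pq.1 x) (pq.2 y))), (fun pq => ex pq.1), (fun pq => ex pq.2).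
split=> [i k|i k|s Y]; rewrite ?sex //.
rewrite lead_mul3 det_minor_expand; apply: eq_bigr => -[p q] _ /=; congr (_ * _).
rewrite -big_split /mono /=.
transitivity (\prod_(k < n | (k < j.+1)%N) (s.1 (inord k) (p (inord k)) * s.2 (q (inord k)) (inord k))).
  rewrite (big_ord_narrow_cond (P := xpredT) jn) /=; apply: eq_bigr => k _.
  by rewrite !mxE !inord_val.
rewrite big_mkcond; apply: eq_bigr => k _; rewrite ltnS /ex; case: leqP => _ /=; last first.
  by rewrite big1 // => l _; rewrite !expr0 mulr1.
rewrite big_split /=; congr (_ * _).
  rewrite (bigD1 (p (inord k))) //= eqxx expr1 big1 ?mulr1 // => l.
  by rewrite eq_sym => /negPf ->; rewrite expr0.
rewrite (bigD1 (q (inord k))) //= eqxx expr1 big1 ?mulr1 // => l.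
by rewrite eq_sym => /negPf ->; rewrite expr0.
Qed.

Lemma homkX la K r : homk la K -> homk (fun k => r * la k)%N (fun s t => K s t ^+ r).
Proof.
move=> hK; elim: r => [|r IH]; first exact: homk1.
have := homkM hK IH; congr homk.
by apply/funext => s; apply/funext => t; rewrite exprS.
Qed.

Lemma homk_prod (J : Type) (r : seq J) (la : J -> 'I_n -> nat) (K : J -> S -> T -> F) :
  (forall j, homk (la j) (K j)) ->
  homk (fun k => \sum_(j <- r) la j k)%N (fun s t => \prod_(j <- r) K j s t).
Proof.
move=> hK; elim: r => [|j r IH].
  have := homk1; congr homk; first by apply/funext => k; rewrite big_nil.
  by apply/funext => s; apply/funext => t; rewrite big_nil.
have := homkM (hK j) IH; congr homk; first by apply/funext => k; rewrite big_cons.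
by apply/funext => s; apply/funext => t; rewrite big_cons.
Qed.

(** A count of the monomials of degree [q] in [m + 1] variables; the bound [L] on the exponents
    provides one finite type common to all rows. *)
Lemma card_compositions L q : (q <= L)%N ->
  (#|[set t : N.-tuple 'I_L.+1 | (\sum_(i <- t) i == q)%N]| <= 'C(m + q, m))%N.
Proof.
move=> qL; rewrite -card_ord_partitions.
have mem_le k (t : seq 'I_k.+1) x : x \in t -> (x <= \sum_(i <- t) i)%N.
  by move=> xt; rewrite (big_rem x) //= leq_addr.
pose f (t : N.-tuple 'I_L.+1) : N.-tuple 'I_q.+1 := map_tuple (fun i : 'I_L.+1 => inord i) t.
rewrite -(card_in_imset (f := f)) => [|t t'].
  apply/subset_leq_card/subsetP => u /imsetP[t]; rewrite !inE => /eqP ht ->; apply/eqP.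
  rewrite big_map -[RHS]ht big_seq [RHS]big_seq; apply: eq_bigr => x /mem_le; rewrite ht => xq.
  by rewrite inordK.
rewrite !inE => /eqP ht /eqP ht' e; apply: eq_from_tnth => i.
have := congr1 (fun u => val (tnth u i)) e; rewrite !tnth_map /= !inordK ?ltnS => [h||].
- exact: val_inj.
- by rewrite -ht'; apply: mem_le; exact: mem_tnth.
- by rewrite -ht; apply: mem_le; exact: mem_tnth.
Qed.

Lemma krank_homk la K : homk la K -> krank K ((\prod_k 'C(m + la k, m)) ^ 2)%N.
Proof.
move=> [I [c [e [e' [h1 h2 h3]]]]]; pose L := (\sum_k la k)%N.
have laL k : (la k <= L)%N by rewrite /L (bigD1 k) //= leq_addr.
pose G (k : 'I_n) := [set t : N.-tuple 'I_L.+1 | (\sum_(i <- t) i == la k)%N].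
pose A : {set {ffun 'I_n -> N.-tuple 'I_L.+1}} := [set E | E \in family G].
have cA : (#|A| <= \prod_k 'C(m + la k, m))%N.
  rewrite cardsE card_family foldrE big_map big_enum /=.
  by apply: leq_prod => k _; apply: card_compositions.
pose tup (u : 'I_n -> 'I_N -> nat) : {ffun 'I_n -> N.-tuple 'I_L.+1} :=
  [ffun k => [tuple inord (u k l) | l < N]].
pose untup (E : {ffun 'I_n -> N.-tuple 'I_L.+1}) (k : 'I_n) (l : 'I_N) : nat := tnth (E k) l.
have tupK u : (forall k, (\sum_l u k l = la k)%N) -> tup u \in A /\ forall k l, untup (tup u) k l = u k l.
  move=> hu; have ul k l : (u k l < L.+1)%N.
    rewrite ltnS; apply: leq_trans (laL k); rewrite -hu (bigD1 l) //= leq_addr //.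
  split; last by move=> k l; rewrite /untup ffunE tnth_mktuple inordK.
  rewrite inE; apply/familyP => k; rewrite inE ffunE -(hu k) big_tuple; apply/eqP.
  by apply: eq_bigr => l _; rewrite tnth_mktuple inordK.
have : krank (fun s t => K s t) #|setX A A|.
  apply: krank_sym.
  have := @krank_group T S I _ xpredT (setX A A) (fun i => (tup (e i), tup (e' i))) c
    (fun EE s => mono s (untup EE.1) (untup EE.2)).
  have hA i : xpredT i -> (tup (e i), tup (e' i)) \in setX A A.
    by move=> _; rewrite inE (tupK _ (h1 i)).1 (tupK _ (h2 i)).1.
  move=> /(_ hA); congr krank; apply/funext => t; apply/funext => s.
  rewrite h3; apply: eq_bigr => i _; rewrite mulrC; congr (_ * _); apply: eq_bigr => k _.
  by apply: eq_bigr => l _; rewrite (tupK _ (h1 i)).2 (tupK _ (h2 i)).2.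
by apply: krankW; rewrite cardsX -mulnn leq_mul.
Qed.

End KernelRank.

(** * Rank bounds from the columns and from the rows of the diagram *)

Section DimensionBounds.
Variables (R : rcfType) (n : nat).
Local Notation C := R[i].
Local Notation N := n.*2.+1.

Definition Ka (a : 'I_n -> nat) (s : 'M[C]_N * 'M[C]_N) (Y : 'M[C]_N) : C := Fa a (s.1 *m Y *m s.2).

Lemma krank_cols (a : 'I_n -> nat) : krank (Ka a) ((\prod_(j < n) 'C(N, j.+1) ^ a j) ^ 2).
Proof.
have := @krank_prod C _ _ _ (index_enum 'I_n) (fun j s Y => \det (lead j.+1 (s.1 *m Y *m s.2)) ^+ a j)
  (fun j => ('C(N, j.+1) ^ 2) ^ a j)%N (fun j => krankX (a j) (krank_minor C n.*2 j.+1)).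
congr krank; rewrite -mulnn -big_split; apply: eq_bigr => j _.
by rewrite /= -expnM mulnC expnM mulnn.
Qed.

Lemma krank_rows (a : 'I_n -> nat) : krank (Ka a) ((\prod_(k < n) 'C(n.*2 + lam a k, n.*2)) ^ 2).
Proof.
have nN : (n < N)%N by lia.
have := krank_homk (homk_prod (index_enum 'I_n) (fun j => homkX (a j) (homk_lead C (ltn_ord j) nN))).
congr krank; congr (_ ^ 2)%N; apply: eq_bigr => k _; congr ('C(_ + _, _))%N.
by rewrite /lam [RHS]big_mkcond; apply: eq_bigr => j _; case: leqP; rewrite ?muln1 ?muln0.
Qed.

Lemma KaD (a b : 'I_n -> nat) s Y : Ka (fun j => a j + b j)%N s Y = Ka a s Y * Ka b s Y.
Proof. by rewrite /Ka /Fa -big_split; apply: eq_bigr => j _; rewrite exprD. Qed.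

Lemma krank_split (a b : 'I_n -> nat) d d' : krank (Ka a) d -> krank (Ka b) d' ->
  krank (Ka (fun j => a j + b j)%N) (d * d').
Proof.
move=> ha hb; have := krankM ha hb; congr krank.
by apply/funext => s; apply/funext => Y; rewrite KaD.
Qed.

End DimensionBounds.

From mathcomp Require Import all_boot all_order all_algebra.
From mathcomp Require Import all_classical all_reals all_analysis.
From mathcomp Require Import ring lra zify.
From mathcomp Require Import measurable_realfun lebesgue_measure.
From mathcomp Require Import fingroup perm.
From mathcomp Require Import complex mxtens.
Import Order.TTheory GRing.Theory Num.Theory.
Import numFieldNormedType.Exports.
Local Open Scope classical_set_scope.
Local Open Scope ring_scope.

(** * The walk and its L2 bound *)

Section SOTopology.
Context {R : realType} {N : nat}.
Local Notation G := (SO R N).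

Lemma open_SO_box (O : set G) (X : G) : open O -> O X ->
  exists2 e : R, 0 < e & forall Y : G,
    (forall i j, `|so_mx X i j - so_mx Y i j| < e) -> O Y.
Proof.
case=> V oV <- VX.
have : nbhs (so_mx X) V by exact: open_nbhs_nbhs.
move=> /nbhs_ballP[e /= e0 sub]; exists e => // Y h.
by apply: sub; split.
Qed.

Lemma SO_box_open (O : set G) :
  (forall X, O X -> exists2 e : R, 0 < e & forall Y : G,
    (forall i j, `|so_mx X i j - so_mx Y i j| < e) -> O Y) -> open O.
Proof.
move=> h.
pose V := \bigcup_(A in [set A : 'M[R]_N | exists2 e : R, 0 < e & forall Y : G,
    (forall i j, `|A i j - so_mx Y i j| < e) -> O Y])
  (\bigcup_(e in [set e : R | 0 < e /\ forall Y : G,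
    (forall i j, `|A i j - so_mx Y i j| < e) -> O Y]) ((ball A e)°)).
exists V.
  by apply: bigcup_open => A _; apply: bigcup_open => e _; exact: open_interior.
apply/seteqP; split => X /=.
  case=> A _ [e [e0 he]] /interior_subset [_ b]; apply: he => i j.
  exact: (b i j).
move=> /h [e e0 he]; exists (so_mx X); first by exists e.
exists e => //=; rewrite /interior.
by apply: nbhsx_ballx.
Qed.

Lemma measurable_entry (i j : 'I_N) :
  measurable_fun setT (fun X : G => so_mx X i j).
Proof.
apply: (@measurability _ _ _ _ setT _ (@measurable_realfun.RGenOInfty.G R)).
  exact: measurable_realfun.RGenOInfty.measurableE.
move=> _ [_ [a ->] <-]; rewrite setTI.
apply: sub_sigma_algebra; apply: SO_box_open => X /=.
rewrite in_itv /= andbT => aX; exists (so_mx X i j - a); first by rewrite subr_gt0.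
move=> Y /(_ i j); rewrite in_itv /= andbT ltr_norml => /andP[_].
by rewrite ltrBlDr addrC -ltrBlDr opprB addrCA subrr addr0.
Qed.

Let box (q : {ffun 'I_N * 'I_N -> rat} * nat) : set G :=
  [set X | forall i j, `|so_mx X i j - ratr (q.1 (i, j))| < q.2.+1%:R^-1].

(** Boxes with rational centres and radii [1 / (k + 1)] form a countable base, so measurability can
    be tested on entries. *)
Lemma open_SO_boxes (O : set G) : open O ->
  O = \bigcup_(q in [set q | box q `<=` O]) box q.
Proof.
move=> oO; apply/seteqP; split => [X OX|X [q /= qO] /qO //].
have [e e0 he] := open_SO_box oO OX.
have [k hk] : exists k : nat, k.+1%:R^-1 < e / 2 :> R.
  exists (Num.truncn (2 / e)).
  rewrite -[ltRHS]invrK ltf_pV2 ?posrE ?invr_gt0 ?divr_gt0 // invf_div.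
  exact: truncnS_gt.
have k0 : 0 < k.+1%:R^-1 :> R by rewrite invr_gt0.
have [f hf] : exists f : 'I_N * 'I_N -> rat, forall p,
    `|so_mx X p.1 p.2 - ratr (f p)| < k.+1%:R^-1.
  suff h p : exists q, `|so_mx X p.1 p.2 - ratr q| < k.+1%:R^-1 by have [f hf] := boolp.choice h; exists f.
  case: p => i j /=.
  have lt1 : so_mx X i j - k.+1%:R^-1 < so_mx X i j by rewrite ltrBlDr ltrDl.
  have [q] := rat_in_itvoo lt1.
  rewrite in_itv /= => /andP[h1 h2]; exists q.
  by rewrite gtr0_norm ?subr_gt0 // ltrBlDr addrC -ltrBlDr.
exists ([ffun p => f p], k) => /=; last by move=> i j; rewrite ffunE; exact: (hf (i, j)).
move=> Y hY; apply: he => i j.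
have := hY i j; rewrite ffunE /= => h1; have := hf (i, j) => /= h2.
rewrite (_ : _ - _ = (so_mx X i j - ratr (f (i, j))) - (so_mx Y i j - ratr (f (i, j)))); last by ring.
rewrite (le_lt_trans (ler_normB _ _)) // (splitr e) ltrD //; exact: lt_trans hk.
Qed.

Lemma measurable_SO d (T : measurableType d) (f : T -> G) :
  (forall i j, measurable_fun setT (fun t => so_mx (f t) i j)) ->
  measurable_fun setT f.
Proof.
move=> h; apply: (@measurability _ _ _ _ setT f (@open G)) => //.
move=> _ [V oV <-]; rewrite setTI (open_SO_boxes oV) preimage_bigcup.
rewrite bigcup_mkcond; apply: countable_bigcupT_measurable => [|q].
  exact: countableP.
case: ifP => _ //.
have -> : f @^-1` box q = \bigcap_(p : 'I_N * 'I_N) ((fun t => so_mx (f t) p.1 p.2) @^-1`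
    (ball (ratr (q.1 p) : R) (q.2.+1%:R^-1 : R))).
  apply/seteqP; split => t /=.
    by move=> ht [i j] _ /=; rewrite /ball /= distrC; exact: ht.
  by move=> ht i j; have := ht (i, j) I; rewrite /ball /= distrC.
apply: fin_bigcap_measurable => // p _.
rewrite -[X in measurable X]setTI; apply: h => //.
by apply: open_measurable; exact: ball_open.
Qed.
End SOTopology.

(** * Expectations of bounded measurable functions *)

Section Expectation.
Context {R : realType} d (T : measurableType d).
Implicit Types f g : T -> R.

(** Boundedness makes all integrals finite, so that expectations can be real numbers and linear, and
    integrals can be exchanged. *)
Definition bmf f := measurable_fun setT f /\ exists M, forall x, `|f x| <= M.

Lemma bmf_cst (c : R) : bmf (fun=> c).
Proof. by split; [exact: measurable_cst | exists `|c|]. Qed.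

Lemma bmfD f g : bmf f -> bmf g -> bmf (fun x => f x + g x).
Proof.
move=> [mf [A hA]] [mg [B hB]]; split; first exact: measurable_funD.
by exists (A + B) => x; rewrite (le_trans (ler_normD _ _)) // lerD.
Qed.

Lemma bmfM f g : bmf f -> bmf g -> bmf (fun x => f x * g x).
Proof.
move=> [mf [A hA]] [mg [B hB]]; split; first exact: measurable_funM.
by exists (A * B) => x; rewrite normrM ler_pM.
Qed.

Lemma bmfZ c f : bmf f -> bmf (fun x => c * f x).
Proof. by move=> hf; apply: bmfM => //; exact: bmf_cst. Qed.

Lemma bmfN f : bmf f -> bmf (fun x => - f x).
Proof.
move=> hf; rewrite (_ : (fun x => - f x) = (fun x => -1 * f x)); first exact: bmfZ.
by apply/funext => x; rewrite mulN1r.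
Qed.

Lemma bmfB f g : bmf f -> bmf g -> bmf (fun x => f x - g x).
Proof. by move=> hf hg; apply: bmfD => //; exact: bmfN. Qed.

Lemma bmfX f n : bmf f -> bmf (fun x => f x ^+ n).
Proof.
move=> hf; elim: n => [|n IH].
  by rewrite (_ : (fun x => _) = (fun=> 1)) //; exact: bmf_cst.
rewrite (_ : (fun x => _) = (fun x => f x * f x ^+ n)); first exact: bmfM.
by apply/funext => x; rewrite exprS.
Qed.

Lemma bmf_sum (I : Type) (s : seq I) (F : I -> T -> R) :
  (forall i, bmf (F i)) -> bmf (fun x => \sum_(i <- s) F i x).
Proof.
move=> h; elim: s => [|i s IH].
  by rewrite (_ : (fun x => _) = (fun=> 0)); [exact: bmf_cst | apply/funext => x; rewrite big_nil].
rewrite (_ : (fun x => _) = (fun x => F i x + \sum_(j <- s) F j x)); first exact: bmfD.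
by apply/funext => x; rewrite big_cons.
Qed.

Lemma bmf_norm f : bmf f -> bmf (fun x => `|f x|).
Proof.
move=> [mf [A hA]]; split; last by exists A => x; rewrite normr_id.
exact: measurableT_comp.
Qed.

Lemma bmf_expR f : bmf f -> bmf (fun x => expR (f x)).
Proof.
move=> [mf [A hA]]; split; first exact: measurableT_comp.
exists (expR A) => x; rewrite ger0_norm ?expR_ge0 // ler_expR.
exact: le_trans (ler_norm _) (hA x).
Qed.

Lemma bmf_comp d' (T' : measurableType d') (f : T -> R) (g : T' -> T) :
  bmf f -> measurable_fun setT g ->
  measurable_fun setT (f \o g) /\ exists M, forall x, `|f (g x)| <= M.
Proof.
move=> [mf [A hA]] mg; split; first exact: measurableT_comp.
by exists A.
Qed.

Variable P : probability T R.

Definition Ex f : R := \int[P]_x f x.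

Lemma bmf_integrable f : bmf f -> P.-integrable setT (EFin \o f).
Proof.
move=> [mf [A hA]]; apply: measurable_bounded_integrable => //.
  by apply: le_lt_trans (probability_le1 P measurableT) _; exact: ltry.
exists A; split; first exact: num_real.
by move=> M AM x _; apply: le_trans (hA x) _; exact: ltW.
Qed.

Lemma ExE f : bmf f -> (Ex f)%:E = (\int[P]_x (f x)%:E)%E.
Proof.
move=> hf; rewrite /Ex /Rintegral fineK //.
exact: integrable_fin_num (bmf_integrable hf).
Qed.

Lemma Ex_cst c : Ex (fun=> c) = c.
Proof.
rewrite /Ex Rintegral_cst // -[RHS]mulr1; congr (_ * _).
by rewrite -[RHS]/(fine 1%E); congr fine; exact: probability_setT.
Qed.

Lemma ExD f g : bmf f -> bmf g -> Ex (fun x => f x + g x) = Ex f + Ex g.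
Proof. by move=> hf hg; apply: RintegralD => //; exact: bmf_integrable. Qed.

Lemma ExZ c f : bmf f -> Ex (fun x => c * f x) = c * Ex f.
Proof. by move=> hf; apply: RintegralZl => //; exact: bmf_integrable. Qed.

Lemma ExN f : bmf f -> Ex (fun x => - f x) = - Ex f.
Proof.
move=> hf; rewrite -mulN1r -ExZ //; congr Ex.
by apply/funext => x; rewrite mulN1r.
Qed.

Lemma ExB f g : bmf f -> bmf g -> Ex (fun x => f x - g x) = Ex f - Ex g.
Proof. by move=> hf hg; rewrite ExD ?ExN //; exact: bmfN. Qed.

Lemma Ex_sum (I : Type) (s : seq I) (F : I -> T -> R) :
  (forall i, bmf (F i)) -> Ex (fun x => \sum_(i <- s) F i x) = \sum_(i <- s) Ex (F i).
Proof.
move=> h; elim: s => [|i s IH].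
  rewrite big_nil (_ : (fun x => _) = (fun=> 0)) ?Ex_cst //.
  by apply/funext => x; rewrite big_nil.
rewrite big_cons -IH -ExD //; last exact: bmf_sum.
by congr Ex; apply/funext => x; rewrite big_cons.
Qed.

Lemma le_Ex f g : bmf f -> bmf g -> (forall x, f x <= g x) -> Ex f <= Ex g.
Proof. by move=> hf hg h; apply: le_Rintegral => //; exact: bmf_integrable. Qed.

Lemma Ex_ge0 f : (forall x, 0 <= f x) -> 0 <= Ex f.
Proof. by move=> h; apply: Rintegral_ge0. Qed.

Lemma Ex_norm f : bmf f -> `|Ex f| <= Ex (fun x => `|f x|).
Proof. by move=> hf; apply: le_normr_Rintegral => //; exact: bmf_integrable. Qed.

Lemma Ex_norm_le f M : bmf f -> (forall x, `|f x| <= M) -> `|Ex f| <= M.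
Proof.
move=> hf h; apply: le_trans (Ex_norm hf) _.
by rewrite -[leRHS]Ex_cst; apply: le_Ex => //; [exact: bmf_norm | exact: bmf_cst].
Qed.

End Expectation.
Arguments Ex {R d T} P f.

Lemma prod_fin {R : realType} d1 d2 (T1 : measurableType d1) (T2 : measurableType d2)
  (P1 : probability T1 R) (P2 : probability T2 R) :
  ((P1 \x P2)%E setT < +oo)%E.
Proof.
have h := product_measure1E P1 P2 (@measurableT _ T1) (@measurableT _ T2).
rewrite setXTT in h.
apply: (@le_lt_trans _ _ (P1 setT * P2 setT)%E); first by rewrite -h.
apply: lte_mul_pinfty; first exact: measure_ge0.
  exact: fin_num_measure.
by apply: le_lt_trans (probability_le1 _ measurableT) _; exact: ltry.
Qed.

Section FubiniBounded.
Context {R : realType} d1 d2 (T1 : measurableType d1) (T2 : measurableType d2).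
Variables (P1 : probability T1 R) (P2 : probability T2 R).
Variable F : T1 -> T2 -> R.
Hypothesis hF : bmf (fun z : T1 * T2 => F z.1 z.2).

Lemma bmf_slice1 x : bmf (F x).
Proof.
by have [] := bmf_comp hF (measurable_pair1 x).
Qed.

Lemma bmf_slice2 y : bmf (F^~ y).
Proof.
by have [] := bmf_comp hF (measurable_pair2 y).
Qed.

Let hint : (P1 \x P2)%E.-integrable setT (EFin \o (fun z : T1 * T2 => F z.1 z.2)).
Proof.
case: hF => mf [A hA]; apply: measurable_bounded_integrable => //.
  exact: prod_fin P1 P2.
exists A; split; first exact: num_real.
by move=> M AM x _; apply: le_trans (hA x) _; exact: ltW.
Qed.

Lemma bmf_Ex : bmf (fun x => Ex P2 (F x)).
Proof.
case: (hF) => mf [A hA]; split; last first.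
  by exists A => x; apply: Ex_norm_le; [exact: bmf_slice1 | move=> y; exact: (hA (x, y))].
apply/measurable_EFinP.
have := measurable_fubini_F hint; apply: eq_measurable_fun => x _.
by rewrite /= /fubini_F /comp /= -ExE //; exact: bmf_slice1.
Qed.

End FubiniBounded.

Lemma Ex_exchange {R : realType} d1 d2 (T1 : measurableType d1) (T2 : measurableType d2)
    (P1 : probability T1 R) (P2 : probability T2 R) (F : T1 -> T2 -> R) :
  bmf (fun z : T1 * T2 => F z.1 z.2) ->
  Ex P1 (fun x => Ex P2 (F x)) = Ex P2 (fun y => Ex P1 (F^~ y)).
Proof.
move=> hF.
have hG : bmf (fun z : T2 * T1 => F z.2 z.1).
  have [? ?] := bmf_comp hF (measurable_swap (T1:=T2) (T2:=T1)); split => //.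
apply: EFin_inj; rewrite ExE; last exact: (bmf_Ex P1 P2 hF).
rewrite [in RHS]ExE; last exact: (bmf_Ex P2 P1 hG).
transitivity (\int[P1]_x \int[P2]_y (F x y)%:E)%E.
  by apply: eq_integral => x _; rewrite ExE //; exact: bmf_slice1 hF x.
transitivity (\int[P2]_y \int[P1]_x (F x y)%:E)%E; last first.
  by apply: eq_integral => y _; rewrite ExE //; exact: bmf_slice2 hF y.
apply: (Fubini (f := EFin \o (fun z => F z.1 z.2))).
case: hF => mf [A hA]; apply: measurable_bounded_integrable => //.
  exact: prod_fin P1 P2.
exists A; split; first exact: num_real.
by move=> M AM x _; apply: le_trans (hA x) _; exact: ltW.
Qed.

(** * Invariance properties of Haar measure *)

Section Haar.
Context {R : realType} {N : nat}.
Local Notation G := (SO R N).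

Lemma entry_le1 (X : G) i j : `|so_mx X i j| <= 1.
Proof.
have /andP[/eqP XX _] := so_mxP X.
have : ((so_mx X)^T *m so_mx X) j j = 1 by rewrite XX mxE eqxx.
rewrite mxE => h; rewrite -(@ler_pXn2r _ 2) ?nnegrE // expr1n -normrX ger0_norm ?sqr_ge0 //.
rewrite -h (bigD1 i) //= mxE expr2 lerDl; apply: sumr_ge0 => k _.
by rewrite mxE -expr2 sqr_ge0.
Qed.

Lemma bmf_entry i j : bmf (fun X : G => so_mx X i j).
Proof. by split; [exact: measurable_entry | exists 1 => X; exact: entry_le1]. Qed.

Lemma measurable_soM d (T : measurableType d) (f g : T -> G) :
  measurable_fun setT f -> measurable_fun setT g ->
  measurable_fun setT (fun t => (f t * g t)%g).
Proof.
move=> mf mg; apply: measurable_SO => i j.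
rewrite (_ : (fun t => _) = (fun t => \sum_(k < N) so_mx (f t) i k * so_mx (g t) k j)).
  apply: measurable_sum => k; apply: measurable_funM.
    by apply: (measurableT_comp (measurable_entry i k)).
  by apply: (measurableT_comp (measurable_entry k j)).
by apply/funext => t; rewrite mxE.
Qed.

Lemma measurable_soV d (T : measurableType d) (f : T -> G) :
  measurable_fun setT f -> measurable_fun setT (fun t => (f t)^-1%g).
Proof.
move=> mf; apply: measurable_SO => i j.
rewrite (_ : (fun t => _) = (fun t => so_mx (f t) j i)).
  by apply: (measurableT_comp (measurable_entry j i)).
by apply/funext => t; rewrite mxE.
Qed.

Variable nu : probability G R.
Hypothesis nuH : is_haar nu.
Local Notation E := (Ex nu).

Lemma Ex_left (g : G) (f : G -> R) : bmf f -> E (fun x : G => f (g * x)%g) = E f.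
Proof.
move=> hf.
have mg : measurable_fun setT (fun x : G => (g * x)%g).
  by apply: measurable_soM; [exact: measurable_cst | exact: measurable_id].
have hfg : bmf (fun x : G => f (g * x)%g) by have [] := bmf_comp hf mg.
apply: EFin_inj; rewrite !ExE //.
transitivity (\int[pushforward nu (fun x : G => (g * x)%g)]_x (f x)%:E)%E.
  rewrite integral_pushforward //; last exact: bmf_integrable.
  by apply/measurable_EFinP; case: hf.
apply: eq_measure_integral => A mA _; rewrite /pushforward.
transitivity (nu [set (g^-1 * x)%g | x in A]); last exact: nuH.
rewrite /=; congr (nu _); apply/seteqP; split => [x /= Ax|x /= [y Ay <-]].
  by exists (g * x)%g => //; rewrite mulgA mulVg mul1g.
by rewrite mulgA mulgV mul1g.
Qed.

(** Integrated first in [x], the function [f (x^-1 y)] has the mean of [f] composed with the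
    inverse; integrated first in [y], it has the mean of [f]. Both use invariance on the left
    only. *)
Lemma Ex_inv (f : G -> R) : bmf f -> E (fun x : G => f x^-1%g) = E f.
Proof.
move=> hf.
have hF : bmf (fun z : G * G => f (z.1^-1 * z.2)%g).
  have [] := @bmf_comp _ _ _ _ _ f (fun z : G * G => (z.1^-1 * z.2)%g) hf => //.
  by apply: measurable_soM; [apply: measurable_soV |]; [exact: measurable_fst | exact: measurable_snd].
have hV : bmf (fun x : G => f x^-1%g).
  by have [] := bmf_comp hf (measurable_soV (@measurable_id _ _ setT)).
transitivity (E (fun y : G => E (fun x : G => f (x^-1 * y)%g))).
  rewrite -[LHS](Ex_cst nu); congr Ex; apply/funext => y.
  rewrite -(Ex_left (y^-1)%g hV) /=; congr Ex; apply/funext => x.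
  by rewrite invgM invgK.
rewrite -(Ex_exchange _ _ hF) -[RHS](Ex_cst nu); congr Ex; apply/funext => x.
exact: Ex_left.
Qed.

Lemma Ex_right (g : G) (f : G -> R) : bmf f -> E (fun x : G => f (x * g)%g) = E f.
Proof.
move=> hf.
have hV : bmf (fun x : G => f x^-1%g).
  by have [] := bmf_comp hf (measurable_soV (@measurable_id _ _ setT)).
have hg : bmf (fun x : G => f (x * g)%g).
  have [] := @bmf_comp _ _ _ _ _ f (fun x : G => (x * g)%g) hf => //.
  by apply: measurable_soM; [exact: measurable_id | exact: measurable_cst].
rewrite -(Ex_inv hg) -(Ex_inv hf) -(Ex_left (g^-1)%g hV); congr Ex; apply/funext => x.
by rewrite invgM invgK.
Qed.
End Haar.

(** * Polynomial functions of the entries and Bernstein approximation *)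

Section PolynomialFunctions.
Context {R : realType} {N : nat}.
Local Notation G := (SO R N).

Inductive polyfun : (G -> R) -> Prop :=
| polyfun_cst c : polyfun (fun=> c)
| polyfun_entry i j : polyfun (fun X => so_mx X i j)
| polyfun_add f g : polyfun f -> polyfun g -> polyfun (fun X => f X + g X)
| polyfun_mul f g : polyfun f -> polyfun g -> polyfun (fun X => f X * g X).

Lemma polyfun_bmf f : polyfun f -> bmf f.
Proof.
elim=> [c|i j|g h _ hg _ hh|g h _ hg _ hh]; [exact: bmf_cst | exact: bmf_entry |
  exact: bmfD | exact: bmfM].
Qed.

(* [bern m phi y] is the expectation of [phi] under the binomial law of
   parameters [m], [y]; it gives the Bernstein polynomials. *)
Fixpoint bern (m : nat) (phi : nat -> R) (y : R) : R :=
  if m is m'.+1 then y * bern m' (fun k => phi k.+1) y + (1 - y) * bern m' phi y else phi 0%N.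

Lemma bernD m phi psi y : bern m (fun k => phi k + psi k) y = bern m phi y + bern m psi y.
Proof. by elim: m phi psi => [//|m IH] phi psi /=; rewrite !IH; ring. Qed.

Lemma bernZ m c phi y : bern m (fun k => c * phi k) y = c * bern m phi y.
Proof. by elim: m phi => [//|m IH] phi /=; rewrite !IH; ring. Qed.

Lemma bern_cst m c y : bern m (fun=> c) y = c.
Proof. by elim: m => [//|m IH] /=; rewrite !IH; ring. Qed.

Lemma bern_le m phi psi y : 0 <= y <= 1 -> (forall k, phi k <= psi k) ->
  bern m phi y <= bern m psi y.
Proof.
move=> /andP[y0 y1]; elim: m phi psi => [|m IH] phi psi h /=; first exact: h.
by apply: lerD; apply: ler_wpM2l; rewrite ?subr_ge0 //; apply: IH.
Qed.

Lemma bern_id m y : bern m (fun k => k%:R) y = m%:R * y.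
Proof.
elim: m => [|m IH] /=; first by rewrite mul0r.
rewrite (_ : (fun k => k.+1%:R) = (fun k => k%:R + 1)); last by apply/funext => k; rewrite natr1.
by rewrite bernD bern_cst IH -natr1; ring.
Qed.

Lemma bern_sq m y : bern m (fun k => k%:R ^+ 2) y = (m%:R * y) ^+ 2 + m%:R * (y * (1 - y)).
Proof.
elim: m => [|m IH] /=; first by ring.
rewrite (_ : (fun k => k.+1%:R ^+ 2) = (fun k => k%:R ^+ 2 + (2 * k%:R + 1))); last first.
  by apply/funext => k; rewrite -natr1; ring.
by rewrite !bernD bern_cst bernZ bern_id IH -natr1; ring.
Qed.

Lemma bern_var m y : bern m (fun k => (k%:R - m%:R * y) ^+ 2) y = m%:R * (y * (1 - y)).
Proof.
rewrite (_ : (fun k => _) = (fun k => k%:R ^+ 2 + ((- 2 * (m%:R * y)) * k%:R + (m%:R * y) ^+ 2))).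
  by rewrite !bernD bern_cst bernZ bern_id bern_sq; ring.
by apply/funext => k; ring.
Qed.

Lemma polyfun_bern m phi f : polyfun f -> polyfun (fun X => bern m phi (f X)).
Proof.
move=> hf; elim: m phi => [|m IH] phi /=; first exact: polyfun_cst.
apply: polyfun_add; apply: polyfun_mul => //.
rewrite (_ : (fun X => _) = (fun X => 1 + -1 * f X)); last by apply/funext => X; ring.
by apply: polyfun_add; [exact: polyfun_cst | apply: polyfun_mul => //; exact: polyfun_cst].
Qed.

(** Bernstein's argument: the error is at most the binomial mean of [L |y - k / m|], and
    [2 x <= x ^ 2 / d + d] reduces it to the variance. The choice of [m] makes the standard
    deviation at most [d]. *)
Lemma bern_approx (g : R -> R) (L eta : R) : 0 < eta -> 0 <= L ->
  (forall x y, `|g x - g y| <= L * `|x - y|) ->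
  exists m, forall y, 0 <= y <= 1 -> `|g y - bern m (fun k => g (k%:R / m%:R)) y| <= eta.
Proof.
move=> eta0 L0 hg; pose d := eta / (L + 1).
have d0 : 0 < d by rewrite divr_gt0 // ltr_wpDl.
have Ld : L * d <= eta.
  by rewrite /d mulrA ler_pdivrMr ?ltr_wpDl // mulrC ler_pM2l // lerDl ler01.
pose m := (Num.truncn (d ^- 2)).+1.
have hm : d ^- 2 <= m%:R by rewrite ltW // truncnS_gt.
have m0 : 0 < m%:R :> R by rewrite ltr0n.
exists m => y y01; have /andP[y0 y1] := y01.
rewrite -{1}(bern_cst m (g y) y) -mulN1r -bernZ -bernD.
pose q k : R := L * (d / 2 + (k%:R - m%:R * y) ^+ 2 / (m%:R ^+ 2) / (2 * d)).
have key k : `|g y + -1 * g (k%:R / m%:R)| <= q k.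
  rewrite mulN1r; apply: le_trans (hg _ _) _; rewrite ler_wpM2l //.
  have -> : (k%:R - m%:R * y) ^+ 2 / m%:R ^+ 2 = `|y - k%:R / m%:R| ^+ 2.
    by rewrite real_normK ?num_real //; field; rewrite lt0r_neq0.
  set x := `|_|; have : 0 <= (x - d) ^+ 2 / (2 * d) by rewrite divr_ge0 ?sqr_ge0 // mulr_ge0 // ltW.
  have -> : (x - d) ^+ 2 / (2 * d) = x ^+ 2 / (2 * d) + d / 2 - x by field; rewrite lt0r_neq0.
  by lra.
have qb : bern m q y <= eta.
  rewrite /q bernZ bernD bern_cst.
  rewrite (_ : (fun k => _ / (2 * d)) = (fun k => (m%:R ^- 2 / (2 * d)) * (k%:R - m%:R * y) ^+ 2)); last first.
    by apply/funext => k; field; rewrite !lt0r_neq0.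
  rewrite bernZ bern_var; apply: le_trans Ld; rewrite ler_wpM2l //.
  have h1 : y * (1 - y) <= 1 by nra.
  have h2 : m%:R ^- 2 / (2 * d) * (m%:R * (y * (1 - y))) <= m%:R^-1 / (2 * d).
    have -> : m%:R ^- 2 / (2 * d) * (m%:R * (y * (1 - y))) = m%:R^-1 / (2 * d) * (y * (1 - y)).
      by field; rewrite !lt0r_neq0.
    by apply: ler_piMr h1; apply: divr_ge0; [rewrite invr_ge0 ler0n | apply: ltW; rewrite mulr_gt0].
  have h3 : m%:R^-1 <= d ^+ 2.
    by rewrite -[leRHS]invrK lef_pV2 ?posrE ?invr_gt0 ?exprn_gt0.
  have : m%:R^-1 / (2 * d) <= d / 2.
    have -> : d / 2 = d ^+ 2 / (2 * d) by field; rewrite lt0r_neq0.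
    by apply: ler_wpM2r => //; rewrite invr_ge0 mulr_ge0 // ltW.
  by lra.
rewrite ler_norml; apply/andP; split.
  have := @bern_le m (fun k => -1 * q k) (fun k => g y + -1 * g (k%:R / m%:R)) y y01.
  move=> /(_ _) H; apply: le_trans (H _).
    by rewrite bernZ mulN1r lerN2.
  by move=> k; rewrite mulN1r; have := key k; rewrite ler_norml => /andP[].
apply: le_trans (bern_le m y01 _) qb => k.
exact: le_trans (ler_norm _) (key k).
Qed.

End PolynomialFunctions.

Lemma Ex_dct {R : realType} d (T : measurableType d) (P : probability T R)
    (f_ : nat -> T -> R) (f : T -> R) (M : R) :
  (forall m, measurable_fun setT (f_ m)) -> (forall m x, `|f_ m x| <= M) -> bmf f ->
  (forall x, f_ m x @[m --> \oo] --> f x) -> Ex P (f_ m) @[m --> \oo] --> Ex P f.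
Proof.
move=> mf hM hf hc.
have bf m : bmf (f_ m) by split=> //; exists M.
have [] := @dominated_convergence _ T R P setT measurableT
  (fun m x => (f_ m x)%:E) (EFin \o f) (cst M%:E).
- by move=> m; apply/measurable_EFinP.
- by apply/measurable_EFinP; case: hf.
- apply: aeW => x _; apply: cvg_EFin; last exact: hc.
  by apply: nearW => m.
- by apply: (@bmf_integrable _ _ _ P (fun=> M)); exact: bmf_cst.
- by apply: aeW => x m _; rewrite lee_fin.
move=> _ _ h; rewrite -ExE // in h.
have h2 := fine_cvg h; rewrite (_ : (fun m => Ex P (f_ m)) = (fun m => fine (\int[P]_x (f_ m x)%:E)%E)) //.
exact: h2.
Qed.

(** * The walk as an operator, and approximation of measurable sets *)

Section Walk.
Context {R : realType} {N : nat}.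
Local Notation G := (SO R N).
Variables (hN : (1 < N)%N) (nu : probability G R) (theta : R).
Hypothesis nuH : is_haar nu.
Local Notation rt := (rot12 hN theta).
Local Notation E := (Ex nu).

Definition walk_op (f : G -> R) (X : G) : R := E (fun U : G => f (U * rt * U^-1 * X)%g).
Local Notation Pr := walk_op.

Lemma bmf_walk2 (f : G -> R) : bmf f -> bmf (fun z : G * G => f (z.2 * rt * z.2^-1 * z.1)%g).
Proof.
move=> hf.
have [] := @bmf_comp _ _ _ _ _ f (fun z : G * G => (z.2 * rt * z.2^-1 * z.1)%g) hf => //.
apply: measurable_soM; last exact: measurable_fst.
apply: measurable_soM; last by apply: measurable_soV; exact: measurable_snd.
by apply: measurable_soM; [exact: measurable_snd | exact: measurable_cst].
Qed.

Lemma bmf_walk (f : G -> R) X : bmf f -> bmf (fun U : G => f (U * rt * U^-1 * X)%g).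
Proof. by move=> hf; exact: (bmf_slice1 (F := fun X U : G => f (U * rt * U^-1 * X)%g) (bmf_walk2 hf) X). Qed.

Lemma bmf_Pr f : bmf f -> bmf (Pr f).
Proof. by move=> hf; exact: (bmf_Ex nu nu (bmf_walk2 hf)). Qed.

Lemma bmf_iter t f : bmf f -> bmf (iter t Pr f).
Proof. by move=> hf; elim: t => //= t IH; exact: bmf_Pr. Qed.

Lemma transition_opE f : bmf f ->
  transition_op hN nu theta (fun Y => (f Y)%:E) = (fun Y => (Pr f Y)%:E).
Proof.
move=> hf; apply/funext => X; rewrite /transition_op /Pr ExE //.
exact: bmf_walk.
Qed.

Lemma bmf_indic (B : set G) : measurable B -> bmf (\1_B : G -> R).
Proof.
move=> mB; split; first exact: measurable_indic.
by exists 1 => x; rewrite indicE; case: (_ \in _); rewrite ?normr1 ?normr0.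
Qed.

Lemma walk_lawE t (B : set G) : measurable B ->
  walk_law hN nu theta t B = (iter t Pr \1_B 1%g)%:E.
Proof.
move=> mB; rewrite /walk_law /apply_law.
have -> : iter t (transition_op hN nu theta) (fun Y => (\1_B Y)%:E) =
    (fun X => (iter t Pr \1_B X)%:E).
  elim: t => [//|t IH] /=; rewrite IH transition_opE //.
  by apply: bmf_iter; exact: bmf_indic.
rewrite integral_dirac //; last first.
  by apply/measurable_EFinP; have [] := bmf_iter t (bmf_indic mB).
by rewrite diracT mul1e.
Qed.

(** The properties shared by the Haar mean and by the law of the walk that the approximation of sets
    relies on; bounded convergence plays the part of countable additivity. *)
Record mean_functional (L : (G -> R) -> R) : Prop := MeanFunctional {
  mf_le : forall f g, bmf f -> bmf g -> (forall x, f x <= g x) -> L f <= L g ;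
  mf_add : forall f g, bmf f -> bmf g -> L (fun x => f x + g x) = L f + L g ;
  mf_scale : forall c f, bmf f -> L (fun x => c * f x) = c * L f ;
  mf_cst : forall c, L (fun=> c) = c ;
  mf_lim : forall (f_ : nat -> G -> R) f, (forall m, bmf (f_ m)) -> bmf f ->
    (forall m x, `|f_ m x| <= 1) -> (forall x, `|f x| <= 1) ->
    (forall x, f_ m x @[m --> \oo] --> f x) -> L (f_ m) @[m --> \oo] --> L f }.

Lemma mean_functional_Ex : mean_functional E.
Proof.
split=> [f g hf hg|f g hf hg|c f hf|c|f_ f h hf h1 _ hc].
- exact: le_Ex.
- exact: ExD.
- exact: ExZ.
- exact: Ex_cst.
- by apply: (Ex_dct (M := 1)) => // m; case: (h m).
Qed.

Lemma mean_functional_Pr L : mean_functional L -> mean_functional (fun f => L (Pr f)).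
Proof.
move=> [h1 h2 h3 h4 h5]; split=> [f g hf hg fg|f g hf hg|c f hf|c|f_ f hf_ hf b1 b2 hc].
- apply: h1; try exact: bmf_Pr.
  by move=> x; apply: le_Ex; [exact: bmf_walk | exact: bmf_walk | move=> U].
- rewrite -h2; try exact: bmf_Pr.
  by congr L; apply/funext => x; rewrite /Pr ExD //; exact: bmf_walk.
- rewrite -h3; try exact: bmf_Pr.
  by congr L; apply/funext => x; rewrite /Pr ExZ //; exact: bmf_walk.
- by rewrite -[RHS]h4; congr L; apply/funext => x; rewrite /Pr Ex_cst.
- apply: h5; try by move=> *; exact: bmf_Pr.
  + by move=> m x; apply: Ex_norm_le; [exact: bmf_walk | move=> U; exact: b1].
  + by move=> x; apply: Ex_norm_le; [exact: bmf_walk | move=> U; exact: b2].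
  + move=> x; apply: (Ex_dct (M := 1)); [by move=> m; case: (bmf_walk x (hf_ m)) | by move=> m U; exact: b1 |
      exact: bmf_walk | by move=> U; exact: hc].
Qed.

Lemma mean_functional_iter t : mean_functional (fun f => iter t Pr f 1%g).
Proof.
suff h L : mean_functional L -> mean_functional (fun f => L (iter t Pr f)).
  apply: (h (fun f => f 1%g)); split=> //.
elim: t L => [//|t IH] L hL.
rewrite (_ : (fun f => _) = (fun f => (fun f => L (Pr f)) (iter t Pr f))) //.
exact: (IH (fun f => L (Pr f)) (mean_functional_Pr hL)).
Qed.

Lemma mf_norm L f : mean_functional L -> bmf f -> `|L f| <= L (fun x => `|f x|).
Proof.
move=> hL hf; rewrite ler_norml; apply/andP; split.
  rewrite -mulN1r -(mf_scale hL) //; last exact: bmf_norm.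
  apply: (mf_le hL) => //; first by apply: bmfZ; exact: bmf_norm.
  by move=> x; rewrite mulN1r lerNl -normrN ler_norm.
by apply: (mf_le hL) => //; [exact: bmf_norm | move=> x; exact: ler_norm].
Qed.

(* Approximation of measurable sets by polynomial functions, simultaneously
   for two mean functionals. *)
Section Approximation.
Variables L1 L2 : (G -> R) -> R.
Hypotheses (h1 : mean_functional L1) (h2 : mean_functional L2).

Definition papprox (f : G -> R) := forall eta, 0 < eta -> exists p,
  [/\ polyfun p, forall X, 0 <= p X <= 1, L1 (fun X => `|f X - p X|) <= eta &
      L2 (fun X => `|f X - p X|) <= eta].

Lemma mf_triangle L f g h : mean_functional L -> bmf f -> bmf g -> bmf h ->
  L (fun X => `|f X - h X|) <= L (fun X => `|f X - g X|) + L (fun X => `|g X - h X|).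
Proof.
move=> hL hf hg hh; rewrite -(mf_add hL); try by apply: bmf_norm; exact: bmfB.
apply: (mf_le hL); first by apply: bmf_norm; exact: bmfB.
  by apply: bmfD; apply: bmf_norm; exact: bmfB.
by move=> x; apply: le_trans (ler_normD _ _); rewrite addrA subrK.
Qed.

Lemma mf_uniform L f g e : mean_functional L -> bmf f -> bmf g ->
  (forall X, `|f X - g X| <= e) -> L (fun X => `|f X - g X|) <= e.
Proof.
move=> hL hf hg h; rewrite -[leRHS](mf_cst hL); apply: (mf_le hL) => //.
  by apply: bmf_norm; exact: bmfB.
exact: bmf_cst.
Qed.

Lemma mf_lim_norm L (f_ : nat -> G -> R) f : mean_functional L -> (forall m, bmf (f_ m)) -> bmf f ->
  (forall m X, 0 <= f_ m X <= 1) -> (forall X, 0 <= f X <= 1) ->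
  (forall X, f_ m X @[m --> \oo] --> f X) -> L (fun X => `|f X - f_ m X|) @[m --> \oo] --> (0 : R).
Proof.
move=> hL hf_ hf b_ b hc; rewrite -(mf_cst hL 0).
apply: (mf_lim hL).
- by move=> m; apply: bmf_norm; exact: bmfB.
- exact: bmf_cst.
- move=> m X; rewrite normr_id ler_norml; have /andP[? ?] := b_ m X; have /andP[? ?] := b X.
  by apply/andP; split; lra.
- by move=> X; rewrite normr0.
- move=> X; rewrite -(normr0 R) -(subrr (f X)); apply: cvg_norm; apply: cvgB => //.
  exact: cvg_cst.
Qed.

Lemma papprox_lim (f_ : nat -> G -> R) f : (forall m, bmf (f_ m)) -> bmf f ->
  (forall m X, 0 <= f_ m X <= 1) -> (forall X, 0 <= f X <= 1) ->
  (forall X, f_ m X @[m --> \oo] --> f X) -> (forall m, papprox (f_ m)) -> papprox f.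
Proof.
move=> hf_ hf b_ b hc hp eta eta0.
have e2 : 0 < eta / 2 by rewrite divr_gt0.
have c1 := mf_lim_norm h1 hf_ hf b_ b hc; have c2 := mf_lim_norm h2 hf_ hf b_ b hc.
have [m [k1 k2]] : exists m, L1 (fun X => `|f X - f_ m X|) <= eta / 2 /\
    L2 (fun X => `|f X - f_ m X|) <= eta / 2.
  have n1 : \forall m \near \oo, L1 (fun X => `|f X - f_ m X|) < eta / 2.
    by apply: (cvgr_lt (0 : R)).
  have n2 : \forall m \near \oo, L2 (fun X => `|f X - f_ m X|) < eta / 2.
    by apply: (cvgr_lt (0 : R)).
  near \oo => m; exists m; split; apply: ltW; near: m; [exact: n1 | exact: n2].
have [p [pp p01 p1 p2]] := hp m _ e2; exists p; split=> //.
  apply: le_trans (mf_triangle h1 hf (hf_ m) (polyfun_bmf pp)) _.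
  by rewrite [leRHS]splitr lerD.
apply: le_trans (mf_triangle h2 hf (hf_ m) (polyfun_bmf pp)) _.
by rewrite [leRHS]splitr lerD.
Unshelve. all: by end_near. Qed.

Lemma papproxC (B : set G) : measurable B -> papprox \1_B -> papprox \1_(~` B).
Proof.
move=> mB hB eta eta0; have [p [pp p01 p1 p2]] := hB _ eta0.
have e : (fun X => `|\1_(~` B) X - (1 + -1 * p X)|) = (fun X => `|\1_B X - p X|).
  apply/funext => X; rewrite -normrN; congr `|_|; rewrite !indicE in_setC.
  by case: (X \in B) => /=; ring.
exists (fun X => 1 + -1 * p X); split; rewrite ?e //.
  by apply: polyfun_add; [exact: polyfun_cst | apply: polyfun_mul => //; exact: polyfun_cst].
by move=> X; have := p01 X => /andP[? ?]; apply/andP; split; lra.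
Qed.

Lemma papproxI (B C : set G) : measurable B -> measurable C ->
  papprox \1_B -> papprox \1_C -> papprox \1_(B `&` C).
Proof.
move=> mB mC hB hC eta eta0; have e2 : 0 < eta / 2 by rewrite divr_gt0.
have [p [pp p01 p1 p2]] := hB _ e2; have [q [qq q01 q1 q2]] := hC _ e2.
have key L : mean_functional L -> L (fun X => `|\1_B X - p X|) <= eta / 2 ->
    L (fun X => `|\1_C X - q X|) <= eta / 2 -> L (fun X => `|\1_(B `&` C) X - p X * q X|) <= eta.
  move=> hL k1 k2; rewrite [leRHS]splitr; apply: le_trans (lerD k1 k2).
  have bB := bmf_indic mB; have bC := bmf_indic mC.
  have bp := polyfun_bmf pp; have bq := polyfun_bmf qq.
  have bBC := bmf_indic (measurableI _ _ mB mC).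
  rewrite -(mf_add hL); try by apply: bmf_norm; exact: bmfB.
  apply: (mf_le hL); first by apply: bmf_norm; apply: bmfB => //; exact: bmfM.
    by apply: bmfD; apply: bmf_norm; exact: bmfB.
  move=> X; have /andP[a1 a2] := p01 X; have /andP[b1 b2] := q01 X.
  rewrite !indicE in_setI; case: (X \in B); case: (X \in C) => /=;
    rewrite ?(ger0_norm (_ : 0 <= 1%:R - p X)) ?(ger0_norm (_ : 0 <= 1%:R - q X)) ?subr_ge0 //
      ?sub0r ?normrN ?(ger0_norm (mulr_ge0 a1 b1)) ?(ger0_norm a1) ?(ger0_norm b1).
  - by rewrite ger0_norm; nra.
  - nra.
  - nra.
  - nra.
exists (fun X => p X * q X); split; [exact: polyfun_mul | | exact: key | exact: key].
move=> X; have /andP[a1 a2] := p01 X; have /andP[b1 b2] := q01 X.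
by rewrite mulr_ge0 //= mulr_ile1.
Qed.

Lemma papprox_bigcup (B : nat -> set G) : (forall k, measurable (B k)) ->
  (forall k, papprox \1_(B k)) -> papprox \1_(\bigcup_k B k).
Proof.
move=> mB hB; pose U m := \big[setU/set0]_(k < m) B k.
have mU m : measurable (U m) by exact: bigsetU_measurable.
have m0 : papprox \1_(set0 : set G).
  move=> eta eta0; exists (fun=> 0); split=> [|X||]; rewrite ?lexx ?ler01 //; first exact: polyfun_cst.
    by rewrite -(mf_cst h1 eta); apply: (mf_le h1); [| exact: bmf_cst | ];
      [by apply: bmf_norm; apply: bmfB; [exact: bmf_indic | exact: bmf_cst]|
       by move=> X; rewrite indicE in_set0 subrr normr0 ltW].
  by rewrite -(mf_cst h2 eta); apply: (mf_le h2); [| exact: bmf_cst | ];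
      [by apply: bmf_norm; apply: bmfB; [exact: bmf_indic | exact: bmf_cst]|
       by move=> X; rewrite indicE in_set0 subrr normr0 ltW].
have hU m : papprox \1_(U m).
  elim: m => [|m IH]; first by rewrite /U big_ord0.
  rewrite /U big_ord_recr /= -/(U m) -[_ `|` _]setCK setCU.
  apply: papproxC; first by apply: measurableI; exact: measurableC.
  by apply: papproxI; try exact: measurableC; apply: papproxC.
have b01 (A : set G) X : 0 <= (\1_A X : R) <= 1 by rewrite indicE; case: (_ \in _); rewrite /= ?lexx ler01.
apply: (@papprox_lim (fun m => \1_(U m))) => //.
- by move=> m; exact: bmf_indic.
- by apply: bmf_indic; exact: bigcup_measurable.
move=> X; rewrite !indicE; case: (boolP (X \in \bigcup_k B k)); rewrite ?inE ?notin_setE.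
  move=> /set_mem [k _ Bk]; apply: cvg_near_cst; near=> m.
  rewrite indicE; suff -> : X \in U m by [].
  by apply/mem_set; rewrite /U -bigcup_mkord; exists k => //=; near: m; exact: nbhs_infty_gt.
move=> hX; apply: cvg_near_cst; apply: nearW => m; rewrite indicE.
suff -> : (X \in U m) = false by [].
apply/negbTE; rewrite notin_setE /U -bigcup_mkord => -[k _ Bk]; apply: hX.
by exists k.
Unshelve. all: by end_near. Qed.

(** The indicator is the limit of the ramps [g m]. These are Lipschitz, hence approximated uniformly
    by Bernstein polynomials of the entry after rescaling [-1, 1] to [0, 1]. *)
Lemma papprox_half i j (s a : R) : (s = 1 \/ s = -1) ->
  papprox \1_[set X : G | a < s * so_mx X i j].
Proof.
move=> hs; pose x (X : G) := s * so_mx X i j.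
have px : polyfun x by apply: polyfun_mul; [exact: polyfun_cst | exact: polyfun_entry].
have x1 X : `|x X| <= 1.
  by rewrite normrM; case: hs => ->; rewrite ?normrN ?normr1 mul1r entry_le1.
pose g (m : nat) (y : R) := Num.min 1 (m%:R * Num.max 0 (y - a)).
have lip m y z : `|g m y - g m z| <= m%:R * `|y - z|.
  have m0 : 0 <= m%:R :> R by [].
  have k1 : `|Num.max 0 (y - a) - Num.max 0 (z - a)| <= `|y - z|.
    rewrite ler_norml; set n := `|_|; have : `|y - z| <= n by [].
    rewrite ler_norml => /andP[? ?].
    by case: (leP 0 (y - a)); case: (leP 0 (z - a)) => ? ?; apply/andP; split; lra.
  have : `|m%:R * Num.max 0 (y - a) - m%:R * Num.max 0 (z - a)| <= m%:R * `|y - z|.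
    by rewrite -mulrBr normrM (ger0_norm m0) ler_wpM2l.
  rewrite /g; set u := m%:R * _; set v := m%:R * _; rewrite !ler_norml => /andP[? ?].
  have ? : 0 <= m%:R * `|y - z| by rewrite mulr_ge0.
  by case: (leP 1 u); case: (leP 1 v) => ? ?; apply/andP; split; lra.
have g01 m y : 0 <= g m y <= 1.
  rewrite /g le_min ler01 ge_min lexx andbT mulr_ge0 // le_max lexx //.
have gb m : bmf (fun X => g m (x X)).
  split; last by exists 1 => X; have /andP[? ?] := g01 m (x X); rewrite ger0_norm.
  have mx : measurable_fun setT x by case: (polyfun_bmf px).
  apply: measurable_minr; first exact: measurable_cst.
  apply: measurable_funM; first exact: measurable_cst.
  apply: measurable_maxr; first exact: measurable_cst.
  by apply: measurable_funB => //; exact: measurable_cst.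
have mH : measurable [set X : G | a < x X].
  have mx : measurable_fun setT x by case: (polyfun_bmf px).
  have := mx measurableT `]a, +oo[%classic (measurable_itv _); rewrite setTI; congr measurable.
  by apply/seteqP; split => X /=; rewrite in_itv /= andbT.
have b01 (A : set G) X : 0 <= (\1_A X : R) <= 1 by rewrite indicE; case: (_ \in _); rewrite /= ?lexx ler01.
apply: (@papprox_lim (fun m X => g m (x X))) => //; first exact: bmf_indic.
  move=> X; rewrite indicE; case: (boolP (X \in _)); rewrite ?inE ?notin_setE /=.
    move=> /set_mem /= ax; apply: cvg_near_cst; near=> m.
    have ax' : 0 < x X - a by rewrite subr_gt0.
    suff : 1 <= m%:R * Num.max 0 (x X - a) by move=> ?; rewrite /g min_l.
    rewrite (max_r (ltW ax')) -ler_pdivrMr // div1r.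
    by near: m; exact: nbhs_infty_ger.
  move=> /negP; rewrite -leNgt => xa; apply: cvg_near_cst; apply: nearW => m.
  by rewrite /g max_l ?subr_le0 // mulr0 min_r.
move=> m eta eta0.
have lip2 y z : `|g m (2 * y - 1) - g m (2 * z - 1)| <= m%:R * 2 * `|y - z|.
  apply: le_trans (lip m _ _) _.
  rewrite -mulrA ler_wpM2l // (_ : 2 * y - 1 - (2 * z - 1) = 2 * (y - z)); last by ring.
  by rewrite normrM ger0_norm.
have [k hk] := bern_approx eta0 (mulr_ge0 (ler0n _ _) (ler0n _ _)) lip2.
exists (fun X => bern k (fun l => g m (2 * (l%:R / k%:R) - 1)) (2^-1 * (1 + x X))).
have y01 X : 0 <= 2^-1 * (1 + x X) <= 1.
  by have := x1 X; rewrite ler_norml => /andP[? ?]; apply/andP; split; lra.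
have pb : polyfun (fun X => bern k (fun l => g m (2 * (l%:R / k%:R) - 1)) (2^-1 * (1 + x X))).
  apply: polyfun_bern; apply: polyfun_mul; first exact: polyfun_cst.
  by apply: polyfun_add => //; exact: polyfun_cst.
have un X : `|g m (x X) - bern k (fun l => g m (2 * (l%:R / k%:R) - 1)) (2^-1 * (1 + x X))| <= eta.
  have := hk _ (y01 X); congr (`|g m _ - _| <= _); by field.
split=> //.
- move=> X; pose phi l := g m (2 * (l%:R / k%:R) - 1).
  have := @bern_le _ k (fun=> 0) phi _ (y01 X) (fun l => (andP (g01 m _)).1).
  have := @bern_le _ k phi (fun=> 1) _ (y01 X) (fun l => (andP (g01 m _)).2).
  by rewrite !bern_cst => -> ->.
- by apply: mf_uniform h1 (gb m) (polyfun_bmf pb) un.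
- by apply: mf_uniform h2 (gb m) (polyfun_bmf pb) un.
Unshelve. all: by end_near. Qed.

(** The measurable sets that can be approximated form a sigma-algebra. It contains the half-spaces,
    so the rational boxes, so the open sets. *)
Lemma papprox_measurable (B : set G) : measurable B -> papprox \1_B.
Proof.
pose H : set (set G) := [set A | measurable A /\ papprox \1_A].
have HC A : H A -> H (~` A) by move=> [mA pA]; split; [exact: measurableC | exact: papproxC].
have HI A A' : H A -> H A' -> H (A `&` A').
  by move=> [mA pA] [mA' pA']; split; [exact: measurableI | exact: papproxI].
have HU (A : nat -> set G) : (forall k, H (A k)) -> H (\bigcup_k A k).
  move=> hA; split; first by apply: bigcup_measurable => k _; case: (hA k).
  by apply: papprox_bigcup => k; case: (hA k).
have Hh i j s a : (s = 1 \/ s = -1) -> H [set X : G | a < s * so_mx X i j].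
  move=> hs; split; last exact: papprox_half.
  have mx : measurable_fun setT (fun X : G => s * so_mx X i j) by case: (bmfZ s (bmf_entry i j)).
  have := mx measurableT `]a, +oo[%classic (measurable_itv _); rewrite setTI; congr measurable.
  by apply/seteqP; split => X /=; rewrite in_itv /= andbT.
have HT : H setT.
  have := Hh (Ordinal (ltnW hN)) (Ordinal (ltnW hN)) 1 (-2) (or_introl (erefl _)).
  congr H; apply/seteqP; split => // X _ /=.
  have := entry_le1 X (Ordinal (ltnW hN)) (Ordinal (ltnW hN)); rewrite ler_norml => /andP[? ?].
  by rewrite mul1r; lra.
have H0 : H set0 by rewrite -setCT; apply: HC.
have HIs (I : eqType) (r : seq I) (A : I -> set G) : (forall i, H (A i)) ->
    H [set X | forall i, i \in r -> A i X].
  move=> hA; elim: r => [|i r IH].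
    by congr H: HT; apply/seteqP; split.
  congr H: (HI _ _ (hA i) IH); apply/seteqP; split => X /=.
    by move=> [a1 a2] k; rewrite inE => /orP[/eqP ->|/a2].
  by move=> hX; split; [apply: hX; rewrite mem_head | move=> k kr; apply: hX; rewrite inE kr orbT].
have Hbox (f : 'I_N * 'I_N -> R) e : H [set X : G | forall i j, `|so_mx X i j - f (i, j)| < e].
  have := HIs _ (index_enum ('I_N * 'I_N)%type) (fun ij => [set X : G | `|so_mx X ij.1 ij.2 - f ij| < e]).
  move=> /(_ _)/[dup] _ HH; have {HH} := HH (fun ij => _).
  have : forall ij, H [set X : G | `|so_mx X ij.1 ij.2 - f ij| < e].
    move=> ij; have := HI _ _ (Hh ij.1 ij.2 1 (f ij - e) (or_introl (erefl _)))
      (Hh ij.1 ij.2 (-1) (- (f ij + e)) (or_intror (erefl _))).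
    congr H; apply/seteqP; split => X /=; rewrite ltr_norml mul1r mulN1r.
      by move=> [? ?]; apply/andP; split; lra.
    by move=> /andP[? ?]; split; lra.
  move=> h /(_ h); congr H; apply/seteqP; split => X /= hX.
    by move=> i j; apply: (hX (i, j)); rewrite mem_index_enum.
  by move=> [i j] _; exact: hX.
have sH : sigma_algebra setT H.
  by split=> // A hA; rewrite setTD; exact: HC.
suff sub : measurable `<=` H by move=> /sub [].
apply: smallest_sub => // O oO; rewrite (open_SO_boxes oO).
pose bx (q : {ffun 'I_N * 'I_N -> rat} * nat) : set G :=
  [set X : G | forall i j, `|so_mx X i j - ratr (q.1 (i, j))| < q.2.+1%:R^-1].
pose c k : set G := if unpickle k is Some q then (if `[< bx q `<=` O >] then bx q else set0) else set0.
suff -> : \bigcup_(q in [set q | bx q `<=` O]) bx q = \bigcup_k c k.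
  apply: HU => k; rewrite /c; case: (unpickle k) => [q|] //; case: asboolP => _ //.
  exact: (Hbox (fun p => ratr (q.1 p))).
apply/seteqP; split => X.
  by move=> [q qO hq]; exists (pickle q) => //; rewrite /c pickleK; case: asboolP.
move=> [k _]; rewrite /c; case: (unpickle k) => [q|] //; case: asboolP => // qO hq.
by exists q.
Qed.

End Approximation.

End Walk.

(** * The L2 bound *)

Section QuadraticForms.
Context {R : realType}.

Lemma psd_cauchy d (Q : 'M[R]_d) (u w : 'rV[R]_d) : Q^T = Q ->
  (forall v : 'rV[R]_d, v != 0 -> 0 < (v *m Q *m v^T) 0 0) ->
  (u *m Q *m w^T) 0 0 ^+ 2 <= (u *m Q *m u^T) 0 0 * (w *m Q *m w^T) 0 0.
Proof.
move=> Qs Qp; have [->|w0] := eqVneq w 0.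
  by rewrite trmx0 !mulmx0 !mxE expr0n mulr0.
have cp := Qp w w0; set c := (w *m Q *m w^T) 0 0 in cp *.
set a := (u *m Q *m u^T) 0 0; set b := (u *m Q *m w^T) 0 0.
have Qge (v : 'rV[R]_d) : 0 <= (v *m Q *m v^T) 0 0.
  by case: (eqVneq v 0) => [->|/Qp h]; [rewrite !mul0mx mxE | rewrite le_eqVlt h orbT].
have bs : (w *m Q *m u^T) 0 0 = b.
  have e : (u *m Q *m w^T)^T = w *m Q *m u^T by rewrite !trmx_mul trmxK Qs mulmxA.
  by rewrite -e mxE.
have := Qge (u - (b / c) *: w).
have -> : ((u - (b / c) *: w) *m Q *m (u - (b / c) *: w)^T) 0 0 =
    a - (b / c) * b - ((b / c) * b - (b / c) * ((b / c) * c)).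
  have -> : (u - (b / c) *: w)^T = u^T - (b / c) *: w^T by rewrite linearB linearZ.
  rewrite !(mulmxBl, mulmxBr) -!scalemxAl -!scalemxAr.
  have sB (p q : 'M[R]_1) : (p - q) 0 0 = p 0 0 - q 0 0 by rewrite !mxE.
  have sZ k (p : 'M[R]_1) : (k *: p) 0 0 = k * p 0 0 by rewrite mxE.
  by rewrite !(sB, sZ) bs.
have -> : a - b / c * b - (b / c * b - b / c * (b / c * c)) = a - b ^+ 2 / c.
  by field; rewrite lt0r_neq0.
by rewrite subr_ge0 ler_pdivrMr.
Qed.

End QuadraticForms.

Section L2Bound.
Context {R : realType} {N : nat}.
Local Notation G := (SO R N).
Variables (hN : (1 < N)%N) (nu : probability G R) (theta : R).
Hypothesis nuH : is_haar nu.
Local Notation rt := (rot12 hN theta).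
Local Notation E := (Ex nu).
Local Notation Pr := (walk_op hN nu theta).

Lemma Pr_translate t (f : G -> R) (g x : G) :
  iter t Pr (fun y : G => f (y * g^-1)%g) x = iter t Pr f (x * g^-1)%g.
Proof.
elim: t x => [//|t IH] x; rewrite /= /walk_op; congr Ex; apply/funext => U.
by rewrite IH mulgA.
Qed.

Lemma bmf_left (g : G) (f : G -> R) : bmf f -> bmf (fun x : G => f (g * x)%g).
Proof.
move=> hf; have [] := @bmf_comp _ _ _ _ _ f (fun x : G => (g * x)%g) hf => //.
by apply: measurable_soM; [exact: measurable_cst | exact: measurable_id].
Qed.

Lemma bmf_right (g : G) (f : G -> R) : bmf f -> bmf (fun x : G => f (x * g)%g).
Proof.
move=> hf; have [] := @bmf_comp _ _ _ _ _ f (fun x : G => (x * g)%g) hf => //.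
by apply: measurable_soM; [exact: measurable_id | exact: measurable_cst].
Qed.

Hypothesis rtV : exists W : G, (rt^-1 = W * rt * W^-1)%g.

Lemma Pr_inv (f : G -> R) X : bmf f -> Pr f X = E (fun U : G => f (U * rt^-1 * U^-1 * X)%g).
Proof.
move=> hf; have [W hW] := rtV; rewrite hW.
have hb := bmf_walk hN theta X hf.
rewrite /walk_op -(Ex_right nuH W hb); congr Ex; apply/funext => U.
by congr f; rewrite invgM !mulgA.
Qed.

(** Reversibility: the inverse of a step has the law of a step, because the inverse rotation is
    conjugate to the rotation. *)
Lemma Pr_sym (f h : G -> R) : bmf f -> bmf h ->
  E (fun x => f x * Pr h x) = E (fun x => Pr f x * h x).
Proof.
move=> hf hh.
have m1 : measurable_fun setT (fun z : G * G => (z.2 * rt * z.2^-1 * z.1)%g).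
  apply: measurable_soM; last exact: measurable_fst.
  apply: measurable_soM; last by apply: measurable_soV; exact: measurable_snd.
  by apply: measurable_soM; [exact: measurable_snd | exact: measurable_cst].
have m2 : measurable_fun setT (fun z : G * G => (z.2 * rt^-1 * z.2^-1 * z.1)%g).
  apply: measurable_soM; last exact: measurable_fst.
  apply: measurable_soM; last by apply: measurable_soV; exact: measurable_snd.
  by apply: measurable_soM; [exact: measurable_snd | exact: measurable_cst].
have b1 : bmf (fun z : G * G => f z.1 * h (z.2 * rt * z.2^-1 * z.1)%g).
  apply: bmfM; first by have [] := bmf_comp hf (measurable_fst (T1 := G) (T2 := G)).
  by have [] := bmf_comp hh m1.
have b2 : bmf (fun z : G * G => f (z.2 * rt^-1 * z.2^-1 * z.1)%g * h z.1).
  apply: bmfM; first by have [] := bmf_comp hf m2.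
  by have [] := bmf_comp hh (measurable_fst (T1 := G) (T2 := G)).
have hi x : bmf (fun U : G => f (U * rt^-1 * U^-1 * x)%g).
  have [W hW] := rtV; rewrite hW.
  have := bmf_right W (bmf_walk hN theta x hf); congr bmf.
  by apply/funext => U; congr f; rewrite invgM !mulgA.
transitivity (E (fun x => E (fun U : G => f x * h (U * rt * U^-1 * x)%g))).
  by congr Ex; apply/funext => x; rewrite ExZ //; exact: bmf_walk.
rewrite (Ex_exchange (F := fun x U : G => f x * h (U * rt * U^-1 * x)%g) nu nu b1).
transitivity (E (fun U : G => E (fun x : G => f (U * rt^-1 * U^-1 * x)%g * h x))).
  congr Ex; apply/funext => U.
  have bU : bmf (fun x : G => f x * h (U * rt * U^-1 * x)%g).
    exact: (bmf_slice2 (F := fun x U : G => f x * h (U * rt * U^-1 * x)%g) b1 U).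
  rewrite -(Ex_left nuH (U * rt^-1 * U^-1)%g bU); congr Ex; apply/funext => x.
  by congr (_ * h _); rewrite !mulgA mulgKV mulgK mulgV mul1g.
rewrite -(Ex_exchange (F := fun x U : G => f (U * rt^-1 * U^-1 * x)%g * h x) nu nu b2).
congr Ex; apply/funext => x.
rewrite Pr_inv //; under eq_fun do rewrite mulrC.
by rewrite ExZ // mulrC.
Qed.

(** For every [g], the value at 1 is the value at [g] of the iterate of a right translate of [f]: a
    pairing of the coefficients [c g] with the numbers [r i ^ t * e i g]. Cauchy-Schwarz for the
    Gram form of the [e i] bounds its square by the mean of [f ^ 2] times a quadratic form in these
    numbers. Averaged over [g], that form becomes the trace of the squared iterate on the span. *)
Theorem l2_bound t d (e : 'I_d -> G -> R) (r : 'I_d -> R) (f : G -> R) (c : G -> 'I_d -> R) (B : R) :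
  (forall i, bmf (e i)) -> (forall i x, Pr (e i) x = r i * e i x) -> bmf f ->
  (forall g x : G, f (x * g^-1)%g = \sum_i c g i * e i x) -> (forall g i, `|c g i| <= B) ->
  iter t Pr f 1%g ^+ 2 <= (\sum_i r i ^+ t.*2) * E (fun x => f x ^+ 2).
Proof.
move=> be ee bf fc cB.
pose Ga : 'M[R]_d := \matrix_(i, j) E (fun x => e i x * e j x).
pose A : 'M[R]_d := diag_mx (\row_i r i ^+ t).
have bee i j : bmf (fun x => e i x * e j x) by exact: bmfM.
(* By reversibility the Gram entries between different eigenvalues vanish, so [A] commutes with
   [Ga]. *)
have rsym i j : r i * Ga i j = r j * Ga i j.
  rewrite mxE -!ExZ //; transitivity (E (fun x => Pr (e i) x * e j x)).
    by congr Ex; apply/funext => x; rewrite ee mulrA.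
  rewrite -Pr_sym //; congr Ex; apply/funext => x; rewrite ee; ring.
have rsymt i j : r i ^+ t * Ga i j = r j ^+ t * Ga i j.
  have [g0|g0] := eqVneq (Ga i j) 0; first by rewrite g0 !mulr0.
  by rewrite (mulIf g0 (rsym i j)).
have AG : A *m Ga = Ga *m A.
  by apply/matrixP => i j; rewrite mul_diag_mx mul_mx_diag ![in LHS]mxE ![in RHS]mxE -/(Ga i j);
    have := rsymt i j; rewrite !mxE => ->; rewrite mulrC.
have Gs : Ga^T = Ga by apply/matrixP => i j; rewrite !mxE; congr Ex; apply/funext => x; rewrite mulrC.
have Gq (u v : 'rV[R]_d) : (u *m Ga *m v^T) 0 0 = E (fun x => (\sum_i u 0 i * e i x) * (\sum_j v 0 j * e j x)).
  have -> : (fun x => (\sum_i u 0 i * e i x) * (\sum_j v 0 j * e j x)) =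
     (fun x => \sum_j \sum_i u 0 i * v 0 j * (e i x * e j x)).
    apply/funext => x; rewrite mulr_sumr; apply: eq_bigr => j _.
    by rewrite mulr_suml; apply: eq_bigr => i _; ring.
  rewrite Ex_sum; last by move=> j; apply: bmf_sum => i; exact: bmfZ.
  rewrite mxE; apply: eq_bigr => j _; rewrite Ex_sum; last by move=> i; exact: bmfZ.
  rewrite mxE mulr_suml; apply: eq_bigr => i _; rewrite ExZ // !mxE; ring.
set S := \sum_i r i ^+ t.*2; set V := iter t Pr f 1%g; set F2 := E _.
have S0 : 0 <= S by apply: sumr_ge0 => i _; rewrite -muln2 exprM sqr_ge0.
(* The [e i] may be dependent and [Ga] singular, so [eta] times the identity is added; the bound [B]
   on the coefficients makes its cost vanish with [eta]. *)
suff key eta : 0 < eta -> V ^+ 2 <= S * (F2 + eta * (d%:R * B ^+ 2)).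
  apply/ler_addgt0Pr => z z0; have zc : 0 < z / (S * (d%:R * B ^+ 2) + 1).
    by rewrite divr_gt0 // ltr_wpDl // mulr_ge0 // mulr_ge0 // sqr_ge0.
  apply: le_trans (key _ zc) _; rewrite mulrDr lerD2l mulrCA -ler_pdivlMl //.
  set k := S * _; have k0 : 0 <= k by rewrite mulr_ge0 // mulr_ge0 // sqr_ge0.
  have -> : (z / (k + 1))^-1 * z = k + 1 by field; rewrite !lt0r_neq0 // ltr_wpDl.
  by rewrite lerDl.
move=> eta0; pose Q := Ga + eta%:M.
have Qs : Q^T = Q by rewrite /Q linearD /= Gs tr_scalar_mx.
have Qq (u v : 'rV[R]_d) : (u *m Q *m v^T) 0 0 = (u *m Ga *m v^T) 0 0 + eta * \sum_i u 0 i * v 0 i.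
  rewrite /Q mulmxDr mulmxDl [LHS]mxE; congr (_ + _).
  rewrite mul_mx_scalar -scalemxAl [LHS]mxE; congr (_ * _); rewrite mxE.
  by apply: eq_bigr => i _; rewrite mxE.
have Gp (v : 'rV[R]_d) : 0 <= (v *m Ga *m v^T) 0 0.
  by rewrite Gq; apply: Ex_ge0 => x; rewrite -expr2 sqr_ge0.
have Qp (v : 'rV[R]_d) : v != 0 -> 0 < (v *m Q *m v^T) 0 0.
  move=> v0; rewrite Qq ltr_wpDl // mulr_gt0 // lt_neqAle sumr_ge0 ?andbT => [|i _]; last by rewrite -expr2 sqr_ge0.
  apply: contra v0; rewrite eq_sym psumr_eq0 => [/allP h|i _]; last by rewrite -expr2 sqr_ge0.
  apply/eqP/rowP => i; rewrite [RHS]mxE; have := h i (mem_index_enum _).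
  by rewrite /= mulf_eq0 orbb => /eqP.
have Qu : Q \in unitmx.
  rewrite -row_free_unit -kermx_eq0; apply/rowV0P => v /sub_kermxP vQ; apply/eqP/negPn/negP => v0.
  by have := Qp v v0; rewrite vQ mul0mx mxE ltxx.
pose M := invmx Q.
have Ms : M^T = M by rewrite /M trmx_inv Qs.
have AQ : A *m Q = Q *m A by rewrite /Q mulmxDr mulmxDl AG scalar_mxC.
have AM : A *m M = M *m A.
  by rewrite -[LHS]mul1mx -(mulVmx Qu) -!mulmxA (mulmxA Q A) -AQ -(mulmxA A) mulmxV // mulmx1.
have Mii i : 0 <= M i i.
  pose v : 'rV[R]_d := row i M.
  have : 0 <= (v *m Q *m v^T) 0 0.
    by have [->|/Qp/ltW //] := eqVneq v 0; rewrite mul0mx mul0mx mxE.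
  rewrite /v -row_mul mulVmx // tr_row Ms.
  by rewrite -row_mul mul1mx !mxE.
pose y (g : G) : 'rV[R]_d := \row_i (r i ^+ t * e i g).
have itE i x : iter t Pr (e i) x = r i ^+ t * e i x.
  elim: t {A rsymt AG S V S0 AQ AM y} x => [|t IH] x /=; first by rewrite expr0 mul1r.
  rewrite (_ : iter t Pr (e i) = (fun x => r i ^+ t * e i x)); last by apply/funext.
  rewrite /walk_op ExZ; last exact: bmf_walk.
  by rewrite -[X in _ * X]/(Pr (e i) x) ee exprSr mulrA.
have VE g : V = \sum_i c g i * y g 0 i.
  rewrite /V -[in LHS](mulgV g) -Pr_translate.
  rewrite (_ : (fun y0 : G => f (y0 * g^-1)%g) = (fun x => \sum_i c g i * e i x)); last exact/funext.
  have L x : iter t Pr (fun x => \sum_i c g i * e i x) x = \sum_i c g i * iter t Pr (e i) x.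
    elim: t {A rsymt AG S V S0 AQ AM y itE} x => [//|t IH] x /=.
    rewrite (_ : iter t Pr _ = (fun x => \sum_i c g i * iter t Pr (e i) x)); last exact/funext.
    rewrite /walk_op Ex_sum; last by move=> i; apply: bmfZ; apply: bmf_walk; exact: bmf_iter.
    by apply: eq_bigr => i _; rewrite ExZ //; apply: bmf_walk; exact: bmf_iter.
  by rewrite L; apply: eq_bigr => i _; rewrite itE mxE.
have CS g : V ^+ 2 <= (F2 + eta * (d%:R * B ^+ 2)) * (y g *m M *m (y g)^T) 0 0.
  pose u : 'rV[R]_d := \row_i c g i.
  have e1 : V = (u *m Q *m (y g *m M)^T) 0 0.
    rewrite trmx_mul Ms -mulmxA (mulmxA Q) mulmxV // mul1mx (VE g) mxE.
    by apply: eq_bigr => i _; rewrite ![in RHS]mxE ![in LHS]mxE.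
  have e2 : (y g *m M *m Q *m (y g *m M)^T) 0 0 = (y g *m M *m (y g)^T) 0 0.
    by rewrite -(mulmxA (y g)) mulVmx // mulmx1 trmx_mul Ms mulmxA.
  have := psd_cauchy u (y g *m M) Qs Qp; rewrite -e1 e2 => h; apply: le_trans h _.
  have k1 : (u *m Q *m u^T) 0 0 <= F2 + eta * (d%:R * B ^+ 2).
    rewrite Qq lerD //.
      rewrite Gq /F2 -(Ex_right nuH (g^-1)%g (bmfX 2 bf)).
      by rewrite le_eqVlt; apply/orP; left; apply/eqP; congr Ex; apply/funext => x;
        rewrite fc expr2; congr (_ * _); apply: eq_bigr => i _; rewrite mxE.
    rewrite ler_pM2l //; have -> : d%:R * B ^+ 2 = \sum_(i < d) B ^+ 2.
      by rewrite sumr_const card_ord mulr_natl.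
    apply: ler_sum => i _; rewrite mxE -expr2 -real_normK ?num_real //.
    by rewrite lerXn2r ?nnegrE // (le_trans _ (cB g i)).
  apply: ler_wpM2r k1; rewrite -e2.
  by have [->|/Qp/ltW //] := eqVneq (y g *m M) 0; rewrite mul0mx mul0mx mxE.
have by2 : bmf (fun g => (y g *m M *m (y g)^T) 0 0).
  rewrite (_ : (fun g => _) = (fun g => \sum_j \sum_i M i j * (r i ^+ t * r j ^+ t) * (e i g * e j g))).
    by apply: bmf_sum => j; apply: bmf_sum => i; exact: bmfZ.
  apply/funext => g; rewrite mxE; apply: eq_bigr => j _; rewrite mxE mulr_suml.
  by apply: eq_bigr => i _; rewrite !mxE; ring.
(* As [A] commutes with [M], the mean is the trace of [A ^ 2 (1 - eta M)], and the diagonal of [M]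
   is nonnegative. *)
have Ey : E (fun g => (y g *m M *m (y g)^T) 0 0) <= S.
  have -> : E (fun g => (y g *m M *m (y g)^T) 0 0) = \tr (A *m M *m A *m Ga).
    transitivity (\sum_j \sum_i M i j * (r i ^+ t * r j ^+ t) * Ga i j).
      rewrite (_ : (fun g => _) = (fun g => \sum_j \sum_i M i j * (r i ^+ t * r j ^+ t) * (e i g * e j g))).
        rewrite Ex_sum; last by move=> j; apply: bmf_sum => i; exact: bmfZ.
        apply: eq_bigr => j _; rewrite Ex_sum; last by move=> i; exact: bmfZ.
        by apply: eq_bigr => i _; rewrite ExZ // mxE.
      apply/funext => g; rewrite mxE; apply: eq_bigr => j _; rewrite mxE mulr_suml.
      by apply: eq_bigr => i _; rewrite !mxE; ring.
    rewrite exchange_big /= /mxtrace; apply: eq_bigr => i _; rewrite mxE; apply: eq_bigr => j _.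
    have -> : Ga j i = Ga i j by rewrite -{1}Gs mxE.
    have -> : (A *m M *m A) i j = r i ^+ t * M i j * r j ^+ t.
      by rewrite /A mul_mx_diag mxE mul_diag_mx mxE [X in X * _ * _]mxE [X in _ * X]mxE.
    by ring.
  have -> : A *m M *m A *m Ga = A *m (A *m (M *m Ga)).
    by rewrite -(mulmxA A M A) -AM !mulmxA.
  have -> : M *m Ga = 1%:M - eta *: M.
    have -> : Ga = Q - eta%:M by rewrite /Q addrK.
    by rewrite mulmxBr mulVmx // mul_mx_scalar.
  rewrite mulmxA /A mulmx_diag /mxtrace /S; apply: ler_sum => i _.
  rewrite mul_diag_mx !mxE eqxx /= -exprMn -expr2 -exprM mulnC muln2 -/M -[X in _ <= X]mulr1.
  rewrite ler_wpM2l //; first by rewrite -muln2 exprM sqr_ge0.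
  by rewrite gerBl mulr_ge0 // ?Mii // ltW.
have K0 : 0 <= F2 + eta * (d%:R * B ^+ 2).
  rewrite addr_ge0 //; first by apply: Ex_ge0 => x; exact: sqr_ge0.
  by apply: mulr_ge0; [exact: ltW | apply: mulr_ge0 => //; exact: sqr_ge0].
have h := le_Ex nu (bmf_cst _ (V ^+ 2)) (bmfZ (F2 + eta * (d%:R * B ^+ 2)) by2) CS.
rewrite Ex_cst ExZ // in h; apply: le_trans h _.
by rewrite mulrC ler_wpM2r.
Qed.

End L2Bound.

(** * Total variation distance *)

Section TotalVariation.
Context {R : realType} {N : nat}.
Local Notation G := (SO R N).
Variables (hN : (1 < N)%N) (nu : probability G R) (theta : R).
Hypothesis nuH : is_haar nu.
Local Notation E := (Ex nu).
Local Notation Pr := (walk_op hN nu theta).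

Lemma nuE (B : set G) : measurable B -> nu B = (E \1_B)%:E.
Proof.
by move=> mB; rewrite ExE ?integral_indic ?setIT //; exact: bmf_indic.
Qed.

(** One polynomial with values in [0, 1] approximates the indicator of the set under both laws; the
    mean of its square is at most 1. *)
Lemma tv_le t (K : R) : 0 <= K ->
  (forall p, polyfun p -> (iter t Pr p 1%g - E p) ^+ 2 <= K * E (fun x => p x ^+ 2)) ->
  (tv_dist (walk_law hN nu theta t) nu <= (Num.sqrt K)%:E)%E.
Proof.
move=> K0 hp; apply: ge_ereal_sup => _ [B mB <-].
rewrite walk_lawE // nuE // -EFinB lee_fin.
apply/ler_addgt0Pr => eta eta0.
have e2 : 0 < eta / 2 by rewrite divr_gt0.
have hL := mean_functional_iter hN nu theta t; have hE := mean_functional_Ex nu.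
have [p [pp p01 p1 p2]] := papprox_measurable hN hL hE mB e2.
have bp := polyfun_bmf pp; have bB := bmf_indic mB.
have l1 : iter t Pr \1_B 1%g <= iter t Pr p 1%g + eta / 2.
  rewrite -lerBlDl; apply: le_trans p1.
  have := mf_norm hL (bmfB bB bp); apply: le_trans.
  apply: le_trans (ler_norm _); rewrite (_ : (fun x => \1_B x - p x) = (fun x => \1_B x + -1 * p x)); last first.
    by apply/funext => x; rewrite mulN1r.
  by rewrite (mf_add hL) //; [rewrite (mf_scale hL) // mulN1r | exact: bmfZ].
have l2 : E p <= E \1_B + eta / 2.
  rewrite -lerBlDl; apply: le_trans p2.
  have := Ex_norm nu (bmfB bB bp); apply: le_trans.
  by rewrite ExB // distrC ler_norm.
have l3 : iter t Pr p 1%g - E p <= Num.sqrt K.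
  apply: le_trans (ler_norm _) _; rewrite -sqrtr_sqr ler_wsqrtr //.
  apply: le_trans (hp p pp) _; rewrite ler_piMr //.
  rewrite -[leRHS](Ex_cst nu 1); apply: le_Ex; [exact: bmfX | exact: bmf_cst |].
  by move=> x; have /andP[? ?] := p01 x; rewrite exprn_ile1.
by rewrite [X in _ + X]splitr; lra.
Qed.

Lemma tv_ge t (B : set G) : measurable B ->
  ((iter t Pr \1_B 1%g - E \1_B)%:E <= tv_dist (walk_law hN nu theta t) nu)%E.
Proof.
move=> mB; rewrite EFinB -nuE // -walk_lawE //.
by apply: ereal_sup_ubound; exists B.
Qed.

Lemma tv_le1 t : (tv_dist (walk_law hN nu theta t) nu <= 1)%E.
Proof.
apply: ge_ereal_sup => _ [B mB <-]; rewrite walk_lawE // nuE // -EFinB lee_fin.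
have hL := mean_functional_iter hN nu theta t.
have bB := bmf_indic mB.
have : iter t Pr \1_B 1%g <= 1.
  have h x : (\1_B : G -> R) x <= (fun=> 1) x by rewrite indicE; case: (_ \in _).
  by have := mf_le hL bB (bmf_cst _ 1) h; rewrite (mf_cst hL).
have : 0 <= E \1_B by apply: Ex_ge0 => x; rewrite indicE; case: (_ \in _).
lra.
Qed.

End TotalVariation.

(** * Eigenvalues of the walk *)

Section ComplexExpectation.
Context {R : realType} d (T : measurableType d) (P : probability T R).
Local Notation C := R[i].
Local Notation ReC := (@complex.Re R).
Local Notation ImC := (@complex.Im R).
Implicit Types f g : T -> C.

Definition cbmf f := bmf (fun x => ReC (f x)) /\ bmf (fun x => ImC (f x)).

Definition Ec f : C := (Ex P (fun x => ReC (f x)) +i* Ex P (fun x => ImC (f x)))%C.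

Lemma ReM (x y : C) : ReC (x * y) = ReC x * ReC y - ImC x * ImC y.
Proof. by case: x y => [? ?] [? ?]. Qed.

Lemma ImM (x y : C) : ImC (x * y) = ReC x * ImC y + ImC x * ReC y.
Proof. by case: x y => [? ?] [? ?]. Qed.

Lemma eq_cbmf f g : f =1 g -> cbmf f -> cbmf g.
Proof. by move=> /funext ->. Qed.

Lemma cbmf_cst c : cbmf (fun=> c).
Proof. by split; exact: bmf_cst. Qed.

Lemma cbmfD f g : cbmf f -> cbmf g -> cbmf (fun x => f x + g x).
Proof.
move=> [f1 f2] [g1 g2]; split.
  by have := bmfD f1 g1; congr bmf; apply/funext => x; rewrite raddfD.
by have := bmfD f2 g2; congr bmf; apply/funext => x; rewrite raddfD.
Qed.

Lemma cbmfM f g : cbmf f -> cbmf g -> cbmf (fun x => f x * g x).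
Proof.
move=> [f1 f2] [g1 g2]; split.
  have := bmfB (bmfM f1 g1) (bmfM f2 g2); congr bmf.
  by apply/funext => x; rewrite ReM.
have := bmfD (bmfM f1 g2) (bmfM f2 g1); congr bmf.
by apply/funext => x; rewrite ImM.
Qed.

Lemma cbmfZ c f : cbmf f -> cbmf (fun x => c * f x).
Proof. by move=> hf; apply: cbmfM => //; exact: cbmf_cst. Qed.

Lemma cbmf_sum (I : Type) (s : seq I) (F : I -> T -> C) :
  (forall i, cbmf (F i)) -> cbmf (fun x => \sum_(i <- s) F i x).
Proof.
move=> h; elim: s => [|i s IH].
  by have := cbmf_cst 0; congr cbmf; apply/funext => x; rewrite big_nil.
by have := cbmfD (h i) IH; congr cbmf; apply/funext => x; rewrite big_cons.
Qed.

Lemma cbmf_prod (I : Type) (s : seq I) (F : I -> T -> C) :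
  (forall i, cbmf (F i)) -> cbmf (fun x => \prod_(i <- s) F i x).
Proof.
move=> h; elim: s => [|i s IH].
  by have := cbmf_cst 1; congr cbmf; apply/funext => x; rewrite big_nil.
by have := cbmfM (h i) IH; congr cbmf; apply/funext => x; rewrite big_cons.
Qed.

Lemma cbmfX m f : cbmf f -> cbmf (fun x => f x ^+ m).
Proof.
move=> hf; elim: m => [|m IH]; first exact: cbmf_cst.
by have := cbmfM hf IH; congr cbmf; apply/funext => x; rewrite exprS.
Qed.

Lemma cbmf_mulmx m p q (A : T -> 'M[C]_(m, p)) (B : T -> 'M[C]_(p, q)) :
  (forall i j, cbmf (fun x => A x i j)) -> (forall i j, cbmf (fun x => B x i j)) ->
  forall i j, cbmf (fun x => (A x *m B x) i j).
Proof.
move=> hA hB i j; rewrite (_ : (fun x => _) = (fun x => \sum_k A x i k * B x k j)).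
  by apply: cbmf_sum => k; exact: cbmfM.
by apply/funext => x; rewrite mxE.
Qed.

Lemma cbmf_det m (A : T -> 'M[C]_m) : (forall i j, cbmf (fun x => A x i j)) ->
  cbmf (fun x => \det (A x)).
Proof.
move=> hA; apply: cbmf_sum => s; apply: cbmfM; first exact: cbmf_cst.
exact: cbmf_prod.
Qed.

Lemma EcD f g : cbmf f -> cbmf g -> Ec (fun x => f x + g x) = Ec f + Ec g.
Proof.
move=> [f1 f2] [g1 g2]; apply/eqP; rewrite eq_complex; apply/andP; split; apply/eqP.
  by rewrite raddfD /= -ExD //; congr Ex; apply/funext => x; rewrite raddfD.
by rewrite raddfD /= -ExD //; congr Ex; apply/funext => x; rewrite raddfD.
Qed.

Lemma EcZ c f : cbmf f -> Ec (fun x => c * f x) = c * Ec f.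
Proof.
move=> [f1 f2]; apply/eqP; rewrite eq_complex; apply/andP; split; apply/eqP.
  rewrite ReM /Ec /= -!ExZ // -ExB; try exact: bmfZ.
  by congr Ex; apply/funext => x; rewrite ReM.
rewrite ImM /Ec /= -!ExZ // -ExD; try exact: bmfZ.
by congr Ex; apply/funext => x; rewrite ImM.
Qed.

Lemma Ec_sum (I : Type) (s : seq I) (F : I -> T -> C) : (forall i, cbmf (F i)) ->
  Ec (fun x => \sum_(i <- s) F i x) = \sum_(i <- s) Ec (F i).
Proof.
move=> h; elim: s => [|i s IH].
  rewrite big_nil /Ec; apply/eqP; rewrite eq_complex; apply/andP; split; apply/eqP => /=.
    by rewrite -[RHS](Ex_cst P); congr Ex; apply/funext => x; rewrite big_nil.
  by rewrite -[RHS](Ex_cst P); congr Ex; apply/funext => x; rewrite big_nil.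
rewrite big_cons -IH -EcD //; last exact: cbmf_sum.
by congr Ec; apply/funext => x; rewrite big_cons.
Qed.

Lemma Ec_conj f : cbmf f -> Ec (fun x => conjc (f x)) = conjc (Ec f).
Proof.
move=> [f1 f2]; apply/eqP; rewrite eq_complex; apply/andP; split; apply/eqP => /=.
  by congr Ex; apply/funext => x; case: (f x).
by rewrite -ExN //; congr Ex; apply/funext => x; case: (f x).
Qed.

Lemma Ec_bilin m p q (x : 'M[C]_(p, m)) (y : 'M[C]_(m, q)) (g : T -> 'M[C]_m) i j :
  (forall a b, cbmf (fun t => g t a b)) ->
  (x *m (\matrix_(a, b) Ec (fun t => g t a b)) *m y) i j = Ec (fun t => (x *m g t *m y) i j).
Proof.
move=> cg; have -> : (fun t => (x *m g t *m y) i j) =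
    (fun t => \sum_b \sum_a (x i a * y b j) * g t a b).
  apply/funext => U; rewrite mxE; apply: eq_bigr => b _; rewrite mxE mulr_suml.
  by apply: eq_bigr => c _; ring.
rewrite Ec_sum; last by move=> b; apply: cbmf_sum => c; exact: cbmfZ.
rewrite mxE; apply: eq_bigr => b _; rewrite Ec_sum; last by move=> c; exact: cbmfZ.
rewrite mxE mulr_suml; apply: eq_bigr => c _; rewrite EcZ // [X in _ * X * _]mxE; ring.
Qed.

Lemma eq_Ec f g : f =1 g -> Ec f = Ec g.
Proof. by move=> /funext ->. Qed.

Lemma Ec_comp f g : Ex P (fun x => ReC (f x)) = Ex P (fun x => ReC (g x)) ->
  Ex P (fun x => ImC (f x)) = Ex P (fun x => ImC (g x)) -> Ec f = Ec g.
Proof. by rewrite /Ec => -> ->. Qed.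

End ComplexExpectation.

Lemma rot12E {R : realType} N (hN : (1 < N)%N) (theta : R) (i j : 'I_N) :
  so_mx (rot12 hN theta) i j =
  if (i < 2)%N && (j < 2)%N then rot2 theta (inord i) (inord j) else (i == j)%:R.
Proof.
rewrite /= /rot12_mx castmxE.
have vi (k : 'I_N) : cast_ord (esym (subnKC hN)) k = k :> nat by [].
set i' := cast_ord _ i; set j' := cast_ord _ j.
have -> : (i == j) = (i' == j') by rewrite -!val_eqE.
rewrite -(vi i) -(vi j) -/i' -/j'.
case: (split_ordP i') => a ->; case: (split_ordP j') => b ->.
- by rewrite block_mxEul /=; congr (rot2 theta _ _); apply: val_inj; rewrite /= inordK.
- by rewrite block_mxEur mxE andbF eq_lrshift.
- by rewrite block_mxEdl mxE /= eq_rlshift.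
- by rewrite block_mxEdr mxE /= eq_rshift.
Qed.

(** * Highest weight functions are eigenfunctions *)

Section Eigenfunctions.
Variables (R : realType) (n : nat).
Hypothesis n0 : (0 < n)%N.
Local Notation N := n.*2.+1.
Local Notation G := (SO R N).
Local Notation C := R[i].
Variables (hN : (1 < N)%N) (nu : probability G R) (theta : R).
Hypothesis nuH : is_haar nu.
Local Notation rt := (rot12 hN theta).
Local Notation E := (Ex nu).

Lemma so_isSO (X : G) : isSO (so_mx X).
Proof. by have /andP[/eqP ? /eqP ?] := so_mxP X. Qed.

Lemma isSO_so (X : 'M[R]_N) : isSO X -> exists X' : G, so_mx X' = X.
Proof.
move=> [h1 h2]; have h : special_orthogonal X by rewrite /special_orthogonal h1 h2 !eqxx.
by exists (MkSO h).
Qed.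

(** Changing the sign of the second coordinate reverses the rotation, and changing that of the
    third, which the rotation fixes, restores determinant 1. *)
Lemma rot12_inv_conj : exists W : G, (rt^-1 = W * rt * W^-1)%g.
Proof.
pose s (i : 'I_N) : R := if (i == 1 :> nat) || (i == 2 :> nat) then -1 else 1.
have ss i : s i * s i = 1 by rewrite /s; case: ifP => _; rewrite ?mulN1r ?opprK ?mulr1.
pose D := diag_mx (\row_i s i).
have n3 : (2 < N)%N by lia.
have DO : special_orthogonal D.
  rewrite /special_orthogonal tr_diag_mx mulmx_diag; apply/andP; split.
    by apply/eqP/matrixP => i j; rewrite !mxE ss.
  rewrite det_diag (bigD1 (Ordinal hN)) //= (bigD1 (Ordinal n3)) //= big1 ?mulr1.
    by rewrite !mxE /s /= mulrNN mulr1.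
  move=> i /andP[i1 i2]; rewrite mxE /s; case: ifP => // /orP[]/eqP e.
    by move: i1; rewrite -val_eqE /= e.
  by move: i2; rewrite -val_eqE /= e.
exists (MkSO DO); apply: val_inj; apply/matrixP => i j.
transitivity (so_mx rt j i); first by rewrite [LHS]mxE.
have -> : \val ((MkSO DO : G) * rt * (MkSO DO : G)^-1)%g = D *m so_mx rt *m D.
  by rewrite [LHS]/=; congr (_ *m _); rewrite tr_diag_mx.
rewrite /D mul_mx_diag mxE mul_diag_mx mxE !mxE !rot12E.
rewrite andbC eq_sym; case: ifP => [/andP[i2 j2]|_]; last first.
  by case: eqP => [->|_]; rewrite ?mulr1 ?ss // mulr0 mul0r.
rewrite /rot2 !mxE !inordK //.
case: i i2 => [[|[|i]]] //= hi _; case: j j2 => [[|[|j]]] //= hj _;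
  rewrite /s /=; ring.
Qed.

Lemma cbmf_entry (A B : G) i j : cbmf (fun X : G => (cj (cm (so_mx (A * X * B)%g)) : 'M[C]_N) i j).
Proof.
rewrite /cj; apply: cbmf_mulmx => {i j}[|i j]; last exact: cbmf_cst.
apply: cbmf_mulmx => [i j|i j]; first exact: cbmf_cst.
split; last first.
  by have := bmf_cst G (0 : R); congr bmf; apply/funext => X; rewrite mxE.
have := bmf_left A (bmf_right B (bmf_entry i j)); congr bmf.
by apply/funext => X; rewrite [in RHS]mxE.
Qed.

Lemma cbmf_Fa (a : 'I_n -> nat) (A B : G) : cbmf (fun X : G => Fa a (cj (cm (so_mx (A * X * B)%g)))).
Proof.
apply: cbmf_prod => j; apply: cbmfX; apply: cbmf_det => x y.
by apply: eq_cbmf (cbmf_entry A B (inord x) (inord y)) => X; rewrite [RHS]mxE.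
Qed.

Lemma cbmf_tpow k (A B : G) i j :
  cbmf (fun X : G => (rho k (cj (cm (so_mx (A * X * B)%g))) : 'M[C]_(tdim (1 + N) k)) i j).
Proof.
rewrite /rho; elim: k i j => [|k IH] i j; first exact: cbmf_cst.
case: (mxtens_indexP i) => i0 i1; case: (mxtens_indexP j) => j0 j1.
have : cbmf (fun X : G => (ext 1 (cj (cm (so_mx (A * X * B)%g))) : 'M[C]_(1 + N)) i0 j0 *
    tpow k (ext 1 (cj (cm (so_mx (A * X * B)%g)))) i1 j1).
  apply: cbmfM; last exact: IH.
  rewrite /ext; case: (split_ordP i0) => a ->; case: (split_ordP j0) => b ->.
  - by apply: eq_cbmf (cbmf_cst G (1%:M a b : C)) => X; rewrite block_mxEul.
  - by apply: eq_cbmf (cbmf_cst G (0 : C)) => X; rewrite block_mxEur mxE.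
  - by apply: eq_cbmf (cbmf_cst G (0 : C)) => X; rewrite block_mxEdl mxE.
  - by apply: eq_cbmf (cbmf_entry A B a b) => X; rewrite block_mxEdr.
by apply: eq_cbmf => X; rewrite /= tensmxE.
Qed.

Local Notation wk U := (U * rt * U^-1)%g.

Definition reig (a : 'I_n -> nat) : C := Ec nu (fun U : G => Fa a (cj (cm (so_mx (wk U))))).

Lemma cbmf_wk (f : G -> C) X : cbmf f -> cbmf (fun U : G => f (wk U * X)%g).
Proof. by move=> [f1 f2]; split; [exact: bmf_walk f1 | exact: bmf_walk f2]. Qed.

Lemma cbmf_wk1 (f : G -> C) : cbmf f -> cbmf (fun U : G => f (wk U)).
Proof. by move=> hf; apply: eq_cbmf (cbmf_wk 1%g hf) => U; rewrite mulg1. Qed.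

Lemma mul1X1 (X : G) : (1 * X * 1)%g = X.
Proof. by rewrite mul1g mulg1. Qed.

Lemma cbmf_tpow1 k i j :
  cbmf (fun X : G => (rho k (cj (cm (so_mx X))) : 'M[C]_(tdim (1 + N) k)) i j).
Proof.
by apply: eq_cbmf (@cbmf_tpow k 1%g 1%g i j) => X; rewrite mul1X1.
Qed.

Lemma cbmf_Fa1 (a : 'I_n -> nat) : cbmf (fun X : G => Fa a (cj (cm (so_mx X)))).
Proof.
by apply: eq_cbmf (cbmf_Fa a 1%g 1%g) => X; rewrite mul1X1.
Qed.

Lemma Ec_left (g : G) (f : G -> C) : cbmf f -> Ec nu (fun x : G => f (g * x)%g) = Ec nu f.
Proof.
move=> [f1 f2]; apply: Ec_comp.
  exact: (Ex_left nuH g f1).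
exact: (Ex_left nuH g f2).
Qed.

Lemma Ec_right (g : G) (f : G -> C) : cbmf f -> Ec nu (fun x : G => f (x * g)%g) = Ec nu f.
Proof.
move=> [f1 f2]; apply: Ec_comp.
  exact: (Ex_right nuH g f1).
exact: (Ex_right nuH g f2).
Qed.

Lemma mul_cancel (r s e f q : C) : r != 0 -> s = q * r -> f * s = e * r -> e = q * f.
Proof. by move=> r0 -> h; apply: (mulIf r0); rewrite -h mulrA (mulrC q). Qed.

(** The mean [A] of [rho] over one step commutes with all rotations, so [z *m A] is again invariant
    under lower unipotents and of the same weight. By [hw_agree] its coefficients are multiples of
    the same [Fa a], and evaluation at the identity identifies the factor. *)
Lemma reig_rel a (X : G) : isHW R a ->
  Ec nu (fun U : G => Fa a (cj (cm (so_mx (wk U * X)%g)))) = reig a * Fa a (cj (cm (so_mx X))).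
Proof.
move=> [k [z [z0 zl zu zw]]].
pose g (Y : G) : 'M[C]_(tdim (1 + N) k) := rho k (cj (cm (so_mx Y))).
have gE Y : g Y = rho k (cj (cm (so_mx Y))) by [].
have g1 : g 1%g = 1%:M by rewrite /g /= /cm map_mx1 cj1 rho1.
have gM Y Z : g (Y * Z)%g = g Y *m g Z by rewrite /g -rhoM -cjM /cm map_mxM.
have cg i j : cbmf (fun Y => g Y i j).
  exact: cbmf_tpow1.
pose A : 'M[C]_(tdim (1 + N) k) := \matrix_(i, j) Ec nu (fun U : G => g (wk U) i j).
have cgw a' b : cbmf (fun U : G => g (wk U) a' b) by exact: (cbmf_wk1 (cg a' b)).
have lin (p q : nat) (x : 'M[C]_(p, _)) (y : 'M[C]_(_, q)) i j :
    (x *m A *m y) i j = Ec nu (fun U : G => (x *m g (wk U) *m y) i j).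
  exact: (Ec_bilin nu x y i j cgw).
clearbody g.
have Acomm Y : A *m g Y = g Y *m A.
  have : A = g Y *m A *m g Y^-1%g.
    apply/matrixP => i j; rewrite lin mxE.
    have h := cgw i j.
    rewrite -(Ec_left Y h); apply: eq_Ec => U; rewrite -!gM.
    by congr (g _ i j); rewrite invgM !mulgA.
  by move=> {1}->; rewrite -mulmxA -gM mulVg g1 mulmx1.
have AOJ u : inOJ u -> 1%:M + u \in unitmx -> A *m rho k u = rho k u *m A.
  apply: commute_OJ => X' hX dX; have [Y <-] := isSO_so (conj hX dX).
  by rewrite -gE; exact: Acomm.
pose w := z *m A.
have wl : lowinv w.
  move=> L hL LJ; rewrite /w -mulmxA AOJ //; last exact: lowu_unit1.
  by rewrite mulmxA zl.
have ww : weight (fun j => (lam a j)%:Z) w.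
  move=> t ht; rewrite /w -mulmxA AOJ; [|exact: torus_OJ|exact: torus_unit1].
  by rewrite mulmxA zw // scalemxAl.
have agree (v : 'rV[C]_(tdim (1 + N) k)) (Y : G) : lowinv v -> weight (fun j => (lam a j)%:Z) v ->
    (v *m g Y *m adjm z) 0 0 = Fa a (cj (cm (so_mx Y))) * (v *m adjm z) 0 0.
  by move=> vl vw; have [h1 h2] := cm_isSO (so_isSO Y); rewrite gE; exact: hw_agree.
have zz : (z *m adjm z) 0 0 != 0.
  apply: contra z0 => /eqP h; rewrite -row_adjm_eq0; apply/eqP/matrixP => i j.
  by rewrite !ord1 h mxE.
have cF : cbmf (fun Y : G => Fa a (cj (cm (so_mx Y)))) by exact: cbmf_Fa1.
have e1 Y : (w *m g Y *m adjm z) 0 0 =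
    Ec nu (fun U : G => Fa a (cj (cm (so_mx (wk U * Y)%g)))) * (z *m adjm z) 0 0.
  rewrite /w -(mulmxA (z *m A)) lin mulrC -EcZ; last exact: (cbmf_wk Y cF).
  by apply: eq_Ec => U; rewrite mulmxA -(mulmxA z) -gM agree // mulrC.
have e2 := e1 X; rewrite (agree _ X wl ww) in e2.
have e3 := e1 1%g; rewrite g1 mulmx1 in e3.
have e4 : Ec nu (fun U : G => Fa a (cj (cm (so_mx (wk U * 1)%g)))) = reig a.
  by rewrite /reig; apply: eq_Ec => U; rewrite mulg1.
have e3' : (w *m adjm z) 0 0 = reig a * (z *m adjm z) 0 0 by rewrite -e4; exact: e3.
exact: (mul_cancel zz e3' e2).
Qed.

Lemma Fa_adj (a : 'I_n -> nat) (Y : 'M[C]_N) : Fa a (adjm Y) = conjc (Fa a Y).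
Proof.
rewrite /Fa rmorph_prod; apply: eq_bigr => j _; rewrite rmorphXn; congr (_ ^+ _).
rewrite -det_map_mx -det_tr; congr (\det _); apply/matrixP => x y.
by rewrite !mxE.
Qed.

(** Inverting a step does not change its law and conjugates [Fa]. *)
Lemma reig_real (a : 'I_n -> nat) : reig a = (complex.Re (reig a))%:C%C.
Proof.
have cF : cbmf (fun Y : G => Fa a (cj (cm (so_mx Y)))) by exact: cbmf_Fa1.
have [W hW] := rot12_inv_conj.
have e : conjc (reig a) = reig a.
  rewrite /reig -Ec_conj; last exact: (cbmf_wk1 cF).
  rewrite -(Ec_right W (cbmf_wk1 cF)); apply: eq_Ec => U.
  rewrite -Fa_adj cj_adj cm_adj; congr (Fa a (cj (cm _))).
  have -> : (so_mx (wk U))^T = so_mx (wk U)^-1%g by [].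
  congr so_mx; rewrite invgM invgM invgK hW !invgM !mulgA.
  by [].
move: e; case: (reig a) => x y [] /= h; congr (_ +i* _)%C.
by apply/eqP; have := h; lra.
Qed.

Lemma eig_translate a (A B X : G) : isHW R a ->
  Ec nu (fun U : G => Fa a (cj (cm (so_mx (A * (wk U * X) * B)%g)))) =
  reig a * Fa a (cj (cm (so_mx (A * X * B)%g))).
Proof.
move=> ha; rewrite -(reig_rel (A * X * B)%g ha).
have cF : cbmf (fun Y : G => Fa a (cj (cm (so_mx Y)))) by exact: cbmf_Fa1.
apply: (etrans _ (Ec_left A (cbmf_wk (A * X * B)%g cF))); apply: eq_Ec => U.
have -> // : (A * (wk U * X) * B = A * U * rt * (A * U)^-1 * (A * X * B))%g.
by rewrite invgM !mulgA mulgKV.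
Qed.

End Eigenfunctions.

Lemma eq_big_In (T : Type) (V : nmodType) (s : seq T) (P : pred T) (F H : T -> V) :
  (forall q, List.In q s -> P q -> F q = H q) ->
  \sum_(q <- s | P q) F q = \sum_(q <- s | P q) H q.
Proof.
elim: s => [|q s IH] h; first by rewrite !big_nil.
rewrite !big_cons IH => [|q' h1 h2]; last by apply: h => //; right.
by case: ifP => // Pq; rewrite h //; left.
Qed.

(** * Polynomials are combinations of translated highest weight functions *)

Section PolynomialsAreMatrixCoefficients.
Variables (R : realType) (n : nat).
Local Notation N := n.*2.+1.
Local Notation G := (SO R N).
Local Notation C := R[i].

Lemma polyfun_mono (p : G -> R) : polyfun p -> exists s : seq (R * seq ('I_N * 'I_N)),
  forall X, p X = \sum_(q <- s) q.1 * \prod_(ij <- q.2) so_mx X ij.1 ij.2.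
Proof.
elim=> [c|i j|f g _ [s hs] _ [s' hs']|f g _ [s hs] _ [s' hs']].
- by exists [:: (c, [::])] => X; rewrite big_seq1 big_nil mulr1.
- by exists [:: (1, [:: (i, j)])] => X; rewrite !big_seq1 mul1r.
- by exists (s ++ s') => X; rewrite big_cat hs hs'.
- exists [seq (q.1 * q'.1, q.2 ++ q'.2) | q <- s, q' <- s'] => X.
  rewrite hs hs' big_allpairs_dep /= mulr_suml; apply: eq_bigr => q _; rewrite mulr_sumr.
  by apply: eq_bigr => q' _; rewrite big_cat /= mulrACA.
Qed.

Lemma mono_rho (w : seq ('I_N * 'I_N)) : exists I J : 'I_(tdim (1 + N) (size w)),
  forall X : 'M[C]_N, rho (size w) X I J = \prod_(ij <- w) X ij.1 ij.2.
Proof.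
rewrite /rho; elim: w => [|[i j] w [I [J h]]]; first by exists ord0, ord0 => X; rewrite mxE big_nil.
exists (mxtens_index (rshift 1 i, I)), (mxtens_index (rshift 1 j, J)) => X.
by rewrite /= tensmxE h big_cons /ext block_mxEdr.
Qed.

Lemma row_col_entry m p q r (P : 'M[C]_(m, p)) (M : 'M[C]_(p, q)) (Q : 'M[C]_(q, r)) I J :
  (row I P *m M *m col J Q) 0 0 = (P *m M *m Q) I J.
Proof. by rewrite -row_mul mxE [RHS]mxE; apply: eq_bigr => a _; rewrite [col _ _ _ _]mxE [row _ _ _ _]mxE. Qed.

Lemma hwspanW k k' (f : 'M[R]_N -> C) : (k <= k')%N -> hwspan k f -> hwspan k' f.
Proof.
move=> kk [s [h1 h2]]; exists s; split=> // q /h1 [a1 a2 a3 a4]; split=> // j.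
exact: leq_trans kk.
Qed.

Lemma poly_hwspan (p : G -> R) : polyfun p -> exists k (f : 'M[R]_N -> C),
  hwspan k f /\ forall X, (p X)%:C%C = f (so_mx X).
Proof.
move=> /polyfun_mono [s hs].
suff [k [f [h1 h2]]] : exists k (f : 'M[R]_N -> C), hwspan k f /\
    forall X, f X = \sum_(q <- s) (q.1)%:C%C * \prod_(ij <- q.2) (cm X) ij.1 ij.2.
  exists k, f; split=> // X; rewrite hs h2 rmorph_sum; apply: eq_bigr => q _.
  by rewrite rmorphM rmorph_prod; congr (_ * _); apply: eq_bigr => ij _; rewrite mxE.
elim: s {hs} => [|[c w] s [k [f [h1 h2]]]].
  by exists 0%N, (fun=> 0); split; [exact: hwspan0 | move=> X; rewrite big_nil].
have [I [J hw]] := mono_rho w.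
exists (maxn (size w) k), (fun X => c%:C%C * (\prod_(ij <- w) (cm X) ij.1 ij.2) + f X); split; last first.
  by move=> X; rewrite big_cons h2.
apply: hwspanD; last by apply: hwspanW h1; rewrite leq_maxr.
apply: hwspanZ; apply: (hwspanW (leq_maxl _ _)).
apply: hwspan_ext (hw_complete (row I (rho (size w) (Bmx R n))) (col J (rho (size w) (adjm (Bmx R n))))) => X _.
by rewrite -hw -[in RHS](cjK (cm X)) /cji !rhoM row_col_entry.
Qed.

End PolynomialsAreMatrixCoefficients.

(** * From ranks and eigenvalues to total variation *)

Section UpperAssembly.
Variables (R : realType) (n : nat).
Hypothesis n0 : (0 < n)%N.
Local Notation N := n.*2.+1.
Local Notation G := (SO R N).
Local Notation C := R[i].
Variables (hN : (1 < N)%N) (nu : probability G R) (theta : R).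
Hypothesis nuH : is_haar nu.
Local Notation rt := (rot12 hN theta).
Local Notation E := (Ex nu).
Local Notation Pr := (walk_op hN nu theta).
Local Notation ReC := (@complex.Re R).
Local Notation ImC := (@complex.Im R).

Lemma l2_boundT t (I : finType) (e : I -> G -> R) (r : I -> R) (f : G -> R) (c : G -> I -> R) (B : R) :
  (forall i, bmf (e i)) -> (forall i x, Pr (e i) x = r i * e i x) -> bmf f ->
  (forall g x : G, f (x * g^-1)%g = \sum_i c g i * e i x) -> (forall g i, `|c g i| <= B) ->
  iter t Pr f 1%g ^+ 2 <= (\sum_i r i ^+ t.*2) * E (fun x => f x ^+ 2).
Proof.
move=> be ee bf fc cB.
have re (F : I -> R) : \sum_i F i = \sum_(i < #|I|) F (enum_val i).
  by rewrite (reindex (@enum_val I xpredT)) //=; apply: onW_bij; exact: enum_val_bij.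
rewrite re; apply: (@l2_bound R N hN nu theta nuH (rot12_inv_conj n0 hN theta) t #|I| (fun i => e (enum_val i)) (fun i => r (enum_val i)) f (fun g i => c g (enum_val i)) B) => //.
by move=> g x; rewrite fc re.
Qed.

Definition toG (X : 'M[R]_N) : G := insubd (1%g : G) X.

Lemma ReC_sum (J : Type) (u : seq J) (P : pred J) (F : J -> C) :
  ReC (\sum_(j <- u | P j) F j) = \sum_(j <- u | P j) ReC (F j).
Proof. exact: (raddf_sum ReC). Qed.

Lemma toGK X : isSO X -> so_mx (toG X) = X.
Proof. by move=> [h1 h2]; rewrite /toG insubdK // unfold_in /special_orthogonal h1 h2 !eqxx. Qed.

Definition Kt (a : 'I_n -> nat) (s : G * G) (X : G) : C := Fa a (cj (cm (so_mx (s.1 * X * s.2)%g))).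

Lemma KtE a s X : Kt a s X = Ka a (cj (cm (so_mx s.1)), cj (cm (so_mx s.2))) (cj (cm (so_mx X))).
Proof. by rewrite /Kt /Ka /= /cm !map_mxM !cjM. Qed.

Lemma krank_Kt a d : krank (Ka (R := R) a) d -> krank (Kt a) d.
Proof.
move=> [I [f [g [h1 h2]]]]; exists I, (fun s => f (cj (cm (so_mx s.1)), cj (cm (so_mx s.2)))),
  (fun X => g (cj (cm (so_mx X)))); split=> // s X.
by rewrite KtE h2.
Qed.

Definition bdc (T : Type) (f : T -> C) := exists M : C, forall x, `|f x| <= M.

Lemma bdcM T (f g : T -> C) : bdc f -> bdc g -> bdc (fun x => f x * g x).
Proof. by move=> [M hM] [M' hM']; exists (M * M') => x; rewrite normrM ler_pM. Qed.

Lemma bdc_cst T c : bdc (fun _ : T => c).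
Proof. by exists `|c|. Qed.

Lemma bdc_sum T (I : Type) (s : seq I) (P : pred I) (F : I -> T -> C) : (forall i, bdc (F i)) ->
  bdc (fun x => \sum_(i <- s | P i) F i x).
Proof.
move=> h; elim: s => [|i s [M hM]]; first by exists 0 => x; rewrite big_nil normr0.
have [M' hM'] := h i; exists (M' + M) => x; rewrite big_cons; case: (P i).
  by apply: le_trans (ler_normD _ _) _; rewrite lerD.
by apply: le_trans (hM x) _; rewrite lerDr; apply: le_trans (hM' x); exact: normr_ge0.
Qed.

Lemma bdc_Kt T a (s : T -> G * G) (X : T -> G) : bdc (fun x => Kt a (s x) (X x)).
Proof.
have [[_ [M1 h1]] [_ [M2 h2]]] := @cbmf_Fa1 R n a.
exists (M1%:C + M2%:C)%C => x; rewrite /Kt; set Y := (_ * _)%g.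
have := h1 Y; have := h2 Y; move: (Fa a _) => z hz2 hz1.
have -> : z = (ReC z)%:C%C + 'i%C * (ImC z)%:C%C.
  by case: z {hz1 hz2} => u v; apply/eqP; rewrite eq_complex /=; apply/andP; split; apply/eqP; ring.
apply: le_trans (ler_normD _ _) _; rewrite normrM normCi mul1r lerD //.
  by rewrite normc_def /= expr0n addr0 sqrtr_sqr lecR.
by rewrite normc_def /= expr0n addr0 sqrtr_sqr lecR.
Qed.

Lemma bdc_Re T (f : T -> C) : bdc f -> exists M, forall x, `|ReC (f x)| <= M /\ `|ImC (f x)| <= M.
Proof.
move=> [M hM]; exists (ReC M) => x; have := hM x.
case: (f x) => u v; rewrite lecE normc_def /= => /andP[_ h].
split; apply: le_trans h; rewrite -sqrtr_sqr ler_wsqrtr // ?lerDl ?lerDr sqr_ge0 //.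
Qed.

Lemma Pr_mean (f : G -> R) : bmf f -> E (Pr f) = E f.
Proof.
move=> hf; have := Pr_sym nuH (rot12_inv_conj n0 hN theta) (bmf_cst G (1 : R)) hf.
rewrite (_ : (fun x => 1 * Pr f x) = Pr f); last by apply/funext => x; rewrite mul1r.
move=> ->; congr Ex; apply/funext => x.
by rewrite /walk_op Ex_cst mul1r.
Qed.

Section OneWeight.
Variables (a : 'I_n -> nat) (s : G * G).
Hypothesis ha : isHW R a.
Local Notation ra := (ReC (reig hN nu theta a)).

Lemma Kt_bmf : bmf (fun X => ReC (Kt a s X)) /\ bmf (fun X => ImC (Kt a s X)).
Proof. exact: cbmf_Fa. Qed.

Lemma Kt_eig X : Pr (fun Y => ReC (Kt a s Y)) X = ra * ReC (Kt a s X) /\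
  Pr (fun Y => ImC (Kt a s Y)) X = ra * ImC (Kt a s X).
Proof.
have := @eig_translate R n hN nu theta nuH a s.1 s.2 X ha.
rewrite (@reig_real R n n0 hN nu theta nuH a) => h; split.
  by have := congr1 ReC h; rewrite ReM /= mul0r subr0.
by have := congr1 ImC h; rewrite ImM /= mul0r addr0.
Qed.

Lemma Kt_mean : ra < 1 -> E (fun X => ReC (Kt a s X)) = 0 /\ E (fun X => ImC (Kt a s X)) = 0.
Proof.
move=> r1; have [b1 b2] := Kt_bmf.
have key (f : G -> R) : bmf f -> (forall X, Pr f X = ra * f X) -> E f = 0.
  move=> bf hf; have := Pr_mean bf; rewrite (_ : Pr f = (fun X => ra * f X)); last exact/funext.
  rewrite ExZ // => h; have /eqP : (1 - ra) * E f = 0 by rewrite mulrBl mul1r h subrr.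
  by rewrite mulf_eq0 subr_eq0 (gt_eqF r1) /= => /eqP.
split; apply: key => // X; by case: (Kt_eig X).
Qed.

End OneWeight.

Variables (d : ('I_n -> nat) -> nat) (t : nat) (K : R).
Hypothesis hd : forall a, krank (Ka (R := R) a) (d a).
Hypothesis hr : forall a, isHW R a -> (exists j, a j != 0%N) -> ReC (reig hN nu theta a) < 1.
Hypothesis K0 : 0 <= K.
Hypothesis hK : forall k, \sum_(a : {ffun 'I_n -> 'I_k.+1} | a != [ffun=> ord0])
  2 * (d (fun j => a j))%:R * ReC (reig hN nu theta (fun j => a j)) ^+ t.*2 <= K.

(** The zero weight and the weights that do not occur get the empty basis, so that one can sum over
    all exponents bounded by [k] without distinguishing cases. *)
Definition good_basis (a : 'I_n -> nat) (D : {m : nat & (('I_m -> G * G) * ('I_m -> G) * 'M[C]_m)%type}) :=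
  if `[< isHW R a /\ exists j, a j != 0%N >] then
    (tag D <= d a)%N /\ forall s X, Kt a s X =
      \sum_i (\sum_j Kt a s ((tagged D).1.2 j) * (tagged D).2 j i) * Kt a ((tagged D).1.1 i) X
  else tag D = 0%N.

Lemma good_basis_ex a : exists D, good_basis a D.
Proof.
rewrite /good_basis; case: asboolP => _.
  have [m [x [y [W [h1 h2]]]]] := krank_basis (krank_Kt (hd a)).
  by exists (existT (fun m => (('I_m -> G * G) * ('I_m -> G) * 'M[C]_m)%type) m (x, y, W)).
exists (existT (fun m => (('I_m -> G * G) * ('I_m -> G) * 'M[C]_m)%type) 0%N
  ((fun=> (1%g, 1%g)), (fun=> 1%g), 0)) => //.
Qed.

(** The centred polynomial and all its right translates lie in the span of the real and imaginary
    parts of the basis kernels. There are at most [2 * d a] of these for the weight [a], which is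
    the factor 2 in [hK]. *)
Lemma upper_poly (p : G -> R) : polyfun p ->
  (iter t Pr p 1%g - E p) ^+ 2 <= K * E (fun x => p x ^+ 2).
Proof.
move=> pp; pose f X := p X + - E p.
have pf : polyfun f by apply: polyfun_add => //; exact: polyfun_cst.
have bp := polyfun_bmf pp; have bf := polyfun_bmf pf.
have Ef : E f = 0 by rewrite ExD ?Ex_cst ?subrr //; exact: bmf_cst.
have [k [F [[s [s1 s2]] hF]]] := poly_hwspan pf.
pose af (q : hwterm R n) : {ffun 'I_n -> 'I_k.+1} := [ffun j => inord (q.1.2 j)].
pose av (a : {ffun 'I_n -> 'I_k.+1}) : 'I_n -> nat := fun j => a j.
have afK q : List.In q s -> av (af q) = q.1.2.
  move=> /s1 [_ h _ _]; apply/funext => j; rewrite /av ffunE inordK // ltnS.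
  exact: h.
have [D hD] := boolp.choice (fun a : {ffun 'I_n -> 'I_k.+1} => good_basis_ex (av a)).
pose m a := tag (D a); pose bx a : 'I_(m a) -> G * G := (tagged (D a)).1.1.
pose by_ a : 'I_(m a) -> G := (tagged (D a)).1.2; pose W a : 'M[C]_(m a) := (tagged (D a)).2.
pose I := ({a : {ffun 'I_n -> 'I_k.+1} & 'I_(m a)} * bool)%type.
pose e (i : I) (X : G) : R := if i.2 then ImC (Kt (av (tag i.1)) (bx _ (tagged i.1)) X)
  else ReC (Kt (av (tag i.1)) (bx _ (tagged i.1)) X).
pose r (i : I) : R := ReC (reig hN nu theta (av (tag i.1))).
(* Right translation by [g^-1] is absorbed in the second rotation, so that only coefficients depend
   on [g]. *)
pose st (q : hwterm R n) (g : G) : G * G := (toG q.2.1, (g^-1 * toG q.2.2)%g).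
pose ga (g : G) (u : {a : {ffun 'I_n -> 'I_k.+1} & 'I_(m a)}) : C :=
  \sum_(q <- s | af q == tag u) q.1.1 * \sum_j Kt (av (tag u)) (st q g) (by_ _ j) * W _ j (tagged u).
pose c (g : G) (i : I) : R := if i.2 then - ImC (ga g i.1) else ReC (ga g i.1).
have mok a : (0 < m a)%N -> isHW R (av a) /\ exists j, av a j != 0%N.
  by have := hD a; rewrite /good_basis; case: asboolP => // _; rewrite /m => ->.
have be i : bmf (e i).
  by rewrite /e; case: i.2; [case: (Kt_bmf (av (tag i.1)) (bx _ (tagged i.1))) |
    case: (Kt_bmf (av (tag i.1)) (bx _ (tagged i.1)))].
have ee i X : Pr (e i) X = r i * e i X.
  case: i => [[a i] b]; have [ha _] : isHW R (av a) /\ exists j, av a j != 0%N.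
    by apply: mok; apply: leq_ltn_trans (ltn_ord i).
  rewrite /e /r /=; have [h1 h2] := Kt_eig (bx a i) ha X.
  by case: b.
have [B hB] : exists B, forall g i, `|c g i| <= B.
  have hM (u : {a : {ffun 'I_n -> 'I_k.+1} & 'I_(m a)}) : exists M, forall g, `|ReC (ga g u)| <= M /\ `|ImC (ga g u)| <= M.
    apply: bdc_Re; apply: bdc_sum => q; apply: bdcM; first exact: bdc_cst.
    apply: (@bdc_sum _ _ _ xpredT) => j; apply: bdcM; last exact: bdc_cst.
    exact: (@bdc_Kt _ _ (st q) (fun=> by_ _ j)).
  have [M hM'] := boolp.choice hM; exists (\sum_u `|M u|) => g [u b].
  have Mu : M u <= \sum_u `|M u|.
    by apply: le_trans (ler_norm _) _; rewrite (bigD1 u) //= lerDl sumr_ge0.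
  by rewrite /c /=; have [h1 h2] := hM' u g; case: b; rewrite ?normrN; apply: le_trans Mu.
pose z0 : {ffun 'I_n -> 'I_k.+1} := [ffun=> ord0].
have sq g x q : List.In q s -> hwval q (so_mx (x * g^-1)%g) = q.1.1 * Kt (av (af q)) (st q g) x.
  move=> hq; have [_ _ h3 h4] := s1 q hq.
  have em : so_mx ((st q g).1 * x * (st q g).2)%g = q.2.1 *m so_mx (x * g^-1)%g *m q.2.2.
    by rewrite /= !toGK // !mulmxA.
  by rewrite /hwval /Kt em afK.
have bterm g x a : \sum_(q <- s | af q == a) q.1.1 * Kt (av a) (st q g) x *+ (a != z0) =
    \sum_i ga g (Tagged (fun a => 'I_(m a)) i) * Kt (av a) (bx a i) x.
  have -> : \sum_i ga g (Tagged (fun a => 'I_(m a)) i) * Kt (av a) (bx a i) x =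
      \sum_(q <- s | af q == a) q.1.1 * \sum_i (\sum_j Kt (av a) (st q g) (by_ a j) * W a j i) * Kt (av a) (bx a i) x.
    rewrite /ga /=; under eq_bigr do rewrite mulr_suml.
    rewrite exchange_big /=; apply: eq_bigr => q _; rewrite mulr_sumr.
    by apply: eq_bigr => i _; rewrite mulrA.
  apply: eq_big_In => q qs /eqP qa.
  have [az|az] := eqVneq a z0.
    have ma : m a = 0%N.
      have := hD a; rewrite /good_basis; case: asboolP => // -[_ [j]].
      by rewrite az /av ffunE.
    rewrite mulr0n big1 ?mulr0 // => i _; have := ltn_ord i; rewrite {2}ma; by [].
  rewrite mulr1n; congr (_ * _); have := hD a; rewrite /good_basis; case: asboolP => [_ [_ ->] //|].
  case; split; first by rewrite -qa afK //; case: (s1 q qs).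
  apply/existsP; apply: contraNT az; rewrite negb_exists => /forallP h.
  by apply/eqP/ffunP => j; apply: val_inj; rewrite ffunE /=; apply/eqP; have := h j; rewrite negbK.
have key (g x : G) : f (x * g^-1)%g = ReC (\sum_(q <- s | af q == z0) q.1.1) +
    \sum_i c g i * e i x.
  have -> : f (x * g^-1)%g = ReC (\sum_(q <- s) q.1.1 * Kt (av (af q)) (st q g) x).
    have := hF (x * g^-1)%g; rewrite s2; last exact: so_isSO.
    move=> /(congr1 ReC) /= ->; congr ReC; apply: eq_big_In => q qs _; exact: sq.
  rewrite (bigID (fun q => af q == z0)) /= raddfD; congr (_ + _).
    congr ReC; apply: eq_bigr => q /eqP ->; rewrite /Kt /Fa big1 ?mulr1 // => j _.
    by rewrite /av ffunE expr0.
  have -> : \sum_i c g i * e i x = ReC (\sum_u ga g u * Kt (av (tag u)) (bx _ (tagged u)) x).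
    rewrite -(pair_bigA_idem _ (fun u b => c g (u, b) * e (u, b) x)); last exact: addr0.
    apply: (etrans _ (esym (ReC_sum _ _ _))); apply: eq_bigr => u _.
    by rewrite big_bool /c /e /= ReM mulNr addrC.
  apply: (congr1 ReC).
  have := @sig_big_dep C 0 +%R {ffun 'I_n -> 'I_k.+1} (fun a => 'I_(m a)) xpredT (fun _ => xpredT)
    (fun a i => ga g (Tagged (fun a => 'I_(m a)) i) * Kt (av a) (bx a i) x).
  move=> /= H; rewrite (eq_bigr (fun u => ga g (Tagged (fun a => 'I_(m a)) (tagged u)) * Kt (av (tag u)) (bx _ (tagged u)) x)).
    rewrite -H (partition_big af xpredT) //=; apply: eq_bigr => a _; rewrite -bterm.
    rewrite big_mkcond [RHS]big_mkcond; apply: eq_bigr => q _.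
    by case: (eqVneq (af q) a) => [->|]; rewrite ?andbF ?andbT //; case: (a != z0).
  by move=> [a i] _.
(* The zero weight contributes a constant, and this constant is 0 because [f] and all other
   eigenfunctions have mean 0. *)
have k0 : ReC (\sum_(q <- s | af q == z0) q.1.1) = 0.
  have : E (fun x : G => f (x * 1^-1)%g) = 0 by rewrite (Ex_right nuH _ bf) Ef.
  rewrite (_ : (fun x : G => _) = (fun x => ReC (\sum_(q <- s | af q == z0) q.1.1) + \sum_i c 1%g i * e i x)); last first.
    by apply/funext => x; exact: key.
  rewrite ExD ?Ex_cst; [|exact: bmf_cst|by apply: bmf_sum => i; exact: bmfZ].
  rewrite Ex_sum; last by move=> i; exact: bmfZ.
  have Ez (i : I) : E (fun x => c 1%g i * e i x) = 0.
    have -> : E (fun x => c 1%g i * e i x) = c 1%g i * E (e i) by apply: ExZ; exact: be.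
    case: i => -[a i] b.
    have [ha hj] : isHW R (av a) /\ exists j, av a j != 0%N.
      by apply: mok; apply: leq_ltn_trans (ltn_ord i).
    have [h1 h2] := Kt_mean (bx a i) ha (hr ha hj).
    have -> : E (e (existT (fun a => 'I_(m a)) a i, b)) = 0 by case: b; [exact: h2 | exact: h1].
    by rewrite mulr0.
  have -> : \sum_i E (fun x => c 1%g i * e i x) = 0 by apply: big1 => i _; exact: Ez.
  by rewrite addr0.
have main := @l2_boundT t I e r f c B be ee bf.
have {}main : iter t Pr f 1%g ^+ 2 <= (\sum_i r i ^+ t.*2) * E (fun x => f x ^+ 2).
  by apply: main => // g x; rewrite key k0 add0r.
have hL := mean_functional_iter hN nu theta t.
have -> : iter t Pr p 1%g - E p = iter t Pr f 1%g.
  by rewrite /f (mf_add hL bp) ?(mf_cst hL) //; exact: bmf_cst.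
apply: le_trans main _.
have S0 : 0 <= E (fun x => f x ^+ 2) by apply: Ex_ge0 => x; exact: sqr_ge0.
apply: (@le_trans _ _ (K * E (fun x => f x ^+ 2))).
  apply: ler_wpM2r => //; apply: le_trans (hK k).
  have [P PE] : exists P : {ffun 'I_n -> 'I_k.+1} -> R, forall a, P a = ReC (reig hN nu theta (av a)) ^+ t.*2.
    by exists (fun a => ReC (reig hN nu theta (av a)) ^+ t.*2).
  have -> : \sum_i r i ^+ t.*2 = \sum_u \sum_(b : bool) P (tag (u : {a : {ffun 'I_n -> 'I_k.+1} & 'I_(m a)})).
    rewrite pair_bigA; apply: eq_bigr => i _; by rewrite PE.
  have -> : \sum_u \sum_(b : bool) P (tag (u : {a : {ffun 'I_n -> 'I_k.+1} & 'I_(m a)})) =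
      \sum_a (2 * P a) *+ m a.
    have := @sig_big_dep R 0 +%R {ffun 'I_n -> 'I_k.+1} (fun a => 'I_(m a)) xpredT (fun _ => xpredT)
      (fun a i => 2 * P a).
    move=> H; transitivity (\sum_(u : {a : {ffun 'I_n -> 'I_k.+1} & 'I_(m a)}) 2 * P (tag u)).
      by apply: eq_bigr => u _; rewrite big_bool /=; ring.
    by apply: etrans (esym H) _; apply: eq_bigr => a _; rewrite sumr_const card_ord.
  rewrite [leRHS]big_mkcond; apply: ler_sum => a _; rewrite -PE -mulr_natl.
  have p0 : 0 <= P a by rewrite PE -muln2 exprM sqr_ge0.
  have hDa := hD a; rewrite /good_basis -/(m a) in hDa.
  case: eqVneq => [az|az] /=.
    have -> : m a = 0%N.
      move: hDa; case: asboolP => // -[_ [j]].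
      by rewrite az /av ffunE.
    by rewrite mul0r.
  rewrite mulrCA -mulrA ler_wpM2l // ler_wpM2r // ler_nat.
  by move: hDa; case: asboolP => [_ []|_ ->].
apply: ler_wpM2l => //.
have -> : (fun x => f x ^+ 2) = (fun x => p x ^+ 2 + ((- 2 * E p) * p x + E p ^+ 2)).
  by apply/funext => x; rewrite /f; ring.
have b1 := bmfX 2 bp; have b2 := bmfZ (- 2 * E p) bp.
rewrite ExD // ?ExD ?Ex_cst ?ExZ //; try (by apply: bmfD => //; exact: bmf_cst); try exact: bmf_cst.
have := sqr_ge0 (E p); rewrite expr2; lra.
Qed.

Theorem tv_upper : (tv_dist (walk_law hN nu theta t) nu <= (Num.sqrt K)%:E)%E.
Proof. by apply: tv_le => // p pp; exact: upper_poly. Qed.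

End UpperAssembly.

Lemma sum_double (V : nmodType) J (f : nat -> V) :
  \sum_(i < J.*2) f i = \sum_(p < J) (f p.*2 + f p.*2.+1).
Proof. by elim: J => [|J IH]; rewrite ?big_ord0 // doubleS !big_ord_recr /= IH addrA. Qed.

Lemma det_mx22E (F : comNzRingType) (M : 'M[F]_2) : \det M = M 0 0 * M 1 1 - M 0 1 * M 1 0.
Proof.
rewrite (expand_det_row _ ord0) !big_ord_recl big_ord0 /cofactor !det_mx11 !mxE /=.
rewrite expr0 mul1r addr0 expr1 mulN1r mulrN; congr (_ * M _ _ - M _ _ * M _ _); exact: val_inj.
Qed.

Lemma det_sylvester (F : comNzRingType) m p (P : 'M[F]_(m, p)) (Q : 'M[F]_(p, m)) :
  \det (1%:M + P *m Q) = \det (1%:M + Q *m P).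
Proof.
have e : block_mx 1%:M 0 Q 1%:M *m block_mx 1%:M (- P) 0 (1%:M + Q *m P) =
         block_mx (1%:M + P *m Q) (- P) 0 1%:M *m block_mx 1%:M 0 Q 1%:M.
  rewrite !mulmx_block !mul1mx !mulmx1 !mul0mx !mulmx0 !addr0 !add0r mulNmx mulmxN addrK.
  by rewrite addrCA addNr addr0.
have := congr1 determinant e; rewrite !det_mulmx !det_lblock !det_ublock !det1 !mul1r !mulr1.
by move=> ->.
Qed.

(** * A pointwise bound on the minors of one step *)

Section PointwiseBound.
Variables (R : realType) (n : nat).
Local Notation N := n.*2.+1.
Local Notation G := (SO R N).
Local Notation C := R[i].
Implicit Types U : G.

Definition uu U (i : nat) : R := so_mx U (inord i) ord0.
Definition vv U (i : nat) : R := so_mx U (inord i) (inord 1).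

(** The first two columns of [U], restricted to the first [J] coordinate planes, are read as complex
    vectors: [fA] and [fB] are half their squared norms, [fX] and [fY] half the real part and, up to
    sign, half the imaginary part of their inner product. Together they make up the Gram matrix of
    [Pm]; [fb] is the combination that gives the real part of the minor in [lead_det]. *)
Definition fA J U := 2^-1 * \sum_(i < J.*2) uu U i ^+ 2.
Definition fB J U := 2^-1 * \sum_(i < J.*2) vv U i ^+ 2.
Definition fX J U := 2^-1 * \sum_(i < J.*2) uu U i * vv U i.
Definition fY J U := 2^-1 * \sum_(p < J) (uu U p.*2 * vv U p.*2.+1 - uu U p.*2.+1 * vv U p.*2).
Definition fb J U := fA J U + fB J U - 2 * (fA J U * fB J U - fX J U ^+ 2 - fY J U ^+ 2).

Definition Psi (a : 'I_n -> nat) U := \sum_(j < n) (a j)%:R * (fb j.+1 U * (1 - fb j.+1 U)).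

Hypothesis n0 : (0 < n)%N.
Variables (hN : (1 < N)%N) (theta : R).
Local Notation rt := (rot12 hN theta).
Local Notation Sq := (sin (theta / 2) ^+ 2).

Lemma cos_half : cos theta = 1 - 2 * Sq.
Proof.
have {1}-> : theta = (theta / 2) *+ 2 by rewrite -mulr_natr mulfVK ?pnatr_eq0.
by rewrite cos_mulr2n cos2sin2 -mulr_natr; ring.
Qed.

Lemma orth_rows U (i j : 'I_N) : \sum_k so_mx U k i * so_mx U k j = (i == j)%:R.
Proof.
have /andP[/eqP /matrixP /(_ i j) h _] := so_mxP U; rewrite mxE [RHS]mxE in h; rewrite -h.
by apply: eq_bigr => k _; rewrite [in RHS]mxE.
Qed.

Lemma sum_inord (f : 'I_N -> R) : \sum_i f i = \sum_(i < N) f (inord i).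
Proof. by apply: eq_bigr => i _; rewrite inord_val. Qed.

Lemma sum_split_le (f : nat -> R) J : (J <= N)%N ->
  \sum_(i < N) f i = \sum_(i < J) f i + \sum_(J <= i < N) f i.
Proof. by move=> h; rewrite -!(big_mkord xpredT) (big_cat_nat (n := J)). Qed.

Lemma cauchy_sum (s : seq nat) (f g : nat -> R) :
  (\sum_(i <- s) f i * g i) ^+ 2 <= (\sum_(i <- s) f i ^+ 2) * (\sum_(i <- s) g i ^+ 2).
Proof.
set a := \sum_(i <- s) f i ^+ 2; set b := \sum_(i <- s) f i * g i; set c := \sum_(i <- s) g i ^+ 2.
have q x y : 0 <= x ^+ 2 * a + 2 * (x * y) * b + y ^+ 2 * c.
  have -> : x ^+ 2 * a + 2 * (x * y) * b + y ^+ 2 * c = \sum_(i <- s) (x * f i + y * g i) ^+ 2.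
    rewrite /a /b /c !mulr_sumr -!big_split; apply: eq_bigr => i _ /=; ring.
  by apply: sumr_ge0 => i _; exact: sqr_ge0.
have c0 : 0 <= c by apply: sumr_ge0 => i _; exact: sqr_ge0.
have a0 : 0 <= a by apply: sumr_ge0 => i _; exact: sqr_ge0.
have [cz|cz] := eqVneq c 0.
  rewrite cz mulr0; have [->|b0] := eqVneq b 0; first by rewrite expr0n.
  have := q 1 (- (a + 1) / (2 * b)); rewrite cz mulr0 addr0.
  have -> : 1 ^+ 2 * a + 2 * (1 * (- (a + 1) / (2 * b))) * b = -1 by field.
  by lra.
have cp : 0 < c by rewrite lt_neqAle eq_sym cz.
by have := q c (- b); nra.
Qed.

Section FixJ.
Variables (J : nat) (U : G).
Hypothesis Jn : (J <= n)%N.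
Local Notation A := (fA J U). Local Notation B := (fB J U).
Local Notation X := (fX J U). Local Notation Y := (fY J U).
Local Notation b := (fb J U).

Lemma fA_ge0 : 0 <= A.
Proof. by rewrite mulr_ge0 ?invr_ge0 ?sumr_ge0 // => i _; exact: sqr_ge0. Qed.

Lemma fB_ge0 : 0 <= B.
Proof. by rewrite mulr_ge0 ?invr_ge0 ?sumr_ge0 // => i _; exact: sqr_ge0. Qed.

Let J2N : (J.*2 <= N)%N. Proof. by lia. Qed.

Let uN : \sum_(i < J.*2) uu U i ^+ 2 + \sum_(J.*2 <= i < N) uu U i ^+ 2 = 1.
Proof.
have := orth_rows U ord0 ord0; rewrite eqxx sum_inord (sum_split_le (fun i => so_mx U (inord i) ord0 * so_mx U (inord i) ord0) J2N) => h; apply: (etrans _ h).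
by congr (_ + _); apply: eq_bigr => i _; rewrite expr2.
Qed.

Let vN : \sum_(i < J.*2) vv U i ^+ 2 + \sum_(J.*2 <= i < N) vv U i ^+ 2 = 1.
Proof.
have := orth_rows U (inord 1) (inord 1); rewrite eqxx sum_inord (sum_split_le (fun i => so_mx U (inord i) (inord 1) * so_mx U (inord i) (inord 1)) J2N) => h; apply: (etrans _ h).
by congr (_ + _); apply: eq_bigr => i _; rewrite expr2.
Qed.

Let uvN : \sum_(i < J.*2) uu U i * vv U i + \sum_(J.*2 <= i < N) uu U i * vv U i = 0.
Proof.
have := orth_rows U ord0 (inord 1); rewrite sum_inord (sum_split_le (fun i => so_mx U (inord i) ord0 * so_mx U (inord i) (inord 1)) J2N).
have -> : (ord0 == inord 1 :> 'I_N) = false by apply/eqP => /(congr1 val) /=; rewrite inordK //.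
by [].
Qed.

Lemma fA_le : A <= 2^-1.
Proof.
have : 0 <= \sum_(J.*2 <= i < N) uu U i ^+ 2 by apply: sumr_ge0 => i _; exact: sqr_ge0.
by have := uN; rewrite /fA; lra.
Qed.

Lemma fB_le : B <= 2^-1.
Proof.
have : 0 <= \sum_(J.*2 <= i < N) vv U i ^+ 2 by apply: sumr_ge0 => i _; exact: sqr_ge0.
by have := vN; rewrite /fB; lra.
Qed.

(* Cauchy-Schwarz on the complementary coordinates *)
Lemma fX_compl : 4 * X ^+ 2 <= (1 - 2 * A) * (1 - 2 * B).
Proof.
have := cauchy_sum (index_iota J.*2 N) (uu U) (vv U).
have e1 : \sum_(J.*2 <= i < N) uu U i ^+ 2 = 1 - 2 * A by have := uN; rewrite /fA; lra.
have e2 : \sum_(J.*2 <= i < N) vv U i ^+ 2 = 1 - 2 * B by have := vN; rewrite /fB; lra.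
have e3 : \sum_(J.*2 <= i < N) uu U i * vv U i = - (2 * X) by have := uvN; rewrite /fX; lra.
by rewrite e1 e2 e3; nra.
Qed.

(** Cauchy-Schwarz for the complex inner product, written in real coordinates: a combination of [X]
    and [Y] pairs the first column with a combination of the second one and its quarter turn. *)
Lemma fXY_le : X ^+ 2 + Y ^+ 2 <= A * B.
Proof.
pose f1 p := uu U p.*2; pose f2 p := uu U p.*2.+1; pose g1 p := vv U p.*2; pose g2 p := vv U p.*2.+1.
have key x y : (2 * x * X + 2 * y * Y) ^+ 2 <= (x ^+ 2 + y ^+ 2) * (2 * A * (2 * B)).
  have -> : 2 * x * X + 2 * y * Y = \sum_(0 <= i < J.*2) uu U i *
      (x * vv U i + y * (if odd i then - vv U i.-1 else vv U i.+1)).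
    rewrite /fX /fY big_mkord (sum_double J (fun i => uu U i * vv U i)).
    rewrite (sum_double J (fun i => uu U i * (x * vv U i + y * (if odd i then - vv U i.-1 else vv U i.+1)))).
    rewrite !mulr_sumr -big_split.
    by apply: eq_bigr => p _ /=; rewrite odd_double /=; field.
  apply: le_trans (cauchy_sum _ _ _) _; rewrite mulrCA; apply: ler_pM => //.
  - by apply: sumr_ge0 => i _; exact: sqr_ge0.
  - by apply: sumr_ge0 => i _; exact: sqr_ge0.
  - by rewrite /fA big_mkord; lra.
  - rewrite /fB big_mkord (sum_double J (fun i => vv U i ^+ 2)).
    rewrite (sum_double J (fun i => (x * vv U i + y * (if odd i then - vv U i.-1 else vv U i.+1)) ^+ 2)) le_eqVlt; apply/orP; left; apply/eqP.
    rewrite (mulrA 2) mulfV ?pnatr_eq0 // mul1r.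
    by rewrite mulr_sumr; apply: eq_bigr => p _ /=; rewrite odd_double /=; ring.
have := key X Y; have A0 := fA_ge0; have B0 := fB_ge0.
have -> : 2 * X * X + 2 * Y * Y = 2 * (X ^+ 2 + Y ^+ 2) by ring.
have : 0 <= X ^+ 2 + Y ^+ 2 by rewrite addr_ge0 ?sqr_ge0.
have : 0 <= A * B by rewrite mulr_ge0.
move: (X ^+ 2 + Y ^+ 2) => t AB tge; have [-> //|tn] := eqVneq t 0.
have t0 : 0 < t by rewrite lt_neqAle eq_sym tn.
have -> : (2 * t) ^+ 2 = (4 * t) * t by ring.
have -> : t * (2 * A * (2 * B)) = (4 * t) * (A * B) by ring.
by rewrite ler_pM2l // mulr_gt0.
Qed.

Lemma fb_le : b <= A + B.
Proof. by have := fXY_le; rewrite /fb; lra. Qed.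

Lemma fb_quad : A + B - (A + B) ^+ 2 / 2 <= b.
Proof.
have := sqr_ge0 X; have := sqr_ge0 Y; have := sqr_ge0 (A - B).
by rewrite /fb !expr2; lra.
Qed.

Lemma fb_half : (A + B) / 2 <= b.
Proof.
apply: le_trans fb_quad; have := fA_le; have := fB_le; have := fA_ge0; have := fB_ge0.
by rewrite expr2; nra.
Qed.

(** Indeed [1 - b] equals [(1 - 4 Y ^ 2) / 2] plus half of [(1 - 2 A) (1 - 2 B) - 4 X ^ 2],
    nonnegative by [fX_compl]. *)
Lemma fb_compl : (1 - 4 * Y ^+ 2) / 2 <= 1 - b.
Proof. by have := fX_compl; rewrite /fb; lra. Qed.

(** With [m = (A + B) / 2], [b - 2 |Y|] is at least [2 (m - |Y|) (1 - m - |Y|)], and both factors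
    are nonnegative. *)
Lemma fY_le : 2 * `|Y| <= b.
Proof.
have y2 : Y ^+ 2 = `|Y| ^+ 2 by rewrite real_normK // num_real.
have := fXY_le; have := fA_le; have := fB_le; have := fA_ge0; have := fB_ge0; have := sqr_ge0 X.
rewrite /fb y2; have := normr_ge0 Y; move: `|Y| (X ^+ 2) A B => y x a c y0 x0 c0 a0 c1 a1 h.
have h1 : y ^+ 2 <= ((a + c) / 2) ^+ 2.
  by apply: (@le_trans _ _ (a * c)); [lra | have := sqr_ge0 (a - c); rewrite !expr2; lra].
have h2 : y <= (a + c) / 2.
  by rewrite -(@ler_pXn2r _ 2) // nnegrE; lra.
have h3 : 0 <= ((a + c) / 2 - y) * (1 - (a + c) / 2 - y).
  by apply: mulr_ge0; [lra | lra].
have h4 := sqr_ge0 (a - c); rewrite !expr2 in h3 h4 *; lra.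
Qed.

Lemma fb01 : 0 <= b <= 1.
Proof.
have := fb_le; have := fA_le; have := fB_le; have := fY_le; have := normr_ge0 Y.
by move=> ? ? ? ? ?; apply/andP; split; lra.
Qed.

Lemma Y_le1 : 4 * Y ^+ 2 <= 1.
Proof.
have y2 : Y ^+ 2 = `|Y| ^+ 2 by rewrite real_normK // num_real.
have := fY_le; have /andP[_ b1] := fb01; have := normr_ge0 Y; rewrite y2; nra.
Qed.

Lemma fb_var_ge0 : 0 <= b * (1 - b).
Proof. by have /andP[? ?] := fb01; rewrite mulr_ge0 // subr_ge0. Qed.

Lemma fb_var_quad : A + B - 3 / 2 * (A + B) ^+ 2 <= b * (1 - b).
Proof.
have h1 := fb_quad; have h2 := fb_le; have /andP[h3 h4] := fb01.
have : b ^+ 2 <= (A + B) ^+ 2 by rewrite lerXn2r // nnegrE; lra.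
by rewrite mulrBr mulr1 -expr2; lra.
Qed.

Lemma fb_var_omega : (A + B) * (1 - 4 * Y ^+ 2) / 4 <= b * (1 - b).
Proof.
have h1 := fb_half; have h2 := fb_compl; have h3 := fA_ge0; have h4 := fB_ge0; have h5 := Y_le1.
have -> : (A + B) * (1 - 4 * Y ^+ 2) / 4 = ((A + B) / 2) * ((1 - 4 * Y ^+ 2) / 2) by field.
by apply: ler_pM => //; lra.
Qed.

End FixJ.

Local Notation wk U := (U * rt * U^-1)%g.
Definition colsel : 'M[R]_(N, 2) := \matrix_(i, k) (i == k :> nat)%:R.
Definition Krot : 'M[R]_2 := rot2 theta - 1%:M.

Lemma rot12_low_rank : so_mx rt = 1%:M + colsel *m Krot *m colsel^T.
Proof.
apply/matrixP => i j; rewrite rot12E !mxE !big_ord_recl big_ord0 !mxE !big_ord_recl !big_ord0 !mxE /=.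
rewrite !addr0 -(inj_eq val_inj).
case: i => [[|[|i]] hi]; case: j => [[|[|j]] hj] => /=;
  rewrite ?inordK //= ?mulr0 ?mul0r ?mulr1 ?mul1r ?addr0 ?add0r ?subr0 ?subrr //; try ring.
Qed.

Lemma wk_low_rank U : so_mx (wk U) = 1%:M + (so_mx U *m colsel) *m Krot *m (so_mx U *m colsel)^T.
Proof.
have UU : so_mx U *m (so_mx U)^T = 1%:M.
  by have /andP[/eqP h _] := so_mxP U; exact: mulmx1C.
rewrite -[LHS]/(so_mx U *m so_mx rt *m (so_mx U)^T) rot12_low_rank mulmxDr mulmxDl mulmx1 UU.
by rewrite trmx_mul !mulmxA.
Qed.

Lemma cm_adjr m p (X : 'M[R]_(m, p)) : adjm (cm X) = cm X^T :> 'M[C]_(p, m).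
Proof. by rewrite /adjm cm_conj /cm map_trmx. Qed.

Lemma Ucol0 U q : (so_mx U *m colsel) q 0 = so_mx U q ord0.
Proof.
rewrite mxE (bigD1 ord0) //= mxE eqxx mulr1 big1 ?addr0 // => i i0.
rewrite mxE; have -> : (i == 0%N :> nat) = false by apply/negbTE.
by rewrite mulr0.
Qed.

Lemma Ucol1 U q : (so_mx U *m colsel) q 1 = so_mx U q (inord 1).
Proof.
rewrite mxE (bigD1 (inord 1)) //= mxE inordK // eqxx mulr1 big1 ?addr0 // => i i0.
rewrite mxE; case: eqP => [e|_]; last by rewrite mulr0.
by move: i0; rewrite -val_eqE /= inordK // e.
Qed.

Definition Pm U J : 'M[C]_(J, 2) := \matrix_(p < J, k < 2) (adjm (Bmx R n) *m cm (so_mx U *m colsel)) (inord p) k.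

Lemma PmE U J (p : 'I_J) k : (J <= n)%N -> Pm U J p k =
  hf R * ((so_mx U *m colsel) (inord p.*2) k)%:C%C - hf R * ('i%C * ((so_mx U *m colsel) (inord p.*2.+1) k)%:C%C).
Proof.
move=> Jn; have pJ := ltn_ord p; rewrite [LHS]mxE [LHS]mxE.
have -> : \sum_j adjm (Bmx R n) (inord p) j * cm (so_mx U *m colsel) j k =
    conjc (\sum_j Bmx R n j (inord p) * ((so_mx U *m colsel) j k)%:C%C).
  rewrite rmorph_sum; apply: eq_bigr => j _; rewrite rmorphM.
  congr (_ * _); first by rewrite !mxE.
  by rewrite mxE; apply/esym; exact: conjc_real.
rewrite (Bmx_colsum (inord p) (fun j => ((so_mx U *m colsel) j k)%:C%C)) inordK; last by lia.
have -> : (p == n :> nat) = false by apply/eqP; lia.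
have -> : (p < n)%N by lia.
have -> : minn p (n.*2 - p) = p by apply/minn_idPl; lia.
rewrite /hf; move: ((so_mx U *m colsel) (inord p.*2) k) ((so_mx U *m colsel) (inord p.*2.+1) k) => x y.
by apply/eqP; rewrite eq_complex; apply/andP; split; apply/eqP => /=; ring.
Qed.

Lemma lead_wk U J : (J <= n)%N -> lead J (cj (cm (so_mx (wk U)))) =
  1%:M + Pm U J *m (cm Krot *m adjm (Pm U J)).
Proof.
move=> Jn; pose Q := adjm (Bmx R n) *m cm (so_mx U *m colsel).
have e : cj (cm (so_mx (wk U))) = 1%:M + Q *m cm Krot *m adjm Q.
  have -> : cm (so_mx (wk U)) = 1%:M + cm (so_mx U *m colsel) *m cm Krot *m cm (so_mx U *m colsel)^T :> 'M[C]_N.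
    by rewrite wk_low_rank /cm map_mxD map_mx1 !map_mxM.
  rewrite /cj mulmxDr mulmxDl mulmx1 Bmx_unitary; congr (_ + _).
  by rewrite /Q adjmM adjmK cm_adjr !mulmxA.
apply/matrixP => x y; rewrite mxE e [LHS]mxE [RHS]mxE; congr (_ + _).
  rewrite !mxE; congr (_%:R); congr nat_of_bool; apply/eqP/eqP => [h|->//].
  have := congr1 val h; rewrite /= !inordK; [exact: val_inj | |].
    by have := ltn_ord y; lia.
  by have := ltn_ord x; lia.
rewrite -mulmxA mxE [RHS]mxE; apply: eq_bigr => k _; congr (_ * _); first by rewrite [RHS]mxE.
rewrite mxE [RHS]mxE; apply: eq_bigr => l _; congr (_ * _).
by rewrite [RHS]mxE [RHS]mxE [LHS]mxE [LHS]mxE; congr conjc; rewrite [RHS]mxE.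
Qed.

Definition Mc U (q : nat) (c : 'I_2) : R := (so_mx U *m colsel) (inord q) c.

Lemma gram_Pm U J k l : (J <= n)%N -> (adjm (Pm U J) *m Pm U J) k l =
  (2^-1 * \sum_(i < J.*2) Mc U i k * Mc U i l)%:C%C -
  'i%C * (2^-1 * \sum_(p < J) (Mc U p.*2 k * Mc U p.*2.+1 l - Mc U p.*2.+1 k * Mc U p.*2 l))%:C%C.
Proof.
move=> Jn; rewrite mxE (sum_double J (fun i => Mc U i k * Mc U i l)) !mulr_sumr !rmorph_sum mulr_sumr -sumrB.
apply: eq_bigr => p _; rewrite [adjm _ _ _]mxE [map_mx _ _ _ _]mxE !PmE // -/(Mc U p.*2 k) -/(Mc U p.*2 l) -/(Mc U p.*2.+1 k) -/(Mc U p.*2.+1 l).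
rewrite /hf; set h := (Num.sqrt 2)^-1.
have hh : h * h = 2^-1 by rewrite /h -invfM -expr2 sqr_sqrtr ?ler0n.
move: (Mc U p.*2 k) (Mc U p.*2 l) (Mc U p.*2.+1 k) (Mc U p.*2.+1 l) => a b c d.
rewrite -hh; apply/eqP; rewrite eq_complex; apply/andP; split; apply/eqP => /=; ring.
Qed.

(** A step differs from the identity by a matrix of rank 2, so Sylvester's identity reduces a minor
    of any size to a 2 by 2 determinant in the Gram matrix of [Pm]. *)
Lemma lead_det U J : (J <= n)%N -> \det (lead J (cj (cm (so_mx (wk U))))) =
  ((1 - 2 * Sq * fb J U) +i* (- (2 * sin theta * fY J U)))%C.
Proof.
move=> Jn; rewrite lead_wk // det_sylvester -mulmxA det_mx22E.
have G00 : (adjm (Pm U J) *m Pm U J) 0 0 = (fA J U)%:C%C.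
  rewrite gram_Pm // [X in _ - 'i%C * (_ * X)%:C%C]big1; last by move=> p _; rewrite mulrC subrr.
  rewrite mulr0 (_ : 0%:C%C = 0) // mulr0 subr0.
  by congr (_%:C%C); rewrite /fA; congr (_ * _); apply: eq_bigr => i _; rewrite /Mc Ucol0 expr2.
have G11 : (adjm (Pm U J) *m Pm U J) 1 1 = (fB J U)%:C%C.
  rewrite gram_Pm // [X in _ - 'i%C * (_ * X)%:C%C]big1; last by move=> p _; rewrite mulrC subrr.
  rewrite mulr0 (_ : 0%:C%C = 0) // mulr0 subr0.
  by congr (_%:C%C); rewrite /fB; congr (_ * _); apply: eq_bigr => i _; rewrite /Mc Ucol1 expr2.
have G01 : (adjm (Pm U J) *m Pm U J) 0 1 = (fX J U)%:C%C - 'i%C * (fY J U)%:C%C.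
  rewrite gram_Pm //= /fX /fY; congr (_%:C%C - 'i%C * _%:C%C); congr (_ * _);
    by apply: eq_bigr => i _; rewrite /Mc !Ucol0 !Ucol1.
have G10 : (adjm (Pm U J) *m Pm U J) 1 0 = (fX J U)%:C%C + 'i%C * (fY J U)%:C%C.
  rewrite gram_Pm //= /fX /fY -mulrN -rmorphN -mulrN -sumrN; congr (_%:C%C + 'i%C * _%:C%C); congr (_ * _);
    by apply: eq_bigr => i _; rewrite /Mc !Ucol0 !Ucol1 /uu /vv; ring.
rewrite !mxE !big_ord_recl !big_ord0 /= !addr0.
have l1 : lift ord0 ord0 = 1 :> 'I_2 by exact: val_inj.
rewrite l1 !G00 !G11 !G01 !G10 !mxE /=.
have cs := cos2Dsin2 theta; have ch := cos_half.
rewrite /fb; move: (fA J U) (fB J U) (fX J U) (fY J U) => A B X Y.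
have s2 : sin theta * sin theta = 4 * Sq * (1 - Sq).
  by rewrite -expr2 sin2cos2 ch; ring.
rewrite ch; apply/eqP; rewrite eq_complex; apply/andP; split; apply/eqP => /=.
  transitivity (1 - 2 * Sq * (A + B) + (4 * Sq ^+ 2 + sin theta * sin theta) * (A * B - X ^+ 2 - Y ^+ 2)); last first.
    by rewrite s2; ring.
  by ring.
by ring.
Qed.

Hypothesis S1 : Sq <= 1.

(** With [S] the squared sine of the half angle, [sin theta ^ 2 = 4 S (1 - S)]. Together with
    [2 |Y| <= b] this bounds the squared modulus by [1 - 4 S b (1 - b)]. *)
Lemma lead_norm U J : (J <= n)%N -> `|\det (lead J (cj (cm (so_mx (wk U)))))| <=
  (expR (- (2 * Sq) * (fb J U * (1 - fb J U))))%:C%C.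
Proof.
move=> Jn; rewrite lead_det // normc_def lecR /=.
have b1 := fY_le U Jn; have /andP[b2 b3] := fb01 U Jn.
rewrite -[leRHS]ger0_norm ?expR_ge0 // -sqrtr_sqr ler_wsqrtr // -expRM_natl.
apply: le_trans (expR_ge1Dx _).
have s2 : sin theta ^+ 2 = 4 * Sq * (1 - Sq).
  by rewrite sin2cos2 cos_half; ring.
have y2 : fY J U ^+ 2 = `|fY J U| ^+ 2 by rewrite real_normK // num_real.
have h : 4 * fY J U ^+ 2 <= fb J U ^+ 2.
  by rewrite y2 (_ : 4 * _ = (2 * `|fY J U|) ^+ 2) ?lerXn2r ?nnegrE ?mulr_ge0 //; ring.
have h2 : 0 <= 4 * Sq * (1 - Sq) * (fb J U ^+ 2 - 4 * fY J U ^+ 2).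
  by rewrite mulr_ge0 ?subr_ge0 // mulr_ge0 ?subr_ge0 // mulr_ge0 // sqr_ge0.
move: h2; move: (fb J U) (fY J U) => b y h2.
rewrite sqrrN exprMn (exprMn _ 2) s2; move: h2; move: (Sq) => S h2.
rewrite -subr_ge0; congr (0 <= _): h2; ring.
Qed.

Lemma Fa_norm (a : 'I_n -> nat) U : `|complex.Re (Fa a (cj (cm (so_mx (wk U)))))| <= expR (- (2 * Sq) * Psi a U).
Proof.
rewrite -lecR; apply: le_trans (normc_ge_Re _) _; rewrite /Fa normr_prod /Psi mulr_sumr expR_sum rmorph_prod.
apply: ler_prod => j _; rewrite normr_ge0 normrX /=.
rewrite mulrCA expRM_natl rmorphXn lerXn2r ?nnegrE ?lead_norm //; last first.
by rewrite lecR expR_ge0.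
Qed.

End PointwiseBound.

(** * Integration by parts along rotations *)

Section Calculus.
Context {R : realType} {T : Type}.
Implicit Types (F : R -> T -> R) (f : T -> R).

(* [dd F f]: uniformly in [x], [h |-> F h x] has derivative [f x] at [0], with a
   quadratic remainder on [0, 1]. *)
Definition dd F f := exists K, forall h x, 0 <= h <= 1 ->
  [/\ `|F h x| <= K, `|f x| <= K & `|F h x - F 0 x - h * f x| <= K * h ^+ 2].

Lemma eq_dd F F' f f' : (forall h x, 0 <= h <= 1 -> F h x = F' h x) -> f =1 f' -> dd F f -> dd F' f'.
Proof.
move=> eF /funext <- [K hK]; exists K => h x h1; have := hK h x h1.
by rewrite !eF // lexx ler01.
Qed.

Lemma dd_cst f M : (forall x, `|f x| <= M) -> dd (fun _ => f) (fun=> 0).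
Proof.
move=> hM; exists M => h x h1; split; rewrite ?normr0 //; first exact: le_trans (hM x).
rewrite subrr mulr0 subrr normr0 mulr_ge0 ?sqr_ge0 //; exact: le_trans (hM x).
Qed.

Lemma ddD F f F' f' : dd F f -> dd F' f' -> dd (fun h x => F h x + F' h x) (fun x => f x + f' x).
Proof.
move=> [K hK] [K' hK']; exists (K + K') => h x h1.
have [a b c] := hK h x h1; have [a' b' c'] := hK' h x h1; split.
- by apply: le_trans (ler_normD _ _) _; rewrite lerD.
- by apply: le_trans (ler_normD _ _) _; rewrite lerD.
- rewrite (_ : _ - _ - _ = (F h x - F 0 x - h * f x) + (F' h x - F' 0 x - h * f' x)); last by ring.
  by apply: le_trans (ler_normD _ _) _; rewrite mulrDl lerD.
Qed.

Lemma ddM F f F' f' : dd F f -> dd F' f' ->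
  dd (fun h x => F h x * F' h x) (fun x => f x * F' 0 x + F 0 x * f' x).
Proof.
move=> [K hK] [K' hK']; exists (4 * (K * K')) => h x h1.
have h0 : 0 <= (0 : R) <= 1 by rewrite lexx ler01.
have [a b c] := hK h x h1; have [a' b' c'] := hK' h x h1.
have [a0 _ _] := hK 0 x h0; have [a0' _ _] := hK' 0 x h0.
have K0 := le_trans (normr_ge0 _) a; have K0' := le_trans (normr_ge0 _) a'.
have KK : 0 <= K * K' by rewrite mulr_ge0.
split.
- by apply: (@le_trans _ _ (K * K')); [rewrite normrM ler_pM | lra].
- apply: le_trans (ler_normD _ _) _; rewrite !normrM.
  have := ler_pM (normr_ge0 _) (normr_ge0 _) b a0'; have := ler_pM (normr_ge0 _) (normr_ge0 _) a0 b'; lra.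
- have /andP[hh0 hh1] := h1.
  rewrite (_ : _ - _ - _ = (F h x - F 0 x - h * f x) * F' 0 x + F h x * (F' h x - F' 0 x - h * f' x)
     + h * f' x * (F h x - F 0 x)); last by ring.
  have t1 : `|(F h x - F 0 x - h * f x) * F' 0 x| <= K * h ^+ 2 * K' by rewrite normrM ler_pM.
  have t2 : `|F h x * (F' h x - F' 0 x - h * f' x)| <= K * (K' * h ^+ 2) by rewrite normrM ler_pM.
  have e1 : `|h * f x| <= h * K by rewrite normrM ger0_norm // ler_wpM2l.
  have e2 : `|h * f' x| <= h * K' by rewrite normrM ger0_norm // ler_wpM2l.
  have e3 : `|F h x - F 0 x| <= h * (2 * K).
    rewrite -(subrK (h * f x) (F h x - F 0 x)); apply: le_trans (ler_normD _ _) _.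
    have : K * h ^+ 2 <= K * h by rewrite ler_wpM2l // expr2 ler_piMr.
    by move: c e1; lra.
  have t3 : `|h * f' x * (F h x - F 0 x)| <= h * K' * (h * (2 * K)) by rewrite normrM ler_pM.
  apply: le_trans (ler_normD _ _) _; apply: le_trans (lerD (ler_normD _ _) (lexx _)) _.
  apply: le_trans (lerD (lerD t1 t2) t3) _; rewrite le_eqVlt; apply/orP; left; apply/eqP; ring.
Qed.

Lemma ddZ c F f : dd F f -> dd (fun h x => c * F h x) (fun x => c * f x).
Proof.
move=> hF; have := ddM (dd_cst (fun x => lexx `|(fun=> c) x|)) hF; apply: eq_dd => // x /=.
by rewrite mul0r add0r.
Qed.

Lemma dd_sum (I : Type) (s : seq I) (F : I -> R -> T -> R) (f : I -> T -> R) :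
  (forall i, dd (F i) (f i)) -> dd (fun h x => \sum_(i <- s) F i h x) (fun x => \sum_(i <- s) f i x).
Proof.
move=> h; elim: s => [|i s IH].
  by exists 0 => h' x _; rewrite !big_nil mulr0 !subr0 normr0 mul0r lexx; split.
by have := ddD (h i) IH; apply: eq_dd => [? ? _|?]; rewrite big_cons.
Qed.

(** Bounds on value and derivative and a quadratic Taylor remainder on bounded parts of [D]: what
    the chain rule for [dd] consumes. For [ln (1 + y)] the domain is the half-line of nonnegative
    numbers. *)
Definition c11 (D : R -> Prop) (phi phi' : R -> R) := forall M, exists L, forall x y,
  D x -> D y -> `|x| <= M -> `|y| <= M ->
  [/\ `|phi x| <= L, `|phi' x| <= L & `|phi y - phi x - phi' x * (y - x)| <= L * (y - x) ^+ 2].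

Lemma dd_comp D phi phi' F f : c11 D phi phi' -> (forall h x, 0 <= h <= 1 -> D (F h x)) ->
  dd F f -> dd (fun h x => phi (F h x)) (fun x => phi' (F 0 x) * f x).
Proof.
move=> hphi hD [K hK]; have [L hL] := hphi K.
exists (L + L * K + 4 * (L * (K * K))) => h x h1.
have h0 : 0 <= (0 : R) <= 1 by rewrite lexx ler01.
have [a b c] := hK h x h1; have [a0 _ _] := hK 0 x h0.
have K0 := le_trans (normr_ge0 _) a.
have [p1 p2 _] := hL _ _ (hD h x h1) (hD 0 x h0) a a0.
have [q1 q2 q3] := hL _ _ (hD 0 x h0) (hD h x h1) a0 a.
have L0 := le_trans (normr_ge0 _) p1.
have LK : 0 <= L * K by rewrite mulr_ge0.
have LKK : 0 <= L * (K * K) by rewrite !mulr_ge0.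
have /andP[hh0 hh1] := h1.
have t : `|phi' (F 0 x) * f x| <= L * K by rewrite normrM ler_pM.
split; [lra | lra |].
have e1 : `|h * f x| <= h * K by rewrite normrM ger0_norm // ler_wpM2l.
have e3 : `|F h x - F 0 x| <= h * (2 * K).
  rewrite -(subrK (h * f x) (F h x - F 0 x)); apply: le_trans (ler_normD _ _) _.
  have : K * h ^+ 2 <= K * h by rewrite ler_wpM2l // expr2 ler_piMr.
  by move: c e1; lra.
have e4 : (F h x - F 0 x) ^+ 2 <= (h * (2 * K)) ^+ 2.
  by rewrite -[leLHS]real_normK ?num_real // lerXn2r ?nnegrE // mulr_ge0 // mulr_ge0.
rewrite (_ : _ - _ - _ = (phi (F h x) - phi (F 0 x) - phi' (F 0 x) * (F h x - F 0 x))
   + phi' (F 0 x) * (F h x - F 0 x - h * f x)); last by ring.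
apply: le_trans (ler_normD _ _) _.
have t2 : `|phi' (F 0 x) * (F h x - F 0 x - h * f x)| <= L * (K * h ^+ 2) by rewrite normrM ler_pM.
apply: le_trans (lerD q3 t2) _; apply: le_trans (lerD (ler_wpM2l L0 e4) (lexx _)) _.
have : 0 <= L * h ^+ 2 by rewrite mulr_ge0 // sqr_ge0.
rewrite !exprMn; lra.
Qed.

End Calculus.

Section C11Functions.
Context {R : realType}.

Lemma exp_quad (d : R) : 0 <= expR d - 1 - d <= d ^+ 2 * expR `|d|.
Proof.
have h1 := expR_ge1Dx d; have h2 := expR_ge1Dx (- d).
have e0 := expR_gt0 d; have eN : expR d * expR (- d) = 1 by rewrite -expRD subrr expR0.
have h3 : expR d - 1 <= d * expR d by nra.
apply/andP; split; first lra.
have [d0|d0] := leP 0 d.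
  rewrite ger0_norm //; have : d * (expR d - 1) <= d * (d * expR d) by rewrite ler_wpM2l.
  rewrite expr2 -mulrA; nra.
have h4 : d * (expR d - 1) <= d * d by nra.
have : 1 <= expR `|d| by apply: le_trans (expR_ge1Dx _); rewrite lerDl.
have := sqr_ge0 d; rewrite expr2; nra.
Qed.

Lemma c11_expR : c11 (fun=> True) (@expR R) expR.
Proof.
move=> M; exists (expR (3 * M)) => x y _ _ hx hy.
have M0 := le_trans (normr_ge0 _) hx.
have ex : `|expR x| <= expR (3 * M).
  by rewrite ger0_norm ?expR_ge0 // ler_expR; have := ler_norm x; lra.
split=> //.
have -> : expR y - expR x - expR x * (y - x) = expR x * (expR (y - x) - 1 - (y - x)).
  have -> : expR y = expR x * expR (y - x) by rewrite -expRD addrC subrK.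
  by ring.
have /andP[q0 q1] := exp_quad (y - x).
rewrite normrM (ger0_norm (expR_ge0 _)) (ger0_norm q0).
apply: le_trans (ler_wpM2l (expR_ge0 _) q1) _; rewrite mulrCA mulrC ler_wpM2r ?sqr_ge0 //.
rewrite -expRD ler_expR; have := ler_norm x; have := ler_normB y x; lra.
Qed.

Lemma ln1p_le (z : R) : -1 < z -> ln (1 + z) <= z.
Proof.
move=> z1; rewrite -[leRHS]expRK ler_ln ?posrE ?expR_gt0 //; last lra.
exact: expR_ge1Dx.
Qed.

Lemma ln1p_ge (z : R) : -1 < z -> z / (1 + z) <= ln (1 + z).
Proof.
move=> z1; have z0 : 0 < 1 + z by lra.
have h : -1 < - (z / (1 + z)).
  by rewrite ltrN2 ltr_pdivrMr //; lra.
have := ln1p_le h; have -> : 1 + - (z / (1 + z)) = (1 + z)^-1 by field; rewrite lt0r_neq0.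
by rewrite lnV ?posrE // lerNl opprK.
Qed.

Lemma c11_ln1p : c11 (fun y => 0 <= y) (fun y : R => ln (1 + y)) (fun y => (1 + y)^-1).
Proof.
move=> M; exists (M + 1) => x y x0 y0 hx hy.
have M0 := le_trans (normr_ge0 _) hx.
have x1 : 0 < 1 + x by lra. have y1 : 0 < 1 + y by lra.
have i1 : (1 + x)^-1 <= 1 by rewrite invf_le1 //; lra.
have i0 : 0 < (1 + x)^-1 by rewrite invr_gt0.
split.
- rewrite ger0_norm ?ln_ge0 //; last lra.
  have := @ln1p_le x; rewrite ger0_norm // in hx *; lra.
- by rewrite (ger0_norm (ltW i0)); apply: le_trans i1 _; lra.
pose z := (y - x) / (1 + x).
have z1 : -1 < z by rewrite /z ltr_pdivlMr //; lra.
have e : ln (1 + y) - ln (1 + x) = ln (1 + z).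
  have -> : 1 + z = (1 + y) / (1 + x) by rewrite /z; field; rewrite lt0r_neq0.
  by rewrite ln_div ?posrE.
rewrite e mulrC -/z; have h1 := ln1p_le z1; have h2 := ln1p_ge z1.
have h3 : z - z / (1 + z) <= (y - x) ^+ 2.
  have -> : z - z / (1 + z) = (y - x) ^+ 2 * ((1 + x)^-1 * (1 + y)^-1).
    rewrite /z; field; rewrite !lt0r_neq0 //=; lra.
  have j1 : (1 + y)^-1 <= 1 by rewrite invf_le1 //; lra.
  rewrite ler_piMr ?sqr_ge0 //; apply: mulr_ile1 => //; first exact: ltW.
  by rewrite invr_ge0 ltW.
have := sqr_ge0 (y - x); rewrite ler0_norm; nra.
Qed.

End C11Functions.

(** * Rotations of two coordinates *)

Section Rotations.
Context {R : realType} {N : nat}.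
Local Notation G := (SO R N).
Variable nu : probability G R.
Hypothesis nuH : is_haar nu.
Local Notation E := (Ex nu).

Definition rotmx (i q : 'I_N) (c s : R) : 'M[R]_N :=
  1%:M + (c - 1) *: (delta_mx i i + delta_mx q q) + s *: (delta_mx i q - delta_mx q i).

Lemma rotmx_SO i q c s : i != q -> c ^+ 2 + s ^+ 2 = 1 -> special_orthogonal (rotmx i q c s).
Proof.
move=> iq cs; pose P : 'M[R]_(N, 2) := \matrix_(a, k) (a == (if k == 0 then i else q))%:R.
pose K : 'M[R]_2 := \matrix_(k, l) (if k == l then c - 1 else if k == 0 then s else - s).
have PP : P^T *m P = 1%:M.
  apply/matrixP => k l; rewrite !mxE; under eq_bigr do rewrite !mxE.
  rewrite (bigD1 (if k == 0 then i else q)) //= eqxx mul1r big1 ?addr0 => [|a /negPf ->]; last by rewrite mul0r.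
  case: k => [[|[|//]] hk]; case: l => [[|[|//]] hl] //=; rewrite ?eqxx // ?(negPf iq) //.
  by rewrite eq_sym (negPf iq).
have e : rotmx i q c s = 1%:M + P *m K *m P^T.
  apply/matrixP => a b; rewrite !mxE !big_ord_recl !big_ord0 !mxE !big_ord_recl !big_ord0 !mxE /=.
  case: (eqVneq a i) => [->|ai]; case: (eqVneq b i) => [->|bi]; rewrite ?(negPf iq) ?eqxx /=;
    case: (eqVneq b q) => [bq|bq]; rewrite ?(negPf iq) ?[q == i]eq_sym ?(negPf iq) ?eqxx /=;
    try (case: (eqVneq a q) => [aq|aq]; rewrite /=); ring.
have cs' : c * c = 1 - s * s by move: cs; rewrite !expr2; lra.
have KK : K^T + K + K^T *m K = 0.
  apply/matrixP => k l; rewrite !mxE !big_ord_recl big_ord0 !mxE.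
  by case: k => [[|[|//]] hk]; case: l => [[|[|//]] hl] /=; ring: cs'.
rewrite /special_orthogonal e; apply/andP; split; apply/eqP.
  have -> : (1%:M + P *m K *m P^T)^T = 1%:M + P *m (K^T *m P^T).
    by rewrite linearD /= trmx1 !trmx_mul trmxK.
  rewrite mulmxDl mul1mx mulmxDr mulmx1 -addrA -[RHS]addr0; congr (_ + _).
  rewrite (_ : P *m K *m P^T + (P *m (K^T *m P^T) + P *m (K^T *m P^T) *m (P *m K *m P^T)) =
    P *m (K^T + K + K^T *m K) *m P^T); first by rewrite KK mulmx0 mul0mx.
  have -> : P *m (K^T *m P^T) *m (P *m K *m P^T) = P *m (K^T *m K) *m P^T.
    by rewrite !mulmxA -(mulmxA _ P^T P) PP mulmx1.
  by rewrite !mulmxDr !mulmxDl !mulmxA addrA [X in X + _ = _]addrC.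
rewrite -mulmxA det_sylvester -mulmxA PP mulmx1 det_mx22E !mxE /=.
by ring: cs'.
Qed.

(** The parameter is the sine of the angle; at 0 this gives the same derivative as the angle itself,
    and only a square root has to be estimated. When [h] is not a sine the value is the identity. *)
Definition rg (i q : 'I_N) (h : R) : G := insubd (1%g : G) (rotmx i q (Num.sqrt (1 - h ^+ 2)) h).

Lemma rgE i q h : i != q -> 0 <= h <= 1 -> so_mx (rg i q h) = rotmx i q (Num.sqrt (1 - h ^+ 2)) h.
Proof.
move=> iq /andP[h0 h1]; rewrite /rg insubdK // unfold_in; apply: rotmx_SO => //.
by rewrite sqr_sqrtr ?subrK // subr_ge0 exprn_ile1.
Qed.

Lemma sqrt_quad (h : R) : 0 <= h <= 1 -> `|Num.sqrt (1 - h ^+ 2) - 1| <= h ^+ 2.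
Proof.
move=> /andP[h0 h1]; set c := Num.sqrt _; have c0 : 0 <= c by exact: sqrtr_ge0.
have hh : 0 <= 1 - h ^+ 2 by rewrite subr_ge0 exprn_ile1.
have cc : c ^+ 2 = 1 - h ^+ 2 by rewrite sqr_sqrtr.
have c1 : c <= 1 by rewrite -(@ler_pXn2r _ 2) ?nnegrE // cc expr1n gerBl sqr_ge0.
by rewrite ler0_norm ?subr_le0 // opprB; nra.
Qed.

Lemma rotmx_entry i q c s (M : 'M[R]_N) a b : i != q -> (rotmx i q c s *m M) a b =
  M a b + (if a == i then (c - 1) * M i b + s * M q b else
           if a == q then (c - 1) * M q b - s * M i b else 0).
Proof.
move=> iq; have dm (x y : 'I_N) : (delta_mx x y *m M) a b = (a == x)%:R * M y b.
  rewrite mxE (bigD1 y) //= mxE eqxx andbT big1 ?addr0 // => k ky.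
  by rewrite mxE (negPf ky) andbF mul0r.
rewrite /rotmx !mulmxDl mul1mx -!scalemxAl mulmxDl mulmxBl [LHS]mxE [X in X + _]mxE -addrA; congr (_ + _).
have sE x (Y : 'M[R]_N) : (x *: Y) a b = x * Y a b by rewrite mxE.
have aE (Y Z : 'M[R]_N) : (Y + Z) a b = Y a b + Z a b by rewrite mxE.
have bE (Y Z : 'M[R]_N) : (Y - Z) a b = Y a b - Z a b by rewrite !mxE.
rewrite !sE aE bE !dm; case: (eqVneq a i) => [->|ai]; first by rewrite (negPf iq) /=; ring.
by case: (a == q) => /=; ring.
Qed.

Lemma dd_entry i q a b : i != q -> dd (fun h (U : G) => so_mx (rg i q h * U)%g a b)
  (fun U => if a == i then so_mx U q b else if a == q then - so_mx U i b else 0).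
Proof.
move=> iq; exists 2 => h U h1; have /andP[h0 hle] := h1.
have z1 : 0 <= (0 : R) <= 1 by rewrite lexx ler01.
split; first by apply: le_trans (entry_le1 _ _ _) _; rewrite ler1n.
  case: ifP => _; last case: ifP => _; rewrite ?normrN ?normr0 //;
    by apply: le_trans (entry_le1 _ _ _) _; rewrite ler1n.
have e x : 0 <= x <= 1 -> so_mx (rg i q x * U)%g a b = (rotmx i q (Num.sqrt (1 - x ^+ 2)) x *m so_mx U) a b.
  by move=> hx; rewrite -(rgE iq hx).
rewrite !e // !rotmx_entry // expr0n subr0 sqrtr1 subrr !mul0r.
have sq := sqrt_quad h1; set c := Num.sqrt _ - 1 in sq *.
have c2 x : `|x| <= 1 -> `|c * x| <= h ^+ 2.
  by move=> x1; rewrite normrM; apply: le_trans (ler_pM _ _ sq x1) _; rewrite ?mulr1.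
have t1 := c2 _ (entry_le1 U i b); have t2 := c2 _ (entry_le1 U q b).
have hh : 0 <= h ^+ 2 by exact: sqr_ge0.
have two x : `|x| <= h ^+ 2 -> `|x| <= 2 * h ^+ 2 by move=> ?; lra.
case: (a == i); last case: (a == q).
- rewrite (_ : _ - _ = c * so_mx U i b); last by ring.
  exact: two.
- rewrite (_ : _ - _ = c * so_mx U q b); last by ring.
  exact: two.
- rewrite (_ : _ - _ = 0); last by ring.
  by rewrite normr0 mulr_ge0.
Qed.

End Rotations.

(** * Integration by parts *)

Section Ibp.
Context {R : realType} {N : nat}.
Local Notation G := (SO R N).
Variable nu : probability G R.
Hypothesis nuH : is_haar nu.
Local Notation E := (Ex nu).

Lemma rg0 i q : i != q -> rg i q 0 = 1%g :> G.
Proof.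
move=> iq; apply: val_inj; rewrite /= rgE ?lexx ?ler01 // expr0n subr0 sqrtr1 /rotmx.
by rewrite subrr !scale0r !addr0.
Qed.

Lemma rotmx_tr (i q : 'I_N) (c s : R) : (rotmx i q c s)^T = rotmx q i c s.
Proof.
apply/matrixP => a b; rewrite !mxE [b == a]eq_sym ![(b == _) && _]andbC; ring.
Qed.

Lemma dd_entry_right i q a b : i != q -> dd (fun h (U : G) => so_mx (U * rg i q h)%g a b)
  (fun U => if b == q then so_mx U a i else if b == i then - so_mx U a q else 0).
Proof.
move=> iq; have qi : q != i by rewrite eq_sym.
have [K hK] := dd_entry (R := R) b a qi; exists K => h U h1.
have eq x : 0 <= x <= 1 -> so_mx (U * rg i q x)%g a b = so_mx (rg q i x * U^-1)%g b a.
  move=> hx; rewrite [LHS](_ : _ = (so_mx U *m rotmx i q (Num.sqrt (1 - x ^+ 2)) x) a b); last first.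
    by rewrite -(rgE iq hx).
  rewrite [RHS](_ : _ = (rotmx q i (Num.sqrt (1 - x ^+ 2)) x *m (so_mx U)^T) b a); last first.
    by rewrite -(rgE qi hx).
  by rewrite -(rotmx_tr i q) -trmx_mul [RHS]mxE.
have vE x y : so_mx U^-1%g x y = so_mx U y x by rewrite [LHS]mxE.
have h00 : 0 <= (0 : R) <= 1 by rewrite lexx ler01.
by have := hK h U^-1%g h1; rewrite !eq // !vE.
Qed.

(** The mean of the difference quotient is 0, and by the uniform quadratic remainder it tends to the
    mean of [g]. *)
Lemma dd_mean d (T : measurableType d) (P : probability T R) (F : R -> T -> R) g :
  (forall h, 0 <= h <= 1 -> bmf (F h)) -> bmf g -> dd F g ->
  (forall h, 0 <= h <= 1 -> Ex P (F h) = Ex P (F 0)) -> Ex P g = 0.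
Proof.
move=> bF bg [K hK] e; apply/eqP; rewrite -normr_eq0; apply/eqP; apply/le_anti.
rewrite normr_ge0 andbT; have K0 : 0 <= K.
  suff : `|Ex P (F 0)| <= K by exact: le_trans.
  apply: Ex_norm_le => [|x]; first by apply: bF; rewrite lexx ler01.
  by have [|] := hK 0 x; rewrite ?lexx ?ler01.
apply/ler_addgt0Pl => e0 e0p; rewrite addr0.
pose h := Num.min 1 (e0 / (K + 1)).
have hp : 0 < h by rewrite lt_min ltr01 divr_gt0 //; lra.
have h1 : 0 <= h <= 1 by rewrite ltW // ge_min lexx.
have hle : K * h <= e0.
  apply: (@le_trans _ _ ((K + 1) * (e0 / (K + 1)))); last by rewrite mulrC divfK // lt0r_neq0 //; lra.
  by rewrite ler_pM //; [exact: ltW | lra | rewrite ge_min lexx orbT].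
have h00 : 0 <= (0 : R) <= 1 by rewrite lexx ler01.
have : `|Ex P (fun x => F h x - F 0 x - h * g x)| <= K * h ^+ 2.
  apply: Ex_norm_le => [|x]; last by have [] := hK h x h1.
  by apply: bmfB; [apply: bmfB; exact: bF | exact: bmfZ].
rewrite ExB ?ExB ?ExZ //; [|exact: bF|exact: bF|by apply: bmfB; exact: bF|exact: bmfZ].
rewrite e // subrr sub0r normrN normrM (gtr0_norm hp) expr2 mulrA [leRHS]mulrC ler_pM2l //.
by move=> t; apply: le_trans t hle.
Qed.

Lemma ibp_left i q (f g : G -> R) : i != q -> bmf f -> bmf g ->
  dd (fun h U => f (rg i q h * U)%g) g -> E g = 0.
Proof.
move=> iq bf bg h; apply: (dd_mean (P := nu) _ bg h) => [x _|x _]; first exact: bmf_left.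
by rewrite !Ex_left.
Qed.

Lemma ibp_right i q (f g : G -> R) : i != q -> bmf f -> bmf g ->
  dd (fun h U => f (U * rg i q h)%g) g -> E g = 0.
Proof.
move=> iq bf bg h; apply: (dd_mean (P := nu) _ bg h) => [x _|x _]; first exact: bmf_right.
by rewrite !Ex_right.
Qed.

End Ibp.

(** * Functions of the squared entries of the first column *)

Section RowGradient.
Context {R : realType} {N : nat}.
Local Notation G := (SO R N.+1).
Variable nu : probability G R.
Hypothesis nuH : is_haar nu.
Local Notation E := (Ex nu).
Local Notation u U i := (so_mx U i ord0).

(* [rad H r]: [H] depends on the first column [u] only, and [r i] stands for the
   partial derivative of [H] with respect to [u_i ^ 2]. *)
Definition rad (H : G -> R) (r : 'I_N.+1 -> G -> R) :=
  [/\ bmf H, forall i, bmf (r i) &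
      forall i q, i != q -> dd (fun h U => H (rg i q h * U)%g)
        (fun U => 2 * u U i * u U q * (r i U - r q U))].

Lemma eq_rad H H' r r' : H =1 H' -> (forall i, r i =1 r' i) -> rad H r -> rad H' r'.
Proof.
by move=> /funext <- h; have -> : r' = r by apply/funext => i; apply/funext => x; rewrite h.
Qed.

Lemma rad_cst c : rad (fun=> c) (fun _ _ => 0).
Proof.
split=> [|i|i q iq]; [exact: bmf_cst|exact: bmf_cst|].
apply: eq_dd (dd_cst (f := fun=> c) (M := `|c|) _) => // x /=; by rewrite subrr mulr0.
Qed.

Lemma radD H r H' r' : rad H r -> rad H' r' ->
  rad (fun U => H U + H' U) (fun i U => r i U + r' i U).
Proof.
move=> [b1 c1 d1] [b2 c2 d2]; split=> [|i|i q iq]; [exact: bmfD|exact: bmfD|].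
by apply: eq_dd (ddD (d1 i q iq) (d2 i q iq)) => // x /=; ring.
Qed.

Lemma rg_left0 i q (U : G) : i != q -> (rg i q 0 * U)%g = U.
Proof. by move=> iq; rewrite rg0 // mul1g. Qed.

Lemma radM H r H' r' : rad H r -> rad H' r' ->
  rad (fun U => H U * H' U) (fun i U => r i U * H' U + H U * r' i U).
Proof.
move=> [b1 c1 d1] [b2 c2 d2]; split=> [|i|i q iq]; first exact: bmfM.
  by apply: bmfD; exact: bmfM.
apply: eq_dd (ddM (d1 i q iq) (d2 i q iq)) => // x /=; rewrite rg_left0 //; ring.
Qed.

Lemma radZ c H r : rad H r -> rad (fun U => c * H U) (fun i U => c * r i U).
Proof.
by move=> h; apply: eq_rad (radM (rad_cst c) h) => // i x /=; rewrite mul0r add0r.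
Qed.

Lemma rad_sum (I : Type) (s : seq I) (H : I -> G -> R) r :
  (forall k, rad (H k) (r k)) ->
  rad (fun U => \sum_(k <- s) H k U) (fun i U => \sum_(k <- s) r k i U).
Proof.
move=> h; elim: s => [|k s IH].
  by apply: eq_rad (rad_cst 0) => [x|i x]; rewrite big_nil.
by apply: eq_rad (radD (h k) IH) => [x|i x]; rewrite big_cons.
Qed.

Lemma rad_comp D phi phi' H r : c11 D phi phi' -> (forall U, D (H U)) ->
  bmf (fun U => phi (H U)) -> bmf (fun U => phi' (H U)) -> rad H r ->
  rad (fun U => phi (H U)) (fun i U => phi' (H U) * r i U).
Proof.
move=> hphi hD b1 b2 [b c d]; split=> // [i|i q iq]; first exact: bmfM.
apply: eq_dd (dd_comp hphi (fun h x _ => hD _) (d i q iq)) => // x /=; rewrite rg_left0 //; ring.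
Qed.

Lemma rad_expR H r : rad H r -> rad (fun U => expR (H U)) (fun i U => expR (H U) * r i U).
Proof.
move=> h; have [b _ _] := h; apply: (rad_comp c11_expR) => //; exact: bmf_expR.
Qed.

Lemma rad_sq l : rad (fun U => u U l ^+ 2) (fun i _ => (i == l)%:R).
Proof.
split=> [|i|i q iq]; [by apply: bmfX; exact: bmf_entry|exact: bmf_cst|].
apply: eq_dd (ddM (dd_entry l ord0 iq) (dd_entry l ord0 iq)) => [h x _|x]; first by rewrite expr2.
cbv beta; rewrite rg_left0 //; case: (eqVneq l i) => [->|li].
  by rewrite [q == i]eq_sym (negPf iq) /=; ring.
case: (eqVneq l q) => [->|lq]; first by rewrite /=; ring.
by rewrite /=; ring.
Qed.

Lemma sum_u2 (U : G) : \sum_i u U i ^+ 2 = 1.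
Proof.
have /andP[/eqP /matrixP /(_ ord0 ord0) h _] := so_mxP U; rewrite mxE [RHS]mxE eqxx in h; rewrite -[RHS]h.
by apply: eq_bigr => k _; rewrite expr2 [in RHS]mxE.
Qed.

(** Sum over [q] of the integrations by parts of [u_i u_q H] along the rotation of [i] and [q].
    Since the [u_q ^ 2] add up to 1, the sum closes up to a divergence formula on the sphere in the
    variables [u_q ^ 2]. *)
Lemma ibp_rad H r i : rad H r ->
  E (fun U => (1 - N.+1%:R * u U i ^+ 2) * H U
     + 2 * u U i ^+ 2 * (r i U - \sum_l u U l ^+ 2 * r l U)) = 0.
Proof.
move=> [b c d].
pose g q U := (u U q ^+ 2 - u U i ^+ 2) * H U + u U i * u U q * (2 * u U i * u U q * (r i U - r q U)).
have be l : bmf (fun U : G => u U l) by exact: bmf_entry.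
have bg q : bmf (g q).
  apply: bmfD; first by apply: bmfM b; apply: bmfB; exact: bmfX.
  apply: bmfM; first exact: bmfM.
  apply: bmfM; last exact: bmfB.
  by apply: bmfM => //; exact: bmfZ.
have z q : q != i -> E (g q) = 0.
  rewrite eq_sym => iq; apply: (ibp_left nuH (f := fun U => u U i * u U q * H U) iq) => //.
    by apply: bmfM => //; exact: bmfM.
  apply: eq_dd (ddM (ddM (dd_entry i ord0 iq) (dd_entry q ord0 iq)) (d i q iq)) => // x; cbv beta.
  by rewrite !rg_left0 // !eqxx [q == i]eq_sym (negPf iq) /g; ring.
transitivity (\sum_(q | q != i) E (g q)); last exact: big1.
rewrite big_mkcond /= (_ : \sum_q _ = \sum_q E (fun U => (q != i)%:R * g q U)); last first.
  apply: eq_bigr => q _; rewrite ExZ //; case: (q != i); rewrite ?mul1r ?mul0r //.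
rewrite -Ex_sum; last by move=> q; exact: bmfZ.
congr (Ex _ _); apply/funext => U.
have -> : \sum_q (q != i)%:R * g q U = \sum_q g q U.
  by apply: eq_bigr => q _; case: (eqVneq q i) => [->|_]; rewrite ?mul1r // /g !subrr !mul0r !mulr0 addr0.
rewrite [RHS](eq_bigr (fun q => u U q ^+ 2 * (H U + 2 * u U i ^+ 2 * r i U)
  + (- (u U i ^+ 2 * H U)) - 2 * u U i ^+ 2 * (u U q ^+ 2 * r q U))); last by move=> q _; rewrite /g; ring.
rewrite sumrB big_split /= -mulr_suml sum_u2 sumr_const card_ord -mulr_sumr -mulr_natl.
by ring.
Qed.

End RowGradient.

(** * Means that decrease in a parameter *)

Section ParamDecr.
Context {R : realType} d (T : measurableType d) (P : probability T R).

(** Forces the time into [0, 1]: one instance of [dd], with the time as part of the point, then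
    yields a remainder uniform in time. *)
Definition clamp (x : R) : R := Num.max 0 (Num.min 1 x).

Lemma clamp01 x : 0 <= clamp x <= 1.
Proof. by rewrite /clamp le_max lexx /= ge_max ler01 ge_min lexx. Qed.

Lemma clampK x : 0 <= x <= 1 -> clamp x = x.
Proof. by move=> /andP[x0 x1]; rewrite /clamp min_r // max_r. Qed.

Lemma dd_time : dd (fun h (x : R * T) => clamp x.1 + h) (fun=> 1).
Proof.
exists 2 => h x /andP[h0 h1]; have /andP[c0 c1] := clamp01 x.1; split.
- by rewrite ger0_norm; lra.
- by rewrite normr1; lra.
- rewrite (_ : _ - _ = 0); last by ring.
  by rewrite normr0 mulr_ge0 ?sqr_ge0.
Qed.

(** Over [m] equal steps the quadratic remainders add up to [K / m], so the mean need not be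
    differentiated as a function of time. *)
Lemma param_decr (f df : R -> T -> R) :
  (forall t, 0 <= t -> bmf (f t)) -> (forall t, 0 <= t <= 1 -> bmf (df t)) ->
  dd (fun h x => f (clamp x.1 + h) x.2) (fun x => df (clamp x.1) x.2) ->
  (forall t, 0 <= t <= 1 -> Ex P (df t) <= 0) -> Ex P (f 1) <= Ex P (f 0).
Proof.
move=> bf bdf [K hK] neg.
have K0 : 0 <= K.
  suff : `|Ex P (f (clamp 0 + 0))| <= K by exact: le_trans.
  apply: Ex_norm_le => [|x].
    by apply: bf; rewrite addr0; have /andP[] := clamp01 0.
  by have [|] := hK 0 (0, x); rewrite ?lexx ?ler01.
have step t h : 0 <= t -> 0 <= h -> t + h <= 1 -> Ex P (f (t + h)) <= Ex P (f t) + K * h ^+ 2.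
  move=> t0 h0 th; have t1 : 0 <= t <= 1 by lra.
  have h1 : 0 <= h <= 1 by lra.
  apply: (@le_trans _ _ (Ex P (fun x => f t x + h * df t x + K * h ^+ 2))).
    apply: le_Ex => [||x]; first by apply: bf; lra.
      apply: bmfD; last exact: bmf_cst.
      by apply: bmfD; [exact: bf | apply: bmfZ; exact: bdf].
    have [_ _] := hK h (t, x) h1; rewrite /= clampK // addr0 => hh.
    by have := ler_norm (f (t + h) x - f t x - h * df t x); lra.
  have b1 := bf t t0; have b2 : bmf (fun x => h * df t x) by apply: bmfZ; exact: bdf.
  rewrite ExD; [|exact: bmfD|exact: bmf_cst].
  rewrite ExD // Ex_cst lerD2r gerDl ExZ; last exact: bdf.
  by rewrite mulr_ge0_le0 // neg.
have tel m k : (k <= m.+1)%N -> Ex P (f (k%:R / m.+1%:R)) <= Ex P (f 0) + k%:R * (K / m.+1%:R ^+ 2).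
  elim: k => [|k IH] km; first by rewrite !mul0r addr0.
  have m0 : 0 < m.+1%:R :> R by rewrite ltr0n.
  pose w : R := m.+1%:R^-1; have w0 : 0 <= w by rewrite invr_ge0 ltW.
  have e : k.+1%:R / m.+1%:R = k%:R * w + w by rewrite -natr1 mulrDl mul1r.
  have le1 : k%:R * w + w <= 1 by rewrite -e ler_pdivrMr // mul1r ler_nat.
  have := step _ _ (mulr_ge0 (ler0n _ k) w0) w0 le1; rewrite e => hh.
  apply: le_trans hh _; have := IH (ltnW km); rewrite -[k.+1%:R]natr1 mulrDl mul1r -exprVn -/w; lra.
apply/ler_addgt0Pl => e e0.
have [m hm] : exists m : nat, K / e < m.+1%:R.
  exists (Num.truncn (K / e)); exact: truncnS_gt.
have m0 : 0 < m.+1%:R :> R by rewrite ltr0n.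
have := tel m m.+1 (leqnn _); rewrite divff ?lt0r_neq0 // => h; apply: le_trans h _.
have -> : m.+1%:R * (K / m.+1%:R ^+ 2) = K / m.+1%:R :> R by field; rewrite lt0r_neq0.
rewrite addrC lerD2r.
rewrite ler_pdivrMr // -ler_pdivrMl // mulrC; exact: ltW.
Qed.

End ParamDecr.

Section BoundedLog.
Context {R : realType} d (T : measurableType d).

Lemma bmf_ln1p (f : T -> R) : bmf f -> (forall x, 0 <= f x) -> bmf (fun x => ln (1 + f x)).
Proof.
move=> bf f0; split.
  apply: measurableT_comp; first exact: measurable_ln.
  by have [] : bmf (fun x => 1 + f x) by apply: bmfD; first exact: bmf_cst.
have [_ [M hM]] := bf; exists M => x.
rewrite ger0_norm ?ln_ge0 ?lerDl //; apply: le_trans (ln1p_le _) (le_trans (ler_norm _) (hM x)).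
by apply: lt_le_trans (f0 x); rewrite ltrN10.
Qed.

Lemma bmf_inv1p (f : T -> R) : bmf f -> (forall x, 0 <= f x) -> bmf (fun x => (1 + f x)^-1).
Proof.
move=> bf f0; have := bmf_expR (bmfN (bmf_ln1p bf f0)); congr bmf; apply/funext => x.
by rewrite expRN lnK // posrE ltr_pwDl.
Qed.

End BoundedLog.

(** * The second column, given the first *)

Section ColumnBound.
Context {R : realType} {n : nat}.
Hypothesis n0 : (0 < n)%N.
Local Notation N := n.*2.+1.
Local Notation G := (SO R N).
Variable nu : probability G R.
Hypothesis nuH : is_haar nu.
Local Notation E := (Ex nu).
Local Notation c1 := (inord 1 : 'I_N).

Definition first_col_fun (f : G -> R) := forall U V : G, (forall a, so_mx U a ord0 = so_mx V a ord0) -> f U = f V.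

Lemma first_col_fun_rg f i q h U : first_col_fun f -> i != q -> i != ord0 -> q != ord0 -> 0 <= h <= 1 ->
  f (U * rg i q h)%g = f U.
Proof.
move=> hf iq i0 q0 h1; apply: hf => a.
have qi : q != i by rewrite eq_sym.
have vE (V : G) x y : so_mx V^-1%g x y = so_mx V y x by rewrite [LHS]mxE.
rewrite [LHS](_ : _ = (so_mx U *m rotmx i q (Num.sqrt (1 - h ^+ 2)) h) a ord0); last first.
  by rewrite -(rgE iq h1).
rewrite -(trmxK (so_mx U)) -(rotmx_tr q i) -trmx_mul mxE rotmx_entry //.
by rewrite ![ord0 == _]eq_sym (negPf i0) (negPf q0) addr0 [RHS]mxE.
Qed.

Lemma c1_neq0 : c1 != ord0 :> 'I_N.
Proof. by rewrite -val_eqE /= inordK //; lia. Qed.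

Variable w : 'I_N -> G -> R.
Hypothesis wf : forall a, first_col_fun (w a).
Hypothesis wb : forall a, bmf (w a).
Hypothesis w1 : forall U, \sum_a w a U ^+ 2 <= 1.
Hypothesis w0 : forall U, \sum_a w a U * so_mx U a ord0 = 0.
Let s q U := \sum_a w a U * so_mx U a q.

Let s_bmf q : bmf (s q).
Proof. by apply: bmf_sum => a; apply: bmfM => //; exact: bmf_entry. Qed.

(** The [s q] are the coordinates of [w] in the orthonormal basis of the columns of [U], and the
    coordinate on the first column is 0. *)
Let s_rest U : \sum_(q | (q != ord0) && (q != c1)) s q U ^+ 2 <= 1 - s c1 U ^+ 2.
Proof.
have tot : \sum_q s q U ^+ 2 = \sum_a w a U ^+ 2.
  under eq_bigr => q _ do rewrite expr2 /s mulr_suml.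
  rewrite exchange_big /=; apply: eq_bigr => a _.
  under eq_bigr => q _ do rewrite mulr_sumr.
  rewrite exchange_big /= (bigD1 a) //= [X in _ + X]big1 ?addr0 => [|b ba].
    rewrite (eq_bigr (fun q => w a U ^+ 2 * so_mx U a q ^+ 2)); last by move=> q _; ring.
    rewrite -mulr_sumr (_ : \sum_q _ = 1) ?mulr1 //.
    rewrite -[RHS](_ : (so_mx U *m (so_mx U)^T) a a = 1); first by rewrite mxE; apply: eq_bigr => k _; rewrite mxE expr2.
    by have /andP[/eqP /mulmx1C -> _] := so_mxP U; rewrite mxE eqxx.
  rewrite (eq_bigr (fun q => w a U * w b U * (so_mx U a q * so_mx U b q))); last by move=> q _; ring.
  rewrite -mulr_sumr (_ : \sum_q _ = 0) ?mulr0 //.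
  rewrite -[RHS](_ : (so_mx U *m (so_mx U)^T) a b = 0); first by rewrite mxE; apply: eq_bigr => k _; rewrite mxE.
  by have /andP[/eqP /mulmx1C -> _] := so_mxP U; rewrite mxE eq_sym (negPf ba).
have := w1 U; rewrite -tot (bigD1 ord0) //= (bigD1 c1) /=; last exact: c1_neq0.
by rewrite {1}/s w0 expr0n /= add0r; lra.
Qed.

Let s_le1 U : s c1 U ^+ 2 <= 1.
Proof.
have := s_rest U; have : 0 <= \sum_(q | (q != ord0) && (q != c1)) s q U ^+ 2 by apply: sumr_ge0 => q _; exact: sqr_ge0.
by lra.
Qed.

Lemma dd_s q b : q != ord0 -> b != ord0 -> b != q -> dd (fun h U => s b (U * rg q b h)%g) (fun U => s q U).
Proof.
move=> q0 b0 bq; have qb : q != b by rewrite eq_sym.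
apply: eq_dd (dd_sum (index_enum 'I_N) (F := fun a h U => w a U * so_mx (U * rg q b h)%g a b)
  (f := fun a U => w a U * so_mx U a q) _).
- move=> h U h1; apply: eq_bigr => a _; congr (_ * _).
  by rewrite (@first_col_fun_rg _ q b).
- by [].
move=> a; have [_ [M hM]] := wb a.
apply: eq_dd (ddM (dd_cst hM) (dd_entry_right a b qb)) => // U /=.
by rewrite eqxx mul0r add0r.
Qed.

Lemma dd_sN q b : q != ord0 -> b != ord0 -> b != q -> dd (fun h U => s q (U * rg q b h)%g) (fun U => - s b U).
Proof.
move=> q0 b0 bq; have qb : q != b by rewrite eq_sym.
apply: eq_dd (dd_sum (index_enum 'I_N) (F := fun a h U => w a U * so_mx (U * rg q b h)%g a q)
  (f := fun a U => w a U * - so_mx U a b) _).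
- move=> h U h1; apply: eq_bigr => a _; congr (_ * _).
  by rewrite (@first_col_fun_rg _ q b).
- by move=> U; rewrite /s -sumrN; apply: eq_bigr => a _; rewrite mulrN.
move=> a; have [_ [M hM]] := wb a.
apply: eq_dd (ddM (dd_cst hM) (dd_entry_right a q qb)) => // U /=.
by rewrite (negPf qb) eqxx mul0r add0r.
Qed.

Variables (g B : G -> R).
Hypotheses (gb : bmf g) (Bb : bmf B) (gf : first_col_fun g) (Bf : first_col_fun B).
Hypotheses (g0 : forall U, 0 <= g U) (B0 : forall U, 0 <= B U).
Let z U := 1 - s c1 U ^+ 2.
Let ez (t : R) U := expR (- (t * B U * z U)).

Let z_bmf : bmf z.
Proof. by apply: bmfB; [exact: bmf_cst | exact: bmfX]. Qed.

Let z0 U : 0 <= z U. Proof. by rewrite subr_ge0. Qed.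

Let ez_bmf t : bmf (ez t).
Proof. by apply: bmf_expR; apply: bmfN; apply: bmfM => //; exact: bmfZ. Qed.

(** Integration by parts along the rotations of the second column with each later one. They fix the
    first column, hence [p], [B] and [w]. In the sum the squares of the other [s q] are replaced by
    their upper bound [z]. The result says that, under the weight [ez t], the mean of [z] is at
    least [(N - 2) / (N - 1 + 2 t B)]. *)
Lemma column_ibp (t : R) (p : G -> R) : 0 <= t -> bmf p -> first_col_fun p -> (forall U, 0 <= p U) ->
  0 <= E (fun U => p U * ez t U * (z U * ((N - 1)%:R + 2 * t * B U) - (N - 2)%:R)).
Proof.
move=> t0 pb pf p0.
pose gq q U := p U * ez t U * (s q U ^+ 2 * (1 + 2 * t * B U * s c1 U ^+ 2) - s c1 U ^+ 2).
have bgq q : bmf (gq q).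
  apply: bmfM; first exact: bmfM.
  apply: bmfB; last exact: bmfX.
  apply: bmfM; first exact: bmfX.
  apply: bmfD; first exact: bmf_cst.
  by apply: bmfM; [exact: bmfZ | exact: bmfX].
have z_q q : (q != ord0) && (q != c1) -> E (gq q) = 0.
  move=> /andP[q0 q1]; have q1' : c1 != q by rewrite eq_sym.
  have c10 := c1_neq0.
  apply: (ibp_right nuH (f := fun U => p U * ez t U * (s q U * s c1 U)) q1) => //.
    by apply: bmfM; exact: bmfM.
  have [_ [Mp hMp]] := pb. have [_ [MB hMB]] := Bb.
  have D1 := dd_s q0 c10 q1'. have D2 := dd_sN q0 c10 q1'.
  have Dz := ddD (dd_cst (f := fun=> 1 : R) (M := 1) (fun _ => eq_ind_r (fun x => x <= 1) (lexx 1) (normr1 R))) (ddZ (-1) (ddM D1 D1)).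
  have De := dd_comp c11_expR (fun _ _ _ => I) (ddM (ddZ (- t) (dd_cst hMB)) Dz).
  apply: eq_dd (ddM (ddM (dd_cst hMp) De) (ddM D2 D1)) => [h U h1|U].
    rewrite (first_col_fun_rg U pf q1 q0 c10 h1) /ez /z (first_col_fun_rg U Bf q1 q0 c10 h1).
    by congr (_ * expR _ * _); ring.
  cbv beta; rewrite rg0 // mulg1 /gq /ez /z.
  rewrite (_ : - t * B U * (1 + -1 * (s c1 U * s c1 U)) = - (t * B U * (1 - s c1 U ^+ 2))); last by ring.
  by ring.
have e0 : E (fun U => \sum_(q | (q != ord0) && (q != c1)) gq q U) = 0.
  rewrite [X in E X](_ : _ = (fun U => \sum_q ((q != ord0) && (q != c1))%:R * gq q U)); last first.
    by apply/funext => U; rewrite big_mkcond; apply: eq_bigr => q _; case: ifP; rewrite ?mul1r ?mul0r.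
  rewrite Ex_sum => [|q]; last exact: bmfZ.
  apply: big1 => q _; rewrite ExZ //; case h : ((q != ord0) && (q != c1)); rewrite ?mul0r // mul1r; exact: z_q.
rewrite -e0; apply: le_Ex => [||U].
- rewrite (_ : (fun U => _) = (fun U => \sum_q ((q != ord0) && (q != c1))%:R * gq q U)); last first.
    by apply/funext => U; rewrite big_mkcond; apply: eq_bigr => q _; case: ifP; rewrite ?mul1r ?mul0r.
  by apply: bmf_sum => q; exact: bmfZ.
- apply: bmfM; first exact: bmfM.
  apply: bmfB; last exact: bmf_cst.
  by apply: bmfM => //; apply: bmfD; [exact: bmf_cst | exact: bmfZ].
rewrite /gq -mulr_sumr ler_wpM2l ?mulr_ge0 ?expR_ge0 //.
rewrite sumrB -mulr_suml sumr_const (_ : #|_| = (N - 2)%N); last first.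
  have := cardC (pred2 ord0 c1 : pred 'I_N); rewrite card2 eq_sym c1_neq0 card_ord.
  have -> : #|predC (pred2 ord0 c1 : pred 'I_N)| = #|[pred q : 'I_N | (q != ord0) && (q != c1)]|.
    by apply: eq_card => q; rewrite -!topredE /= negb_or.
  by move=> h; apply/eqP; rewrite -(eqn_add2l 2) h /=; lia.
have tb : 0 <= 2 * t * B U * s c1 U ^+ 2 by apply: mulr_ge0; [apply: mulr_ge0; [exact: mulr_ge0 | exact: B0] | exact: sqr_ge0].
have sr := s_rest U.
apply: le_trans (lerB (ler_wpM2r _ sr) (lexx _)) _; first by rewrite addr_ge0.
rewrite -[s c1 U ^+ 2 *+ _]mulr_natl /z natrB; last by lia.
rewrite natrB //; have : 0 <= 2 * t * B U * (z U * z U).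
  by apply: mulr_ge0; [apply: mulr_ge0; [exact: mulr_ge0 | exact: B0] | exact: mulr_ge0].
rewrite /z; lra.
Qed.

(** The two sides are the ends of a family [f t], whose logarithmic derivative is
    [B (N - 2) / (N - 1 + 2 t B) - B z]; by [column_ibp] its weighted mean is at most 0. *)
Lemma column_bound : E (fun U => g U * expR (- (B U * z U))) <=
  E (fun U => g U * expR (- ((N - 2)%:R / 2 * ln (1 + 2 / (N - 1)%:R * B U)))).
Proof.
pose m : R := (N - 1)%:R. pose k : R := (N - 2)%:R.
have m0 : 0 < m by rewrite ltr0n; lia.
have k0 : 0 <= k by [].
have mB t U : 0 <= t -> 0 < 1 + 2 / m * B U * t.
  by move=> ?; rewrite ltr_pwDl // !mulr_ge0 // ?B0 // invr_ge0 ltW.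
pose L t U := k / 2 * (ln (1 + 2 / m * B U) - ln (1 + 2 / m * B U * t)).
pose f t U := expR (- (L t U)) * g U * ez t U.
pose df t U := f t U * (k / 2 * (2 / m * B U) / (1 + 2 / m * B U * t) - B U * z U).
have bc c : bmf (fun U => 2 / m * B U * c) by apply: bmfM; [exact: bmfZ | exact: bmf_cst].
have pc c U : 0 <= c -> 0 <= 2 / m * B U * c by move=> c0; rewrite !mulr_ge0 // invr_ge0 ltW.
have b3 c : 0 <= c -> bmf (fun U => ln (1 + 2 / m * B U * c)).
  by move=> c0; apply: bmf_ln1p => // U; exact: pc.
have b4 : bmf (fun U => ln (1 + 2 / m * B U)).
  by have := b3 1 ler01; congr bmf; apply/funext => U; rewrite mulr1.
have bi c : 0 <= c -> bmf (fun U => (1 + 2 / m * B U * c)^-1).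
  by move=> c0; apply: bmf_inv1p => // U; exact: pc.
have bL c : 0 <= c -> bmf (L c).
  by move=> c0; apply: bmfZ; apply: bmfB => //; exact: b3.
have bf c : 0 <= c -> bmf (f c).
  by move=> c0; apply: bmfM => //; apply: bmfM => //; apply: bmf_expR; apply: bmfN; exact: bL.
have bdf c : 0 <= c <= 1 -> bmf (df c).
  move=> /andP[c0 _]; apply: bmfM; first exact: bf.
  apply: bmfB; last exact: bmfM.
  by apply: bmfM; [apply: bmfZ; exact: bmfZ | exact: bi].
have e1 : (fun U => g U * expR (- (B U * z U))) = f 1.
  by apply/funext => U; rewrite /f /L /ez mulr1 subrr mulr0 oppr0 expR0 !mul1r.
have e0 : (fun U => g U * expR (- (k / 2 * ln (1 + 2 / m * B U)))) = f 0.
  by apply/funext => U; rewrite /f /L /ez mulr0 addr0 ln1 subr0 !mul0r oppr0 expR0 mulr1 mulrC.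
rewrite e1 e0; apply: param_decr bf bdf _ _.
- have [_ [Mg hMg]] := gb. have [_ [MB hMB]] := Bb. have [_ [Mz hMz]] := z_bmf. have [_ [Ml hMl]] := b4.
  have lift (phi : G -> R) M : (forall U, `|phi U| <= M) ->
    dd (fun (_ : R) (x : R * G) => phi x.2) (fun=> 0).
    by move=> h; apply: (dd_cst (f := fun x : R * G => phi x.2) (M := M)) => x; exact: h.
  have Dt : dd (fun h (x : R * G) => clamp x.1 + h) (fun=> 1) by exact: dd_time.
  have hD h (x : R * G) : 0 <= h <= 1 -> 0 <= 2 / m * B x.2 * (clamp x.1 + h).
    by move=> /andP[hh _]; have /andP[cc _] := clamp01 x.1; rewrite !mulr_ge0 ?invr_ge0 ?(ltW m0) //; lra.
  have Dl := dd_comp c11_ln1p hD (ddM (ddZ (2 / m) (lift _ _ hMB)) Dt).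
  have DL := ddZ (- (k / 2)) (ddD (lift _ _ hMl) (ddZ (-1) Dl)).
  have DE := ddM (ddM (dd_comp c11_expR (fun _ _ _ => I) DL) (lift _ _ hMg))
    (dd_comp c11_expR (fun _ _ _ => I) (ddM (ddZ (-1) (ddM Dt (lift _ _ hMB))) (lift _ _ hMz))).
  apply: eq_dd DE => [h x hh|x].
  + rewrite /f /L /ez; congr (expR _ * _ * expR _); ring.
  + have /andP[c0 _] := clamp01 x.1; have := mB _ x.2 c0; rewrite /df /f /L /ez /= !addr0 => mm.
    set c := clamp x.1 in c0 mm *.
    rewrite (_ : - (k / 2) * (ln (1 + 2 / m * B x.2) + -1 * ln (1 + 2 / m * B x.2 * c)) =
      - (k / 2 * (ln (1 + 2 / m * B x.2) - ln (1 + 2 / m * B x.2 * c)))); last by ring.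
    rewrite (_ : -1 * (c * B x.2) * z x.2 = - (c * B x.2 * z x.2)); last by ring.
    by set i := (1 + _)^-1; ring.
- move=> c c01; have /andP[c0 _] := c01.
  have -> : df c = (fun U => - (m^-1 * (((B U * (g U * expR (- L c U))) * (1 + 2 / m * B U * c)^-1) * ez c U *
     (z U * (m + 2 * c * B U) - k)))).
    apply/funext => U; rewrite /df /f; have := mB _ U c0; move: (ez c U) (expR _) => x1 x2 h.
    have -> : 2 / m * B U * c = 2 * c * B U / m by ring.
    by field; rewrite ?lt0r_neq0 //; move: h; rewrite (_ : _ + _ = (m + 2 * c * B U) / m) ?pmulr_lgt0 ?invr_gt0 //; field; rewrite lt0r_neq0.
  have bp : bmf (fun U => (B U * (g U * expR (- L c U))) * (1 + 2 / m * B U * c)^-1).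
    apply: bmfM; last exact: bi.
    by apply: bmfM => //; apply: bmfM => //; apply: bmf_expR; apply: bmfN; exact: bL.
  have bq : bmf (fun U => ((B U * (g U * expR (- L c U))) * (1 + 2 / m * B U * c)^-1) * ez c U *
     (z U * (m + 2 * c * B U) - k)).
    apply: bmfM; first exact: bmfM.
    apply: bmfB; last exact: bmf_cst.
    by apply: bmfM => //; apply: bmfD; [exact: bmf_cst | exact: bmfZ].
  rewrite ExN; last exact: bmfZ.
  rewrite ExZ // oppr_le0 mulr_ge0 ?invr_ge0 ?(ltW m0) //.
  apply: (column_ibp c0 bp) => [U V UV|U].
    by rewrite /L (gf UV) (Bf UV).
  by rewrite !mulr_ge0 ?expR_ge0 // invr_ge0 ltW // mB.
Qed.

End ColumnBound.

Section Jensen.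
Context {R : realType}.
Implicit Types (p x : nat -> R).

Lemma jensen_expR (I : Type) (s : seq I) (p x : I -> R) : (forall i, 0 <= p i) -> \sum_(i <- s) p i = 1 ->
  expR (\sum_(i <- s) p i * x i) <= \sum_(i <- s) p i * expR (x i).
Proof.
move=> p0 p1; set m := \sum_(i <- s) _.
rewrite (_ : expR m = \sum_(i <- s) p i * (expR m * (1 + (x i - m)))); last first.
  rewrite (eq_bigr (fun i => expR m * ((1 - m) * p i + p i * x i))); last by move=> i _; ring.
  by rewrite -mulr_sumr big_split /= -mulr_sumr p1 -/m mulr1 subrK mulr1.
apply: ler_sum => i _; rewrite ler_wpM2l //.
rewrite -{2}(subrK m (x i)) expRD mulrC ler_wpM2r ?expR_ge0 //; exact: expR_ge1Dx.
Qed.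

Lemma sum_ln1p_le (N : nat) (x : 'I_N -> R) : (0 < N)%N -> (forall i, 0 <= x i) ->
  \sum_i ln (1 + x i) <= N%:R * ln (1 + (\sum_i x i) / N%:R).
Proof.
move=> N0 x0; set m := _ / N%:R; have N0' : 0 < N%:R :> R by rewrite ltr0n.
have m0 : 0 <= m by rewrite divr_ge0 // sumr_ge0.
rewrite (_ : N%:R * _ = \sum_i (ln (1 + m) + (x i - m) / (1 + m))); last first.
  rewrite big_split /= sumr_const card_ord -mulr_suml sumrB sumr_const card_ord.
  by rewrite -[ln _ *+ N]mulr_natl -[m *+ N]mulr_natl [N%:R * m]mulrC /m divfK ?lt0r_neq0 // subrr mul0r addr0.
apply: ler_sum => i _; rewrite -lerBlDl -ln_div ?posrE ?ltr_pwDl //.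
rewrite (_ : (1 + x i) / (1 + m) = 1 + (x i - m) / (1 + m)); last first.
  by field; rewrite lt0r_neq0 // ltr_pwDl.
have d : 0 < 1 + m by rewrite ltr_pwDl.
apply: ln1p_le; rewrite ltr_pdivlMr //; have := x0 i; lra.
Qed.

End Jensen.

(** * A product over the coordinates of the first column *)

Section SphereProduct.
Context {R : realType} {N : nat}.
Local Notation G := (SO R N.+1).
Variable nu : probability G R.
Hypothesis nuH : is_haar nu.
Local Notation E := (Ex nu).
Local Notation u U i := (so_mx U i ord0).
Local Notation M := (N.+1%:R : R).
Variables (p : R) (c : 'I_N.+1 -> R).
Hypotheses (p01 : 0 <= p <= 2^-1) (c0 : forall i, 0 <= c i).

Let H (t : R) i U := expR (- \sum_l (p + (l == i)%:R) * ln (1 + t * c l * u U l ^+ 2)).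

Let cu0 t l U : 0 <= t -> 0 <= t * c l * u U l ^+ 2.
Proof. by move=> t0; exact: mulr_ge0 (mulr_ge0 t0 (c0 l)) (sqr_ge0 _). Qed.

Let bu (l : 'I_N.+1) : bmf (fun U : G => u U l ^+ 2).
Proof. by apply: bmfX; exact: bmf_entry. Qed.

Let bln t l : 0 <= t -> bmf (fun U : G => ln (1 + t * c l * u U l ^+ 2)).
Proof. by move=> t0; apply: bmf_ln1p => [|U]; [exact: bmfZ | exact: cu0]. Qed.

Let bH t i : 0 <= t -> bmf (H t i).
Proof. by move=> t0; apply: bmf_expR; apply: bmfN; apply: bmf_sum => l; apply: bmfZ; exact: bln. Qed.

(** In [ibp_rad] the derivative of the weight at [i] contributes at most [2 (p + 1) t c_i u_i ^ 2],
    and [2 (p + 1) <= 3]; the averaged derivative has the favourable sign. *)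
Lemma sphere_ibp t i : 0 <= t -> E (fun U => H t i U * (1 - (M + 3 * t * c i) * u U i ^+ 2)) <= 0.
Proof.
move=> t0; have /andP[p0 p1] := p01.
have rl l : rad (fun U : G => ln (1 + t * c l * u U l ^+ 2))
   (fun j U => (1 + t * c l * u U l ^+ 2)^-1 * (t * c l * (j == l)%:R)).
  apply: (rad_comp (H := fun U : G => t * c l * u U l ^+ 2) (r := fun j _ => t * c l * (j == l)%:R) c11_ln1p) => [U|||].
  - exact: cu0.
  - exact: bln.
  - by apply: bmf_inv1p => [|U]; [exact: bmfZ | exact: cu0].
  - exact: radZ (rad_sq l).
have rH : rad (H t i) (fun j U => - (H t i U * ((p + (j == i)%:R) * ((1 + t * c j * u U j ^+ 2)^-1 * (t * c j))))).
  have := rad_expR (radZ (-1) (rad_sum (index_enum 'I_N.+1) (fun l => radZ (p + (l == i)%:R) (rl l)))).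
  apply: eq_rad => [U|j U]; first by rewrite /H mulN1r.
  rewrite /H !mulN1r mulrN; congr (- (_ * _)).
  rewrite (bigD1 j) //= eqxx mulr1 big1 ?addr0 // => l lj.
  by rewrite [j == l]eq_sym (negPf lj) !mulr0.
have := ibp_rad nuH i rH => <-; have [b1 b2 _] := rH.
apply: le_Ex => [||U].
- by apply: bmfM => //; apply: bmfB; [exact: bmf_cst | exact: bmfZ].
- apply: bmfD.
    by apply: bmfM => //; apply: bmfB; [exact: bmf_cst | exact: bmfZ].
  apply: bmfM; first exact: bmfZ.
  apply: bmfB; first exact: b2.
  by apply: bmf_sum => l; apply: bmfM => //; exact: b2.
have s0 : \sum_l u U l ^+ 2 * - (H t i U * ((p + (l == i)%:R) * ((1 + t * c l * u U l ^+ 2)^-1 * (t * c l)))) <= 0.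
  apply: sumr_le0 => l _; rewrite mulrN oppr_le0; apply: mulr_ge0 (sqr_ge0 _) _.
  apply: mulr_ge0 (expR_ge0 _) _; apply: mulr_ge0; first by rewrite addr_ge0.
  by apply: mulr_ge0; [rewrite invr_ge0 addr_ge0 //; exact: cu0 | exact: mulr_ge0].
move: s0; set S := \sum_l _ => s0.
have x0 := cu0 i U t0; have H0 : 0 <= H t i U by exact: expR_ge0.
have v0 : 0 <= u U i ^+ 2 by exact: sqr_ge0.
rewrite eqxx; move: (H t i U) H0 (u U i ^+ 2) v0 x0 => h h0 v v0 x0.
have i1 : (1 + t * c i * v)^-1 <= 1 by rewrite invf_le1 ?lerDl // ltr_pwDl.
have i0 : 0 <= (1 + t * c i * v)^-1 by rewrite invr_ge0 addr_ge0.
have tc : 0 <= h * (t * c i * v) by rewrite mulr_ge0.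
have vS : 0 <= v * - S by rewrite mulr_ge0 // oppr_ge0.
have key : (p + 1) * (1 + t * c i * v)^-1 <= 3 / 2 by nra.
have := ler_wpM2r tc key; move: vS; rewrite (_ : true%:R = 1 :> R) //.
set j := (1 + _)^-1; lra.
Qed.

(** Interpolation in [t]. Differentiating a logarithm produces the factor [(1 + t c_l u_l ^ 2)^-1],
    which is the additional weight in [H t l]. Bringing the difference of the two derivatives over a
    common denominator turns [M + 4 t c_l] into the [M + 3 t c_l] of [sphere_ibp]; this is the
    origin of the constant 4. *)
Lemma sphere_prod : E (fun U => expR (- (p * \sum_l ln (1 + c l * u U l ^+ 2)))) <=
  expR (- (p / 4 * \sum_l ln (1 + 4 * c l / M))).
Proof.
have /andP[p0 p1] := p01; have M0 : 0 < M by rewrite ltr0n.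
pose L (t : R) := p / 4 * \sum_l ln (1 + 4 * c l / M * t).
pose f t U := expR (L t - p * \sum_l ln (1 + c l * u U l ^+ 2 * t)).
pose df t U := f t U * (p / 4 * (\sum_l (1 + 4 * c l / M * t)^-1 * (4 * c l / M))
   - p * (\sum_l (1 + c l * u U l ^+ 2 * t)^-1 * (c l * u U l ^+ 2))).
have cl l (t : R) : 0 <= t -> 0 <= 4 * c l / M * t by move=> t0; rewrite !mulr_ge0 ?c0 // invr_ge0 ltW.
have cut l t U : 0 <= t -> 0 <= c l * u U l ^+ 2 * t.
  by move=> t0; exact: mulr_ge0 (mulr_ge0 (c0 l) (sqr_ge0 _)) t0.
have bc l t : bmf (fun U : G => c l * u U l ^+ 2 * t) by apply: bmfM; [exact: bmfZ | exact: bmf_cst].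
have bf t : 0 <= t -> bmf (f t).
  move=> t0; apply: bmf_expR; apply: bmfB; first exact: bmf_cst.
  by apply: bmfZ; apply: bmf_sum => l; apply: bmf_ln1p => // U; exact: cut.
have bdf t : 0 <= t <= 1 -> bmf (df t).
  move=> /andP[t0 _]; apply: bmfM; first exact: bf.
  apply: bmfB; first exact: bmf_cst.
  apply: bmfZ; apply: bmf_sum => l; apply: bmfM; last exact: bmfZ.
  by apply: bmf_inv1p => // U; exact: cut.
suff h : E (f 1) <= E (f 0).
  have e0 : E (f 0) = 1.
    rewrite -[RHS](Ex_cst nu 1); congr (Ex _ _); apply/funext => U; rewrite /f /L !big1 ?mulr0 ?subr0 ?expR0 // => l _;
      by rewrite mulr0 addr0 ln1.
  have L1 : L 1 = p / 4 * \sum_l ln (1 + 4 * c l / M) by congr (_ * _); apply: eq_bigr => l _; rewrite mulr1.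
  have e1 : E (f 1) = expR (L 1) * E (fun U => expR (- (p * \sum_l ln (1 + c l * u U l ^+ 2)))).
    rewrite -ExZ; last first.
      have := bf 1 ler01 => b; have := bmfZ (expR (- L 1)) b; congr bmf; apply/funext => U.
      by rewrite /f -expRD addKr; congr (expR (- (_ * _))); apply: eq_bigr => l _; rewrite mulr1.
    congr (Ex _ _); apply/funext => U; rewrite /f -expRD; congr (expR (_ - _ * _)).
    by apply: eq_bigr => l _; rewrite mulr1.
  rewrite -L1 expRN -[leRHS]mul1r ler_pdivlMr ?expR_gt0 // [leLHS]mulrC -e1.
  by apply: le_trans h _; rewrite e0.
apply: param_decr bf bdf _ _.
- have lift (phi : G -> R) B : (forall U, `|phi U| <= B) ->
    dd (fun (_ : R) (x : R * G) => phi x.2) (fun=> 0).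
    by move=> h; apply: (dd_cst (f := fun x : R * G => phi x.2) (M := B)) => x; exact: h.
  have Dt : dd (fun h (x : R * G) => clamp x.1 + h) (fun=> 1) by exact: dd_time.
  have D1 l : dd (fun h (x : R * G) => ln (1 + c l * u x.2 l ^+ 2 * (clamp x.1 + h)))
    (fun x => (1 + c l * u x.2 l ^+ 2 * (clamp x.1))^-1 * (c l * u x.2 l ^+ 2)).
    have [_ [B hB]] := bmfZ (c l) (bu l).
    apply: eq_dd (dd_comp c11_ln1p _ (ddM (lift _ _ hB) Dt)) => [//|x|h x /andP[hh _]].
      by rewrite !addr0 mul0r add0r mulr1.
    by apply: cut; have /andP[? _] := clamp01 x.1; lra.
  have D2 l : dd (fun h (x : R * G) => ln (1 + 4 * c l / M * (clamp x.1 + h)))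
    (fun x => (1 + 4 * c l / M * (clamp x.1))^-1 * (4 * c l / M)).
    apply: eq_dd (dd_comp c11_ln1p _ (ddZ (4 * c l / M) Dt)) => [//|x|h x /andP[hh _]].
      by rewrite !addr0 mulr1.
    by apply: cl; have /andP[? _] := clamp01 x.1; lra.
  have D := dd_comp c11_expR (fun _ _ _ => I) (ddD (ddZ (p / 4) (dd_sum (index_enum 'I_N.+1) D2))
    (ddZ (- p) (dd_sum (index_enum 'I_N.+1) D1))).
  apply: eq_dd D => [h x _|x]; first by rewrite /f /L mulNr.
  by rewrite /df /f /L mulNr mulNr !addr0.
move=> t t01; have /andP[t0 _] := t01.
have fH i U : f t U = expR (L t) * (H t i U * (1 + t * c i * u U i ^+ 2)).
  rewrite /f /H expRD; congr (_ * _).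
  rewrite -[X in _ = _ * X]lnK ?posrE ?ltr_pwDl ?cu0 // -expRD; congr expR.
  under [in RHS]eq_bigr => l _ do rewrite mulrDl.
  rewrite big_split /= -mulr_sumr opprD -addrA.
  have -> : \sum_l (l == i)%:R * ln (1 + t * c l * u U l ^+ 2) = ln (1 + t * c i * u U i ^+ 2).
    by rewrite (bigD1 i) //= eqxx mul1r big1 ?addr0 // => l li; rewrite (negPf li) mul0r.
  rewrite addNr addr0; congr (- (_ * _)); apply: eq_bigr => l _; congr ln; ring.
have -> : df t = (fun U => \sum_l (p * expR (L t) * c l / (M + 4 * t * c l)) * (H t l U * (1 - (M + 3 * t * c l) * u U l ^+ 2))).
  apply/funext => U; rewrite /df !mulr_sumr -sumrB mulr_sumr; apply: eq_bigr => l _.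
  rewrite (fH l); have := cu0 l U t0; have := c0 l; have := mulr_ge0 t0 (c0 l).
  move: (H t l U) (expR _) (u U l ^+ 2) => h e v tc cc x0.
  have d1 : 0 < 1 + t * c l * v by rewrite ltr_pwDl.
  have d2 : 0 < M + 4 * t * c l by apply: ltr_pwDl => //; lra.
  rewrite (_ : c l * v * t = t * c l * v); last by ring.
  rewrite (_ : 1 + 4 * c l / M * t = (M + 4 * t * c l) / M); last by field; rewrite lt0r_neq0.
  move: (N.+1%:R : R) M0 d2 => m m0 d2.
  by field; rewrite ?(lt0r_neq0 d1) ?(lt0r_neq0 d2) ?(lt0r_neq0 m0).
have bt l : bmf (fun U => H t l U * (1 - (M + 3 * t * c l) * u U l ^+ 2)).
  by apply: bmfM; [exact: bH | apply: bmfB; [exact: bmf_cst | exact: bmfZ]].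
rewrite Ex_sum => [|l]; last exact: bmfZ.
apply: sumr_le0 => l _; rewrite ExZ // mulr_ge0_le0 ?sphere_ibp //.
by rewrite !mulr_ge0 ?expR_ge0 // invr_ge0 addr_ge0 // !mulr_ge0.
Qed.

End SphereProduct.

(** * A bound on the decay valid for all weights *)

Section Crude.
Context {R : realType} {n : nat}.
Hypothesis n0 : (0 < n)%N.
Local Notation N := n.*2.+1.
Local Notation G := (SO R N).
Variable nu : probability G R.
Hypothesis nuH : is_haar nu.
Local Notation E := (Ex nu).
Implicit Types (a : 'I_n -> nat) (U : G).

(** The first column restricted to the first [J] planes and turned by a quarter turn in each of
    them. It is orthogonal to the first column, and its product with the second one is
    [2 * fY J]. *)
Definition wcol J (i : 'I_N) U : R :=
  if (i < J.*2)%N then (if odd i then uu U i.-1 else - uu U i.+1) else 0.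

Lemma big_wcol J U (f : R -> 'I_N -> R) : (J <= n)%N -> (forall i, f 0 i = 0) ->
  \sum_i f (wcol J i U) i = \sum_(p < J) (f (- uu U p.*2.+1) (inord p.*2) + f (uu U p.*2) (inord p.*2.+1)).
Proof.
move=> Jn f0; pose F (i : nat) := if (i < J.*2)%N then f (if odd i then uu U i.-1 else - uu U i.+1) (inord i) else 0.
transitivity (\sum_(i < N) F i).
  by apply: eq_bigr => i _; rewrite /F /wcol inord_val; case: ifP.
rewrite -(big_mkord xpredT F) (big_cat_nat (n := J.*2)) //=; last by rewrite leqW // leq_double.
rewrite [X in _ + X]big_nat_cond [X in _ + X]big1 ?addr0 => [|i /andP[/andP[h _] _]]; last by rewrite /F ltnNge h.
rewrite big_mkord sum_double; apply: eq_bigr => p _.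
by rewrite /F ltn_double ltn_Sdouble ltn_ord /= odd_double.
Qed.

Lemma bmf_uu i : bmf (fun U => uu U i). Proof. exact: bmf_entry. Qed.

Lemma bmf_fA J : bmf (fA J : G -> R).
Proof. by apply: bmfZ; apply: bmf_sum => i; apply: bmfX; exact: bmf_entry. Qed.

Lemma bmf_fB J : bmf (fB J : G -> R).
Proof. by apply: bmfZ; apply: bmf_sum => i; apply: bmfX; exact: bmf_entry. Qed.

Lemma bmf_fX J : bmf (fX J : G -> R).
Proof. by apply: bmfZ; apply: bmf_sum => i; apply: bmfM; exact: bmf_entry. Qed.

Lemma bmf_fY J : bmf (fY J : G -> R).
Proof. by apply: bmfZ; apply: bmf_sum => i; apply: bmfB; apply: bmfM; exact: bmf_entry. Qed.

Lemma bmf_Psi a : bmf (Psi a : G -> R).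
Proof.
have b J : bmf (fb J : G -> R).
  apply: bmfB; first by apply: bmfD; [exact: bmf_fA | exact: bmf_fB].
  apply: bmfZ; apply: bmfB; last by apply: bmfX; exact: bmf_fY.
  apply: bmfB; first by apply: bmfM; [exact: bmf_fA | exact: bmf_fB].
  by apply: bmfX; exact: bmf_fX.
apply: bmf_sum => j; apply: bmfZ; apply: bmfM => //; apply: bmfB => //; exact: bmf_cst.
Qed.

Lemma fA_first_col J : first_col_fun (fA J : G -> R).
Proof. by move=> U V h; congr (_ * _); apply: eq_bigr => i _; rewrite /uu h. Qed.

Lemma le_expR_eps (x y : R) : 0 < y -> (forall e, 0 < e -> x <= expR e * y) -> x <= y.
Proof.
move=> y0 h; rewrite leNgt; apply/negP => xy; have x0 := lt_trans y0 xy.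
have q : 1 < x / y by rewrite ltr_pdivlMr // mul1r.
have l0 : 0 < ln (x / y) by rewrite ln_gt0.
have := h _ (divr_gt0 l0 (ltr0n R 2)); apply/negP; rewrite -ltNge -ltr_pdivlMr //.
have xy0 : 0 < x / y by exact: lt_trans ltr01 q.
rewrite -{2}(lnK (x := x / y)) ?posrE // ltr_expR; lra.
Qed.

(** By [fb_var_omega], [2 Psi a] is at least the sum of the [q j * z j]. Jensen's inequality with
    the weights [q j / Q] puts the whole of [Q] in front of a single [z j], where [column_bound]
    applies; the outcome is the same for all [j]. *)
Lemma crude_first_column a :
  E (fun U => expR (- (2 * Psi a U))) <=
  E (fun U => expR (- (n%:R / 2 * ln (1 + (\sum_j (a j)%:R / 2 * fA j.+1 U) / n%:R)))).
Proof.
have nR : 0 < n%:R :> R by rewrite ltr0n.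
have A0 j U : 0 <= fA j U by exact: fA_ge0.
pose q (j : 'I_n) U : R := (a j)%:R / 2 * fA j.+1 U.
have q0 j U : 0 <= q j U by rewrite mulr_ge0.
have bq j : bmf (q j) by apply: bmfZ; exact: bmf_fA.
pose Q U := \sum_j q j U; have Q0 U : 0 <= Q U by exact: sumr_ge0.
have bQ : bmf Q by exact: bmf_sum.
have bl : bmf (fun U => expR (- (n%:R / 2 * ln (1 + Q U / n%:R)))).
  apply: bmf_expR; apply: bmfN; apply: bmfZ; apply: bmf_ln1p => [|U]; last by rewrite divr_ge0.
  by apply: bmfM => //; exact: bmf_cst.
pose z (j : 'I_n) U : R := 1 - (\sum_i wcol j.+1 i U * so_mx U i (inord 1)) ^+ 2.
have sY (j : 'I_n) U : \sum_i wcol j.+1 i U * so_mx U i (inord 1) = 2 * fY j.+1 U.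
  rewrite (big_wcol U (f := fun x i => x * so_mx U i (inord 1))) // => [|i]; last by rewrite mul0r.
  by rewrite /fY mulrA divff ?mul1r //; apply: eq_bigr => p _; rewrite /uu /vv; ring.
have zE j U : z j U = 1 - 4 * fY j.+1 U ^+ 2 by rewrite /z sY exprMn; ring.
have Yb (j : 'I_n) U : 4 * fY j.+1 U ^+ 2 <= 1.
  exact: (Y_le1 n0 (ltn1_doubleS n0) U (ltn_ord j)).
have z0 j U : 0 <= z j U by rewrite zE subr_ge0.
have z1 j U : z j U <= 1 by rewrite gerBl sqr_ge0.
have bz j : bmf (z j).
  rewrite (_ : z j = fun U => 1 - 4 * fY j.+1 U ^+ 2); last by apply/funext => U; exact: zE.
  by apply: bmfB; [exact: bmf_cst | apply: bmfZ; apply: bmfX; exact: bmf_fY].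
have step1 U : \sum_j q j U * z j U <= 2 * Psi a U.
  rewrite /Psi mulr_sumr; apply: ler_sum => j _; rewrite zE.
  have A := A0 j.+1 U; have B : 0 <= fB j.+1 U by exact: fB_ge0.
  have v : (fA j.+1 U + fB j.+1 U) * (1 - 4 * fY j.+1 U ^+ 2) / 4 <= fb j.+1 U * (1 - fb j.+1 U).
    exact: (fb_var_omega n0 (ltn1_doubleS n0) U (ltn_ord j)).
  have k0 : 0 <= (a j)%:R :> R by [].
  have := ler_wpM2l k0 v; have zz := z0 j U; rewrite zE in zz.
  by have := mulr_ge0 (mulr_ge0 k0 B) zz; rewrite /q; lra.
apply: le_expR_eps.
  have [_ [M hM]] := bQ.
  apply: (@lt_le_trans _ _ (expR (- (n%:R / 2 * (M / n%:R))))); first exact: expR_gt0.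
  rewrite -(Ex_cst nu (expR _)); apply: le_Ex => // [|U]; first exact: bmf_cst.
  rewrite ler_expR lerN2 ler_wpM2l ?divr_ge0 //.
  have Qn : 0 <= Q U / n%:R by rewrite divr_ge0.
  apply: le_trans (ln1p_le _) _; first by apply: lt_le_trans Qn; rewrite ltrN10.
  by rewrite ler_pM2r ?invr_gt0 // (le_trans (ler_norm _) (hM U)).
(* [Q] may vanish, so each [q j] is raised by [e / n]. As [z j <= 1], this costs a factor
   [expR e]. *)
move=> e e0; pose q' j U := q j U + e / n%:R; pose B U := Q U + e.
have en : 0 < e / n%:R by rewrite divr_gt0.
have q'0 j U : 0 <= q' j U by rewrite addr_ge0 // ltW.
have BE U : B U = \sum_j q' j U.
  by rewrite big_split /= sumr_const card_ord -[_ *+ n]mulr_natl mulrC divfK ?lt0r_neq0.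
have B0 U : 0 < B U by rewrite ltr_wpDl.
have bB : bmf B by apply: bmfD => //; exact: bmf_cst.
have bi : bmf (fun U => (B U)^-1).
  have h : bmf (fun U => (1 + Q U / e)^-1).
    by apply: bmf_inv1p => [|U]; [apply: bmfM => //; exact: bmf_cst | rewrite divr_ge0 // ltW].
  have := bmfZ e^-1 h; congr bmf; apply/funext => U; rewrite -invfM mulrDr mulr1.
  by rewrite [e * _]mulrC divfK ?lt0r_neq0 // addrC.
pose g j U := q' j U / B U.
have bg j : bmf (g j) by apply: bmfM => //; apply: bmfD => //; exact: bmf_cst.
have g0 j U : 0 <= g j U by rewrite divr_ge0 // ltW.
have qf j : first_col_fun (q j) by move=> U V h; rewrite /q (@fA_first_col j.+1 U V h).
have Qf : first_col_fun Q by move=> U V h; apply: eq_bigr => j _; exact: qf.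
have Bf : first_col_fun B by move=> U V h; rewrite /B (Qf _ _ h).
have gf j : first_col_fun (g j) by move=> U V h; rewrite /g /q' (qf j _ _ h) (Bf _ _ h).
have bexp j : bmf (fun U => g j U * expR (- (B U * z j U))).
  by apply: bmfM => //; apply: bmf_expR; apply: bmfN; exact: bmfM.
have bl2 : bmf (fun U => ln (1 + 2 / (N - 1)%:R * B U)).
  by apply: bmf_ln1p => [|U]; [exact: bmfZ | rewrite !mulr_ge0 ?invr_ge0 // ltW].
apply: (@le_trans _ _ (expR e * \sum_j E (fun U => g j U * expR (- (B U * z j U))))).
  rewrite -Ex_sum // -ExZ; last exact: bmf_sum.
  apply: le_Ex => [||U].
  - by apply: bmf_expR; apply: bmfN; apply: bmfZ; exact: bmf_Psi.
  - by apply: bmfZ; exact: bmf_sum.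
  have g1 : \sum_j g j U = 1 by rewrite -mulr_suml -BE divff // lt0r_neq0.
  have := jensen_expR (fun j => - (B U * z j U)) (fun j => g0 j U) g1 => J.
  apply: le_trans (ler_wpM2l (expR_ge0 e) J); rewrite -expRD ler_expR.
  have -> : \sum_j g j U * - (B U * z j U) = - \sum_j q' j U * z j U.
    by rewrite -sumrN; apply: eq_bigr => j _; rewrite /g; field; rewrite lt0r_neq0.
  have : \sum_j q' j U * z j U <= \sum_j q j U * z j U + e.
    rewrite (eq_bigr (fun j => q j U * z j U + e / n%:R * z j U)); last by move=> j _; rewrite mulrDl.
    rewrite big_split /= lerD2l -mulr_sumr; apply: (@le_trans _ _ (e / n%:R * n%:R)); last by rewrite divfK ?lt0r_neq0.
    rewrite ler_wpM2l ?(ltW en) // -[n%:R]mulr1 mulr_natl -[n in _ *+ n]card_ord -sumr_const; exact: ler_sum.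
  have := step1 U; lra.
rewrite ler_wpM2l ?expR_ge0 //.
apply: (@le_trans _ _ (\sum_j E (fun U => g j U * expR (- ((N - 2)%:R / 2 * ln (1 + 2 / (N - 1)%:R * B U)))))).
  apply: ler_sum => j _.
  apply: (column_bound n0 nuH (w := fun i => wcol j.+1 i)) => // [i U V h|i|U|U|U].
  - by rewrite /wcol /uu; case: ifP => // _; case: ifP => _; rewrite h.
  - rewrite /wcol; case: (i < j.+1.*2)%N; last exact: bmf_cst.
    by case: (odd i); [|apply: bmfN]; exact: bmf_uu.
  - rewrite (big_wcol U (f := fun x i => x ^+ 2)) // => [|i]; last by rewrite expr0n.
    have := fA_le n0 (ltn1_doubleS n0) U (ltn_ord j); rewrite /fA (sum_double j.+1 (fun i => uu U i ^+ 2)).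
    rewrite (eq_bigr (fun p : 'I_j.+1 => (- uu U p.*2.+1) ^+ 2 + uu U p.*2 ^+ 2)); last by move=> p _; rewrite sqrrN addrC.
    set S := \sum_(p < _) _; lra.
  - rewrite (big_wcol U (f := fun x i => x * so_mx U i ord0)) // => [|i]; last by rewrite mul0r.
    by apply: big1 => p _; rewrite /uu; ring.
  - exact: ltW.
rewrite -Ex_sum => [|j]; last first.
  by apply: bmfM => //; apply: bmf_expR; apply: bmfN; exact: bmfZ.
apply: le_Ex => // [|U].
  by apply: bmf_sum => j; apply: bmfM => //; apply: bmf_expR; apply: bmfN; exact: bmfZ.
rewrite -mulr_suml (_ : \sum_j g j U = 1) ?mul1r; last by rewrite -mulr_suml -BE divff // lt0r_neq0.
rewrite ler_expR lerN2.
have -> : (N - 1)%:R = 2 * n%:R :> R by rewrite subn1 /= -muln2 natrM mulrC.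
have n2 : n%:R <= (N - 2)%:R :> R by rewrite ler_nat; lia.
have -> : 2 / (2 * n%:R) * B U = B U / n%:R by field; rewrite lt0r_neq0.
have QB : Q U / n%:R <= B U / n%:R by rewrite ler_pM2r ?invr_gt0 // lerDl ltW.
have Qn : 0 <= Q U / n%:R by rewrite divr_ge0.
apply: ler_pM; [by rewrite divr_ge0 | by rewrite ln_ge0 // lerDl | by rewrite ler_pM2r | ].
by rewrite ler_ln ?posrE ?lerD2l // ltr_pwDl // (le_trans Qn QB).
Qed.

(** Regrouped by coordinates, the sum has a coefficient proportional to the row length [lam a i./2]
    at [u_i ^ 2]. Concavity of the logarithm and [N <= 3 n] replace the factor [n / 2] by 1/6 in
    front of a sum over coordinates; [sphere_prod] divides by 4, and each plane has two coordinates,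
    whence 1/12. *)
Lemma crude_bound a :
  E (fun U => expR (- (2 * Psi a U))) <= expR (- (12^-1 * \sum_(k < n) ln (1 + (lam a k)%:R / N%:R))).
Proof.
have nR : 0 < n%:R :> R by rewrite ltr0n.
have NR : 0 < N%:R :> R by rewrite ltr0n.
apply: le_trans (crude_first_column a) _.
pose c (i : 'I_N) : R := (lam a i./2)%:R / 2.
have c0 i : 0 <= c i by rewrite divr_ge0.
have SE U : \sum_j (a j)%:R / 2 * fA j.+1 U = \sum_(i < N) c i * so_mx U i ord0 ^+ 2 / 2.
  rewrite (eq_bigr (fun i : 'I_N => \sum_(j < n) (if (i./2 <= j)%N then (a j)%:R / 4 * so_mx U i ord0 ^+ 2 else 0))); last first.
    by move=> i _; rewrite -big_mkcond /= /c /lam natr_sum !mulr_suml; apply: eq_bigr => j _; field.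
  rewrite exchange_big /=; apply: eq_bigr => j _; rewrite -big_mkcond /=.
  rewrite -mulr_sumr /fA mulrA; congr (_ * _); first by field.
  rewrite (big_ord_widen_cond N xpredT (fun i => uu U i ^+ 2)) /=; last by rewrite leqW // leq_double.
  apply: eq_big => i; last by rewrite /uu inord_val.
  by rewrite leq_half_double doubleS.
apply: (@le_trans _ _ (E (fun U => expR (- (6^-1 * \sum_i ln (1 + c i * so_mx U i ord0 ^+ 2)))))).
  have bs : bmf (fun U => \sum_(i < N) c i * so_mx U i ord0 ^+ 2 / 2).
    by apply: bmf_sum => i; apply: bmfM; [apply: bmfZ; apply: bmfX; exact: bmf_entry | exact: bmf_cst].
  have s0 U : 0 <= \sum_(i < N) c i * so_mx U i ord0 ^+ 2 / 2.
    by apply: sumr_ge0 => i _; rewrite divr_ge0 // mulr_ge0 ?sqr_ge0.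
  apply: le_Ex => [||U].
  - apply: bmf_expR; apply: bmfN; apply: bmfZ.
    rewrite (_ : (fun U => _) = (fun U => ln (1 + (\sum_(i < N) c i * so_mx U i ord0 ^+ 2 / 2) / n%:R))); last first.
      by apply/funext => U; rewrite SE.
    apply: bmf_ln1p => [|U]; last by rewrite divr_ge0.
    by apply: bmfM => //; exact: bmf_cst.
  - apply: bmf_expR; apply: bmfN; apply: bmfZ; apply: bmf_sum => i.
    apply: bmf_ln1p => [|U]; last by rewrite mulr_ge0 ?sqr_ge0.
    by apply: bmfZ; apply: bmfX; exact: bmf_entry.
  rewrite SE ler_expR lerN2.
  have x0 (i : 'I_N) : 0 <= c i * so_mx U i ord0 ^+ 2 by rewrite mulr_ge0 ?sqr_ge0.
  have := sum_ln1p_le (ltn0Sn _) x0; rewrite -mulr_suml; set S := \sum_i c i * _ => h.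
  have S0 : 0 <= S by apply: sumr_ge0.
  have NE : N%:R = 2 * n%:R + 1 :> R by rewrite -natr1 -muln2 natrM mulrC.
  have n1 : 1 <= n%:R :> R by rewrite ler1n.
  have le : ln (1 + S / N%:R) <= ln (1 + S / 2 / n%:R).
    rewrite ler_ln ?posrE ?ltr_pwDl ?divr_ge0 // lerD2l -mulrA -invfM ler_wpM2l // lef_pV2 ?posrE ?mulr_gt0 //.
    by rewrite NE; lra.
  have l0 : 0 <= ln (1 + S / 2 / n%:R) by rewrite ln_ge0 // lerDl !divr_ge0.
  have := ler_wpM2l (ltW NR) le; have : N%:R * ln (1 + S / 2 / n%:R) <= 3 * n%:R * ln (1 + S / 2 / n%:R).
    by rewrite ler_wpM2r // NE; lra.
  by lra.
apply: le_trans (sphere_prod nuH _ c0) _; first by apply/andP; split; lra.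
rewrite ler_expR lerN2.
have -> : \sum_(l < N) ln (1 + 4 * c l / N%:R) = \sum_(k < n) 2 * ln (1 + 2 * (lam a k)%:R / N%:R).
  rewrite big_ord_recr /= (_ : c _ = 0) ?mulr0 ?mul0r ?addr0 ?ln1 ?addr0; last first.
    rewrite /c /lam /= doubleK big_pred0 ?mul0r // => j; by rewrite leqNgt ltn_ord.
  rewrite (sum_double n (fun l => ln (1 + 4 * ((lam a l./2)%:R / 2) / N%:R))).
  apply: eq_bigr => k _; rewrite doubleK -[k.*2.+1]/(true + k.*2)%N half_bit_double.
  by rewrite (_ : 4 * ((lam a k)%:R / 2) = 2 * (lam a k)%:R) ?mulr2n ?mulrDl ?mul1r //; field.
rewrite -mulr_sumr !mulrA (_ : 6^-1 / 4 * 2 = 12^-1); last by field.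
rewrite ler_wpM2l //; apply: ler_sum => k _.
have l0 : 0 <= (lam a k)%:R / N%:R :> R by rewrite divr_ge0.
rewrite -mulrA; move: l0; move: (_ / _) => x x0.
by rewrite ler_ln ?posrE; lra.
Qed.

End Crude.

(** * A sharp bound for few short columns *)

Section SharpBound.
Context {R : realType} {n : nat}.
Hypothesis n0 : (0 < n)%N.
Local Notation N := n.*2.+1.
Local Notation G := (SO R N).
Variable nu : probability G R.
Hypothesis nuH : is_haar nu.
Local Notation E := (Ex nu).
Local Notation u U i := (so_mx U i ord0).
Implicit Types (a s : 'I_n -> nat) (U : G).

Lemma fb_var_split j U : (j < n)%N ->
  (2 * (2 * fA j.+1 U) - 3 * (2 * fA j.+1 U) ^+ 2) + (2 * (2 * fB j.+1 U) - 3 * (2 * fB j.+1 U) ^+ 2)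
  <= 4 * (fb j.+1 U * (1 - fb j.+1 U)).
Proof.
move=> jn; have := fb_var_quad n0 (ltn1_doubleS n0) U jn; have := sqr_ge0 (fA j.+1 U - fB j.+1 U).
by move: (fA _ _) (fB _ _) (fb _ _) => x y b; rewrite !expr2; lra.
Qed.

(** At sine 1 the rotation is a quarter turn and exchanges two columns up to sign. *)
Lemma mul_rg_entry (i q k b : 'I_N) U : i != q ->
  so_mx (U * rg i q 1)%g k b = if b == q then so_mx U k i else if b == i then - so_mx U k q else so_mx U k b.
Proof.
move=> iq; have qi : q != i by rewrite eq_sym.
have h1 : 0 <= (1 : R) <= 1 by rewrite lexx ler01.
rewrite [LHS](_ : _ = (so_mx U *m rotmx i q (Num.sqrt (1 - 1 ^+ 2)) 1) k b); last by rewrite -(rgE iq h1).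
have tE x y : (so_mx U)^T x y = so_mx U y x by rewrite mxE.
rewrite -[LHS](_ : (rotmx q i (Num.sqrt (1 - 1 ^+ 2)) 1 *m (so_mx U)^T) b k = _); last first.
  by rewrite -(rotmx_tr i q) -trmx_mul mxE.
rewrite rotmx_entry // expr1n subrr sqrtr0 sub0r !tE.
case: (eqVneq b q) => [->|bq]; first by ring.
by case: (eqVneq b i) => [->|bi]; ring.
Qed.

Definition sg J U : R := \sum_(i < N | (i < J.*2)%N) u U i ^+ 2.

Lemma sgE J U : (J <= n)%N -> sg J U = 2 * fA J U.
Proof.
move=> Jn; rewrite /fA mulrA divff ?mul1r // /sg.
rewrite (big_ord_widen_cond N xpredT (fun i => uu U i ^+ 2)) /=; last by rewrite leqW // leq_double.
by apply: eq_bigr => i _; rewrite /uu inord_val.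
Qed.

Lemma sg01 J U : 0 <= sg J U <= 1.
Proof.
apply/andP; split; first by apply: sumr_ge0 => i _; exact: sqr_ge0.
rewrite -(sum_u2 U) [leRHS](bigID (fun i : 'I_N => (i < J.*2)%N)) /= lerDl.
by apply: sumr_ge0 => i _; exact: sqr_ge0.
Qed.

Lemma rad_sg J : rad (sg J : G -> R) (fun i _ => (i < J.*2)%N%:R).
Proof.
have := rad_sum (index_enum 'I_N) (fun l => radZ (l < J.*2)%N%:R (@rad_sq R n.*2 l)).
apply: eq_rad => [U|i U].
  by rewrite /sg [RHS]big_mkcond; apply: eq_bigr => l _; case: ifP; rewrite ?mul1r ?mul0r.
rewrite (bigD1 i) //= eqxx mulr1 big1 ?addr0 // => l li.
by rewrite eq_sym (negPf li) mulr0.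
Qed.

Definition quadX s U : R := \sum_j (s j)%:R * (2 * sg j.+1 U - 3 * sg j.+1 U ^+ 2).
Definition quadD s i U : R := \sum_j (s j)%:R * ((i < j.+1.*2)%N%:R * (2 - 6 * sg j.+1 U)).

Lemma rad_quadX s : rad (quadX s : G -> R) (fun i => quadD s i).
Proof.
have := rad_sum (index_enum 'I_n) (fun j => radZ (s j)%:R (radD (radZ 2 (rad_sg j.+1))
   (radZ (-3) (radM (rad_sg j.+1) (rad_sg j.+1))))).
apply: eq_rad => [U|i U]; apply: eq_bigr => j _; congr (_ * _).
  by rewrite expr2; ring.
by ring.
Qed.

(** The quadratic minorant of [4 Psi] is a function of the first column plus the same function of
    the second. Exchanging the two columns by a quarter turn, with the arithmetic-geometric
    inequality, leaves only the first. *)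
Lemma psi_quadX s : E (fun U => expR (- (2 * Psi s U))) <= E (fun U => expR (- quadX s U)).
Proof.
pose w : G := rg (inord 1) ord0 1.
have c10 : (inord 1 : 'I_N) != ord0 by exact: c1_neq0.
have [bX _ _] := rad_quadX s.
have bE : bmf (fun U : G => expR (- quadX s U)) by apply: bmf_expR; exact: bmfN.
have bEw : bmf (fun U : G => expR (- quadX s (U * w)%g)) by exact: (bmf_right w bE).
have sw J U : (J <= n)%N -> sg J (U * w)%g = 2 * fB J U.
  move=> Jn; rewrite sgE // /fA /fB; congr (_ * (_ * _)); apply: eq_bigr => i _.
  by rewrite /uu /vv mul_rg_entry // eqxx.
rewrite -[leRHS](_ : 2^-1 * (E (fun U => expR (- quadX s U)) + E (fun U => expR (- quadX s (U * w)%g))) = _); last first.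
  by rewrite (Ex_right nuH w bE); field.
rewrite -ExD // -ExZ; last exact: bmfD.
apply: le_Ex => [||U].
- by apply: bmf_expR; apply: bmfN; apply: bmfZ; exact: bmf_Psi.
- by apply: bmfZ; exact: bmfD.
have h : quadX s U + quadX s (U * w)%g <= 4 * Psi s U.
  rewrite /quadX /Psi -big_split mulr_sumr; apply: ler_sum => j _ /=.
  rewrite sgE // sw // -[leLHS]mulrDr [leRHS]mulrCA ler_wpM2l //; exact: fb_var_split.
move: h; move: (quadX s U) (quadX s (U * w)%g) (Psi s U) => x y p h.
apply: (@le_trans _ _ (expR (- x / 2) * expR (- y / 2))); first by rewrite -expRD ler_expR; lra.
have -> : expR (- x) = expR (- x / 2) ^+ 2 by rewrite -expRM_natl; congr expR; field.
have -> : expR (- y) = expR (- y / 2) ^+ 2 by rewrite -expRM_natl; congr expR; field.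
have := sqr_ge0 (expR (- x / 2) - expR (- y / 2)); rewrite sqrrB; lra.
Qed.

Section Tilt.
Variable s : 'I_n -> nat.
Let M : R := \sum_j (s j)%:R.
Hypothesis Mn : 16 * M <= n%:R.
Let H U := expR (- quadX s U).

Let M0 : 0 <= M. Proof. by apply: sumr_ge0. Qed.
Let N0 : 0 < N%:R :> R. Proof. by rewrite ltr0n. Qed.
Let nR : 0 < n%:R :> R. Proof. by rewrite ltr0n. Qed.
Let NE : N%:R = 2 * n%:R + 1 :> R. Proof. by rewrite -natr1 -muln2 natrM mulrC. Qed.

Let quadD_le i U : `|quadD s i U| <= 4 * M.
Proof.
apply: le_trans (ler_norm_sum _ _ _) _; rewrite mulr_sumr; apply: ler_sum => j _.
rewrite normrM ger0_norm // mulrC ler_wpM2r // normrM.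
have /andP[h0 h1] := sg01 j.+1 U.
have t : `|2 - 6 * sg j.+1 U| <= 4 by rewrite ler_norml; apply/andP; split; lra.
by case: (_ < _)%N; rewrite ?normr1 ?normr0 ?mul1r ?mul0r.
Qed.

Let drift_le i U : `|quadD s i U - \sum_l u U l ^+ 2 * quadD s l U| <= 8 * M.
Proof.
have t : `|\sum_l u U l ^+ 2 * quadD s l U| <= 4 * M.
  apply: le_trans (ler_norm_sum _ _ _) _; rewrite -[leRHS]mul1r -[X in X * _](sum_u2 U) mulr_suml.
  by apply: ler_sum => l _; rewrite normrM ger0_norm ?sqr_ge0 // ler_wpM2l ?sqr_ge0.
by apply: le_trans (ler_normB _ _) _; have := quadD_le i U; lra.
Qed.

Let radH : rad H (fun i U => - (H U * quadD s i U)).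
Proof.
have := rad_expR (radZ (-1) (rad_quadX s)); apply: eq_rad => [U|i U]; rewrite /H mulN1r //.
by rewrite mulN1r mulrN.
Qed.

Let bH : bmf H. Proof. by have [] := radH. Qed.
Let bu i : bmf (fun U : G => u U i ^+ 2). Proof. by apply: bmfX; exact: bmf_entry. Qed.
Let bsg J : bmf (sg J : G -> R). Proof. by have [] := rad_sg J. Qed.

Let H0 U : 0 < H U. Proof. exact: expR_gt0. Qed.

(** Under the weight [H] the coordinates stay nearly equidistributed: the derivatives of [quadX s]
    are at most [4 M], so [ibp_rad] gives the mean [1 / N] of [u_i ^ 2] with [N] changed by at most
    [16 M]. *)
Lemma tilt_lower i : E H <= (N%:R + 16 * M) * E (fun U => H U * u U i ^+ 2).
Proof.
have bHu : bmf (fun U => H U * u U i ^+ 2) by exact: bmfM.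
rewrite -subr_ge0 -ExZ // -ExB //; last exact: bmfZ.
have z := ibp_rad nuH i radH; have [_ bD _] := radH.
rewrite -[leLHS]oppr0 -[X in - X <= _]z -ExN; last first.
  apply: bmfD; first by apply: bmfM => //; apply: bmfB; [exact: bmf_cst | exact: bmfZ].
  apply: bmfM; first exact: bmfZ.
  by apply: bmfB => //; apply: bmf_sum => l; exact: bmfM.
apply: le_Ex => [||U].
- apply: bmfN; apply: bmfD; first by apply: bmfM => //; apply: bmfB; [exact: bmf_cst | exact: bmfZ].
  apply: bmfM; first exact: bmfZ.
  by apply: bmfB => //; apply: bmf_sum => l; exact: bmfM.
- by apply: bmfB => //; exact: bmfZ.
have -> : \sum_l u U l ^+ 2 * - (H U * quadD s l U) = - (H U * \sum_l u U l ^+ 2 * quadD s l U).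
  by rewrite mulr_sumr -sumrN; apply: eq_bigr => l _; ring.
have := drift_le i U; rewrite ler_norml => /andP[d1 d2].
have p : 0 <= 2 * H U * u U i ^+ 2 by exact: mulr_ge0 (mulr_ge0 (ler0n R 2) (ltW (H0 U))) (sqr_ge0 _).
by have := ler_wpM2l p d1; have := ler_wpM2l p d2; lra.
Qed.

Lemma tilt_upper (f : G -> R) r i : rad f r -> (forall U, 0 <= f U) ->
  (N%:R - 16 * M) * E (fun U => H U * f U * u U i ^+ 2) <=
  E (fun U => H U * f U) + E (fun U => 2 * H U * u U i ^+ 2 * (r i U - \sum_l u U l ^+ 2 * r l U)).
Proof.
move=> rf f0; have [bf br _] := rf.
have bHf : bmf (fun U => H U * f U) by exact: bmfM.
have bHfu : bmf (fun U => H U * f U * u U i ^+ 2) by exact: bmfM.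
have bs : bmf (fun U => \sum_l u U l ^+ 2 * r l U) by apply: bmf_sum => l; exact: bmfM.
have bR : bmf (fun U => 2 * H U * u U i ^+ 2 * (r i U - \sum_l u U l ^+ 2 * r l U)).
  by apply: bmfM; [apply: bmfM => //; exact: bmfZ | exact: bmfB].
rewrite -subr_ge0 -ExZ // -ExD // -ExB //; [|exact: bmfD|exact: bmfZ].
have rHf := radM radH rf; have [_ bD _] := rHf.
rewrite -[leLHS](ibp_rad nuH i rHf); apply: le_Ex => [||U].
- apply: bmfD; first by apply: bmfM => //; apply: bmfB; [exact: bmf_cst | exact: bmfZ].
  apply: bmfM; first exact: bmfZ.
  by apply: bmfB; [exact: bD | apply: bmf_sum => l; apply: bmfM => //; exact: bD].
- by apply: bmfB; [exact: bmfD | exact: bmfZ].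
have -> : \sum_l u U l ^+ 2 * (- (H U * quadD s l U) * f U + H U * r l U) =
  H U * (\sum_l u U l ^+ 2 * r l U) - H U * f U * \sum_l u U l ^+ 2 * quadD s l U.
  by rewrite !mulr_sumr -sumrB; apply: eq_bigr => l _; ring.
have := drift_le i U; rewrite ler_norml => /andP[d1 d2].
have p : 0 <= 2 * H U * f U * u U i ^+ 2.
  exact: mulr_ge0 (mulr_ge0 (mulr_ge0 (ler0n R 2) (ltW (H0 U))) (f0 U)) (sqr_ge0 _).
by have := ler_wpM2l p d1; have := ler_wpM2l p d2; lra.
Qed.

Let EH0 : 0 < E H.
Proof.
have [_ [B hB]] : bmf (quadX s : G -> R) by have [] := rad_quadX s.
apply: lt_le_trans (expR_gt0 (- B)) _; rewrite -(Ex_cst nu (expR _)); apply: le_Ex => // [|U]; first exact: bmf_cst.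
by rewrite ler_expR lerN2; apply: le_trans (ler_norm _) (hB U).
Qed.

Let e0 : n%:R <= N%:R - 16 * M. Proof. by have := Mn; rewrite NE; lra. Qed.

Let sum_sg (J : nat) (f : G -> R) : (J <= n)%N -> bmf f ->
  \sum_(i < N | (i < J.*2)%N) E (fun U => f U * u U i ^+ 2) = E (fun U => f U * sg J U).
Proof.
move=> Jn bf; rewrite big_mkcond /= (_ : \sum_i _ = \sum_(i < N) E (fun U => (i < J.*2)%N%:R * (f U * u U i ^+ 2))); last first.
  apply: eq_bigr => i _; rewrite ExZ; last exact: bmfM.
  by case: (_ < _)%N; rewrite ?mul1r ?mul0r.
rewrite -Ex_sum => [|i]; last by apply: bmfZ; exact: bmfM.
congr (Ex _ _); apply/funext => U; rewrite /sg mulr_sumr [RHS]big_mkcond; apply: eq_bigr => i _.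
by case: (_ < _)%N; rewrite ?mul1r ?mul0r.
Qed.

Let card_low (J : nat) : (J <= n)%N -> #|[pred i : 'I_N | (i < J.*2)%N]| = J.*2.
Proof.
move=> Jn; rewrite -sum1_card -(big_mkord (fun i => i < J.*2)%N (fun=> 1%N)) /=.
rewrite (big_cat_nat (n := J.*2)) //=; last by rewrite leqW // leq_double.
rewrite [X in (X + _)%N]big_nat_cond [X in (_ + X)%N]big_nat_cond [X in (_ + X)%N]big_pred0 ?addn0; last first.
  by move=> i; case: (leqP J.*2 i); rewrite ?andbF.
rewrite (eq_bigl (fun i => 0 <= i < J.*2)%N); last by move=> i; rewrite leq0n /=; case: (_ < _)%N.
by rewrite -big_nat sum_nat_const_nat subn0 muln1.
Qed.

Let sum_cst (J : nat) (c : R) : (J <= n)%N -> \sum_(i < N | (i < J.*2)%N) c = 2 * J%:R * c.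
Proof.
move=> Jn; rewrite sumr_const card_low // -[c *+ _]mulr_natl; congr (_ * _).
by rewrite -muln2 natrM mulrC.
Qed.

Lemma tilt_sg J : (J <= n)%N -> (2 * J%:R) * E H <= (N%:R + 16 * M) * E (fun U => H U * sg J U).
Proof.
move=> Jn; rewrite -(sum_sg Jn bH) -(sum_cst (E H) Jn) mulr_sumr.
by apply: ler_sum => i _; exact: tilt_lower.
Qed.

Lemma tilt_sg_le J : (J <= n)%N -> (N%:R - 16 * M) * E (fun U => H U * sg J U) <= (2 * J%:R) * E H.
Proof.
move=> Jn; rewrite -(sum_sg Jn bH) -(sum_cst (E H) Jn) mulr_sumr.
apply: ler_sum => i _; have := tilt_upper i (rad_cst 1) (fun _ => ler01).
rewrite (_ : E (fun U => 2 * H U * _ * _) = 0) ?addr0; last first.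
  rewrite -[RHS](Ex_cst nu 0); congr (Ex _ _); apply/funext => U.
  by rewrite big1 ?subr0 ?mulr0 // => l _; rewrite mulr0.
have -> : (fun U => H U * 1) = H by apply/funext => U; rewrite mulr1.
by have -> : (fun U => H U * 1 * u U i ^+ 2) = (fun U => H U * u U i ^+ 2) by apply/funext => U; rewrite mulr1.
Qed.

(** [tilt_upper] with [f = sg J] reduces the second moment to the first. As [16 M <= n], each use
    divides by at least [n], and [(2 J + 2) (2 J) <= 8 J ^ 2]. *)
Lemma tilt_sg2 J : (0 < J <= n)%N -> E (fun U => H U * sg J U ^+ 2) <= 8 * J%:R ^+ 2 / n%:R ^+ 2 * E H.
Proof.
move=> /andP[J0 Jn]; have bHs : bmf (fun U => H U * sg J U) by exact: bmfM.
have h1 : (N%:R - 16 * M) * E (fun U => H U * sg J U ^+ 2) <= (2 * J%:R + 2) * E (fun U => H U * sg J U).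
  have -> : (fun U => H U * sg J U ^+ 2) = (fun U => (H U * sg J U) * sg J U) by apply/funext => U; ring.
  rewrite -(sum_sg Jn bHs) mulr_sumr [leRHS]mulrDl -(sum_cst _ Jn).
  have -> : 2 * E (fun U => H U * sg J U) = E (fun U => 2 * H U * sg J U).
    by rewrite -ExZ //; congr (Ex _ _); apply/funext => U; ring.
  rewrite -(sum_sg Jn (bmfZ 2 bH)) -big_split /=; apply: ler_sum => i iJ.
  have sp U : 0 <= sg J U by have /andP[] := sg01 J U.
  apply: le_trans (tilt_upper i (rad_sg J) sp) _.
  rewrite lerD2l iJ; apply: le_Ex => [||U].
  - apply: bmfM; first by apply: bmfM => //; exact: bmfZ.
    by apply: bmfB; [exact: bmf_cst | apply: bmf_sum => l; apply: bmfM => //; exact: bmf_cst].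
  - by apply: bmfM => //; exact: bmfZ.
  rewrite ler_piMr ?gerBl //; first exact: mulr_ge0 (mulr_ge0 (ler0n R 2) (ltW (H0 U))) (sqr_ge0 _).
  by apply: sumr_ge0 => l _; apply: mulr_ge0 => //; exact: sqr_ge0.
have h2 := tilt_sg_le Jn.
have J1 : 1 <= J%:R :> R by rewrite ler1n.
have s0 : 0 <= E (fun U => H U * sg J U ^+ 2) by apply: Ex_ge0 => U; exact: mulr_ge0 (ltW (H0 U)) (sqr_ge0 _).
have s1 : 0 <= E (fun U => H U * sg J U).
  by apply: Ex_ge0 => U; rewrite mulr_ge0 ?(ltW (H0 U)) //; have /andP[] := sg01 J U.
have k1 := le_trans (ler_wpM2r s0 e0) h1. have k2 := le_trans (ler_wpM2r s1 e0) h2.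
rewrite mulrAC ler_pdivlMr ?exprn_gt0 //.
have q : n%:R * (n%:R * E (fun U => H U * sg J U ^+ 2)) <= (2 * J%:R + 2) * (2 * J%:R * E H).
  apply: le_trans (ler_wpM2l (ltW nR) k1) _; rewrite mulrCA ler_wpM2l //; lra.
apply: (@le_trans _ _ ((2 * J%:R + 2) * (2 * J%:R * E H))).
  by move: q; move: (E (fun U => H U * sg J U ^+ 2)) => x; rewrite expr2; lra.
have JE : 0 <= J%:R * E H by rewrite mulr_ge0 // ltW.
by have := ler_wpM2r JE J1; rewrite expr2; lra.
Qed.

(** If [quadX s] has mean at least [m] under the weight [H], convexity of the exponential gives that
    [H] has mean at most [expR (- m)]. The linear part of [quadX] yields the main term, by
    [2 n / (N + 16 M) >= 1 - 9 M / n] for [M >= 1]; the quadratic part yields the correction with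
    12. *)
Lemma sharp_bound : \sum_j (s j)%:R * j.+1%:R * (1 - 9 * M / n%:R - 12 * j.+1%:R / n%:R) <=
  n%:R / 2 * - ln (E (fun U => expR (- (2 * Psi s U)))).
Proof.
pose m : R := \sum_j (s j)%:R * (4 * j.+1%:R / (N%:R + 16 * M) - 24 * j.+1%:R ^+ 2 / n%:R ^+ 2).
have [bX _ _] := rad_quadX s.
have NM : 0 < N%:R + 16 * M by rewrite ltr_pwDl // mulr_ge0 ?M0.
have bs2 J : bmf (fun U => H U * sg J U ^+ 2) by apply: bmfM => //; exact: bmfX.
have bs1 J : bmf (fun U => H U * sg J U) by exact: bmfM.
have mX : m * E H <= E (fun U => H U * quadX s U).
  have -> : (fun U => H U * quadX s U) = fun U => \sum_j (s j)%:R * (2 * (H U * sg j.+1 U) - 3 * (H U * sg j.+1 U ^+ 2)).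
    by apply/funext => U; rewrite mulr_sumr; apply: eq_bigr => j _; ring.
  have b j : bmf (fun U => 2 * (H U * sg j.+1 U) - 3 * (H U * sg j.+1 U ^+ 2)) by apply: bmfB; exact: bmfZ.
  rewrite Ex_sum => [|j]; last exact: bmfZ.
  rewrite mulr_suml; apply: ler_sum => j _; rewrite ExZ // ExB; [|exact: bmfZ|exact: bmfZ].
  rewrite !ExZ // -[leLHS]mulrA ler_wpM2l //.
  have t1 := tilt_sg (ltn_ord j); have t2 := @tilt_sg2 j.+1 (ltn_ord j).
  have t1' : 4 * j.+1%:R / (N%:R + 16 * M) * E H <= 2 * E (fun U => H U * sg j.+1 U).
    rewrite mulrAC ler_pdivrMr // [leRHS]mulrAC -[leRHS]mulrA; lra.
  have -> : 24 * j.+1%:R ^+ 2 / n%:R ^+ 2 = 3 * (8 * j.+1%:R ^+ 2 / n%:R ^+ 2) :> R by rewrite !mulrA; congr (_ * _ * _); ring.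
  by rewrite mulrBl; lra.
have Lm : E (fun U => expR (- (2 * Psi s U))) <= expR (- m).
  apply: le_trans (psi_quadX s) _.
  rewrite -(Ex_cst nu (expR (- m))) -subr_ge0 -ExB //; last exact: bmf_cst.
  apply: le_trans (_ : 0 <= E (fun U => H U * (quadX s U - m))) _.
    rewrite (_ : (fun U => _) = (fun U => H U * quadX s U - m * H U)); last by apply/funext => U; ring.
    by rewrite ExB ?ExZ ?subr_ge0 //; [exact: bmfM | exact: bmfZ].
  apply: le_Ex => [||U].
  - by apply: bmfM => //; apply: bmfB => //; exact: bmf_cst.
  - by apply: bmfB => //; exact: bmf_cst.
  have -> : expR (- m) = H U * expR (quadX s U - m) by rewrite /H -expRD; congr expR; ring.
  rewrite -[X in _ <= _ - X]/(H U) -[X in _ <= _ - X]mulr1 -mulrBr ler_pM2l //.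
  by have := expR_ge1Dx (quadX s U - m); lra.
have P0 : 0 < E (fun U => expR (- (2 * Psi s U))).
  have [_ [B hB]] := bmf_Psi (n := n) (R := R) s.
  apply: lt_le_trans (expR_gt0 (- (2 * B))) _; rewrite -(Ex_cst nu (expR _)); apply: le_Ex => [||U]; first exact: bmf_cst.
    by apply: bmf_expR; apply: bmfN; apply: bmfZ; exact: bmf_Psi.
  by rewrite ler_expR lerN2 ler_wpM2l //; apply: le_trans (ler_norm _) (hB U).
have mL : m <= - ln (E (fun U => expR (- (2 * Psi s U)))).
  by rewrite lerNr -[leRHS]expRK ler_ln ?posrE ?expR_gt0.
apply: le_trans (ler_wpM2l _ mL); last by rewrite divr_ge0.
rewrite /m [leRHS]mulr_sumr; apply: ler_sum => j _.
case: (posnP (s j)) => [->|sj]; first by rewrite !mul0r mulr0.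
have M1 : 1 <= M.
  by rewrite /M (bigD1 j) //= -[leLHS]addr0 lerD ?ler1n ?sumr_ge0.
rewrite -[leLHS]mulrA [leRHS]mulrCA ler_wpM2l //.
have j0 : 0 <= j.+1%:R :> R by [].
have -> : n%:R / 2 * (4 * j.+1%:R / (N%:R + 16 * M) - 24 * j.+1%:R ^+ 2 / n%:R ^+ 2) =
   j.+1%:R * (2 * n%:R / (N%:R + 16 * M) - 12 * j.+1%:R / n%:R).
  by move: (N%:R + 16 * M) NM => q q0; field; rewrite ?lt0r_neq0.
rewrite ler_wpM2l // lerD2r ler_pdivlMr //.
rewrite -subr_ge0 (_ : _ - _ = (9 * M * (N%:R + 16 * M) - n%:R * (1 + 16 * M)) / n%:R); last first.
  by rewrite NE; field; rewrite lt0r_neq0.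
rewrite divr_ge0 ?(ltW nR) // NE; have MM : 0 <= M * M by rewrite mulr_ge0 ?M0.
have := ler_wpM2r (ltW nR) M1; have := M1; have := nR; move: MM; move: M (n%:R : R) => x y; nra.
Qed.

End Tilt.
End SharpBound.

(** * The decay rate *)

Section Rate.
Context {R : realType} {n : nat}.
Hypothesis n0 : (0 < n)%N.
Local Notation N := n.*2.+1.
Local Notation G := (SO R N).
Variable nu : probability G R.
Hypothesis nuH : is_haar nu.
Local Notation E := (Ex nu).
Implicit Types (a s : 'I_n -> nat) (U : G).

Let bE a : bmf (fun U => expR (- (2 * Psi a U))).
Proof. by apply: bmf_expR; apply: bmfN; apply: bmfZ; exact: bmf_Psi. Qed.

Lemma E_Psi_gt0 a : 0 < E (fun U => expR (- (2 * Psi a U))).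
Proof.
have [_ [B hB]] := bmf_Psi (n := n) (R := R) a.
apply: lt_le_trans (expR_gt0 (- (2 * B))) _; rewrite -(Ex_cst nu (expR _)); apply: le_Ex => // [|U].
  exact: bmf_cst.
by rewrite ler_expR lerN2 ler_wpM2l //; apply: le_trans (ler_norm _) (hB U).
Qed.

(** The mean of [2 Psi a] could not take this place: an upper bound on the mean of an exponential is
    needed, and there Jensen's inequality goes the wrong way. *)
Definition rate a : R := - ln (E (fun U => expR (- (2 * Psi a U)))).

Lemma rate_crude a : \sum_(k < n) ln (1 + (lam a k)%:R / N%:R) <= 12 * rate a.
Proof.
have h := crude_bound n0 nuH a; have p := E_Psi_gt0 a.
move: h; rewrite -[X in X <= _]lnK ?posrE // ler_expR /rate; lra.
Qed.

Lemma rate_mono s a : (forall j, (s j <= a j)%N) -> rate s <= rate a.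
Proof.
move=> sa; rewrite /rate lerN2 ler_ln ?posrE ?E_Psi_gt0 //; apply: le_Ex => // U.
rewrite ler_expR lerN2 ler_wpM2l //; apply: ler_sum => j _.
by rewrite ler_wpM2r ?ler_nat //; exact: (fb_var_ge0 n0 (ltn1_doubleS n0) U (ltn_ord j)).
Qed.

Lemma rate_ge0 a : 0 <= rate a.
Proof.
rewrite -(pmulr_rge0 _ (ltr0n R 12)) (le_trans _ (rate_crude a)) // sumr_ge0 // => k _.
by rewrite ln_ge0 // lerDl divr_ge0.
Qed.

Lemma expR_convex (S x : R) : 0 <= S <= 1 -> expR (S * x) <= 1 - S + S * expR x.
Proof.
move=> /andP[S0 S1]; have e0 := expR_ge0 (S * x).
have h1 : expR (S * x) * (1 + (1 - S) * x) <= expR x.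
  rewrite (_ : expR x = expR (S * x) * expR ((1 - S) * x)); first by rewrite ler_wpM2l // expR_ge1Dx.
  by rewrite -expRD; congr expR; ring.
have h2 : expR (S * x) * (1 - S * x) <= 1.
  apply: (@le_trans _ _ (expR (S * x) * expR (- (S * x)))); last by rewrite -expRD subrr expR0.
  by rewrite ler_wpM2l // expR_ge1Dx.
have S1' : 0 <= 1 - S by lra.
have := ler_wpM2l S0 h1; have := ler_wpM2l S1' h2; lra.
Qed.

Variables (hN : (1 < N)%N) (theta : R).
Local Notation Sq := (sin (theta / 2) ^+ 2).

(** A power with exponent in [0, 1] is concave, so it commutes with the mean in the right direction.
    Concretely [expR_convex] is used at [rate a - 2 Psi a], whose exponential has mean 1. *)
Lemma reig_le a : Sq <= 1 -> `|complex.Re (reig hN nu theta a)| <= expR (- (Sq * rate a)).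
Proof.
move=> S1; have S01 : 0 <= Sq <= 1 by rewrite sqr_ge0.
have cF : cbmf (fun X : G => Fa a (cj (cm (so_mx X)))) by exact: cbmf_Fa1.
have [bR _] := cbmf_wk1 hN theta cF.
apply: le_trans (Ex_norm nu bR) _.
apply: (@le_trans _ _ (E (fun U => expR (- (2 * Sq) * Psi a U)))).
  apply: le_Ex => [||U]; first exact: bmf_norm.
    by apply: bmf_expR; apply: bmfZ; exact: bmf_Psi.
  exact: Fa_norm.
have b2 : bmf (fun U => Sq * (expR (rate a) * expR (- (2 * Psi a U)))) by apply: bmfZ; exact: bmfZ.
have b3 : bmf (fun U => 1 - Sq + Sq * (expR (rate a) * expR (- (2 * Psi a U)))).
  by apply: bmfD => //; exact: bmf_cst.
apply: (@le_trans _ _ (E (fun U => expR (- (Sq * rate a)) * (1 - Sq + Sq * (expR (rate a) * expR (- (2 * Psi a U))))))).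
  apply: le_Ex => [||U]; [by apply: bmf_expR; apply: bmfZ; exact: bmf_Psi | exact: bmfZ |].
  have := expR_convex (rate a - 2 * Psi a U) S01; rewrite expRD => h.
  apply: le_trans (ler_wpM2l (expR_ge0 _) h); rewrite -expRD ler_expR; lra.
rewrite ExZ // ExD //; last exact: bmf_cst.
rewrite Ex_cst ExZ; last exact: bmfZ.
rewrite ExZ // (_ : expR (rate a) * _ = 1) ?mulr1 ?subrK ?mulr1 //.
by rewrite /rate expRN lnK ?posrE ?E_Psi_gt0 // mulVf // lt0r_neq0 ?E_Psi_gt0.
Qed.

End Rate.

(** * Dimensions against decay rates *)

Section LogInequalities.
Context {R : realType}.
Implicit Types (x y : R) (m h p n : nat).

Lemma ln_le x : 0 < x -> ln x <= x - 1.
Proof.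
move=> x0; have := @ln1p_le R (x - 1); rewrite addrCA subrr addr0; apply; lra.
Qed.

Lemma ln1p_half x : 0 <= x <= 1 -> x / 2 <= ln (1 + x).
Proof.
move=> /andP[x0 x1]; apply: le_trans (ln1p_ge _); last by lra.
by rewrite ler_wpM2l // lef_pV2 ?posrE; lra.
Qed.

Lemma ln1p_mul x c : 0 <= x -> 1 <= c -> ln (1 + c * x) <= c * ln (1 + x).
Proof.
move=> x0 c1; have c0 : 0 < c by lra.
have ci : 0 <= c^-1 <= 1 by rewrite invr_ge0 (ltW c0) invf_le1.
have := expR_convex (ln (1 + c * x)) ci.
have cx : 0 < 1 + c * x by apply: ltr_pwDl => //; exact: mulr_ge0 (ltW c0) x0.
have x1 : 0 < 1 + x by lra.
rewrite lnK ?posrE // (_ : 1 - c^-1 + c^-1 * (1 + c * x) = 1 + x); last by field; rewrite lt0r_neq0.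
by move=> h; rewrite -ler_pdivrMl // -ler_expR [leRHS]lnK ?posrE.
Qed.

Lemma ln1p_nat n x : 0 <= x -> ln (1 + n%:R * x) <= n%:R * ln (1 + x).
Proof.
case: n => [|n] x0; first by rewrite !mul0r addr0 ln1.
by apply: ln1p_mul => //; rewrite ler1n.
Qed.

(** Half of Stirling's formula: [m! >= (m / e) ^ m]. *)
Lemma ln_fact_ge m : expR (m%:R * ln m%:R - m%:R) <= m`!%:R :> R.
Proof.
elim: m => [|m IH]; first by rewrite mul0r subr0 expR0.
have m1 : 0 < m.+1%:R :> R by [].
rewrite factS natrM -[X in _ <= X * _](lnK (x := m.+1%:R)) ?posrE //.
apply: le_trans (ler_wpM2l (expR_ge0 _) IH); rewrite -expRD ler_expR.
case: m m1 {IH} => [|m] m1; first by rewrite ln1; lra.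
have m0 : 0 < m.+1%:R :> R by [].
have h : m.+1%:R * (ln m.+2%:R - ln m.+1%:R) <= 1 :> R.
  rewrite -ln_div ?posrE // -ler_pdivlMl // mulr1; apply: le_trans (ln_le _) _; first by rewrite divr_gt0.
  by rewrite -[m.+2%:R]natr1 mulrDl divff ?lt0r_neq0 // mul1r addrAC subrr add0r.
rewrite -[in X in X * ln _ - X]natr1; move: h; lra.
Qed.

Lemma bin_le_expR p h : (0 < p)%N -> 'C(p, h)%:R <= expR (h%:R * (ln p%:R + 1 - ln h%:R)) :> R.
Proof.
move=> p0; have f0 : 0 < h`!%:R :> R by rewrite ltr0n fact_gt0.
have ff : (p ^_ h <= p ^ h)%N.
  by elim: h {f0} => // h IH; rewrite ffactnSr expnSr leq_mul // leq_subr.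
rewrite -(ler_pM2r f0) -natrM bin_ffact.
apply: (@le_trans _ _ (p ^ h)%:R); first by rewrite ler_nat.
apply: le_trans (ler_wpM2l (expR_ge0 _) (ln_fact_ge h)); rewrite -expRD natrX.
rewrite -[X in X ^+ _](lnK (x := p%:R)) ?posrE ?ltr0n // -expRM_natl ler_expR; lra.
Qed.

Lemma ln3_le2 : ln 3 <= 2 :> R.
Proof. by apply: le_trans (ln_le _) _; lra. Qed.

(** Write [ln y] as [ln x + ln (y / x)]; the second part costs at most 1. With [y = n] it trades a
    factor ln n in an error term for the logarithm of a smaller quantity, with a small
    coefficient. *)
Lemma log_share x y e : 1 <= x -> x <= e * y -> 0 < e <= 1 -> x / y * ln y <= e * ln x + 1.
Proof.
move=> x1 xy /andP[e0 e1]; have x0 : 0 < x by lra.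
have y0 : 0 < y by rewrite -(pmulr_rgt0 _ e0); exact: lt_le_trans x0 xy.
rewrite (_ : ln y = ln x + ln (y / x)); last by rewrite ln_div ?posrE // addrC subrK.
rewrite mulrDr lerD //; first by rewrite ler_wpM2r ?ln_ge0 // ler_pdivrMr.
apply: (@le_trans _ _ (x / y * (y / x))); last by rewrite mulrA divfK ?lt0r_neq0 // divff // lt0r_neq0.
rewrite ler_wpM2l ?divr_ge0 ?(ltW x0) ?(ltW y0) //; apply: le_trans (ln_le _) _; first by rewrite divr_gt0.
by rewrite gerBl.
Qed.

(** Up to [w h ^ 2], which is at most [w ^ 3], the logarithm of [M] costs [3 ln w]; any excess is
    paid by [M / h ^ 2], which is summable over the heights [h]. *)
Lemma weight_log_share (w M h : R) : 1 <= h -> h <= w -> 0 < M -> w * ln M <= 3 * (w * ln w) + M / h ^+ 2.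
Proof.
move=> h1 hw M0; have h0 : 0 < h by lra. have w0 : 0 < w by lra.
have d0 : 0 < w * h ^+ 2 by rewrite mulr_gt0 // exprn_gt0.
have := ln_le (divr_gt0 M0 d0); rewrite ln_div ?posrE // lnM ?posrE ?exprn_gt0 // expr2 lnM ?posrE // => k.
have lh : ln h <= ln w by rewrite ler_ln ?posrE.
have k2 : ln M <= 3 * ln w + M / (w * (h * h)) by move: k lh; lra.
have := ler_wpM2l (ltW w0) k2; rewrite mulrDr => k3; apply: le_trans k3 _.
rewrite le_eqVlt; apply/orP; left; apply/eqP; field.
by rewrite !lt0r_neq0.
Qed.

Lemma sum_inv_sq n : \sum_(j < n) j.+1%:R ^- 2 <= 2 :> R.
Proof.
case: n => [|n]; first by rewrite big_ord0.
suff h : \sum_(j < n.+1) j.+1%:R ^- 2 <= 2 - n.+1%:R^-1 :> R.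
  by apply: le_trans h _; rewrite gerBl.
elim: n => [|n IH]; first by rewrite big_ord_recl big_ord0 /= invr1 expr1n invr1; lra.
rewrite big_ord_recr /=; apply: le_trans (lerD IH (lexx _)) _.
have a0 : 0 < n.+1%:R :> R by [].
have -> : n.+2%:R = n.+1%:R + 1 :> R by rewrite natr1.
move: (n.+1%:R : R) a0 => a a0; have b0 : 0 < a + 1 by lra.
have e : a^-1 - (a + 1)^-1 = a^-1 * (a + 1)^-1 by field; rewrite !lt0r_neq0.
have : (a + 1) ^- 2 <= a^-1 * (a + 1)^-1.
  by rewrite expr2 invfM ler_wpM2r ?invr_ge0 ?(ltW b0) // lef_pV2 ?posrE //; lra.
lra.
Qed.

(** Jensen's inequality for weights of total at most 1: the missing mass may be put at 0, where the
    function vanishes. *)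
Lemma ln1p_concave (I : Type) (s : seq I) (p x : I -> R) : (forall i, 0 <= p i) -> (forall i, 0 <= x i) ->
  \sum_(i <- s) p i <= 1 -> \sum_(i <- s) p i * ln (1 + x i) <= ln (1 + \sum_(i <- s) p i * x i).
Proof.
move=> p0 x0 p1; set m := \sum_(i <- s) p i * x i.
have m0 : 0 <= m by apply: sumr_ge0 => i _; rewrite mulr_ge0.
have d : 0 < 1 + m by rewrite ltr_pwDl.
apply: (@le_trans _ _ (\sum_(i <- s) p i * (ln (1 + m) + (x i - m) / (1 + m)))).
  apply: ler_sum => i _; rewrite ler_wpM2l // -lerBlDl -ln_div ?posrE ?ltr_pwDl //.
  apply: le_trans (ln_le _) _; first by rewrite divr_gt0 // ltr_pwDl.
  by rewrite le_eqVlt; apply/orP; left; apply/eqP; field; rewrite lt0r_neq0.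
rewrite (eq_bigr (fun i => p i * (ln (1 + m) - m / (1 + m)) + p i * x i / (1 + m))); last first.
  by move=> i _; field; rewrite lt0r_neq0.
rewrite big_split /= -!mulr_suml -/m.
have h := @ln1p_ge R m; have {}h : m / (1 + m) <= ln (1 + m) by apply: h; lra.
have := ler_wpM2r (_ : 0 <= ln (1 + m) - m / (1 + m)) p1; rewrite subr_ge0 => /(_ h); lra.
Qed.

End LogInequalities.

(** * Ranks, one block of columns of equal height at a time *)

Section Dimensions.
Context {R : realType} {n : nat}.
Hypothesis n0 : (0 < n)%N.
Local Notation N := n.*2.+1.
Implicit Types (a s : 'I_n -> nat).

Definition block s j : 'I_n -> nat := fun i => if i == j then s i else 0%N.

Lemma krank_blocks s (d : 'I_n -> nat) : (forall j, krank (@Ka R n (block s j)) (d j)) ->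
  krank (@Ka R n s) (\prod_j d j).
Proof.
move=> h.
have : krank (@Ka R n (fun i => \sum_(j <- enum 'I_n) block s j i)%N) (\prod_(j <- enum 'I_n) d j).
  elim: (enum _) => [|j r IH].
    have := @krank_cols R n (fun=> 0%N); rewrite big1 // exp1n big_nil.
    by congr (krank (Ka _) _); apply/funext => i; rewrite big_nil.
  rewrite big_cons; have := krank_split (h j) IH; congr (krank (Ka _) _).
  by apply/funext => i; rewrite big_cons.
rewrite !big_enum /=; congr (krank (Ka _) _); apply/funext => i.
by rewrite big_enum /= /block (bigD1 i) //= eqxx big1 ?addn0 // => j; rewrite eq_sym => /negPf ->.
Qed.

Lemma krank_min a d d' : krank (@Ka R n a) d -> krank (@Ka R n a) d' -> krank (@Ka R n a) (minn d d').
Proof. by rewrite /minn; case: ltnP. Qed.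

Lemma lam_block s (j : 'I_n) k : lam (block s j) k = if (k <= j)%N then s j else 0%N.
Proof.
rewrite /lam big_mkcond /= (bigD1 j) //= big1 ?addn0 => [|i ij]; first by rewrite /block eqxx.
by rewrite /block (negPf ij); case: ifP.
Qed.

Lemma nR : 0 < n%:R :> R. Proof. by rewrite ltr0n. Qed.

Definition blockw s (j : 'I_n) : R := j.+1%:R * (s j)%:R.

Lemma bin_le3 p h : (0 < p <= 3 * n)%N -> (0 < h)%N ->
  'C(p, h)%:R <= expR (h%:R * (ln n%:R + 3 - ln h%:R)) :> R.
Proof.
move=> /andP[p0 p3] h0; apply: le_trans (bin_le_expR h p0) _; rewrite ler_expR ler_wpM2l //.
have : ln p%:R <= ln (3 * n%:R) :> R by rewrite ler_ln ?posrE ?mulr_gt0 ?ltr0n // -natrM ler_nat.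
by rewrite lnM ?posrE ?nR //; have := @ln3_le2 R; lra.
Qed.

(** The smaller of the squares of the column count and the row count is at most their product. The
    former saves [ln (j + 1)] per box and the latter [ln (s j)], so together they save the logarithm
    of the number [blockw s j] of boxes. *)
Lemma krank_short_block s (j : 'I_n) : (s j <= n)%N ->
  exists2 d, krank (@Ka R n (block s j)) d &
    d%:R <= expR (2 * (blockw s j * (ln n%:R + 3 - ln (blockw s j) / 2))).
Proof.
move=> sn; case: (posnP (s j)) => [sj|sj].
  exists 1%N; last by rewrite /blockw sj mulr0 mul0r mulr0 expR0.
  have := @krank_cols R n (block s j); rewrite big1 ?exp1n // => i _.
  by rewrite /block; case: eqP => [->|_]; rewrite ?sj ?expn0.
pose c := ('C(N, j.+1) ^ s j)%N; pose r := ('C(n.*2 + s j, n.*2) ^ j.+1)%N.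
have kc : krank (@Ka R n (block s j)) (c ^ 2).
  have := @krank_cols R n (block s j); rewrite (bigD1 j) //= big1 => [|i ij]; first by rewrite muln1 /block eqxx.
  by rewrite /block (negPf ij) expn0.
have kr : krank (@Ka R n (block s j)) (r ^ 2).
  have := @krank_rows R n (block s j); congr (krank _ (_ ^ 2)).
  rewrite (eq_bigr (fun k : 'I_n => if (k <= j)%N then 'C(n.*2 + s j, n.*2) else 1%N)); last first.
    by move=> k _; rewrite lam_block; case: ifP; rewrite ?addn0 ?binn.
  rewrite -big_mkcond /= -(big_mkord (fun k => k <= j)%N (fun=> 'C(n.*2 + s j, n.*2))) /r.
  have jn := ltn_ord j; rewrite (big_cat_nat (n := j.+1)) //=.
  rewrite [X in (_ * X)%N]big_nat_cond [X in (_ * X)%N]big_pred0 ?muln1; last first.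
    by move=> k; case: (ltnP j k); rewrite ?andbF // => h; rewrite leqNgt h !andbF.
  rewrite big_nat_cond (eq_bigl (fun k => 0 <= k < j.+1)%N); last by move=> k; rewrite ltnS /= andbb.
  by rewrite -big_nat big_const_nat subn0 iter_muln_1.
exists (minn (c ^ 2) (r ^ 2)); first exact: krank_min.
have mcr : (minn (c ^ 2) (r ^ 2) <= c * r)%N.
  case: (leqP c r) => h; first by apply: leq_trans (geq_minl _ _) _; rewrite leq_mul2l h orbT.
  by apply: leq_trans (geq_minr _ _) _; rewrite leq_mul2r ltnW ?orbT.
apply: (@le_trans _ _ (c * r)%:R); first by rewrite ler_nat.
have s0 : 0 < (s j)%:R :> R by rewrite ltr0n.
have c1 : c%:R <= expR (blockw s j * (ln n%:R + 3 - ln j.+1%:R)) :> R.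
  rewrite natrX (_ : blockw s j * _ = (s j)%:R * (j.+1%:R * (ln n%:R + 3 - ln j.+1%:R))); last by rewrite /blockw; ring.
  rewrite expRM_natl lerXn2r ?nnegrE ?expR_ge0 //; apply: bin_le3 => //.
  by move: n0; clear; lia.
have r1 : r%:R <= expR (blockw s j * (ln n%:R + 3 - ln (s j)%:R)) :> R.
  rewrite natrX (_ : blockw s j * _ = j.+1%:R * ((s j)%:R * (ln n%:R + 3 - ln (s j)%:R))); last by rewrite /blockw; ring.
  rewrite expRM_natl lerXn2r ?nnegrE ?expR_ge0 // -bin_sub ?leq_addr // addKn; apply: bin_le3 => //.
  by move: n0 sn; clear; lia.
rewrite natrM; apply: le_trans (ler_pM _ _ c1 r1) _ => //; rewrite -expRD ler_expR.
have -> : ln (blockw s j) = ln j.+1%:R + ln (s j)%:R by rewrite /blockw lnM ?posrE.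
lra.
Qed.

Lemma krank_short s : (forall j, s j <= n)%N ->
  exists2 d, krank (@Ka R n s) d &
    d%:R <= expR (2 * \sum_j (blockw s j * (ln n%:R + 3 - ln (blockw s j) / 2))).
Proof.
move=> sn; have h j := cid2 (krank_short_block (sn j)); pose d j := s2val (h j).
exists (\prod_j d j)%N; first by apply: krank_blocks => j; exact: s2valP (h j).
rewrite mulr_sumr expR_sum natr_prod; apply: ler_prod => j _; rewrite ler0n.
exact: s2valP' (h j).
Qed.

End Dimensions.

Lemma dim_le_rate_arith {R : realType} (S m L ra rs la : R) : S <= m / 2 * rs * (L + 60) ->
  m / 2 * (L + 60) * rs <= m / 2 * (L + 60) * ra -> m * la <= m * (12 * ra) -> 0 <= m * ra ->
  2 * S + (1728 * m * la + 1600 * m * la) <= m * (L + 20 * 2000) * ra.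
Proof.
move=> h1 h2 h3 h4; apply: (@le_trans _ _ (m * (L + 60) * ra + 3328 * (12 * (m * ra)))); first by lra.
by lra.
Qed.

(** * Ranks against decay rates *)

Section RateDimension.
Context {R : realType} {n : nat}.
Hypothesis n0 : (0 < n)%N.
Local Notation N := n.*2.+1.
Variable nu : probability (SO R N) R.
Hypothesis nuH : is_haar nu.
Local Notation rate := (rate nu).
Implicit Types (a s : 'I_n -> nat).

Lemma lam_le s a k : (forall j, s j <= a j)%N -> (lam s k <= lam a k)%N.
Proof. by move=> sa; apply: leq_sum => j _. Qed.

Let logs a : R := \sum_(k < n) ln (1 + (lam a k)%:R / N%:R).

Let nR : 0 < n%:R :> R. Proof. by rewrite ltr0n. Qed.
Let N0 : 0 < N%:R :> R. Proof. by rewrite ltr0n. Qed.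
Let NE : N%:R = 2 * n%:R + 1 :> R. Proof. by rewrite -natr1 -muln2 natrM mulrC. Qed.
Let n1 : 1 <= n%:R :> R. Proof. by rewrite ler1n. Qed.

Let ln_lam0 a k : 0 <= ln (1 + (lam a k)%:R / N%:R) :> R.
Proof. by rewrite ln_ge0 // lerDl divr_ge0. Qed.

Lemma bin_row (m : nat) :
  'C(n.*2 + m, n.*2)%:R <= expR (2 * n%:R * (1 + 2 * ln (1 + m%:R / N%:R))) :> R.
Proof.
have p0 : (0 < n.*2 + m)%N by rewrite addn_gt0 double_gt0 n0.
have d0 : 0 < n.*2%:R :> R by rewrite ltr0n double_gt0.
have dE : n.*2%:R = 2 * n%:R :> R by rewrite -muln2 natrM mulrC.
apply: le_trans (bin_le_expR _ p0) _; rewrite ler_expR dE ler_wpM2l ?mulr_ge0 //.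
rewrite -dE -addrA [1 + - _]addrC addrA [_ + 1]addrC lerD2l -ln_div ?posrE ?ltr0n ?double_gt0 //.
have m0 : 0 <= m%:R / N%:R :> R by rewrite divr_ge0.
apply: le_trans (ln1p_mul m0 (_ : 1 <= 2)); last by lra.
rewrite natrD mulrDl divff ?lt0r_neq0 // ler_ln ?posrE ?ltr_pwDl ?divr_ge0 ?mulr_ge0 // lerD2l.
rewrite mulrCA ler_wpM2l // ler_pdivlMr // mulrC ler_pdivrMr // dE NE; have := n1; lra.
Qed.

(** Every row through such a column is longer than [n / 128]. With [N <= 3 n] its logarithm is at
    least 1/385, enough to absorb the constant term of [bin_row]. *)
Lemma krank_long a t : (forall j, t j <= a j)%N -> (forall j, (0 < t j)%N -> (n < 128 * lam a j)%N) ->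
  exists2 d, krank (@Ka R n t) d & d%:R <= expR (1600 * n%:R * logs a).
Proof.
move=> ta big; exists ((\prod_(k < n) 'C(n.*2 + lam t k, n.*2)) ^ 2)%N; first exact: krank_rows.
rewrite natrX natr_prod (_ : 1600 * _ * _ = 2%:R * \sum_(k < n) 800 * n%:R * ln (1 + (lam a k)%:R / N%:R)); last first.
  by rewrite -mulr_sumr /logs; ring.
rewrite expRM_natl expR_sum; apply: lerXn2r; rewrite ?nnegrE; first exact: prodr_ge0.
  by apply: prodr_ge0 => i _; exact: expR_ge0.
apply: ler_prod => k _; rewrite ler0n /=.
have [t0|t0] := posnP (lam t k).
  rewrite t0 addn0 binn; apply: le_trans (expR_ge1Dx _); rewrite lerDl.
  exact: mulr_ge0 (mulr_ge0 (ler0n _ _) (ltW nR)) (ln_lam0 a k).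
apply: le_trans (bin_row _) _; rewrite ler_expR.
have le : ln (1 + (lam t k)%:R / N%:R) <= ln (1 + (lam a k)%:R / N%:R) :> R.
  by rewrite ler_ln ?posrE ?ltr_pwDl ?divr_ge0 // lerD2l ler_pM2r ?invr_gt0 // ler_nat lam_le.
have lb : 1 <= 385 * ln (1 + (lam a k)%:R / N%:R) :> R.
  have hl : (n < 128 * lam a k)%N.
    have [j kj tj] : exists2 j : 'I_n, (k <= j)%N & (0 < t j)%N.
      move: t0; rewrite lt0n; rewrite /lam sum_nat_eq0 negb_forall => /existsP[j].
      by rewrite negb_imply => /andP[kj tj]; exists j; rewrite ?lt0n.
    apply: leq_trans (big j tj) _; rewrite leq_mul2l /lam /=.
    rewrite [X in (_ <= X)%N](bigID (fun i : 'I_n => (j <= i)%N)) /=.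
    apply: leq_trans (leq_addr _ _); rewrite leq_eqVlt; apply/orP; left; apply/eqP.
    by apply: eq_bigl => i; case: (leqP j i) => ji; rewrite ?andbF // andbT (leq_trans kj ji).
  have x0 : 384^-1 <= (lam a k)%:R / N%:R :> R.
    rewrite ler_pdivlMr // -ler_pdivlMl // mulrC; have : n%:R <= 128 * (lam a k)%:R :> R by rewrite -natrM ler_nat ltnW.
    by rewrite NE; have := n1; lra.
  have := @ln1p_ge R 384^-1 => h; have {}h := h (_ : -1 < 384^-1).
  have le2 : ln (1 + 384^-1) <= ln (1 + (lam a k)%:R / N%:R) :> R.
    by move: x0; move: (_ / N%:R) => y x0; rewrite ler_ln ?posrE; lra.
  have e : 384^-1 / (1 + 384^-1) = 385^-1 :> R.
    by rewrite (_ : 1 + 384^-1 = 385 / 384 :> R); field.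
  have {}h := h ltac:(lra); rewrite e in h; move: h le2; move: (ln _) (ln _) => x y h le2; lra.
move: le lb; move: (ln _) (ln _) => y x le lb.
have : 1 + 2 * x <= 400 * y by lra.
by move=> h; have := ler_wpM2l (ltW nR) h; lra.
Qed.

(** Each column covers the first [n / 48] rows, so [logs a] is at least [n / 48] times the logarithm
    at the number [M] of columns. If [M <= N], each column is counted by at most [2 ^ N]; if there
    are more, rows are counted. *)
Lemma krank_tall a t (M := (\sum_j t j)%N) : (forall j, t j <= a j)%N -> (forall j : 'I_n, (0 < t j)%N -> (n < 48 * j.+1)%N) ->
  exists2 d, krank (@Ka R n t) d & d%:R <= expR (1728 * n%:R * logs a).
Proof.
move=> ta big.
have lM k : (lam t k <= M)%N by rewrite /M (bigID (fun j : 'I_n => (k <= j)%N)) /= leq_addr.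
have x0 : 0 <= M%:R / N%:R :> R by rewrite divr_ge0.
have rows : n%:R / 48 * ln (1 + M%:R / N%:R) <= logs a.
  pose q := (n %/ 48)%N; have qn : (q < n)%N by rewrite ltn_Pdiv.
  apply: (@le_trans _ _ (\sum_(k < n | (k < q.+1)%N) ln (1 + M%:R / N%:R))).
    rewrite sumr_const -[leRHS]mulr_natl ler_wpM2r ?ln_ge0 ?lerDl //.
    rewrite (_ : #|_| = q.+1); last first.
      rewrite -sum1_card (eq_bigl (fun k : 'I_n => (k < q.+1)%N)) //.
      by rewrite -(big_ord_widen n (fun=> 1%N) qn) sum_nat_const card_ord muln1.
    rewrite ler_pdivrMr // -natrM ler_nat; have := ltn_ceil n (isT : (0 < 48)%N); rewrite -/q; exact: ltnW.
  rewrite /logs [leRHS](bigID (fun k : 'I_n => (k < q.+1)%N)) /= -[leLHS]addr0 lerD ?sumr_ge0 //.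
  apply: ler_sum => k kq; rewrite ler_ln ?posrE ?ltr_pwDl ?divr_ge0 // lerD2l ler_pM2r ?invr_gt0 // ler_nat.
  apply: leq_trans (lam_le k ta); rewrite /M /lam (bigID (fun j : 'I_n => (k <= j)%N)) /=.
  rewrite [X in (_ + X)%N]big1 ?addn0 // => j; rewrite -ltnNge => jk.
  case: (posnP (t j)) => // tj; have := big j tj.
  have : (48 * q <= n)%N by rewrite mulnC leq_trunc_div.
  by move: kq jk; clear; lia.
have l0 : 0 <= ln (1 + M%:R / N%:R) :> R by rewrite ln_ge0 // lerDl.
have red : (exists2 d, krank (@Ka R n t) d & d%:R <= expR (36 * n%:R ^+ 2 * ln (1 + M%:R / N%:R)) :> R) ->
  exists2 d, krank (@Ka R n t) d & d%:R <= expR (1728 * n%:R * logs a).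
  move=> [d kd hd]; exists d => //; apply: le_trans hd _; rewrite ler_expR.
  by have := ler_wpM2l (ltW nR) rows; rewrite expr2; lra.
apply: red.
case: (leqP M N) => MN.
  exists ((\prod_(j < n) 'C(N, j.+1) ^ t j) ^ 2)%N; first exact: krank_cols.
  have c2 p h : ('C(p, h) <= 2 ^ p)%N.
    elim: p h => [|p IH] [|h] //; rewrite ?bin0 ?expn_gt0 // binS expnS mul2n -addnn leq_add //.
  apply: (@le_trans _ _ (2 ^ (N * M * 2))%:R).
    rewrite ler_nat !expnM leq_exp2r // -expnM /M big_distrr /= expn_sum leq_prod // => j _.
    by rewrite expnM; case: (t j) => // m; rewrite leq_exp2r.
  rewrite natrX -[2%:R](lnK (x := 2)) ?posrE // -expRM_natl ler_expR.
  have l2 : ln 2 <= 1 :> R by apply: le_trans (ln_le _) _; lra.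
  have h := @ln1p_half R (M%:R / N%:R); have {}h := h ltac:(by rewrite x0 ler_pdivrMr // mul1r ler_nat).
  apply: (@le_trans _ _ ((N * M * 2)%:R)); first by rewrite ler_piMr.
  rewrite !natrM (_ : N%:R * M%:R * 2 = 2 * N%:R ^+ 2 * (M%:R / N%:R)); last by field; rewrite lt0r_neq0.
  apply: (@le_trans _ _ (4 * N%:R ^+ 2 * ln (1 + M%:R / N%:R))).
    have NN : 0 <= N%:R ^+ 2 :> R by exact: sqr_ge0.
    by have := ler_wpM2l NN h; move: (N%:R ^+ 2 : R) (M%:R / N%:R : R) => y x; lra.
  rewrite ler_wpM2r // NE; have nn : n%:R <= n%:R ^+ 2 :> R by rewrite expr2 ler_peMl.
  by have := n1; rewrite sqrrD; lra.
exists ((\prod_(k < n) 'C(n.*2 + lam t k, n.*2)) ^ 2)%N; first exact: krank_rows.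
rewrite natrX natr_prod (_ : 36 * _ * _ = 2%:R * \sum_(k < n) 18 * n%:R * ln (1 + M%:R / N%:R)); last first.
  by rewrite sumr_const card_ord -[_ *+ n]mulr_natl expr2; ring.
rewrite expRM_natl expR_sum; apply: lerXn2r; rewrite ?nnegrE; first exact: prodr_ge0.
  by apply: prodr_ge0 => i _; exact: expR_ge0.
apply: ler_prod => k _; rewrite ler0n /=; apply: le_trans (bin_row _) _; rewrite ler_expR.
have le : ln (1 + (lam t k)%:R / N%:R) <= ln (1 + M%:R / N%:R) :> R.
  by rewrite ler_ln ?posrE ?ltr_pwDl ?divr_ge0 // lerD2l ler_pM2r ?invr_gt0 // ler_nat lM.
have l2 : ln (1 + 1) <= ln (1 + M%:R / N%:R) :> R.
  by rewrite ler_ln ?posrE ?ltr_pwDl // lerD2l ler_pdivlMr // mul1r ler_nat ltnW.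
have h2 := @ln1p_half R 1; have {}h2 := h2 ltac:(lra).
move: le l2 h2; move: (ln _) (ln _) (ln _) => z y x le l2 h2.
have y0 : 0 <= n%:R * y by apply: mulr_ge0 (ltW nR) _; lra.
have : 1 + 2 * x <= 4 * y by lra.
by move=> h; have := ler_wpM2l (ltW nR) h; lra.
Qed.

(** In a block of [w] boxes, the saving [ln w / 2] in the rank has to pay for the losses [9 M / n]
    and [12 h / n] of [sharp_bound], which are multiplied by ln n. [log_share] turns this ln n into
    [ln M] and [ln h]. The latter is at most [ln w]; the former is charged by [weight_log_share], at
    a total cost of at most [2 M], which the terms [- 2 (s j)] compensate. *)
Lemma short_le_rate s (M := (\sum_j s j)%N) : (128 * M <= n)%N -> (forall j : 'I_n, (0 < s j)%N -> (48 * j.+1 <= n)%N) ->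
  \sum_j (@blockw R n s j * (ln n%:R + 3 - ln (@blockw R n s j) / 2)) <= n%:R / 2 * rate s * (ln n%:R + 60).
Proof.
move=> Mn hn.
have ME : \sum_j (s j)%:R = M%:R :> R by rewrite natr_sum.
have Mn' : 16 * \sum_j (s j)%:R <= n%:R :> R.
  by rewrite ME -natrM ler_nat; apply: leq_trans Mn; rewrite leq_mul2r orbT.
have ln0 : 0 <= ln n%:R :> R by rewrite ln_ge0.
have l60 : 0 <= ln n%:R + 60 :> R by lra.
have sb := sharp_bound n0 nuH Mn'; rewrite ME -/(rate s) in sb.
apply: le_trans (ler_wpM2r l60 sb); rewrite mulr_suml.
have [M0|M0] := posnP M.
  rewrite !big1 // => j _; have : s j = 0%N by apply/eqP; move/eqP: M0; rewrite sum_nat_eq0 => /forallP /(_ j).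
    by move=> ->; rewrite !mul0r.
  by rewrite /blockw => ->; rewrite mulr0 mul0r.
have MR : 1 <= M%:R :> R by rewrite ler1n.
have Mnn : M%:R <= 128^-1 * n%:R :> R.
  by rewrite mulrC ler_pdivlMr // mulrC -natrM ler_nat.
have Msh := log_share MR Mnn (_ : 0 < 128^-1 <= 1); have {}Msh := Msh ltac:(lra).
suff key (j : 'I_n) : @blockw R n s j * (ln n%:R + 3 - ln (@blockw R n s j) / 2) <=
    (s j)%:R * j.+1%:R * (1 - 9 * M%:R / n%:R - 12 * j.+1%:R / n%:R) * (ln n%:R + 60)
    + (- (2 * (s j)%:R) + M%:R * j.+1%:R ^- 2).
  apply: (@le_trans _ _ (\sum_(j < n) ((s j)%:R * j.+1%:R * (1 - 9 * M%:R / n%:R - 12 * j.+1%:R / n%:R) * (ln n%:R + 60)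
    + (- (2 * (s j)%:R) + M%:R * j.+1%:R ^- 2)))); first by apply: ler_sum => j _; exact: key.
  rewrite big_split /= gerDl big_split /= sumrN -!mulr_sumr ME.
  by have := ler_wpM2l (ltW (lt_le_trans ltr01 MR)) (sum_inv_sq (R := R) n); lra.
have h1 : 1 <= j.+1%:R :> R by rewrite ler1n.
case: (posnP (s j)) => [sj|sj].
  rewrite /blockw sj !(mulr0, mul0r) oppr0 !add0r mulr_ge0 ?invr_ge0 ?sqr_ge0 //; lra.
have hj : j.+1%:R <= 48^-1 * n%:R :> R.
  by rewrite mulrC ler_pdivlMr // mulrC -natrM ler_nat hn.
have Hsh := log_share h1 hj (_ : 0 < 48^-1 <= 1); have {}Hsh := Hsh ltac:(lra).
have s1 : 1 <= (s j)%:R :> R by rewrite ler1n.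
have hw : j.+1%:R <= @blockw R n s j by rewrite /blockw ler_peMr //; lra.
have sw : (s j)%:R <= @blockw R n s j by rewrite /blockw ler_peMl //; lra.
have wsh := weight_log_share h1 hw (lt_le_trans ltr01 MR).
have hlw : ln j.+1%:R <= ln (@blockw R n s j) :> R by rewrite ler_ln ?posrE; lra.
rewrite (_ : (s j)%:R * j.+1%:R = @blockw R n s j); last by rewrite mulrC.
have lw0 : 0 <= ln (@blockw R n s j) by rewrite ln_ge0; lra.
have mn1 : M%:R / n%:R <= 128^-1 :> R by rewrite ler_pdivrMr.
have hn1 : j.+1%:R / n%:R <= 48^-1 :> R by rewrite ler_pdivrMr.
move: (@blockw R n s j) hw sw wsh hlw lw0 => w hw sw wsh hlw lw0.
rewrite -[9 * _ / _]mulrA -[12 * _ / _]mulrA.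
have Mh : 0 <= M%:R / j.+1%:R ^+ 2 :> R by rewrite divr_ge0 // sqr_ge0.
move: (M%:R / j.+1%:R ^+ 2) wsh Mh => mh wsh Mh.
move: (M%:R / n%:R : R) (j.+1%:R / n%:R : R) Msh Hsh mn1 hn1 => x y Msh Hsh mn1 hn1.
move: (ln n%:R) (ln M%:R) (ln j.+1%:R) (ln w) ln0 l60 Msh Hsh wsh hlw lw0 => L lM lh lw L0 L60 Msh Hsh wsh hlw lw0.
have w0 : 0 <= w by lra.
have main : L + 3 - lw / 2 <= (1 - 9 * x - 12 * y) * (L + 60) + 9 / 128 * lM - lw / 4 - 2.
  by have xL : x * L <= 128^-1 * lM + 1 by []; have yL : y * L <= 48^-1 * lh + 1 by []; lra.
have wl := mulr_ge0 w0 lw0; have := ler_wpM2l w0 main; lra.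
Qed.

(** The sharp bound for the short part already accounts for the whole of ln n, as the rate is
    monotone in the diagram; the crude bound pays for the two other parts. The constant 40000
    exceeds [60 + 12 (1728 + 1600)]. *)
Lemma dim_le_rate a : exists2 d, krank (@Ka R n a) d &
  d%:R <= expR (n%:R * (ln n%:R + 20 * 2000) * rate a).
Proof.
pose short (j : 'I_n) := ((48 * j.+1 <= n) && (128 * lam a j <= n))%N.
pose tall (j : 'I_n) := (n < 48 * j.+1)%N.
pose s j := if short j then a j else 0%N.
pose t j := if tall j then a j else 0%N.
pose r j := if short j || tall j then 0%N else a j.
have sa j : (s j <= a j)%N by rewrite /s; case: ifP.
have ta j : (t j <= a j)%N by rewrite /t; case: ifP.
have ra j : (r j <= a j)%N by rewrite /r; case: ifP.
have aE : (fun j => s j + (t j + r j))%N = a.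
  apply/funext => j; rewrite /s /t /r /short /tall; case: (leqP (48 * j.+1) n) => h /=; last by rewrite addn0.
  by case: leqP; rewrite /= ?addn0.
(* Row [jm], at the height of the lowest short column, meets all short columns, so their number is
   at most its length. *)
have sn : (128 * \sum_j s j <= n)%N.
  case: (pickP (fun j => 0 < s j)%N) => [j0 hj0|none]; last first.
    by rewrite big1 ?muln0 // => j _; apply/eqP; have := none j; rewrite lt0n => /negbFE.
  pose jm := [arg min_(j < j0 | (0 < s j)%N) (j : nat)].
  have [hm mini] : (0 < s jm)%N /\ forall j, (0 < s j)%N -> (jm <= j)%N.
    by rewrite /jm; case: arg_minnP.
  have /andP[_ lj] : short jm by move: hm; rewrite /s; case: ifP.
  apply: leq_trans lj; rewrite leq_mul2l /lam /=.
  rewrite (bigID (fun j : 'I_n => (jm <= j)%N)) /= [X in (_ + X)%N]big1 ?addn0 => [|j hj].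
    exact: leq_sum.
  by apply/eqP; apply: contraNT hj; rewrite -lt0n => /mini.
have sl j : (s j <= n)%N.
  apply: leq_trans sn; rewrite (bigD1 j) //= mulnDr; apply: leq_trans (leq_addr _ _).
  by rewrite leq_pmull.
have [d1 k1 h1] := krank_short (R := R) n0 sl.
have [d2 k2 h2] : exists2 d, krank (@Ka R n t) d & d%:R <= expR (1728 * n%:R * logs a).
  by apply: krank_tall => // j; rewrite /t /tall; case: ifP.
have [d3 k3 h3] : exists2 d, krank (@Ka R n r) d & d%:R <= expR (1600 * n%:R * logs a).
  apply: krank_long => // j; rewrite /r /short /tall; case: (leqP (48 * j.+1) n) => //= _.
  by rewrite orbF; case: (leqP (128 * lam a j) n) => //= h; rewrite ltnn.
exists (d1 * (d2 * d3))%N; first by rewrite -aE; apply: krank_split => //; exact: krank_split.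
rewrite !natrM; apply: le_trans (ler_pM _ _ h1 (ler_pM _ _ h2 h3)) _ => //; rewrite -!expRD ler_expR.
have sh : \sum_j (@blockw R n s j * (ln n%:R + 3 - ln (@blockw R n s j) / 2)) <= n%:R / 2 * rate s * (ln n%:R + 60).
  by apply: short_le_rate => // j; rewrite /s /short; case: ifP => // /andP[].
have mono : rate s <= rate a by exact: rate_mono.
have cr := rate_crude n0 nuH a; rewrite -/(logs a) in cr.
have l60 : 0 <= n%:R / 2 * (ln n%:R + 60) :> R.
  exact: mulr_ge0 (divr_ge0 (ltW nR) (ler0n _ 2)) (addr_ge0 (ln_ge0 n1) (ler0n _ 60)).
have m1 := ler_wpM2l l60 mono. have m2 := ler_wpM2l (ltW nR) cr.
have r0 := rate_ge0 n0 nuH a; have nr := mulr_ge0 (ltW nR) r0.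
exact: dim_le_rate_arith sh m1 m2 nr.
Qed.

End RateDimension.

(** * Summation over the weights *)

Section SummingUp.
Context {R : realType} {n : nat}.
Hypothesis n0 : (0 < n)%N.
Local Notation N := n.*2.+1.
Variable nu : probability (SO R N) R.
Hypothesis nuH : is_haar nu.
Local Notation rate := (rate nu).
Implicit Types (a : 'I_n -> nat).

(* Spreading the weight [k / (j (j + 1))] of the column of height [j] over the rows [k <= j] bounds
   a sum over rows, which couples the [a j], by a sum over columns. *)
Lemma rows_ge_cols a : \sum_j ln (1 + (a j * j.+1)%:R / 3) <= 2 * \sum_(k < n) ln (1 + (lam a k)%:R / 3) :> R.
Proof.
pose p (k j : 'I_n) : R := if (k <= j)%N then k.+1%:R / (j.+1%:R * j.+2%:R) else 0.
have p0 k j : 0 <= p k j by rewrite /p; case: ifP => // _; rewrite divr_ge0 // mulr_ge0.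
have tel m k : (k <= m)%N -> \sum_(j < m | (k <= j)%N) k.+1%:R / (j.+1%:R * j.+2%:R) = 1 - k.+1%:R / m.+1%:R :> R.
  elim: m => [|m IH]; first by rewrite leqn0 => /eqP ->; rewrite big_ord0 divr1 subrr.
  rewrite leq_eqVlt => /orP[/eqP ->|km].
    rewrite big1 ?divff ?subrr ?pnatr_eq0 // => j; by rewrite leqNgt ltn_ord.
  rewrite big_mkcond big_ord_recr /= -big_mkcond /= IH // -ltnS km.
  have -> : m.+2%:R = m.+1%:R + 1 :> R by rewrite natr1.
  have xm : 0 < m.+1%:R :> R by [].
  by move: (m.+1%:R : R) xm => x x0; field; apply/andP; split; apply: lt0r_neq0; lra.
have p1 k : \sum_j p k j <= 1.
  rewrite -big_mkcond /= tel; last exact: ltnW.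
  by rewrite gerBl divr_ge0.
have p2 j : \sum_k p k j = 2^-1.
  rewrite -big_mkcond /= -mulr_suml (_ : \sum_(k < n | (k <= j)%N) k.+1%:R = j.+1%:R * j.+2%:R / 2 :> R).
    by rewrite mulrAC divff ?mul1r // mulf_neq0 ?pnatr_eq0.
  rewrite -(big_ord_widen n (fun k => k.+1%:R : R) (ltn_ord j)).
  elim: (j : nat) => [|m IH]; first by rewrite big_ord1 /=; field.
  by rewrite big_ord_recr /= IH -![_.+3%:R]natr1 -![_.+2%:R]natr1; field.
have row (k : 'I_n) : \sum_j p k j * ln (1 + (a j * j.+1)%:R / 3) <= ln (1 + (lam a k)%:R / 3).
  apply: le_trans (ln1p_concave (p0 k) _ (p1 k)) _ => [j|]; first by rewrite divr_ge0.
  have s0 : 0 <= \sum_j p k j * ((a j * j.+1)%:R / 3) by apply: sumr_ge0 => j _; rewrite mulr_ge0 // divr_ge0.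
  rewrite ler_ln ?posrE ?ltr_pwDl ?divr_ge0 // lerD2l /lam natr_sum mulr_suml [leRHS]big_mkcond.
  apply: ler_sum => j _; rewrite /p; case: ifP => kj; last by rewrite mul0r.
  rewrite natrM mulrA -[leLHS]mulrA mulrCA [leLHS]mulrA ler_wpM2r // ?invr_ge0 //.
  rewrite -mulrA ler_piMr // mulrA ler_pdivrMr ?mulr_gt0 // mul1r ler_pM2l // ler_nat.
  by rewrite ltnS leqW.
apply: (@le_trans _ _ (2 * \sum_k \sum_j p k j * ln (1 + (a j * j.+1)%:R / 3))); last first.
  by rewrite ler_wpM2l //; apply: ler_sum => k _; exact: row.
rewrite exchange_big /= mulr_sumr; apply: ler_sum => j _.
by rewrite -mulr_suml p2 mulrA divff ?mul1r.
Qed.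

(** [ln (1 + n x) <= n ln (1 + x)] and [N <= 3 n] replace the denominator [N] by 3, at the price of
    the factor [n] that the number of steps provides. *)
Lemma rate_ge_cols a : \sum_j ln (1 + (a j * j.+1)%:R / 3) <= 24 * (n%:R * rate a).
Proof.
apply: le_trans (rows_ge_cols a) _.
have nR : 0 < n%:R :> R by rewrite ltr0n.
have cr := rate_crude n0 nuH a.
suff : \sum_(k < n) ln (1 + (lam a k)%:R / 3) <= n%:R * \sum_(k < n) ln (1 + (lam a k)%:R / N%:R) :> R.
  by move=> h; have := ler_wpM2l (ltW nR) cr; lra.
rewrite mulr_sumr; apply: ler_sum => k _.
have x0 : 0 <= (lam a k)%:R / N%:R :> R by rewrite divr_ge0.
apply: le_trans (ln1p_nat n x0); rewrite ler_ln ?posrE ?ltr_pwDl ?divr_ge0 ?mulr_ge0 // lerD2l.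
rewrite mulrCA ler_wpM2l // ler_pdivlMr // mulrC ler_pdivrMr // -natrM ler_nat.
by move: n0; clear; lia.
Qed.

(** The sum over all exponents is a product of sums over columns, each of the form
    [1 + x <= expR x]; the zero exponent is the subtracted 1. *)
Lemma sum_prod_le (k : nat) (g : 'I_n -> nat -> R) : (forall j m, 0 <= g j m) -> (forall j, g j 0%N = 1) ->
  \sum_(a : {ffun 'I_n -> 'I_k.+1} | a != [ffun=> ord0]) \prod_j g j (a j) <=
  expR (\sum_(j < n) \sum_(m < k) g j m.+1) - 1.
Proof.
move=> g0 g1; rewrite lerBrDl.
have e0 : \prod_j g j (([ffun=> ord0] : {ffun 'I_n -> 'I_k.+1}) j) = 1 by rewrite big1 // => j _; rewrite ffunE g1.
rewrite -[X in X + _]e0 -(bigD1 (P := xpredT) (F := fun a : {ffun 'I_n -> 'I_k.+1} => \prod_j g j (a j)) [ffun=> ord0]) //=.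
rewrite -(bigA_distr_bigA (fun j (m : 'I_k.+1) => g j m)) /= expR_sum; apply: ler_prod => j _.
rewrite sumr_ge0 //= big_ord_recl g1; exact: expR_ge1Dx.
Qed.

(** Two powers of [1 + x / 3] make the double sum converge, with total at most [9 * 4 = 36]; the
    remaining [q - 2] powers give the exponential, since [ln (4 / 3) >= 1 / 4]. *)
Lemma sum_cols_le (k : nat) (q : R) : 2 <= q ->
  \sum_(j < n) \sum_(m < k) expR (- (q * ln (1 + (m.+1 * j.+1)%:R / 3))) <= 36 * expR (- ((q - 2) / 4)) :> R.
Proof.
move=> q2.
have term (m j : nat) : expR (- (q * ln (1 + (m.+1 * j.+1)%:R / 3))) <= 9 * expR (- ((q - 2) / 4)) * (m.+1%:R ^- 2 * j.+1%:R ^- 2) :> R.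
  have x1 : 1 <= (m.+1 * j.+1)%:R :> R by rewrite ler1n muln_gt0.
  pose x : R := (m.+1 * j.+1)%:R; have x1' : 1 <= x by [].
  rewrite -invfM -exprMn -natrM -/x.
  have l1 : 4^-1 <= ln (1 + x / 3).
    apply: le_trans (_ : 4^-1 <= ln (1 + 3^-1)) _; last by rewrite ler_ln ?posrE; lra.
    have e : 3^-1 / (1 + 3^-1) = 4^-1 :> R by rewrite (_ : 1 + 3^-1 = 4 / 3 :> R); field.
    by rewrite -[leLHS]e; apply: ln1p_ge; lra.
  have : expR (- (2 * ln (1 + x / 3))) <= 9 * (x ^+ 2)^-1.
    rewrite expRN expRM_natl lnK ?posrE; last by lra.
    have y0 : 0 < 1 + x / 3 by lra.
    have xx : 0 < x by lra.
    have : x ^+ 2 <= (3 * (1 + x / 3)) ^+ 2 by rewrite lerXn2r ?nnegrE; lra.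
    rewrite exprMn => h; rewrite ler_pdivlMr ?exprn_gt0 // mulrC ler_pdivrMr ?exprn_gt0 //.
    by move: h; move: ((1 + x / 3) ^+ 2) => w; lra.
  move=> h2; rewrite mulrAC; apply: le_trans (ler_wpM2r (expR_ge0 _) h2); rewrite -expRD ler_expR.
  have q0 : 0 <= q - 2 by lra.
  have := ler_wpM2l q0 l1; lra.
have pos : 0 <= 9 * expR (- ((q - 2) / 4)) by rewrite mulr_ge0 // expR_ge0.
apply: (@le_trans _ _ (\sum_(j < n) \sum_(m < k) 9 * expR (- ((q - 2) / 4)) * (m.+1%:R ^- 2 * j.+1%:R ^- 2))).
  by apply: ler_sum => j _; apply: ler_sum => m _; exact: term.
have i0 (m : nat) : 0 <= m.+1%:R ^- 2 :> R by rewrite invr_ge0 sqr_ge0.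
apply: (@le_trans _ _ (9 * expR (- ((q - 2) / 4)) * (2 * 2))); last by lra.
under eq_bigr => j _ do rewrite -mulr_sumr -mulr_suml.
rewrite -mulr_sumr ler_wpM2l // -mulr_sumr ler_pM ?sumr_ge0 //; exact: sum_inv_sq.
Qed.

Variables (hN : (1 < N)%N) (theta : R).
Local Notation Sq := (sin (theta / 2) ^+ 2).
Hypothesis S01 : 0 < Sq <= 1.

Lemma rate_gt0 a : (exists j, a j != 0%N) -> 0 < rate a.
Proof.
move=> [j aj]; have nR : 0 < n%:R :> R by rewrite ltr0n.
have := rate_ge_cols a; rewrite (bigD1 j) //= => h.
have p : 0 < ln (1 + (a j * j.+1)%:R / 3) :> R by rewrite ln_gt0 // ltrDl divr_gt0 // ltr0n muln_gt0 lt0n aj.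
have r0 : 0 <= \sum_(i < n | i != j) ln (1 + (a i * i.+1)%:R / 3) :> R.
  by apply: sumr_ge0 => i _; rewrite ln_ge0 // lerDl divr_ge0.
have : 0 < 24 * (n%:R * rate a) by apply: lt_le_trans h; rewrite ltr_pwDl.
by rewrite pmulr_rgt0 // pmulr_rgt0.
Qed.

(** The eigenvalues contribute [expR (- n (ln n + c) rate)] and the ranks at most
    [expR (n (ln n + 40000) rate)]. By [rate_ge_cols] the quotient is a product over columns with
    exponent [q = (c - 40000) / 24], and the assumption on [c] says [q >= 2]. *)
Lemma tv_le_large (t : nat) (c : R) : 20 * 2000 + 48 <= c -> t%:R = n%:R * (ln n%:R + c) / (2 * Sq) ->
  (tv_dist (walk_law hN nu theta t) nu <=
   (Num.sqrt (2 * (expR (36 * expR (- (((c - 20 * 2000) / 24 - 2) / 4))) - 1)))%:E)%E.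
Proof.
move=> c0 tE; have /andP[S0 S1] := S01.
have nR : 0 < n%:R :> R by rewrite ltr0n.
pose d a := s2val (cid2 (dim_le_rate n0 nuH a)).
have kd a : krank (@Ka R n a) (d a) by exact: s2valP (cid2 (dim_le_rate n0 nuH a)).
have ld a : (d a)%:R <= expR (n%:R * (ln n%:R + 20 * 2000) * rate a) by exact: s2valP' (cid2 (dim_le_rate n0 nuH a)).
pose q := (c - 20 * 2000) / 24; have q2 : 2 <= q by rewrite /q; lra.
apply: (tv_upper n0 nuH kd) => [a _ a0||k].
- have hr : `|complex.Re (reig hN nu theta a)| <= expR (- (Sq * rate a)) by exact: reig_le.
  apply: le_lt_trans (ler_norm _) _; apply: le_lt_trans hr _.
  by rewrite -[X in _ < X]expR0 ltr_expR oppr_lt0 mulr_gt0 // rate_gt0.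
- apply: mulr_ge0 (ler0n _ 2) _; rewrite subr_ge0; apply: le_trans (expR_ge1Dx _); rewrite lerDl.
  exact: mulr_ge0 (ler0n _ 36) (expR_ge0 _).
pose g (j : 'I_n) (m : nat) : R := expR (- (q * ln (1 + (m * j.+1)%:R / 3))).
apply: (@le_trans _ _ (2 * \sum_(a : {ffun 'I_n -> 'I_k.+1} | a != [ffun=> ord0]) \prod_j g j (a j))); last first.
  rewrite ler_wpM2l //; apply: le_trans (sum_prod_le k (g := g) _ _) _ => [j m|j|].
  - exact: expR_ge0.
  - by rewrite /g mul0n mul0r addr0 ln1 mulr0 oppr0 expR0.
  by rewrite lerD2r ler_expR; exact: sum_cols_le.
rewrite mulr_sumr; apply: ler_sum => a _; rewrite -mulrA ler_wpM2l //.
set f := fun j : 'I_n => (a j : nat).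
have r2 : complex.Re (reig hN nu theta f) ^+ t.*2 <= expR (- (n%:R * (ln n%:R + c) * rate f)).
  apply: le_trans (ler_norm _) _; rewrite normrX.
  apply: (@le_trans _ _ (expR (- (Sq * rate f)) ^+ t.*2)).
    by rewrite lerXn2r ?nnegrE ?expR_ge0 //; exact: reig_le.
  rewrite -expRM_natl ler_expR -muln2 natrM tE.
  rewrite le_eqVlt; apply/orP; left; apply/eqP; move: (sin (theta / 2) ^+ 2) S0 => w w0.
  by field; rewrite lt0r_neq0.
apply: (@le_trans _ _ (expR (n%:R * (ln n%:R + 20 * 2000) * rate f) * expR (- (n%:R * (ln n%:R + c) * rate f)))).
  apply: (@le_trans _ _ ((d f)%:R * expR (- (n%:R * (ln n%:R + c) * rate f)))); first by rewrite ler_wpM2l.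
  by rewrite ler_wpM2r ?expR_ge0.
rewrite -expRD -expR_sum ler_expR sumrN -mulr_sumr.
have h := rate_ge_cols f; have q0 : 0 <= q by lra.
have := ler_wpM2l q0 h; rewrite /q; set W := \sum_j _.
by move: (rate f) => r; lra.
Qed.

End SummingUp.

(** * The trace along the walk *)

Section TraceVariance.
Context {R : realType} {n : nat}.
Hypothesis n0 : (0 < n)%N.
Local Notation N := n.*2.+1.
Local Notation G := (SO R N).
Variable nu : probability G R.
Hypothesis nuH : is_haar nu.
Local Notation E := (Ex nu).
Local Notation c1 := (inord 1 : 'I_N).
Local Notation c2 := (inord 2 : 'I_N).
Local Notation en U i j := (so_mx U i j).

Definition qform (X : 'M[R]_N) (j k : 'I_N) (U : G) : R := \sum_a \sum_b en U a j * X a b * en U b k.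

Let be i j : bmf (fun U : G => en U i j). Proof. exact: bmf_entry. Qed.

Lemma bmf_qform X j k : bmf (qform X j k).
Proof. by apply: bmf_sum => a; apply: bmf_sum => b; apply: bmfM => //; apply: bmfM => //; exact: bmf_cst. Qed.

Lemma sum_col2 (U : G) j : \sum_i en U i j ^+ 2 = 1.
Proof.
have h := orth_rows U j j; rewrite eqxx in h; rewrite -[RHS]h.
by apply: eq_bigr => i _; rewrite expr2.
Qed.

Lemma norm_orth (X U : G) j : \sum_a (\sum_b en X a b * en U b j) ^+ 2 = 1.
Proof. by rewrite -(sum_col2 (X * U)%g j); apply: eq_bigr => a _; rewrite [X in _ = X ^+ 2]mxE. Qed.

Variable X : G.
Local Notation Y := (so_mx X + (so_mx X)^T).
Let Q U := qform (so_mx X) ord0 ord0 U.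
Let y i U := \sum_b Y i b * en U b ord0.

Let YE i b : Y i b = en X i b + en X b i. Proof. by rewrite !mxE. Qed.

Let by_ i : bmf (y i).
Proof. by apply: bmf_sum => b; exact: bmfZ. Qed.

Let uy U : \sum_i en U i ord0 * y i U = 2 * Q U.
Proof.
rewrite /y /Q /qform (eq_bigr (fun i => \sum_b en U i ord0 * en X i b * en U b ord0 + \sum_b en U b ord0 * en X b i * en U i ord0)).
  rewrite big_split /= [X in _ + X]exchange_big /=; ring.
by move=> i _; rewrite mulr_sumr -big_split; apply: eq_bigr => b _; rewrite YE /=; ring.
Qed.

Let y2_le U : \sum_i y i U ^+ 2 <= 4.
Proof.
pose p i := \sum_b en X i b * en U b ord0; pose q i := \sum_b en X^-1%g i b * en U b ord0.
have p1 : \sum_i p i ^+ 2 = 1 by exact: norm_orth.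
have q1 : \sum_i q i ^+ 2 = 1 by exact: norm_orth.
have -> : \sum_i y i U ^+ 2 = \sum_i (p i + q i) ^+ 2.
  apply: eq_bigr => i _; congr (_ ^+ 2); rewrite /y -big_split /=; apply: eq_bigr => b _.
  by rewrite YE [en X^-1%g i b]mxE; ring.
apply: (@le_trans _ _ (\sum_i (2 * p i ^+ 2 + 2 * q i ^+ 2))).
  by apply: ler_sum => i _; have := sqr_ge0 (p i - q i); rewrite sqrrB sqrrD; lra.
by rewrite big_split /= -!mulr_sumr p1 q1; lra.
Qed.

Let dd_y i q : i != q ->
  forall k, dd (fun h U => y k (rg i q h * U)%g) (fun U => Y k i * en U q ord0 - Y k q * en U i ord0).
Proof.
move=> iq k.
apply: eq_dd (dd_sum (index_enum 'I_N) (fun b => ddZ (Y k b) (dd_entry b ord0 iq))) => // U.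
rewrite (bigD1 i) //= eqxx (bigD1 q) /=; last by rewrite eq_sym.
rewrite eqxx [q == i]eq_sym (negPf iq) big1 ?addr0 ?mulrN // => b /andP[bi bq].
by rewrite (negPf bi) (negPf bq) mulr0.
Qed.

Let dd_Q i q : i != q -> dd (fun h U => Q (rg i q h * U)%g) (fun U => en U q ord0 * y i U - en U i ord0 * y q U).
Proof.
move=> iq; have qE U : Q U = 2^-1 * \sum_k en U k ord0 * y k U by rewrite uy mulKf.
apply: eq_dd (ddZ 2^-1 (dd_sum (index_enum 'I_N) (fun k => ddM (dd_entry k ord0 iq) (dd_y iq k)))) => [h U _|U].
  by rewrite qE.
cbv beta; rewrite rg0 // mul1g big_split /=.
have s1 : \sum_k (if k == i then en U q ord0 else if k == q then - en U i ord0 else 0) * y k U =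
    en U q ord0 * y i U - en U i ord0 * y q U.
  rewrite (bigD1 i) //= eqxx (bigD1 q) /=; last by rewrite eq_sym.
  rewrite eqxx [q == i]eq_sym (negPf iq) big1 ?addr0 ?mulNr // => b /andP[bi bq].
  by rewrite (negPf bi) (negPf bq) mul0r.
have s2 : \sum_k en U k ord0 * (Y k i * en U q ord0 - Y k q * en U i ord0) =
    en U q ord0 * y i U - en U i ord0 * y q U.
  rewrite /y mulr_sumr [X in _ = _ - X]mulr_sumr -sumrB; apply: eq_bigr => k _.
  by rewrite !YE; ring.
by rewrite s1 s2; field.
Qed.

Let trY : \sum_i Y i i = 2 * \tr (so_mx X).
Proof. by rewrite /mxtrace mulr_sumr; apply: eq_bigr => i _; rewrite YE; ring. Qed.

(** Sum over all pairs of the integrations by parts of [u_q y_i f] along the rotation of [i] and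
    [q]. As [y] is the Euclidean gradient of [Q], this is the divergence theorem on the sphere for
    [f] times the spherical gradient of [Q]. *)
Let casimir (f df : G -> R) (F : 'I_N -> 'I_N -> G -> R) : bmf f -> (forall i q, bmf (F i q)) ->
  (forall i q, i != q -> dd (fun h U => f (rg i q h * U)%g) (F i q)) ->
  (forall i U, F i i U = 0) ->
  (forall U, \sum_i \sum_q en U q ord0 * y i U * F i q U = df U) ->
  E (fun U => (2 * \tr (so_mx X) - 2 * N%:R * Q U) * f U + df U) = 0.
Proof.
move=> bf bF dF F0 sF.
pose g i q U := (- (en U i ord0 * y i U) + en U q ord0 * (Y i i * en U q ord0 - Y i q * en U i ord0)) * f U
   + en U q ord0 * y i U * F i q U.
have bg i q : bmf (g i q).
  apply: bmfD; last by apply: bmfM => //; exact: bmfM.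
  apply: bmfM => //; apply: bmfD; first by apply: bmfN; exact: bmfM.
  by apply: bmfM => //; apply: bmfB; exact: bmfZ.
have z i q : E (fun U => (i != q)%:R * g i q U) = 0.
  rewrite ExZ //; case: (eqVneq i q) => [_|iq]; first by rewrite mul0r.
  rewrite mul1r; apply: (ibp_left nuH (f := fun U => en U q ord0 * y i U * f U) iq) => //.
    by apply: bmfM => //; exact: bmfM.
  apply: eq_dd (ddM (ddM (dd_entry q ord0 iq) (dd_y iq i)) (dF i q iq)) => // U.
  by cbv beta; rewrite rg0 // !mul1g eqxx [q == i]eq_sym (negPf iq) /g; ring.
have -> : (fun U => (2 * \tr (so_mx X) - 2 * N%:R * Q U) * f U + df U) =
    (fun U => \sum_i \sum_q (i != q)%:R * g i q U).
  apply/funext => U.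
  have -> : \sum_i \sum_q (i != q)%:R * g i q U = \sum_i (\sum_q g i q U + en U i ord0 * y i U * f U).
    apply: eq_bigr => i _; rewrite (bigD1 i) //= eqxx mul0r add0r [in RHS](bigD1 i) //= [in RHS]addrAC.
    have gii : g i i U + en U i ord0 * y i U * f U = 0 by rewrite /g F0; ring.
    rewrite gii add0r.
    by apply: eq_bigr => q qi; rewrite eq_sym qi mul1r.
  rewrite big_split /= -mulr_suml uy.
  rewrite (eq_bigr (fun i => (- (en U i ord0 * y i U) *+ N + (Y i i - en U i ord0 * y i U)) * f U + \sum_q en U q ord0 * y i U * F i q U)).
    rewrite big_split /= sF -mulr_suml big_split /= sumrMnl sumrN sumrB uy trY -[_ *+ N]mulr_natl.
    by ring.
  move=> i _; rewrite big_split /= -mulr_suml; congr (_ * _ + _).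
  rewrite big_split /= sumr_const card_ord; congr (_ + _).
  rewrite (eq_bigr (fun q => Y i i * en U q ord0 ^+ 2 - en U i ord0 * (Y i q * en U q ord0))); last by move=> q _; ring.
  by rewrite sumrB -!mulr_sumr sum_u2 mulr1.
rewrite Ex_sum => [|i]; last by apply: bmf_sum => q; exact: bmfZ.
by apply: big1 => i _; rewrite Ex_sum => [|q]; [apply: big1 => q _; exact: z | exact: bmfZ].
Qed.

Let bQ : bmf Q. Proof. exact: bmf_qform. Qed.

Lemma E_qform : N%:R * E Q = \tr (so_mx X).
Proof.
have h := casimir (f := fun=> 1) (df := fun=> 0) (F := fun _ _ _ => 0) (bmf_cst G 1) (fun _ _ => bmf_cst G 0).
have {}h := h (fun i q _ => eq_dd (fun _ _ _ => erefl) (fun _ => erefl) (dd_cst (fun _ : G => lexx `|1 : R|))) (fun _ _ => erefl).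
have {}h : E (fun U => (2 * \tr (so_mx X) - 2 * N%:R * Q U) * 1 + 0) = 0.
  by apply: h => U; rewrite big1 // => i _; rewrite big1 // => q _; rewrite mulr0.
move: h; rewrite (_ : (fun U => _) = (fun U => 2 * \tr (so_mx X) - 2 * N%:R * Q U)); last first.
  by apply/funext => U; rewrite mulr1 addr0.
rewrite ExB; [|exact: bmf_cst|exact: bmfZ].
by rewrite Ex_cst ExZ //; lra.
Qed.

(** The divergence theorem with [f = Q]: the variance is controlled by the squared gradient, and [y]
    is a sum of two unit vectors, so its squared norm is at most 4. *)
Lemma var_qform : N%:R * E (fun U => (Q U - \tr (so_mx X) / N%:R) ^+ 2) <= 2.
Proof.
have N0 : 0 < N%:R :> R by [].
have bQ2 : bmf (fun U => Q U ^+ 2) by exact: bmfX.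
have h : E (fun U => (2 * \tr (so_mx X) - 2 * N%:R * Q U) * Q U + (\sum_i y i U ^+ 2 - (2 * Q U) ^+ 2)) = 0.
  apply: (casimir (F := fun i q U => en U q ord0 * y i U - en U i ord0 * y q U)) => // [i q|i U|U].
  - by apply: bmfB; exact: bmfM.
  - by rewrite subrr.
  transitivity (\sum_i (y i U ^+ 2 - en U i ord0 * y i U * (2 * Q U))).
    apply: eq_bigr => i _.
    rewrite (eq_bigr (fun q => y i U ^+ 2 * en U q ord0 ^+ 2 - en U i ord0 * y i U * (en U q ord0 * y q U))); last by move=> q _; ring.
    by rewrite sumrB -!mulr_sumr sum_u2 mulr1 uy.
  by rewrite sumrB -mulr_suml uy expr2.
have EQ := E_qform; set T := \tr (so_mx X) in h EQ *.
have h2 : 0 <= E (fun U => 2 * T * Q U - (2 * N%:R + 4) * Q U ^+ 2 + 4).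
  rewrite -h; apply: le_Ex => [||U].
  - apply: bmfD; first by apply: bmfM => //; apply: bmfB; [exact: bmf_cst | exact: bmfZ].
    by apply: bmfB; [apply: bmf_sum => i; exact: bmfX | apply: bmfX; exact: bmfZ].
  - by apply: bmfD; [apply: bmfB; exact: bmfZ | exact: bmf_cst].
  by have := y2_le U; rewrite expr2; lra.
have b1 : bmf (fun U => 2 * T * Q U) by exact: bmfZ.
have b2 : bmf (fun U => (2 * N%:R + 4) * Q U ^+ 2) by exact: bmfZ.
rewrite ExD in h2; [|exact: bmfB|exact: bmf_cst].
rewrite ExB // !ExZ // Ex_cst in h2.
have e : E (fun U => (Q U - T / N%:R) ^+ 2) = E (fun U => Q U ^+ 2) - (T / N%:R) ^+ 2.
  rewrite (_ : (fun U => (Q U - T / N%:R) ^+ 2) = (fun U => Q U ^+ 2 - 2 * (T / N%:R) * Q U + (T / N%:R) ^+ 2)); last first.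
    by apply/funext => U; ring.
  rewrite ExD; [|by apply: bmfB => //; exact: bmfZ|exact: bmf_cst].
  rewrite ExB //; last exact: bmfZ.
  rewrite ExZ // Ex_cst (_ : E Q = T / N%:R); last by rewrite -EQ mulrC mulKf ?lt0r_neq0.
  by ring.
have s0 : 0 <= E (fun U => Q U ^+ 2) by apply: Ex_ge0 => U; exact: sqr_ge0.
rewrite e mulrBr; have TE : N%:R * (T / N%:R) ^+ 2 = T * E Q by rewrite -EQ; field.
by rewrite TE; lra.
Qed.

End TraceVariance.

(** * Mean and variance of the trace after one step *)

Section WalkTrace.
Context {R : realType} {n : nat}.
Hypothesis n1 : (1 < n)%N.
Local Notation N := n.*2.+1.
Local Notation G := (SO R N).
Variable nu : probability G R.
Hypothesis nuH : is_haar nu.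
Local Notation E := (Ex nu).
Local Notation c1 := (inord 1 : 'I_N).
Local Notation c2 := (inord 2 : 'I_N).
Local Notation en U i j := (so_mx U i j).

Let n0 : (0 < n)%N. Proof. exact: ltnW. Qed.
Let NR : 0 < N%:R :> R. Proof. by []. Qed.
Let c10 : c1 != ord0. Proof. by rewrite -val_eqE /= inordK //; lia. Qed.
Let c20 : c2 != ord0. Proof. by rewrite -val_eqE /= inordK //; lia. Qed.
Let c21 : c2 != c1. Proof. by rewrite -val_eqE /= !inordK //; lia. Qed.

Let swap01 : G := rg c1 ord0 1.

Let qform_swap (X : 'M[R]_N) U : [/\ qform X ord0 ord0 (U * swap01)%g = qform X c1 c1 U,
   qform X c1 ord0 (U * swap01)%g = - qform X ord0 c1 U & qform X c1 c1 (U * swap01)%g = qform X ord0 ord0 U].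
Proof.
have e0 a : en (U * swap01)%g a ord0 = en U a c1 by rewrite mul_rg_entry // eqxx.
have e1 a : en (U * swap01)%g a c1 = - en U a ord0 by rewrite mul_rg_entry // (negPf c10) eqxx.
split; rewrite /qform -?sumrN; apply: eq_bigr => a _; rewrite -?sumrN; apply: eq_bigr => b _; rewrite ?e0 ?e1; ring.
Qed.

(** The forms are the entries of the first column of [U^-1 X U]. Quarter turns among the other
    columns of [U] make the entries away from the diagonal equidistributed and symmetric, and the
    squares add up to 1. *)
Lemma E_cross (X : G) : E (qform (so_mx X) c1 ord0) = 0 /\ (N%:R - 1) * E (fun U => qform (so_mx X) c1 ord0 U ^+ 2) <= 1.
Proof.
pose w U a := \sum_b en X a b * en U b ord0.
have wE k U : qform (so_mx X) k ord0 U = \sum_a w U a * en U a k.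
  by apply: eq_bigr => a _; rewrite mulr_suml; apply: eq_bigr => b _; ring.
have rot (i q : 'I_N) U : i != q -> i != ord0 -> q != ord0 ->
   qform (so_mx X) q ord0 (U * rg i q 1)%g = qform (so_mx X) i ord0 U /\
   qform (so_mx X) i ord0 (U * rg i q 1)%g = - qform (so_mx X) q ord0 U.
  move=> iq i0 q0; have e0 a : en (U * rg i q 1)%g a ord0 = en U a ord0.
    by rewrite mul_rg_entry // ![ord0 == _]eq_sym (negPf i0) (negPf q0).
  have eq a : en (U * rg i q 1)%g a q = en U a i by rewrite mul_rg_entry // eqxx.
  have ei a : en (U * rg i q 1)%g a i = - en U a q by rewrite mul_rg_entry // (negPf iq) eqxx.
  by split; rewrite /qform -?sumrN; apply: eq_bigr => a _; rewrite -?sumrN; apply: eq_bigr => b _; rewrite ?eq ?ei e0; ring.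
have bq k : bmf (qform (so_mx X) k ord0) by exact: bmf_qform.
split.
  have h1 : E (qform (so_mx X) c1 ord0) = E (qform (so_mx X) c2 ord0).
    rewrite -(Ex_right nuH (rg c2 c1 1) (bq c1)); congr (Ex _ _); apply/funext => U.
    by have [-> _] := rot _ _ U c21 c20 c10.
  have h2 : E (qform (so_mx X) c2 ord0) = - E (qform (so_mx X) c1 ord0).
    rewrite -(Ex_right nuH (rg c2 c1 1) (bq c2)) -ExN //; congr (Ex _ _); apply/funext => U.
    by have [_ ->] := rot _ _ U c21 c20 c10.
  by lra.
have same q : q != ord0 -> E (fun U => qform (so_mx X) q ord0 U ^+ 2) = E (fun U => qform (so_mx X) c1 ord0 U ^+ 2).
  move=> q0; case: (eqVneq q c1) => [->//|qc].
  have b1 : bmf (fun U => qform (so_mx X) c1 ord0 U ^+ 2) by exact: bmfX.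
  rewrite -(Ex_right nuH (rg q c1 1) b1); congr (Ex _ _); apply/funext => U.
  by have [-> _] := rot _ _ U qc q0 c10.
have tot U : \sum_q qform (so_mx X) q ord0 U ^+ 2 = 1.
  have -> : \sum_q qform (so_mx X) q ord0 U ^+ 2 = \sum_q (\sum_a en U^-1%g q a * w U a) ^+ 2.
    by apply: eq_bigr => q _; rewrite wE; congr (_ ^+ 2); apply: eq_bigr => a _; rewrite [en U^-1%g q a]mxE mulrC.
  rewrite -[LHS]mulr1; pose Z := (U^-1 * (X * U))%g.
  have zE q : \sum_a en U^-1%g q a * w U a = en Z q ord0.
    by rewrite [RHS]mxE; apply: eq_bigr => a _; congr (_ * _); rewrite [RHS]mxE.
  rewrite mulr1 (eq_bigr (fun q => en Z q ord0 ^+ 2)); last by move=> q _; rewrite zE.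
  exact: sum_col2.
have : \sum_(q | q != ord0) E (fun U => qform (so_mx X) q ord0 U ^+ 2) <= 1.
  have t1 : \sum_q E (fun U => qform (so_mx X) q ord0 U ^+ 2) = 1.
    rewrite -Ex_sum => [|q]; last exact: bmfX.
    by rewrite -[RHS](Ex_cst nu 1); congr (Ex _ _); apply/funext => U; exact: tot.
  rewrite -t1 [leRHS](bigD1 ord0) //= lerDr; apply: Ex_ge0 => U; exact: sqr_ge0.
rewrite (eq_bigr (fun=> E (fun U => qform (so_mx X) c1 ord0 U ^+ 2))); last by move=> q; exact: same.
rewrite sumr_const cardC1 card_ord -[_ *+ _]mulr_natl.
by rewrite -[N%:R]natr1 addrK.
Qed.

Variables (hN : (1 < N)%N) (theta : R).
Local Notation rt := (rot12 hN theta).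
Local Notation Sq := (sin (theta / 2) ^+ 2).
Hypothesis S1 : Sq <= 1.
Local Notation Pr := (walk_op hN nu theta).
Local Notation trG := (fun X : G => \tr (so_mx X)).
Local Notation lambda := (1 - 4 * Sq / N%:R).
Local Notation wk U := (U * rt * U^-1)%g.

Let tr_wk U (X : G) : \tr (so_mx (wk U * X)%g) = \tr (so_mx X)
  - 2 * Sq * (qform (so_mx X) ord0 ord0 U + qform (so_mx X) c1 c1 U)
  + sin theta * (qform (so_mx X) ord0 c1 U - qform (so_mx X) c1 ord0 U).
Proof.
rewrite -[LHS]/(\tr (so_mx (wk U) *m so_mx X)) wk_low_rank mulmxDl mul1mx linearD /= -addrA; congr (_ + _).
have s2 (f : 'I_2 -> R) : \sum_i f i = f 0 + f 1.
  by rewrite !big_ord_recl big_ord0 addr0; congr (_ + f _); exact: val_inj.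
have main (W : 'M[R]_(N, 2)) : (forall q, W q 0 = en U q ord0) -> (forall q, W q 1 = en U q c1) ->
  \tr (W *m Krot theta *m W^T *m so_mx X) = - (2 * Sq * (qform (so_mx X) ord0 ord0 U + qform (so_mx X) c1 c1 U))
  + sin theta * (qform (so_mx X) ord0 c1 U - qform (so_mx X) c1 ord0 U).
  move=> We0 We1; rewrite -!mulmxA mxtrace_mulC -!mulmxA.
  have e k l j m : (forall q, W q k = en U q j) -> (forall q, W q l = en U q m) ->
     (W^T *m (so_mx X *m W)) k l = qform (so_mx X) j m U.
    move=> hk hl; rewrite mxE; apply: eq_bigr => a _; rewrite [W^T _ _]mxE [(so_mx X *m W) _ _]mxE mulr_sumr.
    by apply: eq_bigr => b _; rewrite -hk -hl mulrA.
  have z00 := e _ _ _ _ We0 We0; have z01 := e _ _ _ _ We0 We1; have z10 := e _ _ _ _ We1 We0; have z11 := e _ _ _ _ We1 We1.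
  move: (W^T *m (so_mx X *m W)) z00 z01 z10 z11 => Z z00 z01 z10 z11.
  rewrite /mxtrace s2 [(Krot theta *m Z) 0 0]mxE [(Krot theta *m Z) 1 1]mxE !s2 z00 z01 z10 z11.
  have ch := cos_half theta.
  have k00 : Krot theta 0 0 = - (2 * Sq) by rewrite !mxE /= ch; ring.
  have k11 : Krot theta 1 1 = - (2 * Sq) by rewrite !mxE /= ch; ring.
  have k01 : Krot theta 0 1 = - sin theta by rewrite !mxE /=; ring.
  have k10 : Krot theta 1 0 = sin theta by rewrite !mxE /=; ring.
  by rewrite k00 k01 k10 k11; ring.
by apply: main => q; [exact: Ucol0 | exact: Ucol1].
Qed.

Let tr_wkE (X : G) : (fun U => \tr (so_mx (wk U * X)%g)) = (fun U => \tr (so_mx X)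
  - 2 * Sq * (qform (so_mx X) ord0 ord0 U + qform (so_mx X) c1 c1 U)
  + sin theta * (qform (so_mx X) ord0 c1 U - qform (so_mx X) c1 ord0 U)).
Proof. by apply/funext => U; exact: tr_wk. Qed.

Let btr : bmf (fun X : G => \tr (so_mx X)).
Proof. by apply: bmf_sum => i; exact: bmf_entry. Qed.

Let bq (X : G) j k : bmf (qform (so_mx X) j k). Proof. exact: bmf_qform. Qed.

Let E_swap (X : G) (h : R -> R) : (forall j k, bmf (fun U => h (qform (so_mx X) j k U))) ->
  E (fun U => h (qform (so_mx X) c1 c1 U)) = E (fun U => h (qform (so_mx X) ord0 ord0 U)) /\
  E (fun U => h (- qform (so_mx X) ord0 c1 U)) = E (fun U => h (qform (so_mx X) c1 ord0 U)).
Proof.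
move=> bh; split.
  rewrite -(Ex_right nuH swap01 (bh ord0 ord0)); congr (Ex _ _); apply/funext => U.
  by have [-> _ _] := qform_swap (so_mx X) U.
rewrite -(Ex_right nuH swap01 (bh c1 ord0)); congr (Ex _ _); apply/funext => U.
by have [_ -> _] := qform_swap (so_mx X) U.
Qed.

Lemma E_tr (X : G) : E (fun U => \tr (so_mx (wk U * X)%g)) = lambda * \tr (so_mx X).
Proof.
rewrite tr_wkE.
have [s1 s2] := E_swap (h := id) (fun j k => bq X j k).
have [e1 _] := E_cross X; have e0 := E_qform nuH X.
rewrite ExD; [|by apply: bmfB; [exact: bmf_cst | apply: bmfZ; exact: bmfD]|by apply: bmfZ; exact: bmfB].
rewrite ExB; [|exact: bmf_cst|by apply: bmfZ; exact: bmfD].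
rewrite !ExZ; [|exact: bmfB|exact: bmfD].
rewrite ExB // ExD // Ex_cst.
move: s2; rewrite ExN // e1 => s2; have -> : E (qform (so_mx X) ord0 c1) = 0 by rewrite -[LHS]opprK s2 oppr0.
rewrite s1 -e0; field; exact: lt0r_neq0.
Qed.

(** The increment of the trace is [- 2 S] times a sum of two diagonal forms plus [sin theta] times a
    difference of two cross forms, with [S] the squared sine of the half angle. Each form has
    variance at most [2 / N]; both [S ^ 2 <= S] and [sin theta ^ 2 <= 4 S] leave a single factor
    [S]. *)
Lemma var_tr (X : G) : E (fun U => (\tr (so_mx (wk U * X)%g) - lambda * \tr (so_mx X)) ^+ 2) <= 128 * Sq / N%:R.
Proof.
have S0 : 0 <= Sq by exact: sqr_ge0.
set T := \tr (so_mx X); pose mu := T / N%:R.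
pose a U := qform (so_mx X) ord0 ord0 U - mu; pose b U := qform (so_mx X) c1 c1 U - mu.
pose c U := qform (so_mx X) ord0 c1 U; pose d U := qform (so_mx X) c1 ord0 U.
have ba : bmf (fun U => a U ^+ 2) by apply: bmfX; apply: bmfB => //; exact: bmf_cst.
have bb : bmf (fun U => b U ^+ 2) by apply: bmfX; apply: bmfB => //; exact: bmf_cst.
have bc : bmf (fun U => c U ^+ 2) by exact: bmfX 2 (bq X ord0 c1).
have bd : bmf (fun U => d U ^+ 2) by exact: bmfX 2 (bq X c1 ord0).
have s4 : sin theta ^+ 2 <= 4 * Sq.
  rewrite {1}(_ : theta = theta / 2 + theta / 2); last by field.
  rewrite sinD (_ : _ + _ = 2 * (sin (theta / 2) * cos (theta / 2))); last by ring.
  have := cos2Dsin2 (theta / 2); rewrite !exprMn; move: (cos _ ^+ 2) => z hz.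
  have : 0 <= Sq * Sq by exact: mulr_ge0.
  by rewrite (_ : z = 1 - Sq); [move: Sq => s; lra | lra].
have bsum : bmf (fun U => 16 * Sq * (a U ^+ 2 + b U ^+ 2) + 16 * Sq * (c U ^+ 2 + d U ^+ 2)).
  by apply: bmfD; apply: bmfZ; exact: bmfD.
apply: (@le_trans _ _ (E (fun U => 16 * Sq * (a U ^+ 2 + b U ^+ 2) + 16 * Sq * (c U ^+ 2 + d U ^+ 2)))).
  apply: le_Ex => // [|U].
    apply: bmfX; apply: bmfB; last exact: bmf_cst.
    rewrite tr_wkE; apply: bmfD; last by apply: bmfZ; exact: bmfB.
    by apply: bmfB; [exact: bmf_cst | apply: bmfZ; exact: bmfD].
  rewrite tr_wk (_ : _ - _ = - (2 * Sq) * (a U + b U) + sin theta * (c U - d U)); last first.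
    by rewrite /a /b /mu -/T /c /d; field; exact: lt0r_neq0.
  move: (a U) (b U) (c U) (d U) => x z v w.
  have sq2 (p q : R) : (p + q) ^+ 2 <= 2 * p ^+ 2 + 2 * q ^+ 2.
    by have := sqr_ge0 (p - q); rewrite sqrrB sqrrD; lra.
  apply: le_trans (sq2 _ _) _; rewrite !exprMn sqrrN exprMn.
  have h1 : (x + z) ^+ 2 <= 2 * x ^+ 2 + 2 * z ^+ 2 by exact: sq2.
  have h2 : (v - w) ^+ 2 <= 2 * v ^+ 2 + 2 * w ^+ 2 by have := sq2 v (- w); rewrite sqrrN.
  have SS : Sq ^+ 2 <= Sq by rewrite expr2 ler_piMl.
  have p1 := ler_pM (sqr_ge0 Sq) (sqr_ge0 (x + z)) SS h1.
  have p2 := ler_pM (sqr_ge0 (sin theta)) (sqr_ge0 (v - w)) s4 h2.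
  by lra.
have [s1 s2] := E_swap (h := fun x => (x - mu) ^+ 2) (fun j k => bmfX 2 (bmfB (bq X j k) (bmf_cst G mu))).
have [_ s3] := E_swap (h := fun x => x ^+ 2) (fun j k => bmfX 2 (bq X j k)).
rewrite ExD; [|by apply: bmfZ; exact: bmfD|by apply: bmfZ; exact: bmfD].
rewrite !ExZ; [|exact: bmfD|exact: bmfD].
rewrite !ExD // [E (fun x => b x ^+ 2)]s1 -/(a _).
have -> : E (fun U => c U ^+ 2) = E (fun U => d U ^+ 2).
  by rewrite -s3; congr (Ex _ _); apply/funext => U; rewrite sqrrN.
have va := var_qform nuH X; have [_ vd] := E_cross X.
have va' : E (fun U => a U ^+ 2) <= 2 / N%:R by rewrite ler_pdivlMr // mulrC.
have N1 : 2 * (N%:R - 1) >= N%:R :> R.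
  have : 2 <= N%:R :> R by rewrite ler_nat; move: n1; clear; lia.
  lra.
have d0 : 0 <= E (fun U => d U ^+ 2) by apply: Ex_ge0 => U; exact: sqr_ge0.
have vd' : E (fun U => d U ^+ 2) <= 2 / N%:R.
  by rewrite ler_pdivlMr // mulrC; have := ler_wpM2r d0 N1; lra.
have -> : 128 * Sq / N%:R = 16 * Sq * (2 / N%:R + 2 / N%:R) + 16 * Sq * (2 / N%:R + 2 / N%:R) by field; exact: lt0r_neq0.
have S16 : 0 <= 16 * Sq by exact: mulr_ge0.
exact: lerD (ler_wpM2l S16 (lerD va' va')) (ler_wpM2l S16 (lerD vd' vd')).
Qed.

End WalkTrace.

(** * Separation from Haar measure by the trace *)

Section LowerBound.
Context {R : realType} {n : nat}.
Hypothesis n1 : (1 < n)%N.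
Local Notation N := n.*2.+1.
Local Notation G := (SO R N).
Variables (hN : (1 < N)%N) (nu : probability G R) (theta : R).
Hypothesis nuH : is_haar nu.
Local Notation E := (Ex nu).
Local Notation Sq := (sin (theta / 2) ^+ 2).
Hypothesis S01 : 0 < Sq <= 1.
Local Notation Pr := (walk_op hN nu theta).
Local Notation lambda := (1 - 4 * Sq / N%:R).

Let tr (X : G) : R := \tr (so_mx X).
Let n0 : (0 < n)%N. Proof. exact: ltnW. Qed.
Let NR : 0 < N%:R :> R. Proof. by []. Qed.
Let N5 : 5 <= N%:R :> R. Proof. by rewrite ler_nat; move: n1; clear; lia. Qed.
Let S0 : 0 < Sq. Proof. by have /andP[] := S01. Qed.
Let S1 : Sq <= 1. Proof. by have /andP[] := S01. Qed.
Let btr : bmf tr. Proof. by apply: bmf_sum => i; exact: bmf_entry. Qed.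
Let btr2 : bmf (fun X => tr X ^+ 2). Proof. exact: bmfX. Qed.

Let x : R := Sq / N%:R.
Let x0 : 0 < x. Proof. exact: divr_gt0. Qed.
Let x5 : 4 * x <= 4 / 5.
Proof. by rewrite ler_pM2l // /x ler_pdivrMr //; have := N5; have := S1; lra. Qed.
Let lamE : lambda = 1 - 4 * x. Proof. by rewrite /x mulrA. Qed.

Lemma iter_tr t X : iter t Pr tr X = lambda ^+ t * tr X.
Proof.
elim: t X => [|t IH] X; first by rewrite mul1r.
have e : iter t Pr tr = fun Y => lambda ^+ t * tr Y by apply/funext.
rewrite iterS e -[LHS]/(E (fun U => lambda ^+ t * tr (U * rot12 hN theta * U^-1 * X)%g)) ExZ; last exact: bmf_walk.
have := E_tr n1 nuH hN theta X; rewrite -/(tr X) => h.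
by rewrite [Ex _ _]h [X in _ = X * _]exprSr mulrA.
Qed.

Lemma Pr_tr2 X : Pr (fun Y => tr Y ^+ 2) X <= lambda ^+ 2 * tr X ^+ 2 + 128 * x.
Proof.
pose f U := tr (U * rot12 hN theta * U^-1 * X)%g.
have bf : bmf f by exact: (bmf_walk hN theta X btr).
have Ef : E f = lambda * tr X by exact: (E_tr n1 nuH hN theta X).
have := var_tr n1 nuH hN S1 X; rewrite -[128 * Sq / _]mulrA -/x => v.
have e : E (fun U => (f U - lambda * tr X) ^+ 2) = E (fun U => f U ^+ 2) - lambda ^+ 2 * tr X ^+ 2.
  rewrite (_ : (fun U => (f U - lambda * tr X) ^+ 2) = (fun U => f U ^+ 2 - 2 * (lambda * tr X) * f U + (lambda * tr X) ^+ 2)); last first.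
    by apply/funext => U; ring.
  rewrite ExD; [|by apply: bmfB; [exact: bmfX | exact: bmfZ]|exact: bmf_cst].
  rewrite ExB; [|exact: bmfX|exact: bmfZ].
  by rewrite ExZ // Ex_cst Ef; ring.
by rewrite -lerBlDl -e.
Qed.

Let lam2 : 32 * lambda ^+ 2 + 128 * x <= 32.
Proof.
rewrite lamE; have := mulr_ge0 (ltW x0) (_ : 0 <= 1 - 4 * x); rewrite expr2 => h.
by have := h ltac:(have := x5; lra); lra.
Qed.

(** The bound 32 on the excess reproduces itself under the recursion of [Pr_tr2]: as
    [lambda = 1 - 4 x] with [4 x <= 1], [32 lambda ^ 2 + 128 x <= 32]. *)
Lemma iter_tr2 t : iter t Pr (fun Y => tr Y ^+ 2) 1%g <= (lambda ^+ t * N%:R) ^+ 2 + 32.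
Proof.
elim: t => [|t IH].
  by rewrite /= /tr mxtrace1 mul1r lerDl.
have L := mean_functional_iter hN nu theta t.
have ek : iter t Pr (fun Y => lambda ^+ 2 * tr Y ^+ 2 + 128 * x) 1%g =
    lambda ^+ 2 * iter t Pr (fun Y => tr Y ^+ 2) 1%g + 128 * x.
  exact: (etrans (mf_add L (bmfZ _ btr2) (bmf_cst _ _)) (congr2 +%R (mf_scale L _ btr2) (mf_cst L _))).
rewrite iterSr; apply: (@le_trans _ _ (lambda ^+ 2 * iter t Pr (fun Y => tr Y ^+ 2) 1%g + 128 * x)).
  rewrite -ek; apply: (mf_le L); [exact: bmf_Pr | | exact: Pr_tr2].
  by apply: bmfD; [exact: bmfZ | exact: bmf_cst].
have := ler_wpM2l (sqr_ge0 lambda) IH; have := lam2; rewrite [lambda ^+ t.+1]exprS.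
move: (iter t Pr _ 1%g) => w; move: (1 - 4 * Sq / N%:R) => l; rewrite !exprMn; lra.
Qed.

(** Haar measure is stationary, so the recursion bounds [(1 - lambda ^ 2)] times the second moment
    by [128 x], which is at most [32 (1 - lambda ^ 2)]. *)
Lemma E_tr2 : E (fun Y => tr Y ^+ 2) <= 32.
Proof.
have h : E (fun Y => tr Y ^+ 2) <= lambda ^+ 2 * E (fun Y => tr Y ^+ 2) + 128 * x.
  rewrite -{1}(Pr_mean n0 hN theta nuH btr2) -ExZ // -(Ex_cst nu (128 * x)) -ExD //; [|exact: bmfZ|exact: bmf_cst].
  apply: le_Ex => [||X]; [exact: bmf_Pr | by apply: bmfD; [exact: bmfZ | exact: bmf_cst] | exact: Pr_tr2].
rewrite leNgt; apply/negP => lt.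
have l1 : 0 < 1 - lambda ^+ 2.
  have p := mulr_gt0 x0 (_ : 0 < 1 - 2 * x); have {}p := p ltac:(have := x5; lra).
  by rewrite lamE; move: p; rewrite expr2; lra.
have := lam2; have : (1 - lambda ^+ 2) * 32 < (1 - lambda ^+ 2) * E (fun Y => tr Y ^+ 2) by rewrite ltr_pM2l.
by move: h; move: (E (fun Y => tr Y ^+ 2)) (lambda ^+ 2) => e l; lra.
Qed.

(** The threshold [m / 2] lies halfway between the two means. On either side Chebyshev's inequality
    loses [4 * 32 / m ^ 2]. *)
Lemma tv_lower t (m := lambda ^+ t * N%:R) :
  ((1 - 256 / m ^+ 2)%:E <= tv_dist (walk_law hN nu theta t) nu)%E.
Proof.
have l0 : 0 < lambda by rewrite lamE; have := x5; lra.
have m0 : 0 < m by rewrite mulr_gt0 // exprn_gt0.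
pose B : set G := [set X | m / 2 <= tr X].
have mB : measurable B.
  have [mt _] := btr; have := mt measurableT `[m / 2, +oo[%classic (measurable_itv _).
  rewrite setTI; congr measurable; apply/seteqP; split => X; rewrite /B /= in_itv /= andbT //.
have tg : ((iter t Pr \1_B 1%g - E \1_B)%:E <= tv_dist (walk_law hN nu theta t) nu)%E by exact: tv_ge.
apply: le_trans tg; rewrite lee_fin.
have L := mean_functional_iter hN nu theta t.
have bB : bmf (\1_B : G -> R) by exact: bmf_indic.
have m2 : 0 < m ^+ 2 by rewrite exprn_gt0.
have ind X : (\1_B : G -> R) X = ((m / 2 <= tr X)%R : bool)%:R.
  have e : (X \in B) = (m / 2 <= tr X) by apply/idP/idP => [/set_mem|h] //; exact: mem_set.
  by rewrite indicE e.
have up : E \1_B <= 128 / m ^+ 2.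
  apply: (@le_trans _ _ (E (fun X => 4 / m ^+ 2 * tr X ^+ 2))).
    apply: le_Ex => // [|X]; first exact: bmfZ.
    rewrite ind; case: (leP (m / 2) (tr X)) => h /=; last by rewrite mulr_ge0 ?sqr_ge0 // divr_ge0 // ltW.
    rewrite mulrAC ler_pdivlMr // mul1r.
    have : (m / 2) ^+ 2 <= tr X ^+ 2 by rewrite lerXn2r ?nnegrE //; lra.
    by rewrite exprMn exprVn; lra.
  rewrite ExZ //; have := E_tr2; have c0 : 0 <= 4 / m ^+ 2 by rewrite divr_ge0 // ltW.
  by move=> h; have := ler_wpM2l c0 h; lra.
have low : 1 - 128 / m ^+ 2 <= iter t Pr \1_B 1%g.
  (* Chebyshev's inequality as a pointwise minorant [1 - 4 (tr - m) ^ 2 / m ^ 2] of the indicator,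
     to which linearity and monotonicity of the iterate apply. *)
  pose g X := (1 - 4) + (8 / m * tr X - 4 / m ^+ 2 * tr X ^+ 2).
  have b1 : bmf (fun X => 8 / m * tr X) by exact: bmfZ.
  have b2 : bmf (fun X => 4 / m ^+ 2 * tr X ^+ 2) by exact: bmfZ.
  have bg : bmf g by apply: bmfD; [exact: bmf_cst | exact: bmfB].
  have gE X : g X = 1 - 4 / m ^+ 2 * (tr X - m) ^+ 2 by rewrite /g; field; exact: lt0r_neq0.
  apply: le_trans (mf_le L bg bB _) => [|X]; last first.
    rewrite gE ind; case: (leP (m / 2) (tr X)) => h /=.
      by rewrite gerBl mulr_ge0 ?sqr_ge0 // divr_ge0 // ltW.
    rewrite subr_le0 mulrAC ler_pdivlMr // mul1r.
    have : (m / 2) ^+ 2 <= (m - tr X) ^+ 2 by rewrite lerXn2r ?nnegrE //; lra.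
    by rewrite exprMn exprVn -[(m - tr X) ^+ 2]sqrrN opprB; lra.
  have gE2 : g = fun X => (1 - 4) + (8 / m * tr X + (- (4 / m ^+ 2)) * tr X ^+ 2).
    by apply/funext => X; rewrite /g mulNr.
  have bz : bmf (fun X => - (4 / m ^+ 2) * tr X ^+ 2) by exact: bmfZ.
  have ek : iter t Pr g 1%g = (1 - 4) + (8 / m * iter t Pr tr 1%g + (- (4 / m ^+ 2)) * iter t Pr (fun Y => tr Y ^+ 2) 1%g).
    rewrite gE2; apply: (etrans (mf_add L (bmf_cst _ _) (bmfD b1 bz))).
    congr (_ + _); first exact: (mf_cst L).
    apply: (etrans (mf_add L b1 bz)); congr (_ + _); exact: (mf_scale L).
  rewrite ek iter_tr.
  have -> : tr 1%g = N%:R by rewrite /tr mxtrace1.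
  rewrite -/m (_ : 8 / m * m = 8); last by field; exact: lt0r_neq0.
  have c0 : 0 <= 4 / m ^+ 2 by rewrite divr_ge0 // ltW.
  have := ler_wpM2l c0 (iter_tr2 t); rewrite -/m mulrDr (_ : 4 / m ^+ 2 * m ^+ 2 = 4); last by field; exact: lt0r_neq0.
  by lra.
by lra.
Qed.

(** Since [t >= 0], [ln n >= - c >= 4], so [n] is large enough for
    [ln lambda >= - 4 x - 2 (4 x) ^ 2]. Over [t] steps the quadratic terms cost at most 4, so the
    mean trace is at least [expR (- c - 4)]. *)
Lemma tv_ge_small (t : nat) (c : R) : c <= -4 -> t%:R = n%:R * (ln n%:R + c) / (2 * Sq) ->
  ((1 - 256 * expR (8 + 2 * c))%:E <= tv_dist (walk_law hN nu theta t) nu)%E.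
Proof.
move=> c4 tE; apply: le_trans (tv_lower t); rewrite lee_fin lerD2l lerN2.
have nR : 0 < n%:R :> R by rewrite ltr0n.
have lc0 : 0 <= ln n%:R + c.
  have : 0 <= n%:R * (ln n%:R + c) / (2 * Sq) by rewrite -tE.
  have s2 : 0 < (2 * Sq)^-1 by rewrite invr_gt0 mulr_gt0.
  by rewrite (pmulr_lge0 _ s2) (pmulr_rge0 _ nR).
have NE : N%:R = 2 * n%:R + 1 :> R by rewrite -natr1 -muln2 natrM mulrC.
have n5 : 5 <= n%:R :> R.
  apply: (@le_trans _ _ (expR 4)); first by apply: le_trans (expR_ge1Dx _); lra.
  by rewrite -[leRHS]lnK ?posrE // ler_expR; lra.
have x2 : 4 * x <= 2^-1.
  by rewrite /x mulrA ler_pdivrMr // NE; have := S1; lra.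
have l0 : 0 < lambda by rewrite lamE; lra.
have gen (z : R) : 0 < z -> 4 * z <= 2^-1 -> (- (4 * z) - 2 * (4 * z) ^+ 2) * (1 - 4 * z) <= - (4 * z).
  move=> z0 z2; have p : 0 <= z * z * (1 - 8 * z) by apply: mulr_ge0; [exact: mulr_ge0 (ltW z0) (ltW z0) | lra].
  by rewrite expr2; lra.
have ll : - (4 * x) - 2 * (4 * x) ^+ 2 <= ln lambda.
  rewrite lamE; apply: le_trans (ln1p_ge _); last by lra.
  by rewrite ler_pdivlMr; [exact: gen | lra].
have tx : t%:R * (4 * x) <= ln n%:R + c.
  rewrite tE /x (_ : _ * _ = (ln n%:R + c) * (2 * n%:R / N%:R)); last first.
    have := S0; have := NR; move: (ln n%:R + c) (sin (theta / 2) ^+ 2) (N%:R : R) => L w y y0 w0.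
    by field; rewrite ?(lt0r_neq0 w0) ?(lt0r_neq0 y0).
  by rewrite ler_piMr // ler_pdivrMr // NE; lra.
have tx2 : t%:R * (2 * (4 * x) ^+ 2) <= 4.
  have t0 : 0 <= t%:R * (4 * x) by exact: mulr_ge0 (ler0n _ _) (mulr_ge0 (ler0n _ 4) (ltW x0)).
  have xn : 8 * x <= 4 / n%:R.
    rewrite /x mulrA ler_pdivrMr // mulrAC ler_pdivlMr // NE; have := ler_wpM2r (ltW nR) S1; lra.
  have x8 : 0 <= 8 * x by exact: mulr_ge0 (ler0n _ 8) (ltW x0).
  have := ler_pM t0 x8 tx xn; have ln' : ln n%:R <= n%:R - 1 :> R by exact: ln_le.
  have : (ln n%:R + c) * (4 / n%:R) <= 4.
    by rewrite mulrA ler_pdivrMr //; lra.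
  by rewrite expr2; lra.
have mE : expR (- c - 4) <= lambda ^+ t * N%:R.
  rewrite -[lambda]lnK ?posrE // -expRM_natl -[X in _ <= _ * X]lnK ?posrE // -expRD ler_expR.
  have lnN : ln n%:R <= ln N%:R :> R by rewrite ler_ln ?posrE // ler_nat; move: n1; clear; lia.
  have t0 : 0 <= t%:R :> R by [].
  have := ler_wpM2l t0 ll; rewrite mulrBr; lra.
have e0 := expR_gt0 (- c - 4).
rewrite ler_pM2l // -[leRHS]invrK lef_pV2 ?posrE ?invr_gt0 ?expR_gt0 ?exprn_gt0 ?mulr_gt0 ?exprn_gt0 //.
rewrite -expRN (_ : - (8 + 2 * c) = 2 * (- c - 4)); last by ring.
by rewrite expRM_natl lerXn2r ?nnegrE ?(ltW e0) // (le_trans (ltW e0)).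
Qed.

End LowerBound.

(** * The limiting profile *)

Section CutoffProfile.
Context {R : realType}.

Definition upper_tail (C c : R) : R :=
  Num.sqrt (2 * (expR (36 * expR (- (((c - C) / 24 - 2) / 4))) - 1)).

Variables (C : R) (C0 : 0 <= C).

(** Between 0 and [C + 48] only the trivial bound 1 is at hand, and for [c] in [-4, 0) the
    exponential exceeds 1, so the minimum is again 1. *)
Definition cutoff_profile (c : R) : R :=
  if c < 0 then Num.min 1 (256 * expR (8 + 2 * c))
  else if C + 48 <= c then Num.min 1 (upper_tail C c) else 1.

Lemma cutoff_profile01 c : 0 <= cutoff_profile c <= 1.
Proof.
rewrite /cutoff_profile; case: ifP => _.
  by rewrite le_min ler01 ge_min lexx /= andbT; apply: mulr_ge0 (ler0n _ _) (expR_ge0 _).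
case: ifP => _; last by rewrite ler01 lexx.
by rewrite le_min ler01 ge_min lexx /= andbT sqrtr_ge0.
Qed.

Lemma cutoff_profile_pinfty : cutoff_profile c @[c --> +oo] --> 0.
Proof.
apply/cvgrPdist_le => e e0; pose y0 := ln (1 + e ^+ 2 / 2) / 36.
have e2 : 0 < e ^+ 2 / 2 by rewrite divr_gt0 // exprn_gt0.
have y0p : 0 < y0 by rewrite divr_gt0 // ln_gt0 // ltrDl.
near=> c.
have cp : C + 48 <= c by near: c; apply: nbhs_pinfty_ge; rewrite num_real.
have cy : C + 24 * (2 - 4 * ln y0) <= c by near: c; apply: nbhs_pinfty_ge; rewrite num_real.
have c0 : 0 <= c by apply: le_trans cp; rewrite addr_ge0.
have /andP[f0 _] := cutoff_profile01 c.
rewrite sub0r normrN ger0_norm // /cutoff_profile ltNge c0 /= cp ge_min; apply/orP; right.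
rewrite /upper_tail.
have yy : expR (- (((c - C) / 24 - 2) / 4)) <= y0.
  by rewrite -[leRHS]lnK ?posrE // ler_expR; lra.
have : expR (36 * expR (- (((c - C) / 24 - 2) / 4))) <= 1 + e ^+ 2 / 2.
  rewrite -[leRHS]lnK ?posrE ?ltr_pwDl ?(ltW e2) // ler_expR.
  have -> : ln (1 + e ^+ 2 / 2) = 36 * y0 by rewrite /y0; field.
  by rewrite ler_pM2l.
move: (expR (36 * _)) => w hw.
rewrite -[leRHS]ger0_norm ?(ltW e0) // -sqrtr_sqr ler_wsqrtr //; lra.
Unshelve. all: by end_near. Qed.

Lemma cutoff_profile_ninfty : cutoff_profile c @[c --> -oo] --> 0.
Proof.
apply/cvgrPdist_le => e e0; near=> c.
have c0 : c < 0 by near: c; apply: nbhs_ninfty_lt; rewrite num_real.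
have ce : c <= (ln (e / 256) - 8) / 2 by near: c; apply: nbhs_ninfty_le; rewrite num_real.
have /andP[f0 _] := cutoff_profile01 c.
rewrite sub0r normrN ger0_norm // /cutoff_profile c0 ge_min; apply/orP; right.
rewrite mulrC -ler_pdivlMr // -[leRHS]lnK ?posrE ?divr_gt0 // ler_expR; lra.
Unshelve. all: by end_near. Qed.

End CutoffProfile.

Lemma tv_ge0 (R : realType) (n : nat) (n0 : (0 < n)%N) (hN : (1 < n.*2.+1)%N)
  (nu : probability (SO R n.*2.+1) R) (theta : R) t : is_haar nu ->
  (0 <= tv_dist (walk_law hN nu theta t) nu)%E.
Proof.
move=> nuH; have tg : ((iter t (walk_op hN nu theta) \1_set0 1%g - Ex nu \1_set0)%:E <=
    tv_dist (walk_law hN nu theta t) nu)%E by exact: tv_ge.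
apply: le_trans tg; rewrite lee_fin.
have -> : (\1_set0 : SO R n.*2.+1 -> R) = fun=> 0 by apply/funext => x; rewrite indicE in_set0.
by rewrite (mf_cst (mean_functional_iter hN nu theta t)) Ex_cst subrr.
Qed.

Lemma tv_le_tail (R : realType) : exists2 C : R, 0 <= C &
  forall (n : nat) (n0 : (0 < n)%N) (nu : probability (SO R n.*2.+1) R) (hN : (1 < n.*2.+1)%N) (theta c : R) (t : nat),
  is_haar nu -> 0 < sin (theta / 2) ^+ 2 <= 1 -> C + 48 <= c ->
  t%:R = n%:R * (ln n%:R + c) / (2 * sin (theta / 2) ^+ 2) ->
  (tv_dist (walk_law hN nu theta t) nu <= (upper_tail C c)%:E)%E.
Proof.
exists (20 * 2000); first exact: mulr_ge0 (ler0n _ 20) (ler0n _ 2000).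
move=> n n0 nu hN theta c t nuH S01; exact: tv_le_large.
Qed.

Theorem theorem1p2 (R : realType) :
  exists f : R -> R,
    [/\ forall c, 0 <= f c <= 1,
        f c @[c --> +oo] --> 0,
        f c @[c --> -oo] --> 0 &
        forall (n : nat) (hn : (1 <= n)%N)
          (nu : probability (SO R n.*2.+1) R) (theta c : R) (t : nat),
          is_haar nu ->
          ln n%:R / Num.sqrt n%:R <= theta <= pi -> 0 < theta ->
          t%:R = n%:R * (ln n%:R + c) / (2 * sin (theta / 2) ^+ 2) ->
          (`| tv_dist (walk_law (ltn1_doubleS hn) nu theta t) nu
              - ((c < 0)%R%:R%:E) | <= (f c)%:E)%E].
Proof.
have [C C0 upperC] := tv_le_tail R.
exists (cutoff_profile C); split; [exact: cutoff_profile01 | exact: cutoff_profile_pinfty | exact: cutoff_profile_ninfty |].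
move=> n hn nu theta c t nuH /andP[_ thpi] th0 tE.
have S01 : 0 < sin (theta / 2) ^+ 2 <= 1.
  have s0 : 0 < sin (theta / 2) by have p := pi_gt0 R; apply: sin_gt0_pi; apply/andP; split; lra.
  rewrite exprn_gt0 //=; have := cos2Dsin2 (theta / 2); have := sqr_ge0 (cos (theta / 2)); lra.
have t0 := @tv_ge0 R n hn (ltn1_doubleS hn) nu theta t nuH.
have t1 : (tv_dist (walk_law (ltn1_doubleS hn) nu theta t) nu <= 1)%E by exact: tv_le1.
have lower : c <= -4 -> ((1 - 256 * expR (8 + 2 * c))%:E <= tv_dist (walk_law (ltn1_doubleS hn) nu theta t) nu)%E.
  (* For [n = 1] the logarithm vanishes and [t >= 0] forces [c >= 0]. *)
  move=> c4; have n1 : (1 < n)%N.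
    rewrite ltnNge; apply/negP => n1; have n1' : n = 1%N by apply/eqP; rewrite eqn_leq n1.
    move: tE; rewrite n1' ln1 add0r mul1r => tE.
    have /andP[S0 _] := S01; have : 0 <= c / (2 * sin (theta / 2) ^+ 2) by rewrite -tE.
    have s2 : 0 < (2 * sin (theta / 2) ^+ 2)^-1 by rewrite invr_gt0 mulr_gt0.
    by rewrite (pmulr_lge0 _ s2); lra.
  exact: (tv_ge_small n1 (ltn1_doubleS hn) nuH S01 c4 tE).
have upper := upperC n hn nu (ltn1_doubleS hn) theta c t nuH S01.
move: t0 t1 lower upper; move: (tv_dist _ _) => [r||] //= t0 t1 lower upper.
have {}t0 : 0 <= r by rewrite -lee_fin. have {}t1 : r <= 1 by rewrite -lee_fin.
rewrite lee_fin /cutoff_profile.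
case: ltP => c0 /=.
  rewrite mulr1n ler0_norm ?subr_le0 // opprB le_min lerBlDr lerDl t0 /=.
  (* Above -4 the exponent [8 + 2 c] is nonnegative and the claimed bound is trivial. *)
  case: (leP c (-4)) => c4; first by have := lower c4; rewrite lee_fin; lra.
  have : 1 <= expR (8 + 2 * c) by apply: le_trans (expR_ge1Dx _); lra.
  by lra.
rewrite mulr0n subr0 ger0_norm //; case: ifP => [cp|_] //.
by rewrite le_min t1 /= -lee_fin; exact: upper cp tE.
Qed.
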